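(* Let $M$ be a complex manifold of complex dimension $n$ with a symplectic form $\omega\in\Omega^{(1,1)}(M)$. For every holomorphic coordinate chart $U\subset M$ on which $\omega=\frac{\sqrt{-1}}{2}\sum_{i,j}h_{i\bar j}\,dz^i\wedge d\bar z^j$ with $h_{i\bar j}=\partial_i\bar\partial_j\Phi$ for some potential $\Phi$ on $U$, let $\bullet_U$ be the product on $C^\infty(U)[[\hbar]]$ given by the formal integral described in the context. Then the products $\bullet_U$ agree on overlaps and define a product $\bullet$ on $C^\infty(M)[[\hbar]]$ which is a deformation quantization of $(M,\omega)$: it is $\mathbb{C}[[\hbar]]$-bilinear and associative, and for $f_1,f_2\in C^\infty(M)$ $$f_1\bullet f_2=f_1f_2+O(\hbar),\qquad f_1\bullet f_2-f_2\bullet f_1=\frac{\hbar}{2\sqrt{-1}}\{f_1,f_2\}+O(\hbar^2),$$ where $\{\cdot,\cdot\}$ is the Poisson bracket of $\omega$.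
   Context: A symplectic form is a real closed nondegenerate 2-form; it is assumed of type $(1,1)$. In local coordinates $\partial_i=\partial/\partial z^i$, $\bar\partial_i=\partial/\partial\bar z^i$, with standard multi-index notation. $H=(h_{i\bar j})$, and $h^{i\bar j}$ are the entries of the inverse matrix, with the convention $\sum_jh^{i\bar j}h_{k\bar j}=\delta^i_k$. The Poisson bracket is, in local coordinates, $$\{f_1,f_2\}=\frac{2}{\sqrt{-1}}\sum_{i,j}h^{i\bar j}(\partial_if_1\bar\partial_jf_2-\bar\partial_jf_1\partial_if_2).$$ **The local product $\bullet_U$.** It is the formal Laplace expansion at $v=z$ of $$\int f_1(z,\bar v)f_2(v,\bar z)e^{\phi(z,\bar z;v,\bar v)/\hbar}\det H(v,\bar v)\prod_i\frac{|dv^i\wedge d\bar v^i|}{2\pi\hbar},$$ where $\phi(z,\bar z;v,\bar v)=\Phi(z,\bar v)+\Phi(v,\bar z)-\Phi(z,\bar z)-\Phi(v,\bar v)$, obtained by substituting $v=z+\epsilon y$, $\epsilon^2=\hbar$. Precisely, fix $z\in U$ and let $E_z$ be the linear functional on polynomials in $y,\bar y$ given by $E_z[y^I\bar y^J]=\partial_u^I\partial_{\bar u}^J\exp\big(\sum_{i,j}h^{i\bar j}(z)u_i\bar u_j\big)\big|_{u=\bar u=0}$ (when $H$ is positive definite this equals $\frac{\det H(z)}{\pi^n}\int_{\mathbb{C}^n} y^I\bar y^J e^{-\sum h_{i\bar j}(z)y^i\bar y^j}\,d\mathrm{Leb}(y)$). Put $$F_1=\sum_J\tfrac{\epsilon^{|J|}}{J!}\bar\partial^Jf_1(z)\,\bar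 y^J,\qquad F_2=\sum_I\tfrac{\epsilon^{|I|}}{I!}\partial^If_2(z)\,y^I,$$ $$S=-\sum_{|I|,|J|\ge1,\,|I|+|J|\ge3}\tfrac{\epsilon^{|I|+|J|-2}}{I!J!}\partial^I\bar\partial^J\Phi(z)\,y^I\bar y^J,\qquad M_z=\tfrac1{\det H(z)}\sum_{I,J}\tfrac{\epsilon^{|I|+|J|}}{I!J!}\partial^I\bar\partial^J(\det H)(z)\,y^I\bar y^J.$$ Then $(f_1\bullet_U f_2)(z):=E_z[F_1F_2\,e^{S}M_z]$, with $E_z$ applied to each coefficient of $\epsilon^k$; odd powers of $\epsilon$ vanish, and $\epsilon^2=\hbar$. The product is extended to $C^\infty(U)[[\hbar]]$ by $\mathbb{C}[[\hbar]]$-bilinearity. Note that only mixed derivatives of $\Phi$, hence only derivatives of $h_{i\bar j}$, enter. *)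

(* Defs.v *)
From HB Require Import structures.
From mathcomp Require Import all_boot all_order all_algebra.
From mathcomp Require Import all_classical all_reals all_analysis.
From mathcomp Require Import complex.
From mathcomp Require mpoly.
(* mpoly's notations clash with those of mathcomp-analysis. *)
Export -(notations) mpoly.

Set Implicit Arguments.
Unset Strict Implicit.
Unset Printing Implicit Defensive.

Import Order.TTheory GRing.Theory Num.Theory numFieldNormedType.Exports.

Local Open Scope classical_set_scope.
Local Open Scope ring_scope.
Local Open Scope complex_scope.

(* The usual topology of the complex numbers, hence of C^n = 'rV[R[i]]_n. *)
HB.instance Definition _ (R : realType) := NormedModule.copy R[i] (R[i])^o.

Section Calculus.
Context {R : realType} {n : nat}.
Local Notation C := R[i].
Implicit Types (F : 'rV[C]_n -> C) (z v : 'rV[C]_n) (D : set 'rV[C]_n).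

(* Real directional derivatives: C^n is seen as a real vector space. *)
Definition rderivable F z v : Prop :=
  derivable (fun t : R => complex.Re (F (z + t%:C *: v))) 0 1 /\
  derivable (fun t : R => complex.Im (F (z + t%:C *: v))) 0 1.

Definition rderive v F : 'rV[C]_n -> C := fun z =>
  derive1 (fun t : R => complex.Re (F (z + t%:C *: v))) 0 +i*
  derive1 (fun t : R => complex.Im (F (z + t%:C *: v))) 0.

(* With z^j = x^j + i y^j: d/dx^j and d/dy^j are the derivatives along
   [xdir j] and [ydir j]. *)
Definition xdir (j : 'I_n) : 'rV[C]_n := delta_mx 0 j.
Definition ydir (j : 'I_n) : 'rV[C]_n := 'i *: delta_mx 0 j.

(* D is meant to be open; off D the values of F are irrelevant. *)
Fixpoint Ck (k : nat) D F : Prop :=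
  (forall z, D z -> {for z, continuous F}) /\
  (if k is k'.+1 then
     forall j : 'I_n,
       [/\ forall z, D z -> rderivable F z (xdir j),
           forall z, D z -> rderivable F z (ydir j),
           Ck k' D (rderive (xdir j) F) &
           Ck k' D (rderive (ydir j) F)]
   else True).

Definition smooth D F : Prop := forall k, Ck k D F.

Definition dz (j : 'I_n) F : 'rV[C]_n -> C := fun z =>
  2^-1 * (rderive (xdir j) F z - 'i * rderive (ydir j) F z).

Definition dzbar (j : 'I_n) F : 'rV[C]_n -> C := fun z =>
  2^-1 * (rderive (xdir j) F z + 'i * rderive (ydir j) F z).

Definition dzI (I : multinom n) F : 'rV[C]_n -> C :=
  foldr (fun i G => iter (I i) (dz i) G) F (enum 'I_n).

Definition dzbarI (J : multinom n) F : 'rV[C]_n -> C :=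
  foldr (fun j G => iter (J j) (dzbar j) G) F (enum 'I_n).

Definition holomorphic D (T : 'rV[C]_n -> 'rV[C]_n) : Prop :=
  forall k : 'I_n,
    smooth D (fun z => T z 0 k) /\
    forall (j : 'I_n) z, D z -> dzbar j (fun z => T z 0 k) z = 0.

Definition multifact (I : multinom n) : nat := (\prod_(i < n) (I i)`!)%N.

End Calculus.

(* A formal power series is the sequence of its coefficients. *)
Section FormalSeries.

Definition fps_mul {A : pzRingType} (a b : nat -> A) : nat -> A :=
  fun k => \sum_(i < k.+1) a i * b (k - i)%N.

Definition fps_one {A : pzRingType} : nat -> A := fun k => (k == 0%N)%:R.

Definition fps_pow {A : pzRingType} (a : nat -> A) (m : nat) : nat -> A :=
  iter m (fps_mul a) fps_one.

(* For a with a 0 = 0: the powers a^m with m > k do not contribute to the k-th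
   coefficient of exp a. *)
Definition fps_exp {K : fieldType} {A : algType K} (a : nat -> A) : nat -> A :=
  fun k => \sum_(m < k.+1) (m`!%:R : K)^-1 *: fps_pow a m k.

End FormalSeries.

(* Here f1, f2, Phi are functions on (an open subset of) C^n.  Polynomials in
   y, ybar (and in u, ubar) are polynomials in n + n indeterminates, the first n
   of which are the y^i. *)
Section LocalProduct.
Context {R : realType} {n : nat}.
Local Notation C := R[i].
Local Notation P := (mpoly (n + n) C).
Implicit Types (f Phi : 'rV[C]_n -> C) (z : 'rV[C]_n).

Definition yvar (i : 'I_n) : P := mpolyX C (mnm1 (lshift n i)).
Definition ybarvar (j : 'I_n) : P := mpolyX C (mnm1 (rshift n j)).
Definition ymon (I : multinom n) : P := \prod_(i < n) yvar i ^+ I i.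
Definition ybarmon (J : multinom n) : P := \prod_(j < n) ybarvar j ^+ J j.

Definition hmx Phi z : 'M[C]_n := \matrix_(i, j) dz i (dzbar j Phi) z.

(* The entries h^{i jbar}: sum_j h^{i jbar} h_{k jbar} = delta^i_k. *)
Definition hinv (H : 'M[C]_n) : 'M[C]_n := invmx H^T.

Definition gaussE_quad (H : 'M[C]_n) : P :=
  \sum_(i < n) \sum_(j < n) hinv H i j *: (yvar i * ybarvar j).

(* The K-th derivative at 0 of exp(gaussE_quad H), whose terms of exponential
   order m > |K| do not contribute. *)
Definition gaussE_mon (H : 'M[C]_n) (K : multinom (n + n)) : C :=
  meval (fun=> 0)
    (mderivm K (\sum_(m < (mdeg K).+1) (m`!%:R : C)^-1 *: gaussE_quad H ^+ m)).

Definition gaussE (H : 'M[C]_n) (p : P) : C :=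
  \sum_(K <- msupp p) mcoeff K p * gaussE_mon H K.

(* The following four are formal power series in epsilon. *)
Definition serF1 f z : nat -> P := fun k =>
  \sum_(J : bmultinom n k.+1 | mdeg J == k)
    ((multifact J)%:R^-1 * dzbarI J f z) *: ybarmon J.

Definition serF2 f z : nat -> P := fun k =>
  \sum_(I : bmultinom n k.+1 | mdeg I == k)
    ((multifact I)%:R^-1 * dzI I f z) *: ymon I.

Definition serS Phi z : nat -> P := fun k =>
  - \sum_(I : bmultinom n k.+3) \sum_(J : bmultinom n k.+3 |
        [&& (1 <= mdeg I)%N, (1 <= mdeg J)%N, (3 <= mdeg I + mdeg J)%N
          & (mdeg I + mdeg J - 2 == k)%N])
      ((multifact I)%:R^-1 * (multifact J)%:R^-1 * dzI I (dzbarI J Phi) z)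
        *: (ymon I * ybarmon J).

Definition serM Phi z : nat -> P := fun k =>
  let detH := fun w => \det (hmx Phi w) in
  (detH z)^-1 *:
    \sum_(I : bmultinom n k.+1) \sum_(J : bmultinom n k.+1 |
        (mdeg I + mdeg J == k)%N)
      ((multifact I)%:R^-1 * (multifact J)%:R^-1 * dzI I (dzbarI J detH) z)
        *: (ymon I * ybarmon J).

Definition bullet_eps Phi f1 f2 z : nat -> C := fun k =>
  gaussE (hmx Phi z)
    (fps_mul (fps_mul (fps_mul (serF1 f1 z) (serF2 f2 z))
                      (fps_exp (serS Phi z)))
             (serM Phi z) k).

(* hbar = epsilon^2; the odd coefficients of [bullet_eps] vanish, since
   gaussE (ymon I * ybarmon J) = 0 unless |I| = |J|. *)
Definition bullet0 Phi f1 f2 z : nat -> C := fun k =>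
  bullet_eps Phi f1 f2 z k.*2.

(* The C[[hbar]]-bilinear extension. *)
Definition bullet Phi (F G : nat -> 'rV[C]_n -> C) : nat -> 'rV[C]_n -> C :=
  fun k z => \sum_(a < k.+1) \sum_(b < (k - a).+1)
    bullet0 Phi (F a) (G b) z (k - a - b)%N.

End LocalProduct.

(* [cmap] and [cinv] are meaningful on [cdom] and on [cimg] only. *)
Record chart (R : realType) (n : nat) (X : topologicalType) := Chart {
  cdom : set X;
  cmap : X -> 'rV[R[i]]_n;
  cinv : 'rV[R[i]]_n -> X;
  cdom_open : open cdom;
  cimg_open : open (cmap @` cdom);
  cmap_continuous : forall p, cdom p -> {for p, continuous cmap};
  cinv_continuous : forall p, cdom p -> {for cmap p, continuous cinv};
  cmapK : forall p, cdom p -> cinv (cmap p) = p }.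

Section Charts.
Context {R : realType} {n : nat} {X : topologicalType}.
Implicit Types c d : chart R n X.

Definition cimg c (W : set X) : set 'rV[R[i]]_n := cmap c @` (cdom c `&` W).

Definition transition c d : 'rV[R[i]]_n -> 'rV[R[i]]_n :=
  fun z => cmap d (cinv c z).

Definition compatible c d : Prop :=
  holomorphic (cimg c (cdom d)) (transition c d) /\
  holomorphic (cimg d (cdom c)) (transition d c).

(* The differential at p of the transition map from c to d. *)
Definition dtransition c d (p : X) (u : 'rV[R[i]]_n) : 'rV[R[i]]_n :=
  \row_(k < n) rderive u (fun z => transition c d z 0 k) (cmap c p).

End Charts.

Record complexManifold (R : realType) (n : nat) := ComplexManifold {
  carrier :> topologicalType;
  manifold_hausdorff : hausdorff_space carrier;
  manifold_second_countable : @second_countable carrier;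
  atlas : set (chart R n carrier);
  atlas_cover : forall p : carrier, exists2 c, atlas c & cdom c p;
  atlas_compatible : forall c d, atlas c -> atlas d -> compatible c d }.

Section Manifold.
Context {R : realType} {n : nat}.
Local Notation C := R[i].

(* The charts of the maximal atlas. *)
Definition holo_chart (M : complexManifold R n) (c : chart R n M) : Prop :=
  forall d, atlas d -> compatible c d.

Definition smooth_on (M : complexManifold R n) (W : set M) (f : M -> C) : Prop :=
  forall c, holo_chart c -> smooth (cimg c W) (f \o cinv c).

(* The elements of C^oo(W)[[hbar]], for W open. *)
Definition fsmooth_on (M : complexManifold R n) (W : set M)
    (F : nat -> M -> C) : Prop :=
  forall k, smooth_on W (F k).

(* A real smooth 2-form.  A tangent vector at p is represented, in each
   holomorphic chart around p, by its coordinates u in C^n (the vector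
   2 Re (sum_i u_i d/dz^i)); [tf_chart] is the change of chart. *)
Record twoForm (M : complexManifold R n) := TwoForm {
  tf_at :> chart R n M -> M -> 'rV[C]_n -> 'rV[C]_n -> R;
  tf_linear : forall c p, holo_chart c -> cdom c p ->
    forall (a : R) u v w,
      tf_at c p (a%:C *: u + v) w = a * tf_at c p u w + tf_at c p v w;
  tf_antisym : forall c p, holo_chart c -> cdom c p ->
    forall u v, tf_at c p u v = - tf_at c p v u;
  tf_chart : forall c d p, holo_chart c -> holo_chart d ->
    cdom c p -> cdom d p -> forall u v,
      tf_at c p u v = tf_at d p (dtransition c d p u) (dtransition c d p v);
  tf_smooth : forall c, holo_chart c -> forall u v,
    smooth (cimg c setT) (fun z => (tf_at c (cinv c z) u v)%:C) }.

Variable M : complexManifold R n.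
Implicit Types (omega : twoForm M) (c : chart R n M) (p : M)
  (f : M -> C) (F : nat -> M -> C) (H : 'M[C]_n).

(* d omega (u, v, w) = 0 for vector fields u, v, w constant in the chart. *)
Definition closed_form omega : Prop :=
  forall c, holo_chart c -> forall z, cimg c setT z -> forall u v w,
    rderive u (fun z => (omega c (cinv c z) v w)%:C) z +
    rderive v (fun z => (omega c (cinv c z) w u)%:C) z +
    rderive w (fun z => (omega c (cinv c z) u v)%:C) z = 0.

Definition nondegenerate omega : Prop :=
  forall c p, holo_chart c -> cdom c p ->
    forall u, (forall v, omega c p u v = 0) -> u = 0.

Definition symplectic omega : Prop := closed_form omega /\ nondegenerate omega.

(* omega = (i/2) sum_{i,j} H_ij dz^i /\ dzbar^j at p. *)
Definition has_coef omega c p H : Prop :=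
  forall u v : 'rV[C]_n,
    (omega c p u v)%:C = 'i / 2 * \sum_(i < n) \sum_(j < n)
      H i j * (u 0 i * (v 0 j)^* - v 0 i * (u 0 j)^*).

Definition type11 omega : Prop :=
  forall c p, holo_chart c -> cdom c p -> exists H, has_coef omega c p H.

(* Phi is a potential of omega on the holomorphic chart c; it is a function of
   the coordinates of c. *)
Definition potential omega c (Phi : 'rV[C]_n -> C) : Prop :=
  [/\ holo_chart c, smooth (cimg c setT) Phi &
      forall p, cdom c p -> has_coef omega c p (hmx Phi (cmap c p))].

Definition chart_bullet c (Phi : 'rV[C]_n -> C) F G : nat -> M -> C :=
  fun k p => bullet Phi (fun a => F a \o cinv c) (fun b => G b \o cinv c)
                    k (cmap c p).

(* The Poisson bracket at p, computed in the chart c, in which omega has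
   coefficients H at p. *)
Definition poisson c H f1 f2 p : C :=
  2 / 'i * \sum_(i < n) \sum_(j < n) hinv H i j *
    (dz i (f1 \o cinv c) (cmap c p) * dzbar j (f2 \o cinv c) (cmap c p)
     - dzbar j (f1 \o cinv c) (cmap c p) * dz i (f2 \o cinv c) (cmap c p)).

Definition fconst f : nat -> M -> C := fun k => if k is 0 then f else 0.

Definition fscale (a : nat -> C) F : nat -> M -> C :=
  fun k p => \sum_(i < k.+1) a i * F (k - i)%N p.

Definition glues_bullets omega
    (star : (nat -> M -> C) -> (nat -> M -> C) -> nat -> M -> C) : Prop :=
  forall F G, fsmooth_on setT F -> fsmooth_on setT G ->
  forall c Phi, potential omega c Phi ->
  forall k p, cdom c p -> star F G k p = chart_bullet c Phi F G k p.

Record deformation_quantization omega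
    (star : (nat -> M -> C) -> (nat -> M -> C) -> nat -> M -> C) : Prop := {
  dq_smooth : forall F G, fsmooth_on setT F -> fsmooth_on setT G ->
    fsmooth_on setT (star F G);
  dq_linearl : forall a F F' G,
    fsmooth_on setT F -> fsmooth_on setT F' -> fsmooth_on setT G ->
    star (fscale a F + F') G = fscale a (star F G) + star F' G;
  dq_linearr : forall a F G G',
    fsmooth_on setT F -> fsmooth_on setT G -> fsmooth_on setT G' ->
    star F (fscale a G + G') = fscale a (star F G) + star F G';
  dq_assoc : forall F G K,
    fsmooth_on setT F -> fsmooth_on setT G -> fsmooth_on setT K ->
    star (star F G) K = star F (star G K);
  dq_classical : forall f1 f2, smooth_on setT f1 -> smooth_on setT f2 ->
    forall p, star (fconst f1) (fconst f2) 0%N p = f1 p * f2 p;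
  dq_commutator0 : forall f1 f2, smooth_on setT f1 -> smooth_on setT f2 ->
    forall p, (star (fconst f1) (fconst f2) - star (fconst f2) (fconst f1)) 0%N p
      = 0;
  dq_commutator1 : forall f1 f2, smooth_on setT f1 -> smooth_on setT f2 ->
    forall c p H, holo_chart c -> cdom c p -> has_coef omega c p H ->
    (star (fconst f1) (fconst f2) - star (fconst f2) (fconst f1)) 1%N p
      = (2 * 'i)^-1 * poisson c H f1 f2 p }.

End Manifold.

(* Main.v *)
(** The Gaussian functional is determined by its value at 1 and by integration
by parts, so the formal integral kills total derivatives.  It follows that
f * _ commutes with D_j = exp(-Phi/hbar) dbar_j exp(Phi/hbar), and _ * h with the
analogous operators for d_i; moreover f * _ only differentiates f in the
directions dbar_j and its argument in the directions d_i.  Changing Phi by the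
sum of a holomorphic and an antiholomorphic polynomial does not affect the
product, and makes all pure derivatives of Phi of bounded order vanish at a given
point; there the operators D act on jets as plain derivatives.  Since the D's
commute with each other, both bracketings of f * g * h have the same expansion.
The coefficient of hbar in a product follows from the same commutation rule.

The formal integral of a density with a given phase is characterised by
integration by parts, by an Euler identity expressing homogeneity in hbar, and by
its leading term.  These properties are preserved by holomorphic changes of
variables, hence so is the product.  Local potentials come from a ddbar-lemma on
polydiscs: the radial homotopy makes omega exact, and dbar is inverted one
variable at a time by the Cauchy transform in polar coordinates. *)

Require Import Defs.
From HB Require Import structures.
From mathcomp Require Import all_boot all_order all_algebra.
From mathcomp Require Import all_classical all_reals all_analysis.
From mathcomp Require Import complex ring lra zify.
From mathcomp Require Import ssrcomplements perm.

Set Implicit Arguments.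
Unset Strict Implicit.
Unset Printing Implicit Defensive.

Import Order.TTheory GRing.Theory Num.Theory numFieldNormedType.Exports.

Local Open Scope classical_set_scope.
Local Open Scope ring_scope.
Local Open Scope complex_scope.

(** * Directional derivatives and Wirtinger calculus *)

(** Associativity needs the jets of f * g and not only its values, because the outer product
    differentiates it again. The operators D involve 1/hbar, so they act on sequences in which the
    function sits at index k; each D lowers the index by at most one, and k steps suffice since the
    coefficient of hbar^k has at most k derivatives in each argument. That bound, rather than the
    evident 2k, holds because the Gaussian functional only sees monomials with as many y as ybar,
    while every term of the phase contains both.

    In the uniqueness of the formal integral, integration by parts leaves one unknown in each order
    k > 0: the integral of the density 1. Integrating the phase by parts gives the factor n for that
    unknown where the Euler identity gives n + k, which forces two integrals with the same leading
    term to agree. Changes of variables enter only through the Piola identity, which turns total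
    derivatives into total derivatives, and through the fact that holomorphic maps do not mix the
    two kinds of derivatives. *)

Section ComplexTopology.
Context {R : realType}.
Local Notation C := R[i].

Lemma ReIm_eq (x y : C) : complex.Re x = complex.Re y -> complex.Im x = complex.Im y -> x = y.
Proof. by case: x y => [a b] [c d] /= -> ->. Qed.

Lemma normc_ge_Im (x : C) : (`|complex.Im x|)%:C <= `|x|.
Proof.
rewrite normc_def lecR -sqrtr_sqr ler_wsqrtr// lerDr sqr_ge0 //.
Qed.

Lemma normc_le_ReIm (x : C) : `|x| <= (`|complex.Re x| + `|complex.Im x|)%:C.
Proof.
rewrite {1}[x]complexE (le_trans (ler_normD _ _))// normrM.
rewrite [`|'i%C|]normc_def /= expr0n expr1n add0r sqrtr1 mul1r.
by rewrite !normc_def /= expr0n !addr0 !sqrtr_sqr -rmorphD.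
Qed.

Lemma Re_continuous : continuous (@complex.Re R : C -> R).
Proof.
move=> x A /nbhs_ballP[e /= e0 eA]; apply/nbhs_ballP.
exists e%:C => /=; first by rewrite ltcR.
move=> y xy; apply: eA; move: xy; rewrite -!ball_normE /= => xy.
by rewrite -raddfB -ltcR (le_lt_trans (normc_ge_Re _)).
Qed.

Lemma Im_continuous : continuous (@complex.Im R : C -> R).
Proof.
move=> x A /nbhs_ballP[e /= e0 eA]; apply/nbhs_ballP.
exists e%:C => /=; first by rewrite ltcR.
move=> y xy; apply: eA; move: xy; rewrite -!ball_normE /= => xy.
by rewrite -raddfB -ltcR (le_lt_trans (normc_ge_Im _)).
Qed.

Lemma RtoC_continuous : continuous (real_complex R : R -> C).
Proof.
move=> x; apply/cvgrPdist_lt => e e0.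
have eE : e = (complex.Re e)%:C by rewrite RRe_real // gtr0_real.
near=> y.
rewrite -rmorphB normc_def /= expr0n addr0 sqrtr_sqr eE ltcR; near: y.
apply: (@cvgr_dist_lt _ R^o _ _ _ id) => //.
by rewrite -ltcR -eE.
Unshelve. all: by end_near. Qed.

Lemma continuous_ReIm (T : topologicalType) (F : T -> C) (z : T) :
  {for z, continuous F} <->
  ({for z, continuous (fun x => complex.Re (F x))} /\
  {for z, continuous (fun x => complex.Im (F x))}).
Proof.
split=> [cF|[cR cI]].
  split; apply: continuous_comp => //; [exact: Re_continuous|exact: Im_continuous].
have -> : F = (fun x => (complex.Re (F x))%:C + 'i%C * (complex.Im (F x))%:C).
  by apply/funext => x; rewrite -complexE.
apply: (@continuousD _ C).
  by apply: (continuous_comp cR); exact: RtoC_continuous.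
apply: (@continuousM C _ (fun=> 'i%C)); first exact: cst_continuous.
by apply: (continuous_comp cI); exact: RtoC_continuous.
Qed.

Lemma conjc_continuous : continuous (@conjc R : C -> C).
Proof.
move=> x; apply/continuous_ReIm; split.
  have -> : (fun y : C => complex.Re y^*) = (@complex.Re R) by apply/funext => -[].
  exact: Re_continuous.
have -> : (fun y : C => complex.Im y^*) = (fun y => - complex.Im y :> R) by apply/funext => -[].
by apply: (@continuousN _ R^o); exact: Im_continuous.
Qed.

Context {n : nat}.
Implicit Types (z v : 'rV[C]_n).

Lemma line_continuous z v : continuous (fun t : R => z + t%:C *: v).
Proof.
move=> t; apply: cvgD; first exact: cvg_cst.
by apply: cvgZr_tmp; exact: RtoC_continuous.
Qed.

End ComplexTopology.

(** * Derivatives of complex-valued curves *)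

Section CurveDerivative.
Context {R : realType}.
Local Notation C := R[i].

(** Stated componentwise, like [rderivable], so that the real theory applies to each part. *)
Definition cder (g : R -> C) (t : R) (d : C) : Prop :=
  is_derive t (1 : R) (fun s => complex.Re (g s)) (complex.Re d) /\
  is_derive t (1 : R) (fun s => complex.Im (g s)) (complex.Im d).

Lemma is_derive_of_cvg (f : R -> R) a d :
  h^-1 * (f (a + h) - f a) @[h --> 0^'] --> d -> is_derive a (1 : R) f d.
Proof.
move=> H.
have H' : h^-1 *: ((f \o shift a) (h *: (1:R)) - f a) @[h --> 0^'] --> d.
  apply: cvg_trans H; apply: near_eq_cvg; near=> h.
  by rewrite /= /GRing.scale /= mulr1 [h + a]addrC.
by split; [apply/cvg_ex; exists d|apply: cvg_lim].
Unshelve. all: by end_near. Qed.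

Lemma is_derive_cvg (f : R -> R) a d : is_derive a (1 : R) f d ->
  h^-1 * (f (a + h) - f a) @[h --> 0^'] --> d.
Proof.
case=> df dv; have := df => /cvg_ex[l Hl].
have <- : l = d by rewrite -dv; apply/esym/cvg_lim.
apply: cvg_trans Hl; apply: near_eq_cvg; near=> h.
by rewrite /= /GRing.scale /= mulr1 [h + a]addrC.
Unshelve. all: by end_near. Qed.

Lemma is_derive_continuous (f : R -> R) a d : is_derive a (1 : R) f d ->
  {for a, continuous f}.
Proof. by case=> df _; apply: differentiable_continuous; apply/derivable1_diffP. Qed.

Lemma cder_continuous g t d : cder g t d -> {for t, continuous g}.
Proof.
by move=> [a b]; apply/continuous_ReIm; split; apply: is_derive_continuous.
Qed.

Lemma cder_eq g t d d' : cder g t d -> d = d' -> cder g t d'.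
Proof. by move=> ? <-. Qed.

Lemma cder_near g h t d : (\forall s \near t, g s = h s) -> cder g t d -> cder h t d.
Proof.
move=> gh [a b]; split.
  by apply: near_eq_is_derive a; apply: filterS gh => s ->.
by apply: near_eq_is_derive b; apply: filterS gh => s ->.
Qed.

Lemma cder_ext g h t d : g =1 h -> cder g t d -> cder h t d.
Proof. by move=> /funext->. Qed.

Lemma cder_cst (c : C) t : cder (fun=> c) t 0.
Proof. by split; apply: is_derive_cst. Qed.

Lemma cder_RtoC (f : R -> R) t d : is_derive t (1 : R) f d -> cder (fun s => (f s)%:C) t d%:C.
Proof. by move=> fd; split => //=; apply: is_derive_cst. Qed.

Lemma ReD (x y : C) : complex.Re (x + y) = complex.Re x + complex.Re y.
Proof. by case: x y => [a b] [c d]. Qed.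

Lemma ImD (x y : C) : complex.Im (x + y) = complex.Im x + complex.Im y.
Proof. by case: x y => [a b] [c d]. Qed.

Lemma cderD g h t d e : cder g t d -> cder h t e -> cder (fun s => g s + h s) t (d + e).
Proof.
move=> [a b] [a' b']; split.
  rewrite raddfD; have -> : (fun s => complex.Re (g s + h s)) = (fun s => complex.Re (g s)) + (fun s => complex.Re (h s)) by apply/funext => s; rewrite raddfD.
  exact: is_deriveD.
rewrite raddfD; have -> : (fun s => complex.Im (g s + h s)) = (fun s => complex.Im (g s)) + (fun s => complex.Im (h s)) by apply/funext => s; rewrite raddfD.
exact: is_deriveD.
Qed.

Lemma ReM (x y : C) : complex.Re (x * y) = complex.Re x * complex.Re y - complex.Im x * complex.Im y.
Proof. by case: x y => [a b] [c d]. Qed.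

Lemma ImM (x y : C) : complex.Im (x * y) = complex.Re x * complex.Im y + complex.Im x * complex.Re y.
Proof. by case: x y => [a b] [c d]. Qed.

Lemma cderM g h t d e : cder g t d -> cder h t e ->
  cder (fun s => g s * h s) t (d * h t + g t * e).
Proof.
move=> [a b] [a' b']; split.
  rewrite ReD !ReM.
  have -> : (fun s => complex.Re (g s * h s)) = (fun s => complex.Re (g s)) * (fun s => complex.Re (h s)) - (fun s => complex.Im (g s)) * (fun s => complex.Im (h s)) by apply/funext => s; rewrite ReM.
  apply: is_derive_eq (is_deriveB (is_deriveM a a') (is_deriveM b b')) _.
  rewrite /GRing.scale/=; clear; ring.
rewrite ImD !ImM.
have -> : (fun s => complex.Im (g s * h s)) = (fun s => complex.Re (g s)) * (fun s => complex.Im (h s)) + (fun s => complex.Im (g s)) * (fun s => complex.Re (h s)) by apply/funext => s; rewrite ImM.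
apply: is_derive_eq (is_deriveD (is_deriveM a b') (is_deriveM b a')) _.
rewrite /GRing.scale/=; clear; ring.
Qed.

Lemma cderZ c h t e : cder h t e -> cder (fun s => c * h s) t (c * e).
Proof. by move=> he; apply: cder_eq (cderM (cder_cst c t) he) _; rewrite mul0r add0r. Qed.

Lemma cder_conj g t d : cder g t d -> cder (fun s => (g s)^*) t d^*.
Proof.
move=> [a b]; split.
  have -> : (fun s => complex.Re (g s)^*) = (fun s => complex.Re (g s)) by apply/funext => s; case: (g s).
  by case: d a b.
have -> : (fun s => complex.Im (g s)^*) = - (fun s => complex.Im (g s)) by apply/funext => s; rewrite fctE; case: (g s).
have -> : complex.Im d^* = - complex.Im d by case: d {a b}.
exact: is_deriveN.
Qed.

Lemma cderV g t d : g t != 0 -> cder g t d -> cder (fun s => (g s)^-1) t (- (g t)^-2 * d).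
Proof.
move=> g0 [a b].
pose A s := complex.Re (g s); pose B s := complex.Im (g s).
pose N s := A s * A s + B s * B s.
have iE s : (g s)^-1 = (A s * (N s)^-1) +i* (- (B s * (N s)^-1)).
  by rewrite /N /A /B; case: (g s) => x y; rewrite -!expr2 /= .
have N0 : N t != 0.
  apply: contra g0; rewrite /N -!expr2 paddr_eq0 ?sqr_ge0 // !sqrf_eq0 => /andP[/eqP x /eqP y].
  by rewrite [g t]complexE -/(A t) -/(B t) x y mulr0 addr0.
have dN : is_derive t (1 : R) N (2 * A t * complex.Re d + 2 * B t * complex.Im d).
  apply: is_derive_eq (is_deriveD (is_deriveM a a) (is_deriveM b b)) _.
  rewrite /GRing.scale/=; clear; ring.
have dV := is_deriveV (f := N) N0 dN.
have E : - (g t)^-2 * d = - ((g t)^-1 * (g t)^-1 * d) by rewrite -exprVn expr2 mulNr.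
split.
  rewrite (_ : (fun s => _) = A * (fun s => (N s)^-1)); last by apply/funext => s; rewrite iE.
  apply: is_derive_eq (is_deriveM a dV) _; rewrite /GRing.scale/= E iE; case: (d) => u v /=.
  by move: N0; rewrite /N -/(A t) -/(B t); move: (A t) (B t) => x y N0; field.
rewrite (_ : (fun s => _) = - (B * (fun s => (N s)^-1))); last by apply/funext => s; rewrite iE.
apply: is_derive_eq (is_deriveN (is_deriveM b dV)) _; rewrite /GRing.scale/= E iE; case: (d) => u v /=.
by move: N0; rewrite /N -/(A t) -/(B t); move: (A t) (B t) => x y N0; field.
Qed.

End CurveDerivative.

(** * The mean value theorem along a direction *)

Section DirectionalMVT.
Context {R : realType} {n : nat}.
Local Notation C := R[i].
Local Notation V := 'rV[C]_n.
Implicit Types (f g : V -> R) (p v w z : V).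

(** The mean value theorem for s -> f (p + s c v) on [0, 1]; it asks for derivatives on that segment
    only. *)
Lemma mvt_dir f g v p (c : R) :
  (forall s, 0 <= s <= 1 -> is_derive 0 (1 : R) (fun t => f (p + (s * c)%:C *: v + t%:C *: v)) (g (p + (s * c)%:C *: v))) ->
  exists2 th : R, 0 <= th <= 1 & f (p + c%:C *: v) - f p = c * g (p + (th * c)%:C *: v).
Proof.
move=> H; pose phi s := f (p + (s * c)%:C *: v).
have dphi (s : R) : 0 <= s <= 1 -> is_derive s (1 : R) phi (c * g (p + (s * c)%:C *: v)).
  move=> s01; rewrite mulrC.
  have -> : phi = (fun t => f (p + (s * c)%:C *: v + t%:C *: v)) \o (fun s' => (s' - s) * c).
    apply/funext => s'; rewrite /phi/= -addrA -scalerDl -rmorphD; congr (f (_ + _%:C *: _)); ring.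
  apply: is_derive1_comp; first by rewrite subrr mul0r; exact: H.
  have -> : (fun s' => (s' - s) * c) = c *: ((id : R -> R) - cst s).
    by apply/funext => s'; rewrite /GRing.scale /= mulrC.
  by apply: is_derive_eq; rewrite subr0 /GRing.scale/= mulr1.
have [|s s01|th th01] := @MVT_segment R phi (fun s => c * g (p + (s * c)%:C *: v)) 0 1 ler01.
- by move=> x; rewrite in_itv/= => /andP[a b]; apply: dphi; rewrite !ltW.
- apply: continuous_in_subspaceT => x; rewrite inE/= in_itv/= => x01.
  by apply: is_derive_continuous; exact: dphi.
rewrite subr0 mulr1 /phi mul1r mul0r scale0r addr0 => E.
by exists th => //; move: th01; rewrite in_itv.
Qed.

(** One [d] serves all base points of the half ball; the mean value arguments below rest on this
    uniformity. *)
Lemma ball_line z (r : C) : 0 < r -> forall v, exists2 d : R, 0 < d &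
  forall w (s : R), `|z - w| < r / 2 -> `|s| < d -> ball z r (w + s%:C *: v).
Proof.
move=> r0 v.
have rE : r = (complex.Re r)%:C by rewrite RRe_real // gtr0_real.
have vE : `|v| = (complex.Re `|v|)%:C by rewrite RRe_real // ger0_real.
have r0' : 0 < complex.Re r by rewrite -ltcR -rE.
have v0' : 0 <= complex.Re `|v| by rewrite -lecR -vE normr_ge0.
exists (complex.Re r / 2 / (complex.Re `|v| + 1)) => [|w s zw sd].
  by rewrite !divr_gt0 // ltr_wpDl.
rewrite -ball_normE /= opprD addrA (le_lt_trans (ler_normB _ _))// normrZ.
rewrite [ltRHS](splitr r) ltr_leD// vE rE normc_def/= expr0n addr0 sqrtr_sqr.
rewrite -(rmorph_nat (real_complex R)) -fmorphV -!rmorphM lecR.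
move: sd; rewrite ltr_pdivlMr ?ltr_wpDl // => /ltW; apply: le_trans.
by rewrite ler_wpM2l // lerDl.
Qed.

(** The curve [q] is only continuous. By the mean value theorem the increment along [v] is c t times
    [g] at an intermediate point, and continuity of [g] gives the limit. In the chain rule, [q]
    collects the other directions. *)
Lemma curve_step f g v z (q : R -> V) (c : R -> R) t0 c' :
  (\forall w \near z, is_derive 0 (1 : R) (fun t => f (w + t%:C *: v)) (g w)) ->
  {for z, continuous g} -> {for t0, continuous q} -> q t0 = z -> c t0 = 0 ->
  is_derive t0 (1 : R) c c' ->
  is_derive t0 (1 : R) (fun t => f (q t + (c t)%:C *: v) - f (q t)) (c' * g z).
Proof.
move=> /nbhs_ballP[r /= r0 dfg] gz qt0 qz c0 dc.
have [d d0 Hd] := ball_line z r0 v.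
have cc : {for t0, continuous c} := is_derive_continuous dc.
(* The intermediate point is chosen as a function of [t]; where the mean value theorem does not
   apply, 0 is a default. *)
have [th Hth] : {th : R -> R & forall t, 0 <= th t <= 1 /\
   (`|z - q t| < r / 2 -> `|c t| < d -> f (q t + (c t)%:C *: v) - f (q t) = c t * g (q t + (th t * c t)%:C *: v))}.
  apply: (@choice _ _ (fun t (x : R) => 0 <= x <= 1 /\ (`|z - q t| < r / 2 -> `|c t| < d -> f (q t + (c t)%:C *: v) - f (q t) = c t * g (q t + (x * c t)%:C *: v)))) => t.
  case: (pselect (`|z - q t| < r / 2 /\ `|c t| < d)) => [[A B]|N]; last first.
    by exists 0; rewrite lexx ler01; split => // ? ?; exfalso; apply: N.
  have [|x x01 E] := @mvt_dir f g v (q t) (c t).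
    move=> s /andP[s0 s1]; apply: dfg; apply: Hd => //.
    rewrite normrM ger0_norm//; apply: le_lt_trans B.
    by rewrite ler_piMl.
  by exists x; split.
have cc0 : c t @[t --> t0] --> (0 : R) by rewrite -c0; exact: cc.
have cth : (th t * c t) @[t --> t0] --> (0 : R).
  apply/cvgr0Pnorm_lt => e e0; have := @cvgr0_norm_lt _ _ _ _ (nbhs_filter t0) c cc0 e e0.
  apply: filterS => t; apply: le_lt_trans; rewrite normrM; have [/andP[a b] _] := Hth t.
  by rewrite ger0_norm// ler_piMl.
have xi : (q t + (th t * c t)%:C *: v) @[t --> t0] --> z.
  have -> : z = q t0 + (0 : R)%:C *: v by rewrite scale0r addr0.
  apply: cvgD; first exact: qt0.
  by apply: cvgZr_tmp; exact: (continuous_cvg _ (@RtoC_continuous R 0) cth).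
have Ht0 : (t0 + h) @[h --> 0^'] --> t0.
  rewrite -[X in _ --> X]addr0; apply: cvgD; first exact: cvg_cst.
  exact: cvg_within.
have gxi : g (q (t0 + h) + (th (t0 + h) * c (t0 + h))%:C *: v) @[h --> 0^'] --> g z.
  have gxi0 : g (q t + (th t * c t)%:C *: v) @[t --> t0] --> g z by exact: (@cvg_comp _ _ _ (fun t => q t + (th t * c t)%:C *: v) g _ _ _ xi gz).
  exact: (cvg_comp (fun h => t0 + h) (fun t => g (q t + (th t * c t)%:C *: v)) Ht0 gxi0).
apply: is_derive_of_cvg; apply: cvg_trans (cvgM (is_derive_cvg dc) gxi); apply: near_eq_cvg.
have near1 : \forall t \near t0, `|z - q t| < r / 2 /\ `|c t| < d.
  apply: filterI; last exact: (@cvgr0_norm_lt _ _ _ _ (nbhs_filter t0) c cc0 d d0).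
  by rewrite -qz; apply: (cvgr_dist_lt _ _ qt0); rewrite divr_gt0.
have near2 : \forall h \near 0^', `|z - q (t0 + h)| < r / 2 /\ `|c (t0 + h)| < d := Ht0 _ near1.
apply: filterS near2 => h [h1 h2] /=.
rewrite c0 !subr0 qz scale0r addr0 subrr subr0 -mulrA; congr (_ * _).
by have [_ ->] := Hth (t0 + h).
Qed.

End DirectionalMVT.

(** * Chain rule and symmetry of second derivatives *)

Section Chain.
Context {R : realType} {n : nat}.
Local Notation C := R[i].
Local Notation V := 'rV[C]_n.
Implicit Types (f g : V -> R) (F G : V -> C) (p v w z : V) (D : set V).

(** Continuous directional derivatives suffice: the displacements are added one at a time, each by
    [curve_step]. *)
Lemma curve_chain_real (I : Type) (s : seq I) f (g : I -> V -> R) (v : I -> V) z (c : I -> R -> R) t0 (c' : I -> R) :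
  (forall i, \forall w \near z, is_derive 0 (1 : R) (fun t => f (w + t%:C *: v i)) (g i w)) ->
  (forall i, {for z, continuous (g i)}) -> (forall i, c i t0 = 0) ->
  (forall i, is_derive t0 (1 : R) (c i) (c' i)) ->
  is_derive t0 (1 : R) (fun t => f (z + \sum_(i <- s) (c i t)%:C *: v i)) (\sum_(i <- s) c' i * g i z).
Proof.
move=> df cg c0 dc; elim: s => [|i s IH].
  rewrite big_nil (_ : (fun t => _) = cst (f z)); first exact: is_derive_cst.
  by apply/funext => t; rewrite big_nil addr0.
pose q t := z + \sum_(i <- s) (c i t)%:C *: v i.
have qt0 : {for t0, continuous q}.
  apply: cvgD; first exact: cvg_cst.
  apply: cvg_big => //; [exact: add_continuous|move=> j _; apply: cvgZr_tmp].
  exact: (continuous_cvg _ (@RtoC_continuous R _) (is_derive_continuous (dc j))).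
have qz : q t0 = z.
  by rewrite /q big1 ?addr0 // => j _; rewrite c0 scale0r.
have H := curve_step (df i) (cg i) qt0 qz (c0 i) (dc i).
rewrite big_cons (_ : (fun t => _) = (fun t => f (q t + (c i t)%:C *: v i) - f (q t)) + (fun t => f (q t))).
  exact: is_deriveD.
by apply/funext => t; rewrite fctE subrK big_cons addrCA addrC.
Qed.

Lemma mvt_dir_near f g v z (r : C) : 0 < r ->
  (forall w, ball z r w -> is_derive 0 (1 : R) (fun t => f (w + t%:C *: v)) (g w)) ->
  exists2 d : R, 0 < d & forall w (s : R), `|z - w| < r / 2 -> `|s| < d ->
    exists2 th : R, 0 <= th <= 1 & f (w + s%:C *: v) - f w = s * g (w + (th * s)%:C *: v).
Proof.
move=> r0 H; have [d d0 Hd] := ball_line z r0 v; exists d => // w s zw sd.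
apply: mvt_dir => x /andP[x0 x1]; apply/H/Hd => //.
by rewrite normrM ger0_norm//; apply: le_lt_trans sd; rewrite ler_piMl.
Qed.

(** The mean value theorem along [v] for psi p = f (p + t w) - f p, and along [w] for [fv], turns
    the second difference into a value of the mixed derivative near [z]. *)
Lemma schwarz_point (f fv fvw : V -> R) v w z (r : C) : 0 < r ->
  (forall p, ball z r p -> is_derive 0 (1 : R) (fun t => f (p + t%:C *: v)) (fv p)) ->
  (forall p, ball z r p -> is_derive 0 (1 : R) (fun t => fv (p + t%:C *: w)) (fvw p)) ->
  exists2 d : R, 0 < d & forall t : R, 0 < t < d -> exists2 p, ball z r p &
    f (z + t%:C *: v + t%:C *: w) - f (z + t%:C *: v) - (f (z + t%:C *: w) - f z) = t * t * fvw p.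
Proof.
move=> r0 H1 H2.
have r2 : 0 < r / 2 by rewrite divr_gt0.
have r4 : 0 < r / 2 / 2 by rewrite divr_gt0.
have [d d0 Hd] := ball_line z r0 w.
have [d' d'0 Hd'] := ball_line z r2 v.
have [d2 d20 Hd2] := mvt_dir_near r0 H2.
have [d3 d30 Hd3] := ball_line z r2 w.
exists (Num.min (Num.min d d2) (Num.min d' d3)); first by rewrite !lt_min d0 d'0 d20 d30.
move=> t /andP[t0]; rewrite !lt_min => /andP[/andP[td td2] /andP[td' td3]].
have tn : `|t| = t by rewrite gtr0_norm.
pose psi (p : V) := f (p + t%:C *: w) - f p.
have Hpsi : forall s : R, 0 <= s <= 1 -> is_derive 0 (1 : R) (fun u => psi (z + (s * t)%:C *: v + u%:C *: v))
    (fv (z + (s * t)%:C *: v + t%:C *: w) - fv (z + (s * t)%:C *: v)).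
  move=> s /andP[s0 s1].
  have b1 : ball z (r/2) (z + (s * t)%:C *: v).
    apply: Hd'; first by rewrite subrr normr0.
    rewrite normrM tn ger0_norm//; apply: le_lt_trans td'; by rewrite ler_piMl // ltW.
  have b2 : ball z r (z + (s * t)%:C *: v) by apply: le_ball b1; rewrite ler_pdivrMr // ler_peMr ?(ltW r0) // ler1n.
  have b3 : ball z r (z + (s * t)%:C *: v + t%:C *: w).
    by apply: Hd; [move: b1; rewrite -ball_normE|rewrite tn].
  have e1 := H1 _ b2; have e2 := H1 _ b3.
  rewrite (_ : (fun t => _) = (fun u => f (z + (s * t)%:C *: v + t%:C *: w + u%:C *: v)) - (fun u => f (z + (s * t)%:C *: v + u%:C *: v))).
    exact: is_deriveB.
  by apply/funext => u; rewrite fctE /psi addrAC.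
have [th th01 E] := mvt_dir (g := fun p : V => fv (p + t%:C *: w) - fv p) Hpsi.
have b1 : ball z (r/2) (z + (th * t)%:C *: v).
  move/andP: th01 => [s0 s1]; apply: Hd'; first by rewrite subrr normr0.
  rewrite normrM tn ger0_norm//; apply: le_lt_trans td'; by rewrite ler_piMl // ltW.
have [||th2 /andP[th20 th21] E2] := Hd2 (z + (th * t)%:C *: v) t.
- by move: b1; rewrite -ball_normE.
- by rewrite tn.
exists (z + (th * t)%:C *: v + (th2 * t)%:C *: w).
  apply: Hd; first by move: b1; rewrite -ball_normE.
  by rewrite normrM tn ger0_norm//; apply: le_lt_trans td; rewrite ler_piMl // ltW.
by rewrite -mulrA -E2 -E.
Qed.

(** Both second differences are the same number, so t^2 [fvw p] = t^2 [fwv q] with [p] and [q] close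
    to [z]; continuity concludes. *)
Lemma schwarz_real (f fv fw fvw fwv : V -> R) v w z :
  (\forall p \near z, is_derive 0 (1 : R) (fun t => f (p + t%:C *: v)) (fv p)) ->
  (\forall p \near z, is_derive 0 (1 : R) (fun t => f (p + t%:C *: w)) (fw p)) ->
  (\forall p \near z, is_derive 0 (1 : R) (fun t => fv (p + t%:C *: w)) (fvw p)) ->
  (\forall p \near z, is_derive 0 (1 : R) (fun t => fw (p + t%:C *: v)) (fwv p)) ->
  {for z, continuous fvw} -> {for z, continuous fwv} -> fvw z = fwv z.
Proof.
move=> A1 A2 A3 A4 c1 c2.
apply/eqP; rewrite -subr_eq0 -normr_le0; apply/ler_addgt0Pl => e e0.
have e2 : 0 < e / 2 by rewrite divr_gt0.
have B1 : \forall p \near z, `|fvw z - fvw p| < e / 2 by apply: (cvgr_dist_lt _ _ c1).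
have B2 : \forall p \near z, `|fwv z - fwv p| < e / 2 by apply: (cvgr_dist_lt _ _ c2).
have /nbhs_ballP[r /= r0 H] : nbhs z (fun p =>
    ((is_derive 0 (1 : R) (fun t => f (p + t%:C *: v)) (fv p) /\
      is_derive 0 (1 : R) (fun t => f (p + t%:C *: w)) (fw p)) /\
     (is_derive 0 (1 : R) (fun t => fv (p + t%:C *: w)) (fvw p) /\
      is_derive 0 (1 : R) (fun t => fw (p + t%:C *: v)) (fwv p))) /\
    (`|fvw z - fvw p| < e / 2 /\ `|fwv z - fwv p| < e / 2)).
  by apply: filterI; [apply: filterI; apply: filterI|apply: filterI].
have [d1 d10 Hd1] := @schwarz_point f fv fvw v w z r r0 (fun p pb => (H p pb).1.1.1) (fun p pb => (H p pb).1.2.1).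
have [d2 d20 Hd2] := @schwarz_point f fw fwv w v z r r0 (fun p pb => (H p pb).1.1.2) (fun p pb => (H p pb).1.2.2).
pose t := Num.min d1 d2 / 2.
have m0 : 0 < Num.min d1 d2 by rewrite lt_min d10.
have t0 : 0 < t by rewrite divr_gt0.
have tm : t < Num.min d1 d2 by rewrite ltr_pdivrMr // ltr_pMr // ltr1n.
move: (tm); rewrite lt_min => /andP[t1 t2].
have [|p pb Ep] := Hd1 t; first by rewrite t0.
have [|q qb Eq] := Hd2 t; first by rewrite t0.
have pq : fvw p = fwv q.
  have tt : t * t != 0 by rewrite mulf_neq0 // gt_eqF.
  apply: (mulfI tt); rewrite -Ep -Eq (addrAC z) -!addrA; congr (_ + _).
  rewrite !opprD !opprK !addrA; congr (_ + _); exact: addrC.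
have := (H p pb).2.1; have := (H q qb).2.2; rewrite -pq /= => b1 b2.
rewrite addr0 (le_trans (ler_distD (fvw p) _ _)) // [leRHS](splitr e) lerD ?ltW //.
by rewrite distrC.
Qed.

End Chain.

(** * Closure properties of functions of class C^k *)

Section Smooth.
Context {R : realType} {n : nat}.
Local Notation C := R[i].
Local Notation V := 'rV[C]_n.
Implicit Types (F G : V -> C) (p v w z : V) (D : set V).

Definition hasD F z v d := cder (fun t : R => F (z + t%:C *: v)) 0 d.

Lemma hasDP F z v : rderivable F z v <-> hasD F z v (rderive v F z).
Proof.
split=> [[a b]|[a b]]; last by split; exact: ex_derive.
by split; rewrite /rderive /= derive1E; apply: DeriveDef.
Qed.

Lemma hasD_rderive F z v d : hasD F z v d -> rderive v F z = d.
Proof.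
move=> [[_ a] [_ b]]; apply/eqP; rewrite eq_complex /rderive /= !derive1E.
by rewrite -a -b !eqxx.
Qed.

Lemma hasD_rderivable F z v d : hasD F z v d -> rderivable F z v.
Proof. by move=> H; apply/hasDP; rewrite (hasD_rderive H). Qed.

Definition rd (b : bool) (j : 'I_n) : V := if b then ydir j else xdir j.

(** [Ck] with the two real directions of a coordinate indexed by a Boolean, so that each closure
    property is proved once. *)
Fixpoint Cksub (k : nat) D F : Prop :=
  (forall z, D z -> {for z, continuous F}) /\
  (if k is k'.+1 then forall b j, (forall z, D z -> rderivable F z (rd b j)) /\
    Cksub k' D (rderive (rd b j) F) else True).

Lemma CkE k D F : Ck k D F <-> Cksub k D F.
Proof.
elim: k F => [|k IH] F; first by []. split=> -[cF H]; split; try exact: cF.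
  move=> b j; have [a b' c /IH d] := H j; move/IH in c; case: b; split; [exact: b'|exact: d|exact: a|exact: c].
by move=> j; have [a /IH b] := H false j; have [c /IH d] := H true j; split; [exact: a|exact: c|exact: b|exact: d].
Qed.

Lemma near_open D z (P : V -> Prop) : open D -> D z -> (forall w, D w -> P w) -> \forall w \near z, P w.
Proof. by move=> oD Dz H; apply: filterS H _; exact: open_nbhs_nbhs. Qed.

Lemma near_line D F G z v : open D -> D z -> (forall w, D w -> F w = G w) ->
  \forall t \near (0 : R), F (z + t%:C *: v) = G (z + t%:C *: v).
Proof.
move=> oD Dz FG.
have H : \forall t \near (0 : R), D (z + t%:C *: v).
  apply: (@line_continuous R n z v 0); rewrite scale0r addr0; exact: open_nbhs_nbhs.
by apply: filterS H => t; exact: FG.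
Qed.

Lemma hasD_eq D F G z v d : open D -> D z -> (forall w, D w -> F w = G w) ->
  hasD F z v d -> hasD G z v d.
Proof. by move=> oD Dz FG; apply: cder_near; exact: near_line FG. Qed.

Lemma rderive_eq D F G z v : open D -> D z -> (forall w, D w -> F w = G w) ->
  rderive v F z = rderive v G z.
Proof.
move=> oD Dz FG; have N := near_line v oD Dz FG.
by congr (_ +i* _); rewrite !derive1E; apply: near_eq_derive; apply: filterS N => t ->.
Qed.

Lemma rderivable_eq D F G z v : open D -> D z -> (forall w, D w -> F w = G w) ->
  rderivable F z v -> rderivable G z v.
Proof. by move=> oD Dz FG /hasDP H; apply: hasD_rderivable (hasD_eq oD Dz FG H). Qed.

Lemma continuous_eq D F G z : open D -> D z -> (forall w, D w -> F w = G w) ->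
  {for z, continuous F} -> {for z, continuous G}.
Proof.
move=> oD Dz FG cF; suff : G x @[x --> z] --> G z by [].
move=> A; rewrite -(FG z Dz) => HA'; have HA : nbhs z (F @^-1` A) := cF A HA'.
have HB : nbhs z (F @^-1` A `&` D) by apply: filterI => //; exact: open_nbhs_nbhs.
have : nbhs z (G @^-1` A); last by [].
by apply: filterS HB => w [h1 h2]; move: h1; rewrite /= (FG w h2).
Qed.

Lemma contD F G z : {for z, continuous F} -> {for z, continuous G} -> {for z, continuous (fun w => F w + G w)}.
Proof. by move=> a b; exact: (cvgD a b). Qed.

Lemma contM F G z : {for z, continuous F} -> {for z, continuous G} -> {for z, continuous (fun w => F w * G w)}.
Proof. by move=> a b; exact: (cvgM a b). Qed.

Lemma contV F z : F z != 0 -> {for z, continuous F} -> {for z, continuous (fun w => (F w)^-1)}.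
Proof. by move=> a b; exact: (cvgV a b). Qed.

Lemma cont_conj F z : {for z, continuous F} -> {for z, continuous (fun w => (F w)^*)}.
Proof. by move=> b; exact: (@cvg_comp _ _ _ F (@conjc R) _ _ _ b (@conjc_continuous R _)). Qed.

Lemma Cksub_cont k D F z : Cksub k D F -> D z -> {for z, continuous F}.
Proof. by case: k => [|k] [H _]; exact: H. Qed.

Lemma Cksub_eq k D F G : open D -> (forall w, D w -> F w = G w) -> Cksub k D F -> Cksub k D G.
Proof.
move=> oD; elim: k F G => [|k IH] F G FG [cF H].
  by split; first by move=> z Dz; exact: continuous_eq FG (cF z Dz).
split; first by move=> z Dz; exact: continuous_eq FG (cF z Dz).
move=> b j; have [a c] := H b j; split; first by move=> z Dz; exact: rderivable_eq FG (a z Dz).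
by apply: IH c => w Dw; exact: rderive_eq FG.
Qed.

Opaque rderive.

Lemma Cksub_le k D F : Cksub k.+1 D F -> Cksub k D F.
Proof.
elim: k F => [|k IH] F [cF H]; split; try exact: cF; first by [].
move=> b j; have [a c] := H b j; split; first exact: a.
exact: IH.
Qed.

Lemma Cksub_sub k D D' F : D' `<=` D -> Cksub k D F -> Cksub k D' F.
Proof.
move=> DD; elim: k F => [|k IH] F [cF H]; split; try (by move=> z /DD; exact: cF); first by [].
move=> b j; have [a c] := H b j; split; first by move=> z /DD; exact: a.
exact: IH.
Qed.

(** The common route to order k + 1: guess the derivatives, check them pointwise, and show that the
    guesses are of class C^k. *)
Lemma CksubS k D F (dF : bool -> 'I_n -> V -> C) : open D ->
  (forall b j z, D z -> hasD F z (rd b j) (dF b j z)) ->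
  (forall z, D z -> {for z, continuous F}) ->
  (forall b j, Cksub k D (dF b j)) -> Cksub k.+1 D F.
Proof.
move=> oD H cF C'; split; first exact: cF.
move=> b j; split; first by move=> z Dz; exact: hasD_rderivable (H b j z Dz).
by apply: Cksub_eq (C' b j) => // w Dw; rewrite (hasD_rderive (H b j w Dw)).
Qed.

Lemma Cksub_hasD k D F z b j : Cksub k.+1 D F -> D z -> hasD F z (rd b j) (rderive (rd b j) F z).
Proof. by move=> [_ H] Dz; apply/hasDP; apply: (H b j).1. Qed.

Lemma Cksub_cst k D c : open D -> Cksub k D (fun=> c).
Proof.
move=> oD; have cc z : {for z, continuous (fun _ : V => c)} by exact: cst_continuous.
elim: k c cc => [|k IH] c cc; first by split; [move=> z _; exact: cc|].
apply: (@CksubS _ _ _ (fun _ _ _ => 0) oD).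
- by move=> b j z _; exact: cder_cst.
- by move=> z _; exact: cc.
- by move=> b j; apply: IH => z; exact: cst_continuous.
Qed.

Lemma Cksub_D k D F G : open D -> Cksub k D F -> Cksub k D G -> Cksub k D (fun z => F z + G z).
Proof.
move=> oD; elim: k F G => [|k IH] F G sF sG.
  by split; [move=> z Dz; exact: (contD (Cksub_cont sF Dz) (Cksub_cont sG Dz))|].
apply: (@CksubS _ _ _ (fun b j z => rderive (rd b j) F z + rderive (rd b j) G z) oD).
- by move=> b j z Dz; apply: cderD; [exact: Cksub_hasD sF Dz|exact: Cksub_hasD sG Dz].
- by move=> z Dz; exact: (contD (Cksub_cont sF Dz) (Cksub_cont sG Dz)).
- by move=> b j; apply: IH; [apply: (sF.2 b j).2|apply: (sG.2 b j).2].
Qed.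

Lemma Cksub_M k D F G : open D -> Cksub k D F -> Cksub k D G -> Cksub k D (fun z => F z * G z).
Proof.
move=> oD; elim: k F G => [|k IH] F G sF sG.
  by split; [move=> z Dz; exact: (contM (Cksub_cont sF Dz) (Cksub_cont sG Dz))|].
apply: (@CksubS _ _ _ (fun b j z => rderive (rd b j) F z * G z + F z * rderive (rd b j) G z) oD).
- move=> b j z Dz; have := cderM (Cksub_hasD b j sF Dz) (Cksub_hasD b j sG Dz).
  by rewrite scale0r addr0.
- by move=> z Dz; exact: (contM (Cksub_cont sF Dz) (Cksub_cont sG Dz)).
- move=> b j; have a := (sF.2 b j).2; have c := (sG.2 b j).2.
  by apply: (Cksub_D oD); apply: IH => //; exact: Cksub_le.
Qed.

Lemma Cksub_conj k D F : open D -> Cksub k D F -> Cksub k D (fun z => (F z)^*).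
Proof.
move=> oD; elim: k F => [|k IH] F sF.
  by split; [move=> z Dz; exact: (cont_conj (Cksub_cont sF Dz))|].
apply: (@CksubS _ _ _ (fun b j z => (rderive (rd b j) F z)^*) oD).
- by move=> b j z Dz; apply: cder_conj; exact: Cksub_hasD sF Dz.
- by move=> z Dz; exact: (cont_conj (Cksub_cont sF Dz)).
- by move=> b j; apply: IH; apply: (sF.2 b j).2.
Qed.

Lemma Cksub_V k D F : open D -> (forall z, D z -> F z != 0) -> Cksub k D F -> Cksub k D (fun z => (F z)^-1).
Proof.
move=> oD F0; elim: k => [|k IH] sF.
  by split; [move=> z Dz; exact: (contV (F0 z Dz) (Cksub_cont sF Dz))|].
apply: (@CksubS _ _ _ (fun b j z => - ((F z)^-1 * (F z)^-1) * rderive (rd b j) F z) oD).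
- move=> b j z Dz; have := cderV _ (Cksub_hasD b j sF Dz).
  by rewrite scale0r addr0 -expr2 -exprVn; apply; exact: F0.
- by move=> z Dz; exact: (contV (F0 z Dz) (Cksub_cont sF Dz)).
- move=> b j; apply: (Cksub_M oD); last by apply: (sF.2 b j).2.
  apply: (@Cksub_eq _ _ (fun z => (-1) * ((F z)^-1 * (F z)^-1)) _ oD); first by move=> w _; rewrite mulN1r.
  apply: (Cksub_M oD); first exact: Cksub_cst.
  by apply: (Cksub_M oD); apply: IH; exact: Cksub_le.
Qed.

Lemma Cksub_coord k D (j : 'I_n) : open D -> Cksub k D (fun z => z 0 j).
Proof.
move=> oD; have cc (z : V) : {for z, continuous (fun z : V => z 0 j)} by exact: coord_continuous.
case: k => [|k]; first by split; [move=> z _; exact: cc|].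
apply: (@CksubS _ _ _ (fun b i z => (rd b i) 0 j) oD).
- move=> b i z Dz; have H := @is_derive_id R _ (0 : R) 1.
  have H1 := cderD (cder_cst (z 0 j) 0) (cderM (cder_RtoC H) (cder_cst (rd b i 0 j) 0)).
  apply: (cder_ext _ (cder_eq H1 _)); first by move=> t; rewrite !mxE.
  by rewrite add0r mul1r mulr0 addr0.
- by move=> z _; exact: cc.
- by move=> b i; exact: Cksub_cst.
Qed.

End Smooth.

Section SmoothTheory.
Context {R : realType} {n : nat}.
Local Notation C := R[i].
Local Notation V := 'rV[C]_n.
Implicit Types (F G : V -> C) (p v w z : V) (D : set V).

Lemma smoothP D F : smooth D F <-> forall k, Cksub k D F.
Proof. by split=> H k; apply/CkE; exact: H. Qed.

Lemma rowE (u : V) : u = \sum_(j < n) ((complex.Re (u 0 j))%:C *: rd false j + (complex.Im (u 0 j))%:C *: rd true j).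
Proof.
apply/rowP => i; rewrite summxE (bigD1 i) //= big1 => [|j ji]; rewrite !mxE.
  by rewrite !eqxx !mulr1 addr0 {1}[u 0 i]complexE; congr (_ + _); exact: mulrC.
by rewrite eqxx eq_sym (negbTE ji) /= !mulr0 addr0.
Qed.

Lemma Cksub_rd k D F b j : Cksub k.+1 D F -> Cksub k D (rderive (rd b j) F).
Proof. by move=> [_ H]; exact: (H b j).2. Qed.

(** The 2n real directions are the displacements of [curve_chain_real]; recombining them in pairs
    gives the Wirtinger form, in which conj d multiplies dbar. *)
Lemma cder_chain D F (g : R -> V) t0 (d : 'I_n -> C) : open D -> Cksub 1 D F -> D (g t0) ->
  (forall j, cder (fun t => g t 0 j) t0 (d j)) ->
  cder (fun t => F (g t)) t0 (\sum_(j < n) (d j * dz j F (g t0) + conjc (d j) * dzbar j F (g t0))).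
Proof.
move=> oD sF Dg dg; set z := g t0.
pose c (i : bool * 'I_n) t := if i.1 then complex.Im (g t 0 i.2 - z 0 i.2) else complex.Re (g t 0 i.2 - z 0 i.2).
pose c' (i : bool * 'I_n) := if i.1 then complex.Im (d i.2) else complex.Re (d i.2).
have gE t : g t = z + \sum_(i : bool * 'I_n) (c i t)%:C *: rd i.1 i.2.
  rewrite -[LHS](subrK z) addrC; congr (_ + _); rewrite [LHS]rowE.
  rewrite (eq_bigr (fun i : bool * 'I_n => (fun b j => (c (b, j) t)%:C *: rd b j) i.1 i.2)); last by case.
  rewrite -(pair_bigA _ (fun b j => (c (b, j) t)%:C *: rd b j)) /= big_bool /= addrC -big_split /=.
  by apply: eq_bigr => j _; rewrite /c /= !mxE.
have c0 i : c i t0 = 0 by rewrite /c; case: ifP => _; rewrite subrr.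
have dc i : is_derive t0 (1 : R) (c i) (c' i).
  have [a b] := cderD (dg i.2) (cder_cst (- z 0 i.2) t0).
  by rewrite /c /c'; move: a b; rewrite addr0; case: ifP.
have H1 (h : C -> R) (hc : (h = @complex.Re R) \/ (h = @complex.Im R)) i :
    \forall w \near z, is_derive 0 (1 : R) (fun t : R => h (F (w + t%:C *: rd i.1 i.2))) (h (rderive (rd i.1 i.2) F w)).
  apply: (near_open oD Dg) => w Dw; have [a b] := Cksub_hasD i.1 i.2 sF Dw.
  by case: hc => ->.
have H2 (h : C -> R) (hc : (h = @complex.Re R) \/ (h = @complex.Im R)) i :
    {for z, continuous (fun w => h (rderive (rd i.1 i.2) F w))}.
  have [cR cI] := (continuous_ReIm _ _).1 (Cksub_cont (Cksub_rd i.1 i.2 sF) Dg).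
  by case: hc => ->; [exact: cR|exact: cI].
have := @curve_chain_real R n _ (index_enum (bool * 'I_n)%type) (fun w => complex.Re (F w)) (fun i w => complex.Re (rderive (rd i.1 i.2) F w)) (fun i => rd i.1 i.2) z c t0 c' (H1 _ (or_introl erefl)) (H2 _ (or_introl erefl)) c0 dc.
have := @curve_chain_real R n _ (index_enum (bool * 'I_n)%type) (fun w => complex.Im (F w)) (fun i w => complex.Im (rderive (rd i.1 i.2) F w)) (fun i => rd i.1 i.2) z c t0 c' (H1 _ (or_intror erefl)) (H2 _ (or_intror erefl)) c0 dc.
move=> hI hR.
have E : \sum_(j < n) (d j * dz j F z + conjc (d j) * dzbar j F z) = \sum_(i : bool * 'I_n) (c' i)%:C * rderive (rd i.1 i.2) F z.
  rewrite [RHS](eq_bigr (fun i : bool * 'I_n => (fun b j => (c' (b, j))%:C * rderive (rd b j) F z) i.1 i.2)); last by case.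
  rewrite -(pair_bigA _ (fun b j => (c' (b, j))%:C * rderive (rd b j) F z)) /= big_bool /= addrC -big_split /=.
  apply: eq_bigr => j _; rewrite /c' /dz /dzbar /= /rd.
  move: (rderive (xdir j) F z) (rderive (ydir j) F z) => x y.
  have -> : conjc (d j) = (complex.Re (d j))%:C + 'i * - (complex.Im (d j))%:C.
    by case: (d j) => u v; rewrite [LHS]complexE complexiE /= rmorphN.
  rewrite {1}[d j]complexE complexiE; move: (complex.Re (d j)) (complex.Im (d j)) => u v.
  have ii : ('i%R : C) * 'i%R = -1 by rewrite mulCii.
  move: ii; move: ('i%R : C) (u%:C) (v%:C) => i a b ii.
  have e2 : (2 : C) != 0 by rewrite pnatr_eq0.
  have -> : (a + i * b) * (2^-1 * (x - i * y)) + (a + i * - b) * (2^-1 * (x + i * y)) = a * x - (i * i) * (b * y) by field.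
  by rewrite ii mulN1r opprK addrC.
split.
  rewrite (_ : (fun s => _) = (fun t => complex.Re (F (z + \sum_(i : bool * 'I_n) (c i t)%:C *: rd i.1 i.2)))); last first.
    by apply/funext => t; rewrite -gE.
  apply: is_derive_eq hR _; rewrite E; elim/big_rec2: _ => // i x y _ ->.
  by rewrite ReD ReM /= mul0r subr0.
rewrite (_ : (fun s => _) = (fun t => complex.Im (F (z + \sum_(i : bool * 'I_n) (c i t)%:C *: rd i.1 i.2)))); last first.
  by apply/funext => t; rewrite -gE.
apply: is_derive_eq hI _; rewrite E; elim/big_rec2: _ => // i x y _ ->.
by rewrite ImD ImM /= mul0r addr0.
Qed.

Lemma rderiveC D F z b j b' j' : open D -> Cksub 2 D F -> D z ->
  rderive (rd b j) (rderive (rd b' j') F) z = rderive (rd b' j') (rderive (rd b j) F) z.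
Proof.
move=> oD sF Dz.
have A (h : C -> R) (hc : (h = @complex.Re R) \/ (h = @complex.Im R)) :
  h (rderive (rd b j) (rderive (rd b' j') F) z) = h (rderive (rd b' j') (rderive (rd b j) F) z).
  have K b1 j1 : Cksub 1 D (rderive (rd b1 j1) F) := Cksub_rd b1 j1 sF.
  have L b1 j1 b2 j2 : {for z, continuous (fun w => h (rderive (rd b2 j2) (rderive (rd b1 j1) F) w))}.
    have [cR cI] := (continuous_ReIm _ _).1 (Cksub_cont (Cksub_rd b2 j2 (K b1 j1)) Dz).
    by case: hc => ->; [exact: cR|exact: cI].
  have N G b1 j1 : Cksub 1 D G -> \forall w \near z, is_derive 0 (1 : R) (fun t : R => h (G (w + t%:C *: rd b1 j1))) (h (rderive (rd b1 j1) G w)).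
    move=> sG; apply: (near_open oD Dz) => w Dw; have [a c] := Cksub_hasD b1 j1 sG Dw.
    by case: hc => ->.
  have s1 : Cksub 1 D F := Cksub_le sF.
  apply: (@schwarz_real R n (fun w => h (F w)) (fun w => h (rderive (rd b' j') F w))
    (fun w => h (rderive (rd b j) F w)) (fun w => h (rderive (rd b j) (rderive (rd b' j') F) w))
    (fun w => h (rderive (rd b' j') (rderive (rd b j) F) w)) (rd b' j') (rd b j) z).
  - exact: N F b' j' s1.
  - exact: N F b j s1.
  - exact: N _ b j (K b' j').
  - exact: N _ b' j' (K b j).
  - exact: L.
  - exact: L.
by apply: ReIm_eq; apply: A; [left|right].
Qed.

End SmoothTheory.

(** * Rules for the Wirtinger derivatives *)

Section Wirtinger.
Context {R : realType} {n : nat}.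
Local Notation C := R[i].
Local Notation V := 'rV[C]_n.
Implicit Types (F G : V -> C) (p v w z : V) (D : set V).

(** Through [unsplit], a direction in ['I_n + 'I_n] matches an indeterminate of the polynomials in y
    and ybar. *)
Definition pd (a : 'I_n + 'I_n) F : V -> C :=
  match a with inl j => dz j F | inr j => dzbar j F end.

(** Both Wirtinger operators are 1/2 (d/dx + s i d/dy) with s = -1 or 1, and are treated by one
    proof. *)
Definition csgn (a : 'I_n + 'I_n) : C := if a is inl _ then -1 else 1.
Definition cidx (a : 'I_n + 'I_n) : 'I_n := match a with inl j => j | inr j => j end.

Lemma pdE a F z : pd a F z =
  2^-1 * (rderive (rd false (cidx a)) F z + csgn a * 'i * rderive (rd true (cidx a)) F z).
Proof. by case: a => j; rewrite /pd /dz /dzbar /=; congr (_ * (_ + _)); ring. Qed.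

Section OpenSet.
Variable D : set V.
Hypothesis oD : open D.
Implicit Types (a : 'I_n + 'I_n).

Lemma smooth_eq F G : (forall z, D z -> F z = G z) -> smooth D F -> smooth D G.
Proof. by move=> FG /smoothP H; apply/smoothP => k; exact: Cksub_eq FG (H k). Qed.

Lemma smooth_cst c : smooth D (fun=> c).
Proof. by apply/smoothP => k; exact: Cksub_cst. Qed.

Lemma smoothD F G : smooth D F -> smooth D G -> smooth D (fun z => F z + G z).
Proof. by move=> /smoothP sF /smoothP sG; apply/smoothP => k; exact: Cksub_D. Qed.

Lemma smoothM F G : smooth D F -> smooth D G -> smooth D (fun z => F z * G z).
Proof. by move=> /smoothP sF /smoothP sG; apply/smoothP => k; exact: Cksub_M. Qed.

Lemma smoothZ c F : smooth D F -> smooth D (fun z => c * F z).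
Proof. by apply: smoothM; exact: smooth_cst. Qed.

Lemma smoothN F : smooth D F -> smooth D (fun z => - F z).
Proof. by move=> sF; apply: smooth_eq (smoothZ (-1) sF) => z _; rewrite mulN1r. Qed.

Lemma smoothB F G : smooth D F -> smooth D G -> smooth D (fun z => F z - G z).
Proof. by move=> sF sG; apply: smoothD sF (smoothN sG). Qed.

Lemma smooth_conj F : smooth D F -> smooth D (fun z => (F z)^*).
Proof. by move=> /smoothP sF; apply/smoothP => k; exact: Cksub_conj. Qed.

Lemma smoothV F : (forall z, D z -> F z != 0) -> smooth D F -> smooth D (fun z => (F z)^-1).
Proof. by move=> F0 /smoothP sF; apply/smoothP => k; exact: Cksub_V. Qed.

Lemma smooth_coord j : smooth D (fun z => z 0 j).
Proof. by apply/smoothP => k; exact: Cksub_coord. Qed.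

Lemma smooth_sum (I : Type) (r : seq I) (P : pred I) (F : I -> V -> C) :
  (forall i, P i -> smooth D (F i)) -> smooth D (fun z => \sum_(i <- r | P i) F i z).
Proof.
move=> H; elim: r => [|i r IH].
  by apply: smooth_eq (smooth_cst 0) => z _; rewrite big_nil.
case: (boolP (P i)) => Pi.
  by apply: smooth_eq (smoothD (H i Pi) IH) => z _; rewrite big_cons Pi.
by apply: smooth_eq IH => z _; rewrite big_cons (negbTE Pi).
Qed.

Lemma smooth_prod (I : Type) (r : seq I) (P : pred I) (F : I -> V -> C) :
  (forall i, P i -> smooth D (F i)) -> smooth D (fun z => \prod_(i <- r | P i) F i z).
Proof.
move=> H; elim: r => [|i r IH].
  by apply: smooth_eq (smooth_cst 1) => z _; rewrite big_nil.
case: (boolP (P i)) => Pi.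
  by apply: smooth_eq (smoothM (H i Pi) IH) => z _; rewrite big_cons Pi.
by apply: smooth_eq IH => z _; rewrite big_cons (negbTE Pi).
Qed.

Lemma smooth_rd b j F : smooth D F -> smooth D (rderive (rd b j) F).
Proof. by move=> /smoothP sF; apply/smoothP => k; exact: Cksub_rd. Qed.

Lemma smooth_pd a F : smooth D F -> smooth D (pd a F).
Proof.
move=> sF; have sf := smooth_rd false (cidx a) sF; have st := smooth_rd true (cidx a) sF.
apply: smooth_eq (smoothZ (2^-1) (smoothD sf (smoothZ (csgn a * 'i) st))) => z _.
by rewrite pdE.
Qed.

Lemma smooth_hasD F z b j : smooth D F -> D z -> hasD F z (rd b j) (rderive (rd b j) F z).
Proof. by move=> /smoothP /(_ 1%N) sF; exact: Cksub_hasD sF. Qed.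

Lemma pd_of_hasD F z a (d : bool -> C) :
  (forall b, hasD F z (rd b (cidx a)) (d b)) -> pd a F z = 2^-1 * (d false + csgn a * 'i * d true).
Proof. by move=> H; rewrite pdE !(hasD_rderive (H _)). Qed.

Lemma pd_eq a F G z : D z -> (forall w, D w -> F w = G w) -> pd a F z = pd a G z.
Proof. by move=> Dz FG; rewrite !pdE !(rderive_eq _ oD Dz FG). Qed.

Lemma pd_cst a c z : pd a (fun=> c) z = 0.
Proof.
rewrite (@pd_of_hasD _ _ _ (fun=> 0)) ?mulr0 ?addr0 ?mulr0 // => b; exact: cder_cst.
Qed.

Lemma pdD a F G z : D z -> smooth D F -> smooth D G -> pd a (fun w => F w + G w) z = pd a F z + pd a G z.
Proof.
move=> Dz sF sG; rewrite (@pd_of_hasD _ _ _ (fun b => rderive (rd b (cidx a)) F z + rderive (rd b (cidx a)) G z)).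
  rewrite !pdE; move: (rderive _ F z) (rderive _ F z) (rderive _ G z) (rderive _ G z) (csgn a) => x y u v s; ring.
by move=> b; apply: cderD; [exact: smooth_hasD sF Dz|exact: smooth_hasD sG Dz].
Qed.

Lemma pdM a F G z : D z -> smooth D F -> smooth D G ->
  pd a (fun w => F w * G w) z = pd a F z * G z + F z * pd a G z.
Proof.
move=> Dz sF sG; rewrite (@pd_of_hasD _ _ _ (fun b => rderive (rd b (cidx a)) F z * G z + F z * rderive (rd b (cidx a)) G z)).
  rewrite !pdE; move: (rderive _ F z) (rderive _ F z) (rderive _ G z) (rderive _ G z) (csgn a) (F z) (G z) => x y u v s f g; ring.
move=> b; have := cderM (smooth_hasD b (cidx a) sF Dz) (smooth_hasD b (cidx a) sG Dz).
by rewrite scale0r addr0.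
Qed.

Lemma pdZ a c F z : D z -> smooth D F -> pd a (fun w => c * F w) z = c * pd a F z.
Proof. by move=> Dz sF; rewrite pdM // ?pd_cst ?mul0r ?add0r //; exact: smooth_cst. Qed.

Lemma pdN a F z : D z -> smooth D F -> pd a (fun w => - F w) z = - pd a F z.
Proof.
by move=> Dz sF; rewrite -mulN1r -pdZ //; apply: pd_eq => // w _; rewrite mulN1r.
Qed.

Lemma pdB a F G z : D z -> smooth D F -> smooth D G -> pd a (fun w => F w - G w) z = pd a F z - pd a G z.
Proof. by move=> Dz sF sG; rewrite pdD ?pdN //; exact: smoothN. Qed.

Lemma pd_sum a (I : Type) (r : seq I) (P : pred I) (F : I -> V -> C) z : D z ->
  (forall i, P i -> smooth D (F i)) ->
  pd a (fun w => \sum_(i <- r | P i) F i w) z = \sum_(i <- r | P i) pd a (F i) z.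
Proof.
move=> Dz H; elim: r => [|i r IH].
  rewrite big_nil; transitivity (pd a (fun=> 0) z); last exact: pd_cst.
  by apply: pd_eq Dz _ => w _; rewrite big_nil.
rewrite big_cons; case: ifPn => Pi.
  rewrite -IH -(pdD a Dz (H i Pi) (smooth_sum r H)); apply: (pd_eq a Dz) => w _.
  by rewrite big_cons Pi.
by rewrite -IH; apply: pd_eq => // w _; rewrite big_cons (negbTE Pi).
Qed.

Lemma pdC a (b : 'I_n + 'I_n) F z : D z -> smooth D F -> pd a (pd b F) z = pd b (pd a F) z.
Proof.
move=> Dz sF; have sr c j := smooth_rd c j sF.
have K c d e w : D w -> rderive (rd c d) (pd e F) w =
    2^-1 * (rderive (rd c d) (rderive (rd false (cidx e)) F) w + csgn e * 'i * rderive (rd c d) (rderive (rd true (cidx e)) F) w).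
  move=> Dw; apply: hasD_rderive.
  apply: (@hasD_eq _ _ D (fun w => 2^-1 * (rderive (rd false (cidx e)) F w + csgn e * 'i * rderive (rd true (cidx e)) F w))) => //.
    by move=> w' _; rewrite pdE.
  by apply: cderZ; apply: cderD; [|apply: cderZ]; exact: smooth_hasD.
have S c j d j' : rderive (rd c j) (rderive (rd d j') F) z = rderive (rd d j') (rderive (rd c j) F) z.
  by apply: (rderiveC _ _ _ _ oD _ Dz); move/smoothP: sF => /(_ 2%N).
rewrite pdE [RHS]pdE !(K _ _ _ _ Dz).
move: (S false (cidx a) false (cidx b)) (S false (cidx a) true (cidx b)) (S true (cidx a) false (cidx b)) (S true (cidx a) true (cidx b)).
generalize (rderive (rd false (cidx a)) (rderive (rd false (cidx b)) F) z) (rderive (rd false (cidx a)) (rderive (rd true (cidx b)) F) z)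
 (rderive (rd true (cidx a)) (rderive (rd false (cidx b)) F) z) (rderive (rd true (cidx a)) (rderive (rd true (cidx b)) F) z)
 (rderive (rd false (cidx b)) (rderive (rd false (cidx a)) F) z) (rderive (rd true (cidx b)) (rderive (rd false (cidx a)) F) z)
 (rderive (rd false (cidx b)) (rderive (rd true (cidx a)) F) z) (rderive (rd true (cidx b)) (rderive (rd true (cidx a)) F) z).
move: (csgn a) (csgn b) => s t x y u v x' y' u' v' -> -> -> ->; ring.
Qed.

Lemma pdV a F z : D z -> (forall w, D w -> F w != 0) -> smooth D F ->
  pd a (fun w => (F w)^-1) z = - (F z)^-2 * pd a F z.
Proof.
move=> Dz F0 sF; have sV := smoothV F0 sF; have Fz := F0 z Dz.
have : pd a (fun w => F w * (F w)^-1) z = 0.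
  by rewrite -(pd_cst a 1 z); apply: pd_eq => // w Dw; rewrite mulfV // F0.
rewrite pdM // => /eqP; rewrite addr_eq0 => /eqP E.
apply: (mulfI Fz); rewrite -[LHS]opprK -E mulNr mulrN; congr (- _).
by rewrite expr2 invfM; field.
Qed.

Lemma pd_conj a F z : D z -> smooth D F ->
  pd a (fun w => (F w)^*) z = (pd (match a with inl j => inr j | inr j => inl j end) F z)^*.
Proof.
move=> Dz sF; rewrite (@pd_of_hasD _ _ _ (fun b => (rderive (rd b (cidx a)) F z)^*)); last first.
  by move=> b; apply: cder_conj; exact: smooth_hasD.
have -> : cidx a = cidx (match a with inl j => inr j | inr j => inl j end) by case: a.
have H (x s y : C) : conjc (2^-1 * (x + s * 'i%R * y)) = 2^-1 * (conjc x + conjc s * - 'i%R * conjc y).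
  rewrite rmorphM rmorphD !rmorphM fmorphV rmorph_nat.
  congr (_ * (_ + _ * _ * _)); exact: (@conjCi C).
rewrite pdE H.
have -> : csgn a = - conjc (csgn (match a with inl j => inr j | inr j => inl j end)).
  by case: a => j; apply/eqP; rewrite eq_complex /= ?oppr0 ?opprK !eqxx.
by rewrite mulNr mulrN.
Qed.

Lemma pd_coord a j z : pd a (fun w => w 0 j) z = if a is inl i then (i == j)%:R else 0.
Proof.
rewrite (@pd_of_hasD _ _ _ (fun b => rd b (cidx a) 0 j)); last first.
  move=> b; have H := @is_derive_id R _ (0 : R) 1.
  have H1 := cderD (cder_cst (z 0 j) 0) (cderM (cder_RtoC H) (cder_cst (rd b (cidx a) 0 j) 0)).
  apply: (cder_ext _ (cder_eq H1 _)); first by move=> t; rewrite !mxE.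
  by rewrite add0r mul1r mulr0 addr0.
have ii : ('i : C) * 'i = -1 by rewrite mulCii.
have e2 : (2 : C) != 0 by rewrite pnatr_eq0.
rewrite /rd /xdir /ydir !mxE eqxx /= [j == _]eq_sym mulrA -(mulrA (csgn a)) ii.
case: a => i /=; rewrite ?mulN1r ?opprK ?mul1r; last by rewrite mulN1r subrr mulr0.
by have -> : forall x : C, 2^-1 * (x + x) = x by move=> x; field.
Qed.

End OpenSet.
End Wirtinger.

(** * Formal Gaussian integrals *)

Transparent rderive.

(** * Formal power series and their exponential *)

Section FpsRing.
Context {A : comNzRingType}.
Implicit Types a b c : nat -> A.

(** Truncating to a polynomial lets the ring laws of series be read off from those of [{poly A}]. *)
Definition fps_tr (N : nat) a : {poly A} := \poly_(i < N) a i.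

Lemma fps_trE N a b k : (k < N)%N -> (fps_tr N a * fps_tr N b)`_k = fps_mul a b k.
Proof.
move=> kN; rewrite coefM; apply: eq_bigr => i _; rewrite !coef_poly.
by rewrite (leq_trans (ltn_ord i) kN) (leq_ltn_trans (leq_subr _ _) kN).
Qed.

Lemma fps_mulC a b : fps_mul a b = fps_mul b a.
Proof. by apply/funext => k; rewrite -!(@fps_trE k.+1) // mulrC. Qed.

Lemma fps_tr_mul N a b k : (k < N)%N -> (fps_tr N (fps_mul a b))`_k = (fps_tr N a * fps_tr N b)`_k.
Proof. by move=> kN; rewrite coef_poly kN fps_trE. Qed.

Lemma fps_mulA a b c : fps_mul a (fps_mul b c) = fps_mul (fps_mul a b) c.
Proof.
apply/funext => k; rewrite -!(@fps_trE k.+1) //.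
transitivity ((fps_tr k.+1 a * (fps_tr k.+1 b * fps_tr k.+1 c))`_k).
  rewrite !coefM; apply: eq_bigr => i _; congr (_ * _); apply: fps_tr_mul.
  by rewrite ltnS leq_subr.
rewrite mulrA !coefM; apply: eq_bigr => i _; congr (_ * _).
by rewrite fps_tr_mul // ltn_ord.
Qed.

Lemma fps_mulDl a b c k : fps_mul (fun i => a i + b i) c k = fps_mul a c k + fps_mul b c k.
Proof. by rewrite -big_split; apply: eq_bigr => i _; rewrite mulrDl. Qed.

Lemma fps_mulAC a b c : fps_mul (fps_mul a b) c = fps_mul (fps_mul a c) b.
Proof. by rewrite -!fps_mulA (fps_mulC b). Qed.

Lemma fps_mulCA a b c : fps_mul a (fps_mul b c) = fps_mul b (fps_mul a c).
Proof. by rewrite !fps_mulA (fps_mulC a). Qed.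

Lemma eq_fps_mul a a' b b' k : (forall i, (i <= k)%N -> a i = a' i) ->
  (forall i, (i <= k)%N -> b i = b' i) -> fps_mul a b k = fps_mul a' b' k.
Proof.
move=> H H'; apply: eq_bigr => i _; rewrite H ?H' ?leq_subr //.
by rewrite -ltnS ltn_ord.
Qed.

Lemma fps_mul_eq0 a b k : (forall i, (i <= k)%N -> a i = 0) -> fps_mul a b k = 0.
Proof.
by move=> H; rewrite /fps_mul big1 // => i _; rewrite H ?mul0r // -ltnS.
Qed.

Lemma fps_mul_shift a b k : a 0%N = 0 ->
  fps_mul a b k.+1 = fps_mul (fun i => a i.+1) b k.
Proof. by move=> a0; rewrite /fps_mul big_ord_recl a0 mul0r add0r. Qed.

Lemma fps_mul_shift0 a b k :
  fps_mul a b k.+1 = a 0%N * b k.+1 + fps_mul (fun i => a i.+1) b k.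
Proof. by rewrite /fps_mul big_ord_recl subn0. Qed.

Lemma fps_powS a m : fps_pow a m.+1 = fps_mul a (fps_pow a m).
Proof. by []. Qed.

Lemma fps_pow_lt a m k : a 0%N = 0 -> (k < m)%N -> fps_pow a m k = 0.
Proof.
move=> a0; elim: m k => // m IH k km; rewrite fps_powS.
case: k km => [|k] km; first by rewrite /fps_mul big_ord1 a0 mul0r.
rewrite fps_mul_shift // fps_mulC; apply: fps_mul_eq0 => i ik; apply: IH; lia.
Qed.

End FpsRing.

Section FpsExp.
Context {K : numFieldType} {A : comAlgType K}.
Implicit Types a b c : nat -> A.

Lemma fps_mulZl x a b k : fps_mul (fun i => x *: a i) b k = x *: fps_mul a b k.
Proof. by rewrite /fps_mul scaler_sumr; apply: eq_bigr => i _; rewrite scalerAl. Qed.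

Lemma fps_mulZr x a b k : fps_mul a (fun i => x *: b i) k = x *: fps_mul a b k.
Proof. by rewrite fps_mulC fps_mulZl fps_mulC. Qed.

Lemma fps_expE a k N : a 0%N = 0 -> (k < N)%N ->
  fps_exp (K := K) a k = \sum_(m < N) (m`!%:R : K)^-1 *: fps_pow a m k.
Proof.
move=> a0 kN; rewrite /fps_exp (big_ord_widen N (fun m => (m`!%:R : K)^-1 *: fps_pow a m k)) //.
rewrite [RHS](bigID (fun m : 'I_N => (m < k.+1)%N)) /= [X in _ + X]big1 ?addr0 // => m.
by rewrite -leqNgt => km; rewrite fps_pow_lt ?scaler0.
Qed.

Lemma fps_exp0 a : fps_exp (K := K) a 0 = 1.
Proof. by rewrite /fps_exp big_ord1 /= fact0 invr1 scale1r. Qed.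

(* [Der k p q]: [q] is the image of the family [p], of weight [k], under a derivation. *)
Section Derivation.
Context {T : Type} (Der : nat -> (T -> A) -> (T -> A) -> Prop).
Hypothesis Der_cst : forall x : K, Der 0 (fun=> x *: 1) (fun=> 0).
Hypothesis Der0 : forall k, Der k (fun=> 0) (fun=> 0).
Hypothesis DerD : forall k p p' q q', Der k p p' -> Der k q q' -> Der k (fun t => p t + q t) (fun t => p' t + q' t).
Hypothesis DerM : forall i j p p' q q', Der i p p' -> Der j q q' ->
  Der (i + j) (fun t => p t * q t) (fun t => p' t * q t + p t * q' t).

Lemma Der_eq k p q q' : Der k p q -> (forall t, q t = q' t) -> Der k p q'.
Proof. by move=> H /funext <-. Qed.

Lemma DerZ k x p p' : Der k p p' -> Der k (fun t => x *: p t) (fun t => x *: p' t).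
Proof.
move=> H; have := DerM (Der_cst x) H; rewrite add0n.
rewrite (_ : (fun t => _ * p t) = (fun t => x *: p t)); last by apply/funext => t; rewrite -scalerAl mul1r.
by move/Der_eq; apply => t; rewrite mul0r add0r -scalerAl mul1r.
Qed.

Lemma Der_sum k (I : Type) (r : seq I) (P : pred I) (p q : I -> T -> A) :
  (forall i, P i -> Der k (p i) (q i)) ->
  Der k (fun t => \sum_(i <- r | P i) p i t) (fun t => \sum_(i <- r | P i) q i t).
Proof.
move=> H; elim: r => [|i r IH].
  rewrite (_ : (fun _ => _) = (fun=> 0)); last by apply/funext => t; rewrite big_nil.
  by apply: Der_eq (Der0 k) _ => t; rewrite big_nil.
case: (boolP (P i)) => Pi.
  rewrite (_ : (fun _ => _) = (fun t => p i t + \sum_(j <- r | P j) p j t)); last first.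
    by apply/funext => t; rewrite big_cons Pi.
  by apply: Der_eq (DerD (H i Pi) IH) _ => t; rewrite big_cons Pi.
rewrite (_ : (fun _ => _) = (fun t => \sum_(j <- r | P j) p j t)); last first.
  by apply/funext => t; rewrite big_cons (negbTE Pi).
by apply: Der_eq IH _ => t; rewrite big_cons (negbTE Pi).
Qed.

Lemma Der_fps_mul (a a' b b' : nat -> T -> A) :
  (forall k, Der k (a k) (a' k)) -> (forall k, Der k (b k) (b' k)) -> forall k,
  Der k (fun t => fps_mul (a ^~ t) (b ^~ t) k)
      (fun t => fps_mul (a' ^~ t) (b ^~ t) k + fps_mul (a ^~ t) (b' ^~ t) k).
Proof.
move=> H H' k; have K0 (i : 'I_k.+1) : true -> Der k (fun t => a i t * b (k - i)%N t) (fun t => a' i t * b (k - i)%N t + a i t * b' (k - i)%N t).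
  by move=> _; rewrite -{1}(subnKC (ltn_ord i : (i <= k)%N)); apply: DerM.
by apply: Der_eq (Der_sum (index_enum 'I_k.+1) K0) _ => t; rewrite big_split.
Qed.

Lemma Der_fps_pow (a a' : nat -> T -> A) : (forall k, Der k (a k) (a' k)) -> forall m k,
  Der k (fun t => fps_pow (a ^~ t) m k)
      (fun t => m%:R * fps_mul (a' ^~ t) (fps_pow (a ^~ t) m.-1) k).
Proof.
move=> H; elim=> [|m IH] k.
  rewrite /= /fps_one; case: k => [|k].
    have := Der_cst 1; rewrite scale1r => h.
    by apply: Der_eq h _ => t; rewrite mul0r.
  by apply: Der_eq (Der0 _) _ => t; rewrite mul0r.
have := Der_fps_mul H (fun k => IH k) k; move/Der_eq; apply => t.
rewrite /=.
have -> : fps_mul (a ^~ t) (fun k0 => m%:R * fps_mul (a' ^~ t) (fps_pow (a ^~ t) m.-1) k0) k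
  = m%:R * fps_mul (a' ^~ t) (fps_mul (a ^~ t) (fps_pow (a ^~ t) m.-1)) k.
  rewrite fps_mulCA /fps_mul mulr_sumr; apply: eq_bigr => i _.
  by rewrite !mulr_sumr; apply: eq_bigr => j _; ring.
case: m {IH} => [|m]; first by rewrite mul0r addr0 mul1r.
by rewrite -[m.+2]add1n natrD mulrDl mul1r.
Qed.

(** The rule exp(a)' = a' exp(a) for several derivations at once: [mderiv], multiplication of the
    k-th coefficient by k, and differentiation of coefficients depending on a parameter. The weight
    is needed for the second. *)
Lemma Der_fps_exp (a a' : nat -> T -> A) : (forall k, Der k (a k) (a' k)) ->
  (forall t, a 0%N t = 0) -> (forall t, a' 0%N t = 0) -> forall k,
  Der k (fun t => fps_exp (K := K) (a ^~ t) k)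
      (fun t => fps_mul (a' ^~ t) (fps_exp (K := K) (a ^~ t)) k).
Proof.
move=> H a0 a'0 k.
have := @Der_sum k _ (index_enum 'I_k.+1) xpredT _ _ (fun (m : 'I_k.+1) _ => DerZ (m`!%:R : K)^-1 (Der_fps_pow H m k)).
move/Der_eq; apply => t; rewrite big_ord_recl mul0r scaler0 add0r.
(* At index 0 both sides vanish since a' starts at index 1. At k + 1 the shift lowers the truncation
   of the exponential by one, which matches the sum over m. *)
case: k => [|k]; first by rewrite big_ord0 /fps_mul big_ord1 a'0 mul0r.
rewrite [RHS]fps_mul_shift //.
transitivity (fps_mul (fun i => a' i.+1 t) (fun j => \sum_(m < k.+1) (m`!%:R : K)^-1 *: fps_pow (a ^~ t) m j) k).
  rewrite [RHS]/fps_mul; under [RHS]eq_bigr do rewrite mulr_sumr.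
  rewrite exchange_big /=; apply: eq_bigr => m _; rewrite fps_mul_shift //.
  rewrite /fps_mul mulr_sumr scaler_sumr; apply: eq_bigr => i _.
  rewrite -scalerAr add0n /bump leq0n add1n.
  have -> : forall u : A, m.+1%:R * u = (m.+1%:R : K) *: u by move=> u; rewrite scaler_nat mulr_natl.
  rewrite scalerA; congr (_ *: _).
  by rewrite factS natrM invfM mulrAC mulVf ?mul1r // pnatr_eq0.
apply: eq_fps_mul => // i ik; rewrite [RHS](fps_expE (N := k.+1)) //.
Qed.

End Derivation.
End FpsExp.

(** * The Gaussian functional: recursion, integration by parts, uniqueness *)

Section Gauss.
Context {R : realType} {n : nat}.
Local Notation C := R[i].
Local Notation P := (mpoly (n + n) C).
Implicit Types (H : 'M[C]_n) (p q : P) (m : multinom (n + n)).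

Definition X_ (a : 'I_(n + n)) : P := mpolyX C (mnm1 a).

(** Summing over all multi-indices below a common bound, instead of the support, makes linearity
    visible. *)
Lemma gaussE_w H p k : (msize p <= k)%N ->
  gaussE H p = \sum_(m : bmultinom (n + n) k) mcoeff m p * gaussE_mon H m.
Proof.
move=> pk; rewrite /gaussE (big_mksub (bmultinom (n + n) k)) //=; first last.
- by move=> x /msize_mdeg_lt /leq_trans; apply.
- by rewrite msupp_uniq.
by rewrite big_rmcond //= => i; move/memN_msupp_eq0 ->; rewrite mul0r.
Qed.

Lemma gaussE_linear H x p q : gaussE H (x *: p + q) = x * gaussE H p + gaussE H q.
Proof.
pose k := maxn (msize (x *: p + q)) (maxn (msize p) (msize q)).
rewrite !(@gaussE_w _ _ k); try by rewrite /k ?leq_max ?leqnn ?orbT.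
by rewrite mulr_sumr -big_split /=; apply: eq_bigr => m _; rewrite mcoeffD mcoeffZ mulrDl mulrA.
Qed.

HB.instance Definition _ H := GRing.isLinear.Build C P C *%R (gaussE H) (fun x p q => gaussE_linear H x p q).

Lemma gaussEX H m : gaussE H (mpolyX C m) = gaussE_mon H m.
Proof. by rewrite /gaussE msuppX big_seq1 mcoeffX eqxx mul1r. Qed.

Definition wfact m : C := (\prod_(i < n + n) (m i)`!)%:R.

Lemma ev_mderivm m p : meval (fun=> 0) (mderivm m p) = mcoeff m p * wfact m.
Proof.
have ev0 q : meval (fun=> 0 : C) q = mcoeff mnm0 q.
  rewrite [in LHS](mpolyE q) [in RHS](mpolyE q) !raddf_sum /=; apply: eq_bigr => k _.
  rewrite mevalZ mevalX mcoeffZ mcoeffX; congr (_ * _).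
  have [->|k0] := eqVneq k mnm0; first by rewrite big1 // => i _; rewrite mnm0E expr0.
  have /existsP[i ki] : [exists i, k i != 0%N].
    apply: contra_neqT k0; rewrite negb_exists => /forallP kk; apply/mnmP => i.
    by rewrite mnm0E; apply/eqP; have := kk i; rewrite negbK.
  by rewrite (bigD1 i) //= expr0n (negbTE ki) mul0r.
rewrite ev0 mcoeff_mderivm addm0 mulr_natr; congr (_ *+ _).
by apply: eq_bigr => i _; rewrite ffactnn.
Qed.

Definition expQ H (d : nat) : P := \sum_(k < d) (k`!%:R : C)^-1 *: gaussE_quad H ^+ k.

Lemma gaussE_quadE H : gaussE_quad H =
  \sum_(i < n) \sum_(j < n) hinv H i j *: mpolyX C (mnm_add (mnm1 (lshift n i)) (mnm1 (rshift n j))).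
Proof. by do 2![apply: eq_bigr => ? _]; rewrite mpolyXD. Qed.

Lemma dhomog_quad H : gaussE_quad H \is (@ishomog1 (n + n) C 2 mdeg).
Proof.
rewrite gaussE_quadE; apply: rpred_sum => i _; apply: rpred_sum => j _.
by apply: rpredZ; rewrite dhomogX /= mdegD !mdeg1.
Qed.

(** The k-th power of the quadratic form is homogeneous of degree 2k, so the terms with k > |m| do
    not reach the coefficient of m. *)
Lemma expQ_coef H d m : (mdeg m < d)%N -> mcoeff m (expQ H d) = mcoeff m (expQ H (mdeg m).+1).
Proof.
move=> md; rewrite /expQ !raddf_sum /=.
rewrite [RHS](big_ord_widen d (fun k => mcoeff m ((k`!%:R : C)^-1 *: gaussE_quad H ^+ k))) //.
rewrite [LHS](bigID (fun k : 'I_d => (k < (mdeg m).+1)%N)) /= [X in _ + X]big1 ?addr0 // => k km.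
rewrite mcoeffZ (@dhomog_nemf_coeff _ _ mdeg (2 * k)%N) ?mulr0 //; first exact: dhomogMn (dhomog_quad H).
by apply/eqP => /= E; move: km; rewrite E; move: (nat_of_ord k) => k'; lia.
Qed.

Lemma gaussE_monE H d m : (mdeg m < d)%N -> gaussE_mon H m = mcoeff m (expQ H d) * wfact m.
Proof. by move=> md; rewrite (expQ_coef H md) /gaussE_mon ev_mderivm. Qed.

Lemma mderiv_expQ H a d : mderiv a (expQ H d.+1) = mderiv a (gaussE_quad H) * expQ H d.
Proof.
rewrite /expQ raddf_sum /= big_ord_recl /= expr0 mderivZ.
have -> : mderiv a (1 : P) = 0 by rewrite -mpolyC1 mderivC.
rewrite scaler0 add0r mulr_sumr; apply: eq_bigr => k _.
have dX (q : P) (m : nat) : mderiv a (q ^+ m.+1) = m.+1%:R *: (mderiv a q * q ^+ m).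
  elim: m => [|m IH]; first by rewrite expr0 mulr1 scale1r.
  rewrite exprS mderivM IH -scalerAr mulrCA -exprS -[m.+2]add1n natrD scalerDl scale1r.
  by [].
rewrite mderivZ /bump leq0n add1n dX scalerA -scalerAr; congr (_ *: _).
by rewrite factS natrM invfM mulrAC mulVf ?mul1r // pnatr_eq0.
Qed.

Lemma wfactD m a : wfact (mnm_add m (mnm1 a)) = (m a).+1%:R * wfact m.
Proof.
rewrite /wfact (bigD1 a) //= [in RHS](bigD1 a) //= mnmDE mnm1E eqxx addn1 factS.
rewrite -natrM mulnA; congr (_ * _)%:R; apply: eq_bigr => i ia.
by rewrite mnmDE mnm1E eq_sym (negbTE ia) addn0.
Qed.

Lemma mnm_subK m a : (0 < m a)%N -> mnm_add (mnm_sub m (mnm1 a)) (mnm1 a) = m.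
Proof.
move=> ma; apply/mnmP => i; rewrite mnmDE mnmBE mnm1E.
by case: eqP => [<-|_]; rewrite ?subn0 ?addn0 // subnK.
Qed.

Lemma gaussE_mon_recur H a m : gaussE_mon H (mnm_add m (mnm1 a)) =
  mcoeff m (mderiv a (gaussE_quad H) * expQ H (mdeg m).+1) * wfact m.
Proof.
rewrite (@gaussE_monE _ (mdeg m).+2); last by rewrite mdegD mdeg1 addn1.
rewrite -mderiv_expQ mcoeff_mderiv wfactD mulrA; congr (_ * _).
by rewrite mulr_natr.
Qed.

Lemma mcoeff_mulX a p m : mcoeff m (X_ a * p) * wfact m =
  (m a)%:R * (mcoeff (mnm_sub m (mnm1 a)) p * wfact (mnm_sub m (mnm1 a))).
Proof.
have [ma|ma] := posnP (m a).
  rewrite ma mul0r; suff -> : mcoeff m (X_ a * p) = 0 by rewrite mul0r.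
  rewrite mcoeffM big1 // => -[k1 k2] /= /eqP E.
  rewrite mcoeffX; case: eqP => [k1a|]; last by rewrite mul0r.
  by have := congr1 (fun m => m a) E; rewrite /= ma mnmDE -k1a mnm1E eqxx.
rewrite -{1 2}(mnm_subK ma) wfactD mulrCA; congr (_ * (_ * _)).
  by rewrite mnmBE mnm1E eqxx subn1 prednK.
by rewrite /X_ [_ * p]mulrC addmC mcoeffMX.
Qed.

Lemma gaussE_recur_mon H a (c : 'I_(n + n) -> C) m :
  mderiv a (gaussE_quad H) = \sum_b c b *: X_ b ->
  gaussE H (X_ a * mpolyX C m) = \sum_b c b * gaussE H (mderiv b (mpolyX C m)).
Proof.
move=> Ea; rewrite /X_ -mpolyXD gaussEX addmC gaussE_mon_recur Ea mulr_suml raddf_sum mulr_suml.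
apply: eq_bigr => b _; rewrite /= -scalerAl mcoeffZ -mulrA; congr (_ * _).
rewrite mcoeff_mulX mderivX linearZ /= gaussEX; congr (_ * _).
by rewrite -gaussE_monE // ltnS mdegB.
Qed.

(** Wick's recursion. One more derivative of exp Q along [a] brings down the linear form d_a Q =
    sum_b c_b u_b; at 0 the factor u_b survives only if another derivative along [b] removes it, and
    this amounts to differentiating the monomial along [b]. *)
Lemma gaussE_recur H a (c : 'I_(n + n) -> C) p :
  mderiv a (gaussE_quad H) = \sum_b c b *: X_ b ->
  gaussE H (X_ a * p) = \sum_b c b * gaussE H (mderiv b p).
Proof.
move=> Ea; elim/mpolyind: p => [|x m p _ _ IH].
  by rewrite mulr0 linear0 big1 // => b _; rewrite mderiv0 linear0 mulr0.
rewrite mulrDr -scalerAr linearP /= IH (gaussE_recur_mon m Ea) mulr_sumr -big_split.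
by apply: eq_bigr => b _ /=; rewrite mderivD mderivZ linearP /= mulrDr mulrCA.
Qed.

Lemma mderiv_X_ a b : mderiv a (X_ b) = (a == b)%:R.
Proof.
rewrite /X_ mderivX mnm1E eq_sym; case: eqP => [->|_]; last by rewrite scale0r.
rewrite scale1r (_ : mnm_sub _ _ = mnm0) ?mpolyX0 //.
by apply/mnmP => i; rewrite mnmBE subnn mnm0E.
Qed.

Lemma sum_half (V : nmodType) (F : 'I_(n + n) -> V) :
  \sum_b F b = \sum_(i < n) F (lshift n i) + \sum_(j < n) F (rshift n j).
Proof. exact: big_split_ord. Qed.

Lemma gaussE_mul_y H i p : gaussE H (X_ (lshift n i) * p) = \sum_(j < n) hinv H i j * gaussE H (mderiv (rshift n j) p).
Proof.
rewrite (@gaussE_recur H _ (fun b => if fintype.split b is inr j then hinv H i j else 0)).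
  rewrite sum_half big1 ?add0r => [|k _]; last by rewrite (unsplitK (inl k)) mul0r.
  by apply: eq_bigr => j _; rewrite (unsplitK (inr j)).
rewrite sum_half big1 ?add0r => [|k _]; last by rewrite (unsplitK (inl k)) scale0r.
rewrite /gaussE_quad raddf_sum (bigD1 i) //= [X in _ + X]big1 ?addr0 => [|k ki].
  rewrite raddf_sum; apply: eq_bigr => j _; rewrite (unsplitK (inr j)) /= mderivZ mderivM !mderiv_X_ eqxx.
  by rewrite mul1r eq_lrshift mulr0 addr0.
rewrite raddf_sum big1 // => j _; rewrite /= mderivZ mderivM !mderiv_X_ eq_lrshift mulr0 addr0.
by rewrite eq_lshift eq_sym (negbTE ki) mul0r scaler0.
Qed.

Lemma gaussE_mul_ybar H j p : gaussE H (X_ (rshift n j) * p) = \sum_(i < n) hinv H i j * gaussE H (mderiv (lshift n i) p).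
Proof.
rewrite (@gaussE_recur H _ (fun b => if fintype.split b is inl i then hinv H i j else 0)).
  rewrite sum_half [X in _ + X]big1 ?addr0 => [|k _]; last by rewrite (unsplitK (inr k)) mul0r.
  by apply: eq_bigr => i _; rewrite (unsplitK (inl i)).
rewrite sum_half [X in _ = _ + X]big1 ?addr0 => [|k _]; last by rewrite (unsplitK (inr k)) scale0r.
rewrite /gaussE_quad raddf_sum; apply: eq_bigr => i _; rewrite (unsplitK (inl i)).
rewrite raddf_sum (bigD1 j) //= big1 ?addr0 => [|k kj].
  by rewrite mderivZ mderivM !mderiv_X_ eqxx eq_rlshift mul0r add0r mulr1.
rewrite mderivZ mderivM !mderiv_X_ eq_rlshift mul0r add0r.
by rewrite eq_rshift eq_sym (negbTE kj) mulr0 scaler0.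
Qed.

Lemma gaussE1 H : gaussE H 1 = 1.
Proof.
rewrite -mpolyX0 gaussEX (@gaussE_monE _ 1) ?mdeg0 // /expQ big_ord1 expr0 fact0 invr1 scale1r.
by rewrite mcoeff1 eqxx mul1r /wfact big1 // => i _; rewrite mnm0E.
Qed.

(** The exponent of the Gaussian weight exp (- quad H); [gaussE_quad] has the inverse matrix
    instead. *)
Definition quad H : P := \sum_(i < n) \sum_(j < n) H i j *: (X_ (lshift n i) * X_ (rshift n j)).

Lemma hinv_mulr H i k : H \in unitmx -> \sum_j hinv H i j * H k j = (i == k)%:R.
Proof.
move=> uH; have : (hinv H *m H^T) i k = (1%:M : 'M[C]_n) i k by rewrite mulVmx // unitmx_tr.
by rewrite !mxE => <-; apply: eq_bigr => j _; rewrite mxE.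
Qed.

Lemma hinv_mull H j k : H \in unitmx -> \sum_i H i j * hinv H i k = (j == k)%:R.
Proof.
move=> uH; have : (H^T *m hinv H) j k = (1%:M : 'M[C]_n) j k by rewrite mulmxV // unitmx_tr.
by rewrite !mxE => <-; apply: eq_bigr => i _; rewrite mxE.
Qed.

Lemma mderiv_quad_y H i : mderiv (lshift n i) (quad H) = \sum_j H i j *: X_ (rshift n j).
Proof.
rewrite /quad raddf_sum (bigD1 i) //= [X in _ + X]big1 ?addr0 => [|k ki].
  rewrite raddf_sum; apply: eq_bigr => j _; rewrite /= mderivZ mderivM !mderiv_X_ eqxx.
  by rewrite mul1r eq_lrshift mulr0 addr0.
rewrite raddf_sum big1 // => j _; rewrite /= mderivZ mderivM !mderiv_X_ eq_lrshift mulr0 addr0.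
by rewrite eq_lshift eq_sym (negbTE ki) mul0r scaler0.
Qed.

Lemma mderiv_quad_ybar H j : mderiv (rshift n j) (quad H) = \sum_i H i j *: X_ (lshift n i).
Proof.
rewrite /quad raddf_sum; apply: eq_bigr => i _.
rewrite raddf_sum (bigD1 j) //= big1 ?addr0 => [|k kj].
  by rewrite mderivZ mderivM !mderiv_X_ eqxx eq_rlshift mul0r add0r mulr1.
rewrite mderivZ mderivM !mderiv_X_ eq_rlshift mul0r add0r.
by rewrite eq_rshift eq_sym (negbTE kj) mulr0 scaler0.
Qed.

(** The integral of d_a (p exp (- quad H)) vanishes. Algebraically, d_a quad is a linear form, and
    the recursion contracts its coefficients with the inverse matrix. *)
Lemma gaussE_ibp H a p : H \in unitmx -> gaussE H (mderiv a p) = gaussE H (mderiv a (quad H) * p).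
Proof.
move=> uH; rewrite -[a]splitK; case: (fintype.split a) => [i|j] /=.
  rewrite mderiv_quad_y mulr_suml [RHS]raddf_sum /=.
  under [RHS]eq_bigr => j _ do rewrite -scalerAl linearZ /= gaussE_mul_ybar mulr_sumr.
  rewrite exchange_big (bigD1 i) //= [X in _ + X]big1 ?addr0.
    under eq_bigr => j _ do rewrite mulrA [H i j * _]mulrC.
    by rewrite -mulr_suml hinv_mulr // eqxx mul1r.
  move=> k ki; under eq_bigr => j _ do rewrite mulrA [H i j * _]mulrC.
  by rewrite -mulr_suml hinv_mulr // (negbTE ki) mul0r.
rewrite mderiv_quad_ybar mulr_suml [RHS]raddf_sum /=.
under [RHS]eq_bigr => i _ do rewrite -scalerAl linearZ /= gaussE_mul_y mulr_sumr.
rewrite exchange_big (bigD1 j) //= [X in _ + X]big1 ?addr0.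
  under eq_bigr => i _ do rewrite mulrA.
  by rewrite -mulr_suml hinv_mull // eqxx mul1r.
move=> k kj; under eq_bigr => i _ do rewrite mulrA.
by rewrite -mulr_suml hinv_mull // eq_sym (negbTE kj) mul0r.
Qed.

(* A linear functional satisfying the recursion of [gaussE H] is a multiple of it;
   induction on the degree, a monomial of positive degree being [X_ a * q]. *)
Lemma gaussE_unique H (F : {linear P -> C | *%R}) : F 1 = 0 ->
  (forall i p, F (X_ (lshift n i) * p) = \sum_j hinv H i j * F (mderiv (rshift n j) p)) ->
  (forall j p, F (X_ (rshift n j) * p) = \sum_i hinv H i j * F (mderiv (lshift n i) p)) ->
  forall p, F p = 0.
Proof.
move=> F1 Fy Fyb.
have Fm d m : (mdeg m <= d)%N -> F (mpolyX C m) = 0.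
  elim: d m => [|d IH] m md; first by move: md; rewrite leqn0 mdeg_eq0 => /eqP ->; rewrite mpolyX0.
  have [->|m0] := eqVneq m mnm0; first by rewrite mpolyX0.
  have /existsP[a ma] : [exists a, (0 < m a)%N].
    apply: contra_neqT m0; rewrite negb_exists => /forallP mm; apply/mnmP => i.
    by rewrite mnm0E; have := mm i; lia.
  rewrite -(mnm_subK ma) mpolyXD mulrC -/(X_ a).
  have dm : (mdeg (mnm_sub m (mnm1 a)) <= d)%N.
    by move: md; rewrite -{1}(mnm_subK ma) mdegD mdeg1 addn1 ltnS.
  have D0 b : F (mderiv b (mpolyX C (mnm_sub m (mnm1 a)))) = 0.
    by rewrite mderivX linearZ /= IH ?mulr0 // (leq_trans (mdegB _ _)).
  move: (mnm_sub m (mnm1 a)) D0 => m' D0.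
  rewrite -[a]splitK; case: (fintype.split a) => [i|j] /=.
    by rewrite Fy big1 // => j _; rewrite D0 mulr0.
  by rewrite Fyb big1 // => i _; rewrite D0 mulr0.
move=> p; rewrite [p]mpolyE linear_sum big1 // => m _.
by rewrite linearZ /= (Fm _ _ (leqnn _)) mulr0.
Qed.

Definition degy m : nat := (\sum_(i < n) m (lshift n i))%N.
Definition degyb m : nat := (\sum_(j < n) m (rshift n j))%N.

Lemma degyD m m' : degy (mnm_add m m') = (degy m + degy m')%N.
Proof. by rewrite -big_split; apply: eq_bigr => i _; rewrite mnmDE. Qed.

Lemma degybD m m' : degyb (mnm_add m m') = (degyb m + degyb m')%N.
Proof. by rewrite -big_split; apply: eq_bigr => i _; rewrite mnmDE. Qed.

Lemma mdeg_degy m : mdeg m = (degy m + degyb m)%N.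
Proof. by rewrite mdegE big_split_ord. Qed.

(** The weight is invariant under y -> exp (i t) y. Here this is read off from the recursion, which
    removes one y and one ybar at a time. *)
Lemma gaussE_unbalanced H m : degy m != degyb m -> gaussE H (mpolyX C m) = 0.
Proof.
have degy1 (i : 'I_n) : degy (mnm1 (lshift n i)) = 1%N.
  rewrite /degy (bigD1 i) //= mnm1E eqxx big1 // => k ki.
  by rewrite mnm1E eq_lshift eq_sym (negbTE ki).
have degy1' (i : 'I_n) : degy (mnm1 (rshift n i)) = 0%N.
  by rewrite /degy big1 // => k _; rewrite mnm1E eq_rlshift.
have degyb1 (i : 'I_n) : degyb (mnm1 (rshift n i)) = 1%N.
  rewrite /degyb (bigD1 i) //= mnm1E eqxx big1 // => k ki.
  by rewrite mnm1E eq_rshift eq_sym (negbTE ki).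
have degyb1' (i : 'I_n) : degyb (mnm1 (lshift n i)) = 0%N.
  by rewrite /degyb big1 // => k _; rewrite mnm1E eq_lrshift.
suff S d : (mdeg m <= d)%N -> degy m != degyb m -> gaussE H (mpolyX C m) = 0 by exact: (S (mdeg m)).
elim: d m => [|d IH] m md mm.
  by move: md mm; rewrite leqn0 mdeg_degy addn_eq0 => /andP[/eqP -> /eqP ->].
have /existsP[a ma] : [exists a, (0 < m a)%N].
  rewrite -[[exists a, _]]negbK negb_exists; apply: contra mm => /forallP h.
  have h' a : m a = 0%N by have := h a; lia.
  by rewrite /degy /degyb !big1.

have dm : (mdeg (mnm_sub m (mnm1 a)) <= d)%N.
  by move: md; rewrite -{1}(mnm_subK ma) mdegD mdeg1 addn1 ltnS.
move: mm; rewrite -{1 2}(mnm_subK ma) degyD degybD => mm.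
rewrite -(mnm_subK ma) mpolyXD mulrC -/(X_ a).
set m' := mnm_sub m (mnm1 a) in dm mm *.
have K b : (forall k, m' = mnm_add k (mnm1 b) -> degy k != degyb k) -> gaussE H (mderiv b (mpolyX C m')) = 0.
  move=> hk; rewrite mderivX linearZ /=; have [->|mb] := posnP (m' b); first by rewrite mul0r.
  rewrite IH ?mulr0 //; first exact: leq_trans (mdegB _ _) dm.
  by apply: hk; rewrite mnm_subK.
move: mm; rewrite -[a]splitK; case: (fintype.split a) => [i|j] /= mm.
  rewrite gaussE_mul_y big1 // => j _; rewrite K ?mulr0 // => k E.
  by move: mm; rewrite E !degyD !degybD degy1 degy1' degyb1 degyb1' !addn0 !addn1 eqSS.
rewrite gaussE_mul_ybar big1 // => i _; rewrite K ?mulr0 // => k E.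
by move: mm; rewrite E !degyD !degybD degy1 degy1' degyb1 degyb1' !addn0 !addn1 eqSS.
Qed.

End Gauss.

(** * Formal integrals with a phase *)

Section FormalIntegral.
Context {R : realType} {n : nat}.
Local Notation C := R[i].
Local Notation P := (mpoly (n + n) C).
Implicit Types (H : 'M[C]_n) (p q : P) (m : multinom (n + n)) (G S : nat -> P).

Definition gint H S G (k : nat) : C := gaussE H (fps_mul G (fps_exp S) k).

(** The full exponent, Gaussian part included. In the applications its term of index k has degree k
    + 2 in y and ybar, the shift by 2 being the division by hbar. *)
Definition phase H S : nat -> P := fun k => (if k == 0%N then - quad H else 0) + S k.

Lemma mderiv1 a : mderiv a (1 : P) = 0.
Proof. by rewrite -mpolyC1 mderivC. Qed.

Lemma mderiv_fps_exp S a k : S 0%N = 0 ->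
  mderiv a (fps_exp S k) = fps_mul (fun i => mderiv a (S i)) (fps_exp S) k.
Proof.
move=> S0; pose Der (_ : nat) (p q : unit -> P) := q = fun t => mderiv a (p t).
have h : Der 0 (fun=> fps_exp S k) (fun=> fps_mul (fun i => mderiv a (S i)) (fps_exp S) k).
  apply: (@Der_fps_exp C P unit Der _ _ _ _ (fun i _ => S i) (fun i _ => mderiv a (S i))) => //.
  - by move=> x; apply/funext => t; rewrite mderivZ mderiv1 scaler0.
  - by move=> i; apply/funext => t; rewrite mderiv0.
  - by move=> i p p' q q' -> ->; apply/funext => t; rewrite mderivD.
  - by move=> i j p p' q q' -> ->; apply/funext => t; rewrite mderivM.
  - by move=> t; rewrite S0 mderiv0.
by have := congr1 (fun f => f tt) h.
Qed.

Lemma mderiv_fps_mul a G G' k : mderiv a (fps_mul G G' k) =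
  fps_mul (fun i => mderiv a (G i)) G' k + fps_mul G (fun i => mderiv a (G' i)) k.
Proof. by rewrite raddf_sum -big_split; apply: eq_bigr => i _; rewrite /= mderivM. Qed.

Lemma gintD H S G G' k : gint H S (fun i => G i + G' i) k = gint H S G k + gint H S G' k.
Proof. by rewrite /gint fps_mulDl linearD. Qed.

Lemma gintZ H S x G k : gint H S (fun i => x *: G i) k = x * gint H S G k.
Proof. by rewrite /gint fps_mulZl linearZ. Qed.

Lemma fps_mul_head x S G k : fps_mul (fun i => (if i == 0%N then x else 0) + S i) G k = x * G k + fps_mul S G k.
Proof.
rewrite fps_mulDl; congr (_ + _); rewrite /fps_mul big_ord_recl subn0 big1 ?addr0 // => i _.
by rewrite mul0r.
Qed.

Lemma fps_phase H S G k : fps_mul (phase H S) G k = - quad H * G k + fps_mul S G k.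
Proof. exact: fps_mul_head. Qed.

(** The derivative of the integrand falls on G, on S and on the Gaussian weight; the last two
    together make the derivative of the phase. *)
Lemma gint_ibp H S G a k : H \in unitmx -> S 0%N = 0 ->
  gint H S (fun i => mderiv a (G i)) k =
  - gint H S (fps_mul (fun i => mderiv a (phase H S i)) G) k.
Proof.
move=> uH S0; apply/eqP; rewrite -addr_eq0 /gint -fps_mulA.
set X := fps_exp S.
have -> : (fun i => mderiv a (phase H S i)) =
    (fun i => (if i == 0%N then - mderiv a (quad H) else 0) + mderiv a (S i)).
  by apply/funext => i; rewrite mderivD; case: eqP; rewrite ?mderivN ?mderiv0.
rewrite fps_mul_head linearD /= mulNr linearN /= -gaussE_ibp // mderiv_fps_mul linearD /= opprD.
have -> : fps_mul G (fun i => mderiv a (X i)) k = fps_mul (fun i => mderiv a (S i)) (fps_mul G X) k.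
  by rewrite fps_mulCA; apply: eq_fps_mul => // i _; rewrite mderiv_fps_exp.
by rewrite addrA addrA subrr add0r addNr.
Qed.

Definition euler p : P := \sum_a X_ a * mderiv a p.

Lemma euler_homog d p : p \is (@ishomog1 (n + n) C d mdeg) -> euler p = d%:R *: p.
Proof.
move=> hp; rewrite [p]mpolyE /euler.
under eq_bigr => a _ do rewrite raddf_sum mulr_sumr.
rewrite exchange_big /= scaler_sumr big_seq [RHS]big_seq; apply: eq_bigr => m mp.
have -> : d = mdeg m by rewrite (dhomog_mf hp).
under eq_bigr => a _ do rewrite mderivZ -scalerAr mderivX -scalerAr.
rewrite scalerA mulrC -scalerA mdegE natr_sum scaler_suml scaler_sumr; apply: eq_bigr => a _.
have [->|ma] := posnP (m a); first by rewrite !scale0r.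
by congr (_ *: (_ *: _)); rewrite /X_ mulrC -mpolyXD mnm_subK.
Qed.

Lemma eulerM p q : euler (p * q) = euler p * q + p * euler q.
Proof.
rewrite /euler mulr_suml mulr_sumr -big_split; apply: eq_bigr => a _ /=.
by rewrite mderivM mulrDr !mulrA [p * X_ a]mulrC.
Qed.

Lemma euler_sum (I : Type) (r : seq I) (F : I -> P) : euler (\sum_(i <- r) F i) = \sum_(i <- r) euler (F i).
Proof.
by rewrite /euler exchange_big; apply: eq_bigr => a _; rewrite raddf_sum mulr_sumr.
Qed.

(** Integrate each X_a d_a p by parts: the commutators of d_a with X_a add up to n + n, and sum_a
    X_a d_a quad = 2 quad. *)
Lemma gaussE_euler H p : H \in unitmx -> gaussE H (euler p) = 2 * gaussE H (quad H * p) - (n + n)%:R * gaussE H p.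
Proof.
move=> uH.
have half (r : 'I_n -> 'I_(n + n)) : quad H = \sum_i mderiv (r i) (quad H) * X_ (r i) ->
    gaussE H (\sum_i X_ (r i) * mderiv (r i) p) = gaussE H (quad H * p) - n%:R * gaussE H p.
  move=> E; rewrite [in RHS]E mulr_suml !raddf_sum /=.
  have -> : n%:R * gaussE H p = \sum_(i < n) gaussE H p by rewrite sumr_const card_ord mulr_natl.
  rewrite -sumrB; apply: eq_bigr => i _.
  by rewrite -mulrA -gaussE_ibp // mderivM mderiv_X_ eqxx mul1r linearD /= [X in X - _]addrC addrK.
rewrite /euler sum_half linearD /= !half.
- by rewrite natrD; ring.
- rewrite {1}/quad exchange_big /=; apply: eq_bigr => j _; rewrite mderiv_quad_ybar mulr_suml.
  by apply: eq_bigr => i _; rewrite scalerAl.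
- rewrite {1}/quad; apply: eq_bigr => i _; rewrite mderiv_quad_y mulr_suml.
  by apply: eq_bigr => j _; rewrite -scalerAl mulrC.
Qed.

(** The operator epsilon d/depsilon is a derivation, so [Der_fps_exp] applies. *)
Lemma fps_exp_index S k : S 0%N = 0 ->
  k%:R * fps_exp S k = fps_mul (fun i => i%:R * S i) (fps_exp S) k.
Proof.
move=> S0; pose Der (k : nat) (p q : unit -> P) := q = fun t => k%:R * p t.
have h : Der k (fun=> fps_exp S k) (fun=> fps_mul (fun i => i%:R * S i) (fps_exp S) k).
  apply: (@Der_fps_exp C P unit Der _ _ _ _ (fun i _ => S i) (fun i _ => i%:R * S i)) => //.
  - by move=> x; apply/funext => t; rewrite mul0r.
  - by move=> i; apply/funext => t; rewrite mulr0.
  - by move=> i p p' q q' -> ->; apply/funext => t; rewrite mulrDr.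
  - by move=> i j p p' q q' -> ->; apply/funext => t; rewrite natrD; ring.
  - by move=> t; rewrite mul0r.
by have := congr1 (fun f => f tt) h.
Qed.

(* The formal counterpart of the homogeneity of the Gaussian integral in hbar. *)
Lemma gint_euler H S G k : H \in unitmx -> S 0%N = 0 ->
  (forall i, S i \is (@ishomog1 (n + n) C i.+2 mdeg)) ->
  (forall i, G i \is (@ishomog1 (n + n) C i mdeg)) ->
  2 * gint H S (fps_mul (phase H S) G) k = - ((n + n + k)%:R * gint H S G k).
Proof.
move=> uH S0 hS hG; rewrite /gint -fps_mulA fps_phase linearD mulNr linearN /=.
set X := fps_exp S.
(* By degrees: an entry of G times m entries of S, of total index k, has degree k + 2m, and
   multiplication by S counts the m factors in the exponential. *)
have E : euler (fps_mul G X k) = k%:R * fps_mul G X k + 2 *: fps_mul S (fps_mul G X) k.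
  have eX i : euler (X i) = i%:R * X i + 2 *: fps_mul S X i.
    have -> : euler (X i) = fps_mul (fun j => euler (S j)) X i.
      rewrite /euler; under eq_bigr => a _ do rewrite mderiv_fps_exp // mulr_sumr.
      rewrite exchange_big; apply: eq_bigr => j _; rewrite mulr_suml.
      by apply: eq_bigr => a _; rewrite mulrA.
    rewrite /X fps_exp_index // -fps_mulZl -fps_mulDl; apply: eq_fps_mul => // j _.
    by rewrite (euler_homog (hS j)) -addn2 natrD scalerDl scaler_nat mulr_natl.
  rewrite euler_sum fps_mulCA -fps_mulZr mulr_sumr -big_split /=.
    have aux (g x s : P) (u v : nat) : u%:R *: g * x + g * (v%:R * x + 2 *: s) = (u%:R + v%:R) * (g * x) + g * (2 *: s).
    rewrite [g * (_ + _)]mulrDr addrA [RHS]addrC mulrDl addrC; congr (_ + (_ + _)).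
      by rewrite mulr_natl scaler_nat mulrnAl.
    by rewrite mulrCA.
  apply: eq_bigr => i _; rewrite eulerM eX (euler_homog (hG i)).
  have kE : (k%:R : P) = i%:R + (k - i)%:R by rewrite -natrD subnKC // -ltnS ltn_ord.
  by rewrite kE; exact: aux.
have := gaussE_euler (fps_mul G X k) uH.
rewrite E linearD linearZ /= mulr_natl raddfMn /= -mulr_natl natrD.
set a := gaussE H (quad H * _); set b := gaussE H (fps_mul S _ k); set c := gaussE H _.
move=> /eqP; rewrite -subr_eq0 => /eqP K.
rewrite -[RHS]addr0 -K; ring.
Qed.

(** Measures the imbalance between y and ybar. A term of the phase of index i has degree i + 2 and
    contains both kinds of variables, so its imbalance is at most i. *)
Definition excess (d : nat) p := forall m, mcoeff m p != 0 ->
  ((degyb m <= degy m + d) && (degy m <= degyb m + d))%N.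

Lemma excess0 d : excess d 0.
Proof. by move=> m; rewrite mcoeff0 eqxx. Qed.

Lemma excessD d p q : excess d p -> excess d q -> excess d (p + q).
Proof.
move=> hp hq m; rewrite mcoeffD; have [->|/hp //] := eqVneq (mcoeff m p) 0.
by rewrite add0r; exact: hq.
Qed.

Lemma excessZ d x p : excess d p -> excess d (x *: p).
Proof. by move=> hp m; rewrite mcoeffZ mulf_eq0 negb_or => /andP[_ /hp]. Qed.

Lemma excess_sum d (I : Type) (r : seq I) (Q : pred I) (F : I -> P) :
  (forall i, Q i -> excess d (F i)) -> excess d (\sum_(i <- r | Q i) F i).
Proof. by move=> H; apply: big_ind => //; [exact: excess0|exact: excessD]. Qed.

Lemma mcoeffM_neq0 p q m : mcoeff m (p * q) != 0 ->
  exists m1 m2, [/\ m = mnm_add m1 m2, mcoeff m1 p != 0 & mcoeff m2 q != 0].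
Proof.
rewrite mcoeffM => h.
have [k /andP[/eqP mk hk]] : exists k : (bmultinom (n + n) (mdeg m).+1 * bmultinom (n + n) (mdeg m).+1)%type,
    (m == mnm_add k.1 k.2) && (mcoeff k.1 p * mcoeff k.2 q != 0).
  apply/existsP; apply: contraNT h; rewrite negb_exists => /forallP h.
  by rewrite big1 // => k mk; have := h k; rewrite mk negbK => /eqP.
by exists k.1, k.2; move: hk; rewrite mulf_eq0 negb_or => /andP[].
Qed.

Lemma excessM d e p q : excess d p -> excess e q -> excess (d + e) (p * q).
Proof.
move=> hp hq m /mcoeffM_neq0[m1 [m2 [-> /hp /andP[a b] /hq /andP[c d']]]].
by rewrite !degyD !degybD; lia.
Qed.

Lemma excess1 : excess 0 1.
Proof.
move=> m; rewrite mcoeff1; have [->|] := eqVneq m mnm0; last by rewrite eqxx.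
by rewrite /degy /degyb !big1 // => i _; rewrite mnm0E.
Qed.

Lemma excess_fps_exp S k : (forall i, excess i (S i)) -> excess k (fps_exp S k).
Proof.
move=> hS; apply: excess_sum => m _; apply: excessZ.
move: (nat_of_ord m) => l {m}; elim: l k => [|l IH] k.
  by rewrite /= /fps_one; case: k => [|k]; [exact: excess1|exact: excess0].
rewrite fps_powS; apply: excess_sum => i _.
by rewrite -{1}(subnKC (ltn_ord i : (i <= k)%N)); apply: excessM.
Qed.

Lemma gaussE_eq0 H p : (forall m, mcoeff m p != 0 -> degy m != degyb m) -> gaussE H p = 0.
Proof.
move=> h; rewrite [p]mpolyE raddf_sum big_seq big1 // => m mp /=.
by rewrite linearZ /= gaussE_unbalanced ?mulr0 // h // -mcoeff_msupp.
Qed.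

(** Only balanced monomials survive, and a term of exp S of index k - i repairs an imbalance of at
    most k - i. For a monomial of degree i, an imbalance above k - i means that 2 max (degy, degyb)
    > k. *)
Lemma gint_bound H S G k : (forall i, excess i (S i)) ->
  (forall i m, mcoeff m (G i) != 0 -> mdeg m = i /\ (k < (maxn (degy m) (degyb m)).*2)%N) ->
  gint H S G k = 0.
Proof.
move=> hS hG; rewrite /gint /fps_mul raddf_sum big1 // => i _ /=.
apply: gaussE_eq0 => m /mcoeffM_neq0[m1 [m2 [-> /hG[m1i km1] /(excess_fps_exp hS)]]].
by move: km1 m1i; rewrite mdeg_degy degyD degybD; have := ltn_ord i; lia.
Qed.

End FormalIntegral.

(** * Taylor polynomials *)

Section MultiIndex.
Context {n : nat}.
Implicit Types (K : multinom (n + n)) (I J : multinom n).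

Definition jn I J : multinom (n + n) :=
  Multinom [tuple match fintype.split a with inl i => I i | inr j => J j end | a < n + n].
Definition p1 K : multinom n := Multinom [tuple K (lshift n i) | i < n].
Definition p2 K : multinom n := Multinom [tuple K (rshift n j) | j < n].

Lemma jnL I J i : jn I J (lshift n i) = I i.
Proof. by rewrite mnmE (unsplitK (inl i)). Qed.

Lemma jnR I J i : jn I J (rshift n i) = J i.
Proof. by rewrite mnmE (unsplitK (inr i)). Qed.

Lemma p1E K i : p1 K i = K (lshift n i). Proof. exact: mnmE. Qed.
Lemma p2E K i : p2 K i = K (rshift n i). Proof. exact: mnmE. Qed.

Lemma jnK K : jn (p1 K) (p2 K) = K.
Proof.
apply/mnmP => a; rewrite -[a]splitK; case: (fintype.split a) => i /=.
  by rewrite jnL p1E.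
by rewrite jnR p2E.
Qed.

Lemma p1_jn I J : p1 (jn I J) = I.
Proof. by apply/mnmP => i; rewrite p1E jnL. Qed.

Lemma p2_jn I J : p2 (jn I J) = J.
Proof. by apply/mnmP => i; rewrite p2E jnR. Qed.

Lemma degy_p1 K : degy K = mdeg (p1 K).
Proof. by rewrite mdegE; apply: eq_bigr => i _; rewrite p1E. Qed.

Lemma degyb_p2 K : degyb K = mdeg (p2 K).
Proof. by rewrite mdegE; apply: eq_bigr => i _; rewrite p2E. Qed.

Lemma mdeg_jn I J : mdeg (jn I J) = (mdeg I + mdeg J)%N.
Proof. by rewrite mdeg_degy degy_p1 degyb_p2 p1_jn p2_jn. Qed.

Lemma jnD I J I' J' : mnm_add (jn I J) (jn I' J') = jn (mnm_add I I') (mnm_add J J').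
Proof.
apply/mnmP => a; rewrite -[a]splitK; case: (fintype.split a) => i /=.
  by rewrite mnmDE !jnL mnmDE.
by rewrite mnmDE !jnR mnmDE.
Qed.

Definition lstI I : seq ('I_n + 'I_n) := flatten [seq nseq (I i) (inl i) | i <- enum 'I_n].
Definition lstJ J : seq ('I_n + 'I_n) := flatten [seq nseq (J j) (inr j) | j <- enum 'I_n].
(** The directions are listed in the order in which [dzI] and [dzbarI] nest. *)
Definition lst K := lstI (p1 K) ++ lstJ (p2 K).

Lemma count_lstI I x : count_mem x (lstI I) = (if x is inl i then I i else 0)%N.
Proof.
rewrite /lstI count_flatten -map_comp sumnE big_map big_enum /=.
case: x => i.
  rewrite (bigD1 i) //= count_nseq /= eqxx mul1n big1 ?addn0 // => k ki.
  by rewrite count_nseq /= (inj_eq inl_inj) (negbTE ki).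
by rewrite big1 // => k _; rewrite count_nseq.
Qed.

Lemma count_lstJ I x : count_mem x (lstJ I) = (if x is inr i then I i else 0)%N.
Proof.
rewrite /lstJ count_flatten -map_comp sumnE big_map big_enum /=.
case: x => i; first by rewrite big1 // => k _; rewrite count_nseq.
rewrite (bigD1 i) //= count_nseq /= eqxx mul1n big1 ?addn0 // => k ki.
by rewrite count_nseq /= (inj_eq inr_inj) (negbTE ki).
Qed.

Lemma count_lst K x : count_mem x (lst K) = K (unsplit x).
Proof.
rewrite count_cat count_lstI count_lstJ; case: x => i /=.
  by rewrite addn0 p1E.
by rewrite p2E.
Qed.

Lemma lst_add K a : perm_eq (lst (mnm_add K (mnm1 a))) (fintype.split a :: lst K).
Proof.
apply/allP => x _; apply/eqP; rewrite /= !count_lst mnmDE mnm1E addnC; congr (_ + _)%N.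
by rewrite -{1}[a]splitK (can_eq (@unsplitK n n)).
Qed.

End MultiIndex.

(** * Iterated derivatives and Taylor polynomials of functions *)

Section Jet.
Context {R : realType} {n : nat}.
Local Notation C := R[i].
Local Notation V := 'rV[C]_n.
Local Notation P := (mpoly (n + n) C).
Implicit Types (f g u Phi : V -> C) (z : V) (K : multinom (n + n)) (I J : multinom n) (h : pred (multinom (n + n))).

Definition pdL (s : seq ('I_n + 'I_n)) f := foldr (@pd R n) f s.

Lemma dzIE I f : dzI I f = pdL (lstI I) f.
Proof.
rewrite /dzI /lstI; elim: (enum 'I_n) => //= i s ->.
rewrite /pdL foldr_cat; elim: (I i) => //= k IH; by rewrite IH.
Qed.

Lemma dzbarIE J f : dzbarI J f = pdL (lstJ J) f.
Proof.
rewrite /dzbarI /lstJ; elim: (enum 'I_n) => //= i s ->.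
rewrite /pdL foldr_cat; elim: (J i) => //= k IH; by rewrite IH.
Qed.

Lemma dzIJ_E I J f : dzI I (dzbarI J f) = pdL (lst (jn I J)) f.
Proof. by rewrite dzIE dzbarIE /lst p1_jn p2_jn /pdL foldr_cat. Qed.

Section OpenSet.
Variable D : set V.
Hypothesis oD : open D.

Lemma smooth_pdL s f : smooth D f -> smooth D (pdL s f).
Proof. by elim: s => //= a s IH sf; exact: (smooth_pd oD a (IH sf)). Qed.

Lemma pdL_eq s f g : (forall z, D z -> f z = g z) -> forall z, D z -> pdL s f z = pdL s g z.
Proof. by move=> fg; elim: s => //= a s IH z Dz; apply: (pd_eq oD). Qed.

Lemma pdL_swap a s f z : D z -> smooth D f -> pdL s (pd a f) z = pd a (pdL s f) z.
Proof.
move=> + sf; elim: s z => //= b s IH z Dz.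
rewrite (pd_eq oD b Dz (fun w Dw => IH w Dw)); apply: (pdC oD) => //.
exact: smooth_pdL.
Qed.

Lemma pdL_perm s t f z : D z -> smooth D f -> perm_eq s t -> pdL s f z = pdL t f z.
Proof.
move=> + sf; elim: s t z => [|a s IH] t z Dz st.
  by move: st; rewrite perm_sym => /perm_nilP ->.
have at_ : a \in t by rewrite -(perm_mem st) mem_head.
have [t1 [t2 tE]] : exists t1 t2, t = t1 ++ a :: t2.
  by case/splitPr: at_ => t1 t2; exists t1, t2.
have st' : perm_eq s (t1 ++ t2).
  by move: st; rewrite tE perm_sym -cat1s perm_catCA cat1s perm_cons perm_sym.
rewrite tE /= (pd_eq oD a Dz (fun w Dw => IH _ w Dw st')).
by rewrite -pdL_swap // /pdL !foldr_cat /= -/(pdL t2 _) -!/(pdL t1 _); apply: pdL_eq => // w Dw; apply: pdL_swap.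
Qed.

Definition tay f z K : C := (wfact K)^-1 * pdL (lst K) f z.

Lemma tay_pd f z K a : D z -> smooth D f ->
  tay f z (mnm_add K (mnm1 a)) * (K a).+1%:R = tay (pd (fintype.split a) f) z K.
Proof.
move=> Dz sf; rewrite /tay (pdL_perm Dz sf (lst_add K a)) /= -pdL_swap // wfactD.
set x := pdL _ _ _; have : ((K a).+1%:R : C) != 0 by rewrite pnatr_eq0.
by move: (_.+1%:R) => y y0; rewrite invfM mulrAC -[_ * _ * y]mulrAC mulVf // mul1r.
Qed.

Lemma pd_tay f z K a : D z -> smooth D f -> pd a (fun w => tay f w K) z = tay (pd a f) z K.
Proof. by move=> Dz sf; rewrite (pdZ oD) //; [rewrite -pdL_swap|exact: smooth_pdL]. Qed.

Lemma smooth_tay f K : smooth D f -> smooth D (fun w => tay f w K).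
Proof. by move=> sf; apply: (smoothZ oD); exact: smooth_pdL. Qed.

(* The part of degree [k] of the Taylor series of [f] at [z], restricted to the
   monomials selected by [h]. *)
Definition Tp h f z (k : nat) : P :=
  \sum_(K : bmultinom (n + n) k.+1 | (mdeg K == k) && h K) tay f z K *: mpolyX C K.

Lemma mcoeff_Tp h f z k K : mcoeff K (Tp h f z k) = if (mdeg K == k) && h K then tay f z K else 0.
Proof.
rewrite /Tp raddf_sum /=.
under eq_bigr do rewrite mcoeffZ mcoeffX.
case: ifPn => [/andP[Kk hK]|nK].
  have Kb : (mdeg K < k.+1)%N by rewrite (eqP Kk).
  rewrite (bigD1 (Sub K Kb)) /= ?Kk // eqxx mulr1 big1 ?addr0 // => L /andP[_ LK].
  by case: eqP => [LE|_]; rewrite ?mulr0 //; move: LK; rewrite -val_eqE /= LE eqxx.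
rewrite big1 // => L /andP[Lk hL]; case: eqP => [LE|_]; rewrite ?mulr0 //.
by move: nK; rewrite -LE Lk hL.
Qed.

Lemma homog_Tp h f z k : Tp h f z k \is (@ishomog1 (n + n) C k mdeg).
Proof.
apply/dhomogP => K; rewrite mcoeff_msupp mcoeff_Tp /=.
by case: (mdeg K =P k) => [->|_] //=; rewrite eqxx.
Qed.

Lemma eq_Tp h h' f g z k : (forall K, mdeg K = k -> h K = h' K) -> (forall K, tay f z K = tay g z K) -> Tp h f z k = Tp h' g z k.
Proof.
move=> hh fg; apply/mpolyP => K; rewrite !mcoeff_Tp; case: eqP => //= Kk.
by rewrite hh // fg.
Qed.

Lemma mderiv_Tp h f z k a : D z -> smooth D f ->
  mderiv a (Tp h f z k.+1) = Tp (fun K => h (mnm_add K (mnm1 a))) (pd (fintype.split a) f) z k.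
Proof.
move=> Dz sf; apply/mpolyP => K; rewrite mcoeff_mderiv !mcoeff_Tp mdegD mdeg1 addn1 eqSS.
by case: ifP => _; rewrite ?mul0rn // -mulr_natr tay_pd.
Qed.

Lemma mderiv_Tp0 h f z a : mderiv a (Tp h f z 0) = 0.
Proof.
apply/mpolyP => K; rewrite mcoeff_mderiv mcoeff_Tp mdegD mdeg1 addn1 mcoeff0.
by rewrite mul0rn.
Qed.

Lemma wfact0 : wfact (mnm0 : multinom (n + n)) = 1 :> C.
Proof. by rewrite /wfact big1 // => i _; rewrite mnm0E. Qed.

Lemma tay0 f z : tay f z mnm0 = f z.
Proof.
rewrite /tay wfact0 invr1 mul1r.
have -> : lst (@mnm0 (n + n)) = [::]; last by [].
by apply/perm_nilP/allP => x _; apply/eqP; rewrite count_lst mnm0E.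
Qed.

Lemma Tp0 h f z : h mnm0 -> Tp h f z 0 = (f z)%:A.
Proof.
move=> h0; apply/mpolyP => K; rewrite mcoeff_Tp mcoeffZ mcoeff1 mdeg_eq0.
by case: eqP => [->|_]; rewrite ?h0 /= ?tay0 ?mulr1 ?mulr0.
Qed.

(** Euler's identity recovers a homogeneous polynomial of positive degree from its derivatives; it
    permits induction on the degree for Taylor polynomials. *)
Lemma Tp_inj_deriv k (p q : P) : p \is (@ishomog1 (n + n) C k.+1 mdeg) -> q \is (@ishomog1 (n + n) C k.+1 mdeg) ->
  (forall a, mderiv a p = mderiv a q) -> p = q.
Proof.
move=> hp hq pq; have := euler_homog hp; rewrite (_ : euler p = euler q); last by apply: eq_bigr => a _; rewrite pq.
by rewrite (euler_homog hq) => /scalerI ->.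
Qed.

Lemma pdM_tay f g z K a : D z -> smooth D f -> smooth D g ->
  tay (pd a (fun w => f w * g w)) z K = tay (fun w => pd a f w * g w) z K + tay (fun w => f w * pd a g w) z K.
Proof.
move=> Dz sf sg; rewrite /tay -mulrDr; congr (_ * _).
have s1 := smoothM oD (smooth_pd oD a sf) sg; have s2 := smoothM oD sf (smooth_pd oD a sg).
have E s w : D w -> pdL s (fun w => pd a f w * g w + f w * pd a g w) w = pdL s (fun w => pd a f w * g w) w + pdL s (fun w => f w * pd a g w) w.
  elim: s w => //= b s IH w Dw; by rewrite (pd_eq oD b Dw IH) (pdD b Dw (smooth_pdL _ s1) (smooth_pdL _ s2)).
by rewrite -E //; apply: pdL_eq => // w Dw; rewrite (pdM a Dw sf sg).
Qed.

Lemma TpD h f g z k : D z -> smooth D f -> smooth D g ->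
  Tp h (fun w => f w + g w) z k = Tp h f z k + Tp h g z k.
Proof.
move=> Dz sf sg; apply/mpolyP => K; rewrite mcoeffD !mcoeff_Tp; case: ifP => _; rewrite ?addr0 //.
rewrite /tay -mulrDr; congr (_ * _); elim: (lst K) z Dz => //= b s IH w Dw.
by rewrite (pd_eq oD b Dw IH) (pdD b Dw (smooth_pdL _ sf) (smooth_pdL _ sg)).
Qed.

(** Discarding the monomials outside [h] respects products when a sum of exponents is selected
    exactly if both summands are. The two sides are compared through their derivatives, by induction
    on the degree. *)
Lemma TpM h f g z k : h mnm0 -> (forall K L, h (mnm_add K L) = h K && h L) ->
  D z -> smooth D f -> smooth D g ->
  Tp h (fun w => f w * g w) z k = fps_mul (Tp h f z) (Tp h g z) k.
Proof.
move=> h0 hD Dz; elim: k f g => [|k IH] f g sf sg.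
  by rewrite /fps_mul big_ord1 !Tp0 // -scalerAl mul1r scalerA.
apply: (@Tp_inj_deriv k); first exact: homog_Tp.
  apply: rpred_sum => i _; have := dhomogM (homog_Tp h f z i) (homog_Tp h g z (k.+1 - i)).
  by rewrite subnKC // -ltnS.
move=> a; have sfg := smoothM oD sf sg.
rewrite mderiv_Tp // mderiv_fps_mul fps_mul_shift ?mderiv_Tp0 //.
rewrite [fps_mul (Tp h f z) _]fps_mulC (@fps_mul_shift _ (fun i => mderiv a (Tp h g z i))) ?mderiv_Tp0 //.
have E f' : smooth D f' -> (fun i => mderiv a (Tp h f' z i.+1)) = Tp (fun K => h (mnm_add K (mnm1 a))) (pd (fintype.split a) f') z.
  by move=> sf'; apply/funext => i; rewrite mderiv_Tp.
rewrite (E f sf) (E g sg) (fps_mulC _ (Tp h f z)).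
(* A direction outside [h] occurs in no selected monomial, so the derivatives along it vanish;
   otherwise Leibniz and the induction hypothesis apply. *)
have [ha|ha] := boolP (h (mnm1 a)); last first.
  have Z f' i : Tp (fun K => h (mnm_add K (mnm1 a))) f' z i = 0.
    by apply/mpolyP => K; rewrite mcoeff_Tp hD (negbTE ha) !andbF mcoeff0.
  rewrite Z fps_mul_eq0 ?add0r; last by move=> i _; exact: Z.
  by rewrite fps_mulC fps_mul_eq0 // => i _; exact: Z.
have Ea f' i : Tp (fun K => h (mnm_add K (mnm1 a))) f' z i = Tp h f' z i.
  by apply: eq_Tp => // K _; rewrite hD ha andbT.
have Ea' f' : Tp (fun K => h (mnm_add K (mnm1 a))) f' z = Tp h f' z by apply/funext => i.
rewrite !Ea' -!IH //; try exact: smooth_pd.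
apply/mpolyP => K; rewrite mcoeffD !mcoeff_Tp; case: ifP => _; rewrite ?addr0 //.
exact: pdM_tay.
Qed.

End OpenSet.
End Jet.

(** * The star product as a formal integral *)

Section Identification.
Context {R : realType} {n : nat}.
Local Notation C := R[i].
Local Notation V := 'rV[C]_n.
Local Notation P := (mpoly (n + n) C).
Implicit Types (f g u Phi : V -> C) (z : V) (K : multinom (n + n)) (I J : multinom n).

Definition mix K := (0 < degy K)%N && (0 < degyb K)%N.
(** For [s = true] only the ybar may occur, the shape of [serF1]; for [s = false] only the y, the
    shape of [serF2]. *)
Definition pure (s : bool) K := (if s then degy K else degyb K) == 0%N.

Lemma ymonE I : ymon I = mpolyX C (jn I (mnm0 : multinom n)).
Proof.
rewrite /ymon /yvar; under eq_bigr do rewrite mpolyXn.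
rewrite -(big_morph (@mpolyX (n + n) C) (@mpolyXD _ _) (@mpolyX0 _ _)); congr mpolyX; apply/mnmP => a; rewrite -[a]splitK mnm_sumE.
case: (fintype.split a) => i /=.
  rewrite jnL (bigD1 i) //= mulmnE mnm1E eqxx mul1n big1 ?addn0 // => k ki.
  by rewrite mulmnE mnm1E (inj_eq (@lshift_inj _ _)) (negbTE ki).
rewrite jnR mnm0E big1 // => k _; rewrite mulmnE mnm1E.
by rewrite ?eq_lrshift ?eq_rlshift mul0n.
Qed.

Lemma ybarmonE J : ybarmon J = mpolyX C (jn (mnm0 : multinom n) J).
Proof.
rewrite /ybarmon /ybarvar; under eq_bigr do rewrite mpolyXn.
rewrite -(big_morph (@mpolyX (n + n) C) (@mpolyXD _ _) (@mpolyX0 _ _)); congr mpolyX; apply/mnmP => a; rewrite -[a]splitK mnm_sumE.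
case: (fintype.split a) => i /=.
  rewrite jnL mnm0E big1 // => k _; rewrite mulmnE mnm1E.
  by rewrite ?eq_lrshift ?eq_rlshift mul0n.
rewrite jnR (bigD1 i) //= mulmnE mnm1E eqxx mul1n big1 ?addn0 // => k ki.
by rewrite mulmnE mnm1E (inj_eq (@rshift_inj _ _)) (negbTE ki).
Qed.

Lemma ymon_ybarmon I J : ymon I * ybarmon J = mpolyX C (jn I J).
Proof. by rewrite ymonE ybarmonE -mpolyXD jnD add0m addm0. Qed.

Lemma wfact_jn K : wfact K = (multifact (p1 K))%:R * (multifact (p2 K))%:R :> C.
Proof.
rewrite /wfact big_split_ord natrM; congr (_%:R * _%:R); apply: eq_bigr => i _.
  by rewrite p1E.
by rewrite p2E.
Qed.

Lemma mcoeff_sum_jn k (Q : multinom n -> multinom n -> bool) (c : multinom n -> multinom n -> C) K :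
  (forall I J, Q I J -> (mdeg I < k)%N && (mdeg J < k)%N) ->
  mcoeff K (\sum_(I : bmultinom n k) \sum_(J : bmultinom n k | Q I J) c I J *: (ymon I * ybarmon J))
  = if Q (p1 K) (p2 K) then c (p1 K) (p2 K) else 0.
Proof.
move=> Qk; rewrite raddf_sum /=.
have E I : mcoeff K (\sum_(J : bmultinom n k | Q I J) c I J *: (ymon I * ybarmon J)) =
    if (I == p1 K) && Q (p1 K) (p2 K) then c (p1 K) (p2 K) else 0.
  rewrite raddf_sum /=; under eq_bigr do rewrite mcoeffZ ymon_ybarmon mcoeffX.
  case: ifPn => [/andP[/eqP-> q]|q].
    have /andP[_ kJ] := Qk _ _ q.
    rewrite (bigD1 (Sub (p2 K) kJ)) //= jnK eqxx mulr1 big1 ?addr0 // => J /andP[_ JK].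
    case: eqP => [JE|_]; rewrite ?mulr0 //; case/eqP: JK; apply: val_inj => /=.
    by rewrite -JE p2_jn.
  rewrite big1 // => J qJ; case: eqP => [JE|_]; rewrite ?mulr0 //.
  by case/negP: q; rewrite -JE p1_jn p2_jn eqxx.
under eq_bigr do rewrite E.
case: ifPn => [q|nq]; last by rewrite big1 // => I _; rewrite andbF.
have /andP[kI _] := Qk _ _ q.
rewrite (bigD1 (Sub (p1 K) kI)) //= eqxx /= big1 ?addr0 // => I IK.
by rewrite ifN // andbT; apply: contraNN IK => /eqP IE; apply/eqP/val_inj.
Qed.

Lemma lstI0 : lstI (mnm0 : multinom n) = [::].
Proof. by apply/perm_nilP/allP => x _; apply/eqP; rewrite count_lstI; case: x => // i; rewrite mnm0E. Qed.

Lemma lstJ0 : lstJ (mnm0 : multinom n) = [::].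
Proof. by apply/perm_nilP/allP => x _; apply/eqP; rewrite count_lstJ; case: x => // i; rewrite mnm0E. Qed.

Lemma tay_dz f z K : tay f z K = (multifact (p1 K))%:R^-1 * (multifact (p2 K))%:R^-1 * dzI (p1 K) (dzbarI (p2 K) f) z.
Proof. by rewrite /tay wfact_jn invfM dzIJ_E jnK. Qed.

Lemma multifact0 : multifact (mnm0 : multinom n) = 1%N.
Proof. by rewrite /multifact big1 // => i _; rewrite mnm0E. Qed.

Lemma serF1E f z : serF1 f z = Tp (pure true) f z.
Proof.
apply/funext => k; apply/mpolyP => K; rewrite mcoeff_Tp /serF1 raddf_sum /=.
under eq_bigr do rewrite mcoeffZ ybarmonE mcoeffX.
case: ifPn => [/andP[/eqP Kk /eqP K0]|nK].
  have p10 : p1 K = mnm0 by apply/eqP; rewrite -mdeg_eq0 -degy_p1 K0.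
  have Kb : (mdeg (p2 K) < k.+1)%N by rewrite -degyb_p2 ltnS -Kk mdeg_degy leq_addl.
  have KE : jn mnm0 (p2 K) = K by rewrite -p10 jnK.
  rewrite (bigD1 (Sub (p2 K) Kb)) /=; last by rewrite -degyb_p2 -Kk mdeg_degy K0.
  rewrite KE eqxx mulr1 big1 ?addr0 => [|J /andP[_ JK]]; last first.
    by case: eqP => [E|_]; rewrite ?mulr0 //; case/eqP: JK; apply: val_inj; rewrite /= -E p2_jn.
  by rewrite tay_dz p10 multifact0 invr1 mul1r dzIE lstI0.
rewrite big1 // => J Jk; case: eqP => [E|_]; rewrite ?mulr0 //; case/negP: nK.
by rewrite -E mdeg_jn mdeg0 add0n Jk /pure degy_p1 p1_jn mdeg0.
Qed.

Lemma serF2E f z : serF2 f z = Tp (pure false) f z.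
Proof.
apply/funext => k; apply/mpolyP => K; rewrite mcoeff_Tp /serF2 raddf_sum /=.
under eq_bigr do rewrite mcoeffZ ymonE mcoeffX.
case: ifPn => [/andP[/eqP Kk /eqP K0]|nK].
  have p10 : p2 K = mnm0 by apply/eqP; rewrite -mdeg_eq0 -degyb_p2 K0.
  have Kb : (mdeg (p1 K) < k.+1)%N by rewrite -degy_p1 ltnS -Kk mdeg_degy leq_addr.
  have KE : jn (p1 K) mnm0 = K by rewrite -p10 jnK.
  rewrite (bigD1 (Sub (p1 K) Kb)) /=; last by rewrite -degy_p1 -Kk mdeg_degy K0 addn0.
  rewrite KE eqxx mulr1 big1 ?addr0 => [|J /andP[_ JK]]; last first.
    by case: eqP => [E|_]; rewrite ?mulr0 //; case/eqP: JK; apply: val_inj; rewrite /= -E p1_jn.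
  by rewrite tay_dz p10 multifact0 invr1 mulr1 dzbarIE lstJ0.
rewrite big1 // => J Jk; case: eqP => [E|_]; rewrite ?mulr0 //; case/negP: nK.
by rewrite -E mdeg_jn mdeg0 addn0 Jk /pure degyb_p2 p2_jn mdeg0.
Qed.

Lemma serME Phi z k : serM Phi z k =
  (\det (hmx Phi z))^-1 *: Tp xpredT (fun w => \det (hmx Phi w)) z k.
Proof.
rewrite /serM; congr (_ *: _); apply/mpolyP => K.
rewrite (@mcoeff_sum_jn k.+1 (fun I J => (mdeg I + mdeg J == k)%N) (fun I J => (multifact I)%:R^-1 * (multifact J)%:R^-1 * dzI I (dzbarI J (fun w => \det (hmx Phi w))) z)); last first.
  by move=> I J /eqP <-; rewrite !ltnS leq_addr leq_addl.
by rewrite mcoeff_Tp -degy_p1 -degyb_p2 -mdeg_degy andbT tay_dz.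
Qed.

Lemma serSE Phi z k : serS Phi z k = if k == 0%N then 0 else - Tp mix Phi z k.+2.
Proof.
rewrite /serS; case: eqP => [->|/eqP k0].
  rewrite big1 ?oppr0 // => I _; rewrite big1 // => J /and4P[_ _ IJ3 /eqP].
  by move/eqP; rewrite subn_eq0 leqNgt IJ3.
congr (- _); apply/mpolyP => K.
rewrite (@mcoeff_sum_jn k.+3 (fun I J => [&& (1 <= mdeg I)%N, (1 <= mdeg J)%N, (3 <= mdeg I + mdeg J)%N
          & (mdeg I + mdeg J - 2 == k)%N]) (fun I J => (multifact I)%:R^-1 * (multifact J)%:R^-1 * dzI I (dzbarI J Phi) z)); last first.
  by move=> I J /and4P[_ _ h3 /eqP <-]; apply/andP; split; lia.
rewrite mcoeff_Tp -degy_p1 -degyb_p2 tay_dz /mix mdeg_degy.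
by congr (if _ then _ else _); apply/idP/idP => [/and4P[a b c /eqP d]|/and3P[/eqP a b c]]; [apply/and3P|apply/and4P]; split; lia.
Qed.

Lemma serS0 Phi z : serS Phi z 0 = 0. Proof. by rewrite serSE. Qed.

Lemma homog_serS Phi z k : serS Phi z k \is (@ishomog1 (n + n) C k.+2 mdeg).
Proof. by rewrite serSE; case: ifP => _; rewrite ?rpred0 // rpredN; exact: homog_Tp. Qed.

Lemma excess_serS Phi z k : excess k (serS Phi z k).
Proof.
move=> m; rewrite serSE; case: ifP => [_|k0]; first by rewrite mcoeff0 eqxx.
rewrite mcoeffN mcoeff_Tp oppr_eq0; case: ifP; last by rewrite eqxx.
by rewrite mdeg_degy /mix => /and3P[/eqP mk a b] _; apply/andP; split; lia.
Qed.

Variable D : set V.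
Hypothesis oD : open D.

(** Both sides are homogeneous of degree 2, so two uses of [Tp_inj_deriv] reduce the claim to the
    second derivatives of Phi at [z]. *)
Lemma quad_Tp Phi z : D z -> smooth D Phi -> quad (hmx Phi z) = Tp mix Phi z 2.
Proof.
move=> Dz sP.
have d1 (i : 'I_n) : degy (mnm1 (lshift n i)) = 1%N /\ degyb (mnm1 (lshift n i)) = 0%N.
  have := mdeg_degy (mnm1 (lshift n i)); rewrite mdeg1 => E.
  suff d : degyb (mnm1 (lshift n i)) = 0%N by rewrite d addn0 in E.
  by rewrite degyb_p2; apply/eqP; rewrite mdeg_eq0; apply/eqP/mnmP => j; rewrite p2E mnm1E mnm0E eq_lrshift.
have d2 (i : 'I_n) : degy (mnm1 (rshift n i)) = 0%N /\ degyb (mnm1 (rshift n i)) = 1%N.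
  have := mdeg_degy (mnm1 (rshift n i)); rewrite mdeg1 => E.
  suff d : degy (mnm1 (rshift n i)) = 0%N by rewrite d in E.
  by rewrite degy_p1; apply/eqP; rewrite mdeg_eq0; apply/eqP/mnmP => j; rewrite p1E mnm1E mnm0E eq_rlshift.
have hX a : X_ a \is (@ishomog1 (n + n) C 1 mdeg) by have := dhomogX C mdeg 1 (mnm1 a); rewrite /= mdeg1 => ->.
have hq : quad (hmx Phi z) \is (@ishomog1 (n + n) C 2 mdeg).
  by apply: rpred_sum => i _; apply: rpred_sum => j _; apply: rpredZ; exact: (dhomogM (hX _) (hX _)).
apply: (@Tp_inj_deriv R n 1); [exact: hq|exact: homog_Tp|move=> a].
rewrite (mderiv_Tp oD) //; apply: (@Tp_inj_deriv R n 0); [|exact: homog_Tp|move=> b].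
  rewrite -[a]splitK; case: (fintype.split a) => i /=; rewrite ?mderiv_quad_y ?mderiv_quad_ybar;
  by apply: rpred_sum => j _; apply: rpredZ; exact: hX.
rewrite (mderiv_Tp oD) //; last exact: (smooth_pd oD).
have E1 h f : h (mnm0 : multinom (n + n)) = false -> Tp h f z 0 = 0.
  move=> h0; apply/mpolyP => K; rewrite mcoeff_Tp mcoeff0 mdeg_eq0.
  by case: eqP => [->|//]; rewrite h0.
rewrite -[a]splitK -[b]splitK; case: (fintype.split a) => i; case: (fintype.split b) => j /=;
  rewrite ?(unsplitK (inl _)) ?(unsplitK (inr _)) ?mderiv_quad_y ?mderiv_quad_ybar raddf_sum /=.
- rewrite E1; last by rewrite /mix !add0m !degybD !(d1 _).2 andbF.
  by rewrite big1 // => k _; rewrite mderivZ mderiv_X_ ?eq_lrshift ?eq_rlshift scaler0.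
- rewrite Tp0; last by rewrite /mix !add0m !degyD !degybD (d1 _).1 (d2 _).2 addn1.
  rewrite (bigD1 j) //= mderivZ mderiv_X_ eqxx big1 ?addr0; last first.
    by move=> k; rewrite eq_sym => kj; rewrite mderivZ mderiv_X_ (inj_eq (@rshift_inj _ _)) (negbTE kj) scaler0.
  by rewrite mxE; congr (_ *: _); exact: (pdC oD (inl i) (inr j) Dz sP).
- rewrite Tp0; last by rewrite /mix !add0m !degyD !degybD (d1 _).1 (d2 _).2 addn1.
  rewrite (bigD1 j) //= mderivZ mderiv_X_ eqxx big1 ?addr0; last first.
    by move=> k; rewrite eq_sym => kj; rewrite mderivZ mderiv_X_ (inj_eq (@lshift_inj _ _)) (negbTE kj) scaler0.
  by rewrite mxE.
- rewrite E1; last by rewrite /mix !add0m !degyD !(d2 _).1.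
  by rewrite big1 // => k _; rewrite mderivZ mderiv_X_ ?eq_lrshift ?eq_rlshift scaler0.
Qed.

(** The Gaussian exponent is the term of degree 2 of the mixed Taylor series of - Phi, so the whole
    phase has one description. *)
Lemma phase_Tp Phi z k : D z -> smooth D Phi -> phase (hmx Phi z) (serS Phi z) k = - Tp mix Phi z k.+2.
Proof.
move=> Dz sP; rewrite /phase serSE; case: eqP => [->|_]; last by rewrite add0r.
by rewrite addr0 quad_Tp.
Qed.

End Identification.

(** * Gaussian integrals depending on a parameter *)

Section Families.
Context {R : realType} {n : nat}.
Local Notation C := R[i].
Local Notation V := 'rV[C]_n.
Local Notation P := (mpoly (n + n) C).
Variable D : set V.
Hypothesis oD : open D.
Implicit Types (f g u Phi : V -> C) (z : V) (K m : multinom (n + n)) (p q : V -> P) (H : V -> 'M[C]_n).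

(** A smooth family of polynomials [p] with derivative [q] along [a]. The uniform bound on the size
    turns sums over varying supports into sums over one fixed finite set. *)
Definition psm a p q := (exists N, forall z, (msize (p z) <= N)%N /\ (msize (q z) <= N)%N) /\
  forall m, smooth D (fun z => mcoeff m (p z)) /\
    forall z, D z -> pd a (fun w => mcoeff m (p w)) z = mcoeff m (q z).

Lemma psm_cst a (p : P) : psm a (fun=> p) (fun=> 0).
Proof.
split; first by exists (msize p) => z; rewrite msize0.
move=> m; split; first exact: (smooth_cst oD).
by move=> z Dz; rewrite pd_cst mcoeff0.
Qed.

Lemma psmD a p p' q q' : psm a p p' -> psm a q q' -> psm a (fun z => p z + q z) (fun z => p' z + q' z).
Proof.
move=> [[N HN] Hp] [[N' HN'] Hq]; split.
  exists (maxn N N') => z; have [a1 a2] := HN z; have [b1 b2] := HN' z.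
  by split; apply: leq_trans (msizeD_le _ _) _; rewrite geq_max !leq_max ?a1 ?a2 ?b1 ?b2 ?orbT.
move=> m; have [sp dp] := Hp m; have [sq dq] := Hq m.
split; first by apply: (smooth_eq oD _ (smoothD oD sp sq)) => z _; rewrite mcoeffD.
move=> z Dz; rewrite mcoeffD -dp // -dq // -(pdD a Dz sp sq); apply: (pd_eq oD) => // w _.
by rewrite mcoeffD.
Qed.

Lemma psmM a p p' q q' : psm a p p' -> psm a q q' ->
  psm a (fun z => p z * q z) (fun z => p' z * q z + p z * q' z).
Proof.
move=> [[N HN] Hp] [[N' HN'] Hq]; split.
  have B (x y : P) : (msize x <= N)%N -> (msize y <= N')%N -> (msize (x * y) <= N + N')%N.
    move=> xN yN; have [->|x0] := eqVneq x 0; first by rewrite mul0r msize0.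
    have [->|y0] := eqVneq y 0; first by rewrite mulr0 msize0.
    by apply: leq_trans (leq_add xN yN); rewrite msizeM // leq_pred.
  exists (N + N')%N => z; have [a1 a2] := HN z; have [b1 b2] := HN' z.
  by split; [exact: B|apply: leq_trans (msizeD_le _ _) _; rewrite geq_max; apply/andP; split; exact: B].
move=> m; have cE (x y : P) := mcoeffM x y m.
have s1 i : smooth D (fun z => mcoeff i (p z) * mcoeff i (q z)) by apply: (smoothM oD (Hp i).1 (Hq i).1).
split.
  apply: (smooth_eq oD (F := fun z => \sum_(k : bmultinom (n + n) (mdeg m).+1 * bmultinom (n + n) (mdeg m).+1 | m == (mnm_add k.1 k.2)) mcoeff k.1 (p z) * mcoeff k.2 (q z))).
    by move=> z _; rewrite cE.
  by apply: (smooth_sum oD) => k _; exact: (smoothM oD (Hp _).1 (Hq _).1).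
move=> z Dz; rewrite mcoeffD !cE -big_split /=.
rewrite (pd_eq oD a Dz (G := fun z => \sum_(k : bmultinom (n + n) (mdeg m).+1 * bmultinom (n + n) (mdeg m).+1 | m == (mnm_add k.1 k.2)) mcoeff k.1 (p z) * mcoeff k.2 (q z))); last by move=> w _; rewrite cE.
rewrite (pd_sum oD) //; last by move=> k _; exact: (smoothM oD (Hp _).1 (Hq _).1).
apply: eq_bigr => k _; rewrite (pdM a Dz (Hp _).1 (Hq _).1).
by rewrite (Hp _).2 // (Hq _).2.
Qed.

Lemma psm_eq a p p' q' : psm a p p' -> (forall z, p' z = q' z) -> psm a p q'.
Proof. by move=> H /funext <-. Qed.

Lemma psm_sum a (T : Type) (r : seq T) (Q : pred T) (p p' : T -> V -> P) : (forall i, Q i -> psm a (p i) (p' i)) ->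
  psm a (fun z => \sum_(i <- r | Q i) p i z) (fun z => \sum_(i <- r | Q i) p' i z).
Proof.
move=> H; elim: r => [|i r IH].
  have := psm_cst a 0; congr psm; apply/funext => z; by rewrite big_nil.
have [Qi|nQ] := boolP (Q i).
  have := psmD (H i Qi) IH; congr psm; apply/funext => z; by rewrite big_cons Qi.
move: IH; congr psm; apply/funext => z; by rewrite big_cons (negbTE nQ).
Qed.

Lemma psm_fps_mul a (p p' q q' : V -> nat -> P) k : (forall i, psm a (p ^~ i) (p' ^~ i)) ->
  (forall i, psm a (q ^~ i) (q' ^~ i)) ->
  psm a (fun z => fps_mul (p z) (q z) k) (fun z => fps_mul (p' z) (q z) k + fps_mul (p z) (q' z) k).
Proof.
move=> Hp Hq; have := @psm_sum a _ (index_enum 'I_k.+1) xpredT _ _ (fun i _ => psmM (Hp i) (Hq (k - i)%N)).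
by move/psm_eq; apply => z; rewrite /fps_mul -big_split.
Qed.

Lemma psm_fps_exp a (p p' : V -> nat -> P) k : (forall i, psm a (p ^~ i) (p' ^~ i)) ->
  (forall z, p z 0%N = 0) -> (forall z, p' z 0%N = 0) ->
  psm a (fun z => fps_exp (K := C) (p z) k) (fun z => fps_mul (p' z) (fps_exp (K := C) (p z)) k).
Proof.
move=> H p0 p'0; apply: (@Der_fps_exp _ _ _ (fun=> psm a)) => //.
- by move=> x; exact: psm_cst.
- by move=> _; exact: psm_cst.
- by move=> _; exact: psmD.
- by move=> _ _; exact: psmM.
Qed.

Lemma psm_Tp a h f k : smooth D f -> psm a (fun z => Tp h f z k) (fun z => Tp h (pd a f) z k).
Proof.
move=> sf; split.
  exists k.+1 => z; split; rewrite msizeE; apply/bigmax_leqP_seq => m; rewrite mcoeff_msupp mcoeff_Tp;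
  by case: (mdeg m =P k) => [->|_] //=; rewrite eqxx.
move=> m; split.
  apply: (smooth_eq oD (F := fun z => if (mdeg m == k) && h m then tay f z m else 0)).
    by move=> z _; rewrite mcoeff_Tp.
  by case: ((mdeg m == k) && h m); [exact: (smooth_tay oD)|exact: (smooth_cst oD)].
move=> z Dz; rewrite mcoeff_Tp (pd_eq oD a Dz (G := fun z => if (mdeg m == k) && h m then tay f z m else 0)).
  by case: ifP => _; [exact: (pd_tay oD)|exact: pd_cst].
by move=> w _; rewrite mcoeff_Tp.
Qed.

Lemma smooth_det k (A : V -> 'M[C]_k) : (forall i j, smooth D (fun z => A z i j)) -> smooth D (fun z => \det (A z)).
Proof.
move=> sA; apply: (smooth_sum oD) => s _; apply: (smoothM oD (smooth_cst oD _)).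
by apply: (smooth_prod oD) => i _.
Qed.

Lemma pd_prod a k (F : 'I_k -> V -> C) z : D z -> (forall i, smooth D (F i)) ->
  pd a (fun w => \prod_i F i w) z = \sum_l \prod_i (if i == l then pd a (F i) z else F i z).
Proof.
move=> Dz sF; have : uniq (index_enum 'I_k) := index_enum_uniq _.
elim: (index_enum 'I_k) => [|x r IH] /=.
  by move=> _; rewrite big_nil (pd_eq oD a Dz (G := fun=> 1)) ?pd_cst // => w _; rewrite big_nil.
move=> /andP[xr ur]; rewrite big_cons (pd_eq oD a Dz (G := fun w => F x w * \prod_(i <- r) F i w)); last first.
  by move=> w _; rewrite big_cons.
rewrite (pdM a Dz (sF x) (smooth_prod oD r (fun i _ => sF i))) IH // big_cons eqxx.
congr (_ * _ + _).
  rewrite !big_seq; apply: eq_bigr => i ir; rewrite ifN //; apply: contraNneq xr => <-; exact: ir.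
rewrite mulr_sumr !big_seq; apply: eq_bigr => l lr; rewrite big_cons ifN //.
by apply: contraNneq xr => ->.
Qed.

Section DerivedMatrix.
Variables (H H' : V -> 'M[C]_n) (a : 'I_n + 'I_n).
Hypothesis sH : forall i j, smooth D (fun z => H z i j).
Hypothesis dH : forall i j z, D z -> pd a (fun w => H w i j) z = H' z i j.
Hypothesis uH : forall z, D z -> H z \in unitmx.

Lemma det_neq0 z : D z -> \det (H z) != 0.
Proof. by move=> Dz; have := uH Dz; rewrite unitmxE unitfE. Qed.

Lemma cofactor_hinv z i j : D z -> cofactor (H z) i j = \det (H z) * hinv (H z) i j.
Proof.
move=> Dz; rewrite /hinv -trmx_inv mxE /invmx uH // mxE mxE mulrA mulfV ?mul1r //.
exact: det_neq0.
Qed.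

Lemma smooth_hinv i j : smooth D (fun z => hinv (H z) i j).
Proof.
apply: (smooth_eq oD (F := fun z => (\det (H z))^-1 * cofactor (H z) i j)).
  by move=> z Dz; rewrite cofactor_hinv // mulrA mulVf ?mul1r //; exact: det_neq0.
apply: (smoothM oD (smoothV oD det_neq0 (smooth_det sH))).
apply: (smoothM oD (smooth_cst oD _)); apply: smooth_det => k l.
by apply: (smooth_eq oD _ (sH (lift i k) (lift j l))) => z _; rewrite !mxE.
Qed.

(** Jacobi's formula: the sum over rows [l] of the determinant with row [l] differentiated, expanded
    along that row. *)
Lemma pd_det z : D z -> pd a (fun w => \det (H w)) z = \det (H z) * \sum_i \sum_j H' z i j * hinv (H z) i j.
Proof.
move=> Dz; rewrite (pd_sum oD) //; last first.
  by move=> s _; apply: (smoothM oD (smooth_cst oD _)); apply: (smooth_prod oD) => i _.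
rewrite (eq_bigr (fun s : 'S_n => \sum_l (-1) ^+ s * \prod_i (if i == l then H' z i (s i) else H z i (s i)))); last first.
  move=> s _; rewrite (pdZ oD) //; last by apply: (smooth_prod oD) => i _.
  rewrite pd_prod // mulr_sumr; apply: eq_bigr => l _; congr (_ * _); apply: eq_bigr => i _.
  by case: ifP => // _; rewrite dH.
rewrite exchange_big /= mulr_sumr; apply: eq_bigr => l _.
pose B := \matrix_(i, j) (if i == l then H' z i j else H z i j).
transitivity (\det B).
  by apply: eq_bigr => s _; congr (_ * _); apply: eq_bigr => i _; rewrite mxE.
rewrite (expand_det_row _ l) mulr_sumr; apply: eq_bigr => j _.
rewrite [B l j]mxE eqxx [RHS]mulrCA -cofactor_hinv //; congr (_ * _); rewrite /cofactor; congr (_ * \det _).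
by apply/matrixP => r c; rewrite !mxE eq_sym (negbTE (neq_lift l r)).
Qed.

(** Differentiate the relation between H and its inverse, and multiply by the inverse. *)
Lemma pd_hinv z i l : D z ->
  pd a (fun w => hinv (H w) i l) z = - \sum_j \sum_k hinv (H z) i j * H' z k j * hinv (H z) k l.
Proof.
move=> Dz; pose X i := pd a (fun w => hinv (H w) i l) z.
have S i' k w : D w -> \sum_j hinv (H w) i' j * H w k j = (i' == k)%:R by move=> Dw; rewrite hinv_mulr // uH.
have E k : \sum_j pd a (fun w => hinv (H w) i j) z * H z k j = - \sum_j hinv (H z) i j * H' z k j.
  apply/eqP; rewrite -subr_eq0 opprK -big_split /=; apply/eqP.
  rewrite -[RHS](pd_cst a (i == k)%:R z) -(pd_eq oD a Dz (S i k)) (pd_sum oD) //.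
    by apply: eq_bigr => j _; rewrite (pdM a Dz (smooth_hinv i j) (sH k j)) dH.
  by move=> j _; exact: (smoothM oD (smooth_hinv i j) (sH k j)).
transitivity (\sum_j pd a (fun w => hinv (H w) i j) z * (\sum_k H z k j * hinv (H z) k l)).
  rewrite (bigD1 l) //= hinv_mull ?uH // eqxx mulr1 big1 ?addr0 // => j jl.
  by rewrite hinv_mull ?uH // (negbTE jl) mulr0.
under eq_bigr do rewrite mulr_sumr.
rewrite exchange_big /= [X in - X]exchange_big /= -sumrN; apply: eq_bigr => k _.
under eq_bigr do rewrite mulrA.
by rewrite -mulr_suml E mulNr -mulr_suml.
Qed.

(** Induction on the degree through the recursion, whose coefficients [hinv] are smooth. *)
Lemma smooth_gaussEX m : smooth D (fun z => gaussE (H z) (mpolyX C m)).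
Proof.
have [k] := ubnP (mdeg m); elim: k m => // k IH m; rewrite ltnS => mk.
have [->|m0] := eqVneq m mnm0.
  by apply: (smooth_eq oD _ (smooth_cst oD 1)) => z _; rewrite mpolyX0 gaussE1.
have [b mb] : exists b, (0 < m b)%N.
  apply/existsP; apply: contraNT m0; rewrite negb_exists => /forallP m0; apply/eqP/mnmP => b.
  by rewrite mnm0E; apply/eqP; rewrite -leqn0 leqNgt.
have mE : mpolyX C m = X_ b * mpolyX C (mnm_sub m (mnm1 b)).
  by rewrite /X_ -mpolyXD addmC mnm_subK.
have md : (mdeg (mnm_sub m (mnm1 b)) < k)%N.
  by apply: leq_trans mk; rewrite -[X in (_ < mdeg X)%N](mnm_subK mb) mdegD mdeg1 addn1.
set m' := mnm_sub m (mnm1 b) in mE md.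
have sD c : smooth D (fun z => gaussE (H z) (mderiv c (mpolyX C m'))).
  apply: (smooth_eq oD (F := fun z => (m' c)%:R * gaussE (H z) (mpolyX C (mnm_sub m' (mnm1 c))))).
    by move=> z _; rewrite mderivX -scaler_nat linearZ.
  by apply: (smoothZ oD); apply: IH; apply: leq_ltn_trans md; apply: mdegB.
move: mE; rewrite -[b]splitK; case: (fintype.split b) => i /= ->.
  apply: (smooth_eq oD (F := fun z => \sum_j hinv (H z) i j * gaussE (H z) (mderiv (rshift n j) (mpolyX C m')))).
    by move=> z _; rewrite gaussE_mul_y.
  by apply: (smooth_sum oD) => j _; exact: (smoothM oD (smooth_hinv _ _) (sD _)).
apply: (smooth_eq oD (F := fun z => \sum_j hinv (H z) j i * gaussE (H z) (mderiv (lshift n j) (mpolyX C m')))).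
  by move=> z _; rewrite gaussE_mul_ybar.
by apply: (smooth_sum oD) => j _; exact: (smoothM oD (smooth_hinv _ _) (sD _)).
Qed.

Lemma gaussE_family p N z : (msize (p z) <= N)%N ->
  gaussE (H z) (p z) = \sum_(m : bmultinom (n + n) N) mcoeff m (p z) * gaussE (H z) (mpolyX C m).
Proof. by move=> pN; rewrite (gaussE_w _ pN); apply: eq_bigr => m _; rewrite gaussEX. Qed.

Lemma smooth_gaussE p q : psm a p q -> smooth D (fun z => gaussE (H z) (p z)).
Proof.
move=> [[N HN] Hp].
apply: (smooth_eq oD (F := fun z => \sum_(m : bmultinom (n + n) N) mcoeff m (p z) * gaussE (H z) (mpolyX C m))).
  by move=> z _; rewrite (gaussE_family (HN z).1).
by apply: (smooth_sum oD) => m _; exact: (smoothM oD (Hp m).1 (smooth_gaussEX _)).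
Qed.

Lemma pd_gaussE p q z : psm a p q -> D z ->
  pd a (fun w => gaussE (H w) (p w)) z =
  gaussE (H z) (q z) + \sum_(m <- msupp (p z)) mcoeff m (p z) * pd a (fun w => gaussE (H w) (mpolyX C m)) z.
Proof.
move=> [[N HN] Hp] Dz.
rewrite (pd_eq oD a Dz (fun w _ => gaussE_family (HN w).1)) (pd_sum oD) //; last first.
  by move=> m _; exact: (smoothM oD (Hp m).1 (smooth_gaussEX _)).
rewrite (gaussE_family (HN z).2).
rewrite [X in _ + X](_ : _ = \sum_(m : bmultinom (n + n) N) mcoeff m (p z) * pd a (fun w => gaussE (H w) (mpolyX C m)) z).
  rewrite -big_split /=; apply: eq_bigr => m _.
  by rewrite (pdM a Dz (Hp m).1 (smooth_gaussEX _)) (Hp m).2.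
rewrite (big_mksub (bmultinom (n + n) N)) //=; first last.
- by move=> m mp; have := msize_mdeg_lt mp; move/leq_trans; apply; exact: (HN z).1.
- exact: msupp_uniq.
rewrite big_rmcond //= => m; rewrite mcoeff_msupp negbK => /eqP ->; exact: mul0r.
Qed.

(** The defect in the formula for differentiating the normalised integral, det H times the integral
    of p exp (- quad H): the trace comes from det H, the term with [quad (H' z)] from the
    exponent. *)
Definition dgauss z (p : P) : C := pd a (fun w => gaussE (H w) p) z +
  gaussE (H z) (quad (H' z) * p) - (\sum_i \sum_j H' z i j * hinv (H z) i j) * gaussE (H z) p.

Let sg z (p : P) : smooth D (fun w => gaussE (H w) p).
Proof. exact: smooth_gaussE (psm_cst a p). Qed.

Lemma dgauss_linear z : D z -> linear_for *%R (dgauss z).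
Proof.
move=> Dz c p q; rewrite /dgauss mulrDr -scalerAr !gaussE_linear.
rewrite (pd_eq oD a Dz (G := fun w => c * gaussE (H w) p + gaussE (H w) q)); last first.
  by move=> w _; rewrite gaussE_linear.
rewrite (pdD a Dz (smoothZ oD c (sg z p)) (sg z q)) (pdZ oD) //; last exact: sg.
move: (pd _ _ _) (pd _ _ _) (gaussE _ _) (gaussE _ _) (gaussE _ _) (gaussE _ _) (\sum_i _) => x1 x2 x3 x4 x5 x6 x7.
ring.
Qed.

(** The defect is linear, vanishes at 1 and inherits the recursion of [gaussE], so [gaussE_unique]
    applies. *)
Lemma dgauss_eq0 z (p : P) : D z -> dgauss z p = 0.
Proof.
move=> Dz; pose L := GRing.isLinear.Build _ _ _ *%R (dgauss z) (dgauss_linear Dz).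
pose F : {linear P -> C | *%R} := HB.pack (dgauss z) L.
have FE (q : P) : F q = dgauss z q by [].
have eqQ : gaussE (H z) (quad (H' z)) = \sum_i \sum_j H' z i j * hinv (H z) i j.
  rewrite raddf_sum; apply: eq_bigr => i _; rewrite raddf_sum; apply: eq_bigr => j _ /=.
  rewrite linearZ /= gaussE_mul_y; congr (_ * _); rewrite (bigD1 j) //= mderiv_X_ eqxx gaussE1 mulr1.
  by rewrite big1 ?addr0 // => k kj; rewrite mderiv_X_; case: eqP => [/rshift_inj E|_]; [by rewrite E eqxx in kj|rewrite linear0 mulr0].
rewrite -FE; apply: (gaussE_unique (H := H z)) => {p} [|i p|j p]; rewrite !FE.
- rewrite /dgauss mulr1 eqQ (pd_eq oD a Dz (G := fun=> 1)) ?pd_cst => [|w _]; last exact: gaussE1.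
  by rewrite gaussE1 mulr1 add0r subrr.
- rewrite /dgauss (pd_eq oD a Dz (fun w _ => gaussE_mul_y (H w) i p)) (pd_sum oD) //; last first.
    by move=> j _; exact: (smoothM oD (smooth_hinv _ _) (sg z _)).
  rewrite mulrCA !gaussE_mul_y mulr_sumr -sumrN -!big_split /=.
  transitivity (\sum_j (hinv (H z) i j * dgauss z (mderiv (rshift n j) p) +
     (pd a (fun w => hinv (H w) i j) z * gaussE (H z) (mderiv (rshift n j) p) +
      hinv (H z) i j * gaussE (H z) (mderiv (rshift n j) (quad (H' z)) * p)))).
    apply: eq_bigr => j _; rewrite (pdM a Dz (smooth_hinv i j) (sg z _)) mderivM linearD /= /dgauss.
    move: (pd _ _ _) (pd _ _ _) (gaussE _ _) (gaussE _ _) (gaussE _ _) (\sum_i _) (hinv _ _ _) => x1 x2 x3 x4 x5 x6 x7.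
    ring.
  (* The terms with the derivative of [hinv] cancel those in which the recursion differentiates
     [quad (H' z)]. *)
  rewrite big_split /= [X in _ + X]big_split /= [X in _ + (X + _)](eq_bigr (fun l => - \sum_j \sum_k hinv (H z) i j * H' z k j * hinv (H z) k l * gaussE (H z) (mderiv (rshift n l) p))); last first.
    by move=> l _; rewrite pd_hinv // mulNr mulr_suml; congr (- _); apply: eq_bigr => j _; rewrite mulr_suml.
  rewrite sumrN [X in _ + (_ + X)](eq_bigr (fun j => \sum_k \sum_l hinv (H z) i j * H' z k j * hinv (H z) k l * gaussE (H z) (mderiv (rshift n l) p))); last first.
    move=> j _; rewrite mderiv_quad_ybar mulr_suml raddf_sum mulr_sumr; apply: eq_bigr => k _ /=.
    rewrite -scalerAl linearZ /= gaussE_mul_y mulrA mulr_sumr; apply: eq_bigr => l _.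
    by rewrite mulrA.
  rewrite [X in - X]exchange_big /=; under [X in - X]eq_bigr do rewrite exchange_big /=.
  by rewrite addNr addr0.
- rewrite /dgauss (pd_eq oD a Dz (fun w _ => gaussE_mul_ybar (H w) j p)) (pd_sum oD) //; last first.
    by move=> i _; exact: (smoothM oD (smooth_hinv _ _) (sg z _)).
  rewrite mulrCA !gaussE_mul_ybar mulr_sumr -sumrN -!big_split /=.
  transitivity (\sum_i (hinv (H z) i j * dgauss z (mderiv (lshift n i) p) +
     (pd a (fun w => hinv (H w) i j) z * gaussE (H z) (mderiv (lshift n i) p) +
      hinv (H z) i j * gaussE (H z) (mderiv (lshift n i) (quad (H' z)) * p)))).
    apply: eq_bigr => i _; rewrite (pdM a Dz (smooth_hinv i j) (sg z _)) mderivM linearD /= /dgauss.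
    move: (pd _ _ _) (pd _ _ _) (gaussE _ _) (gaussE _ _) (gaussE _ _) (\sum_i _) (hinv _ _ _) => x1 x2 x3 x4 x5 x6 x7.
    ring.
  rewrite big_split /= [X in _ + X]big_split /= [X in _ + (X + _)](eq_bigr (fun i => - \sum_k \sum_l hinv (H z) i k * H' z l k * hinv (H z) l j * gaussE (H z) (mderiv (lshift n i) p))); last first.
    by move=> i _; rewrite pd_hinv // mulNr mulr_suml; congr (- _); apply: eq_bigr => k _; rewrite mulr_suml.
  rewrite sumrN [X in _ + (_ + X)](eq_bigr (fun l => \sum_k \sum_i hinv (H z) i k * H' z l k * hinv (H z) l j * gaussE (H z) (mderiv (lshift n i) p))); last first.
    move=> l _; rewrite mderiv_quad_y mulr_suml raddf_sum mulr_sumr; apply: eq_bigr => k _ /=.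
    rewrite -scalerAl linearZ /= gaussE_mul_ybar mulrA mulr_sumr; apply: eq_bigr => i _.
    by rewrite mulrA; congr (_ * _); ring.
  under [X in - X]eq_bigr do rewrite exchange_big /=.
  rewrite [X in - X]exchange_big /=; under [X in - X]eq_bigr do rewrite exchange_big /=.
  by rewrite addNr addr0.
Qed.

(** Division by det H undoes the normalisation and removes the trace term, so differentiation passes
    under the integral sign. *)
Lemma pd_gaussE_div p q z : psm a p q -> D z ->
  pd a (fun w => gaussE (H w) (p w) / \det (H w)) z =
  gaussE (H z) (q z - quad (H' z) * p z) / \det (H z).
Proof.
move=> pq Dz; have sd := smooth_det sH.
rewrite (pdM a Dz (smooth_gaussE pq) (smoothV oD det_neq0 sd)) (pdV oD a Dz det_neq0 sd) pd_det //.
rewrite (pd_gaussE pq Dz) linearB /=.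
have E : \sum_(m <- msupp (p z)) mcoeff m (p z) * pd a (fun w => gaussE (H w) (mpolyX C m)) z =
   (\sum_i \sum_j H' z i j * hinv (H z) i j) * gaussE (H z) (p z) - gaussE (H z) (quad (H' z) * p z).
  have := fun m => dgauss_eq0 (mpolyX C m) Dz; rewrite /dgauss; set tau := \sum_i _ => dE.
  rewrite [X in _ * gaussE _ X - _]mpolyE [X in _ - gaussE _ (_ * X)]mpolyE [quad _ * _]mulr_sumr.
  have gS (F : multinom (n + n) -> P) : gaussE (H z) (\sum_(m <- msupp (p z)) F m) = \sum_(m <- msupp (p z)) gaussE (H z) (F m) by rewrite raddf_sum.
  rewrite !gS mulr_sumr -sumrB; apply: eq_bigr => m _.
  have := dE m => /eqP; rewrite -addrA addr_eq0 => /eqP ->.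
  have gZ c (r : P) : gaussE (H z) (c *: r) = c * gaussE (H z) r by rewrite linearZ.
  by rewrite -scalerAr !gZ opprB mulrBr; congr (_ - _); rewrite mulrCA.
rewrite E; have := det_neq0 Dz; move: (\det _) => d d0.
by field.
Qed.

End DerivedMatrix.

End Families.

(** * The commutation rule for the product *)

Section Star.
Context {R : realType} {n : nat}.
Local Notation C := R[i].
Local Notation V := 'rV[C]_n.
Local Notation P := (mpoly (n + n) C).
Implicit Types (f g u p q : V -> C) (z : V) (K : multinom (n + n)).
Variable D : set V.
Hypothesis oD : open D.
Variable Phi : V -> C.

Local Notation mu := (fun w => \det (hmx Phi w)).

(** Unnormalised by the division by det H, so that derivatives carry no trace term. *)
Definition Lam (G : V -> nat -> P) z (m : nat) : C := gint (hmx Phi z) (serS Phi z) (G z) m / \det (hmx Phi z).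

(* [s = true] is the product of Defs, [s = false] its opposite. *)
Definition bulG (s : bool) p q z := fps_mul (fps_mul (Tp (pure s) p z) (Tp (pure (~~ s)) q z)) (Tp xpredT mu z).
Definition bul s p q z (m : nat) := Lam (bulG s p q) z m.

Lemma bulC s p q z m : bul s p q z m = bul (~~ s) q p z m.
Proof. by rewrite /bul /Lam /bulG negbK (fps_mulC (Tp _ p z)). Qed.

Lemma bullet_epsE f g z k : bullet_eps Phi f g z k = bul true f g z k.
Proof.
rewrite /bullet_eps serF1E serF2E (_ : serM Phi z = fun k => (\det (hmx Phi z))^-1 *: Tp xpredT mu z k); last first.
  by apply/funext => i; rewrite serME.
by rewrite fps_mulZr linearZ /= mulrC /bul /Lam /gint fps_mulAC.
Qed.

Hypothesis sPhi : smooth D Phi.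
Hypothesis uH : forall z, D z -> hmx Phi z \in unitmx.

Lemma hmxE F i j z : hmx F z i j = pd (inl i) (pd (inr j) F) z.
Proof. exact: mxE. Qed.

Lemma smooth_hmx i j : smooth D (fun z => hmx Phi z i j).
Proof. by apply: (smooth_eq oD _ (smooth_pd oD (inl i) (smooth_pd oD (inr j) sPhi))) => z _; rewrite hmxE. Qed.

Lemma pd_hmx a i j z : D z -> pd a (fun w => hmx Phi w i j) z = hmx (pd a Phi) z i j.
Proof.
move=> Dz; have E w (Dw : D w) := hmxE Phi i j w.
etransitivity; first exact: (pd_eq oD a Dz E).
etransitivity; last exact: (esym (hmxE (pd a Phi) i j z)).
etransitivity; first exact: (pdC oD a (inl i) Dz (smooth_pd oD (inr j) sPhi)).
exact: (pd_eq oD (inl i) Dz (fun w Dw => pdC oD a (inr j) Dw sPhi)).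
Qed.

Lemma smooth_mu : smooth D mu.
Proof. exact: (smooth_det oD smooth_hmx). Qed.

Lemma psm_serS a i : psm D a (fun w => serS Phi w i) (fun w => if i == 0%N then 0 else - Tp mix (pd a Phi) w i.+2).
Proof.
case: i => [|i].
  by have := psm_cst oD a (0 : P); congr psm; apply/funext => w; rewrite serSE.
have := psmM oD (psm_cst oD a (-1 : P)) (psm_Tp oD a mix i.+3 sPhi); congr psm; apply/funext => w.
  by rewrite serSE mulN1r.
by rewrite mul0r add0r mulN1r.
Qed.

Lemma psm_gint a (G G' : V -> nat -> P) m : (forall i, psm D a (G ^~ i) (G' ^~ i)) ->
  psm D a (fun w => fps_mul (G w) (fps_exp (K := C) (serS Phi w)) m)
    (fun w => fps_mul (G' w) (fps_exp (K := C) (serS Phi w)) m +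
       fps_mul (G w) (fps_mul (fun i => if i == 0%N then 0 else - Tp mix (pd a Phi) w i.+2) (fps_exp (K := C) (serS Phi w))) m).
Proof.
move=> HG; apply: (psm_fps_mul oD m HG) => i.
exact: (psm_fps_exp oD i (psm_serS a) (serS0 Phi) (fun=> erefl)).
Qed.

Lemma smooth_Lam a (G G' : V -> nat -> P) m : (forall i, psm D a (G ^~ i) (G' ^~ i)) -> smooth D (fun w => Lam G w m).
Proof.
move=> HG; apply: (smoothM oD (smooth_gaussE oD smooth_hmx uH (psm_gint m HG))).
exact: (smoothV oD (det_neq0 uH) smooth_mu).
Qed.

(** Differentiation under the integral sign; the phase contributes the derivative of its
    coefficients, minus the mixed Taylor series of [pd a Phi]. *)
Lemma pd_Lam a (G G' : V -> nat -> P) m z : (forall i, psm D a (G ^~ i) (G' ^~ i)) -> D z ->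
  pd a (fun w => Lam G w m) z = Lam G' z m + Lam (fun w => fps_mul (fun k => - Tp mix (pd a Phi) w k.+2) (G w)) z m.
Proof.
move=> HG Dz.
rewrite /Lam /gint (pd_gaussE_div oD smooth_hmx (pd_hmx a) uH (psm_gint m HG) Dz) -mulrDl.
have gD (x y : P) : gaussE (hmx Phi z) x + gaussE (hmx Phi z) y = gaussE (hmx Phi z) (x + y) by rewrite linearD.
rewrite gD.
congr (gaussE _ _ / _); rewrite -addrA; congr (_ + _).
rewrite (_ : (fun k => - Tp mix (pd a Phi) z k.+2) = fun k => (if k == 0%N then - quad (hmx (pd a Phi) z) else 0) + (if k == 0%N then 0 else - Tp mix (pd a Phi) z k.+2)).
  by rewrite -fps_mulA fps_mul_head fps_mulCA addrC mulNr.
apply/funext => -[|k] /=; last by rewrite add0r.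
by rewrite addr0 (quad_Tp oD Dz (smooth_pd oD a sPhi)).
Qed.

Lemma pureD s K L : pure s (mnm_add K L) = pure s K && pure s L.
Proof. by rewrite /pure; case: s; rewrite ?degyD ?degybD addn_eq0. Qed.

Lemma pure0 s : pure s (mnm0 : multinom (n + n)).
Proof. by rewrite /pure; case: s; rewrite ?degy_p1 ?degyb_p2 mdeg_eq0; apply/eqP/mnmP => i; rewrite ?p1E ?p2E !mnm0E. Qed.

Definition side (a : 'I_n + 'I_n) := if a is inr _ then true else false.

Lemma pure1 s a : pure s (mnm1 (unsplit a) : multinom (n + n)) = (s == side a).
Proof.
rewrite /pure; case: s; rewrite ?degy_p1 ?degyb_p2 mdeg_eq0; case: a => i /=; apply/eqP.
- by move/mnmP/(_ i); rewrite p1E mnm1E mnm0E eqxx.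
- by apply/mnmP => j; rewrite p1E mnm1E mnm0E eq_rlshift.
- by apply/mnmP => j; rewrite p2E mnm1E mnm0E eq_lrshift.
- by move/mnmP/(_ i); rewrite p2E mnm1E mnm0E eqxx.
Qed.

Lemma Tp_pred0 h f z k : (forall K, h K = false) -> Tp h f z k = 0.
Proof. by move=> h0; apply/mpolyP => K; rewrite mcoeff_Tp h0 andbF mcoeff0. Qed.

Lemma mderiv_Tp_pure a f z i : D z -> smooth D f ->
  mderiv (unsplit a) (Tp (pure (side a)) f z i.+1) = Tp (pure (side a)) (pd a f) z i.
Proof.
move=> Dz sf; rewrite (mderiv_Tp oD) // unsplitK; apply: eq_Tp => // K _.
by rewrite pureD pure1 eqxx andbT.
Qed.

Lemma mderiv_Tp_impure a f z i : D z -> smooth D f ->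
  mderiv (unsplit a) (Tp (pure (~~ side a)) f z i) = 0.
Proof.
move=> Dz sf; case: i => [|i]; first exact: mderiv_Tp0.
by rewrite (mderiv_Tp oD) // unsplitK Tp_pred0 // => K; rewrite pureD pure1; case: (side a); rewrite andbF.
Qed.

Lemma psm_bulG a s p q i : smooth D p -> smooth D q ->
  psm D a (fun w => bulG s p q w i) (fun w => fps_mul (fun j => fps_mul (Tp (pure s) (pd a p) w) (Tp (pure (~~ s)) q w) j +
    fps_mul (Tp (pure s) p w) (Tp (pure (~~ s)) (pd a q) w) j) (Tp xpredT mu w) i +
     fps_mul (fps_mul (Tp (pure s) p w) (Tp (pure (~~ s)) q w)) (Tp xpredT (pd a mu) w) i).
Proof.
move=> sp sq; apply: (psm_fps_mul oD) => j; last exact: (psm_Tp oD _ _ _ smooth_mu).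
by apply: (psm_fps_mul oD) => k; exact: (psm_Tp oD).
Qed.

Lemma smooth_bul s p q m : smooth D p -> smooth D q -> smooth D (fun w => bul s p q w m).
Proof.
move=> sp sq; have [n0|i0] := posnP n; last exact: (@smooth_Lam (inl (Ordinal i0)) _ _ m (fun i => psm_bulG _ s i sp sq)).
apply: (smooth_eq oD _ (smooth_cst oD (bul s p q 0 m))) => z _; congr (bul s p q _ m).
by apply/rowP => -[j jn]; exfalso; move: jn; rewrite n0.
Qed.

(** With u = pd a Phi and hbar = epsilon^2 this says D (p . q) = p . D q for D = d_a + u / hbar. The
    derivatives in the parameter z and in the integration variable [unsplit a] act alike on the
    factor of p and on the density; subtracting a total derivative leaves the terms where q or the
    phase is differentiated. *)
Theorem bul_pd a p q z m : D z -> smooth D p -> smooth D q ->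
  pd a (fun w => bul (side a) p q w m) z = bul (side a) p (pd a q) z m
   + bul (side a) p (fun w => pd a Phi w * q w) z m.+2 - pd a Phi z * bul (side a) p q z m.+2.
Proof.
move=> Dz sp sq; have su := smooth_pd oD a sPhi.
rewrite (pd_Lam m (fun i => psm_bulG a (side a) i sp sq) Dz) /bul /Lam.
set s := side a; set H := hmx Phi z; set S := serS Phi z; set d := (\det H)^-1.
set A := Tp (pure s) p z; set B := Tp (pure (~~ s)) q z; set M := Tp xpredT mu z.
set A' := Tp (pure s) (pd a p) z; set B' := Tp (pure (~~ s)) (pd a q) z; set M' := Tp xpredT (pd a mu) z.
(* The Taylor series of u in the variables of the factor of q; by multiplicativity it can be
   absorbed into q. *)
set T := Tp (pure (~~ s)) (pd a Phi) z.
pose Y i := mderiv (unsplit a) (phase H S i).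
have T0 : T 0%N = (pd a Phi z)%:A by rewrite /T Tp0 // pure0.
(* Deriving a mixed monomial along [a] leaves at least one variable of the other side, so the result
   is mixed or purely of the other side. Hence - Y consists of the mixed part of u and of [T]
   without its constant term. *)
have Y0 : Y 0%N = - T 1%N.
  rewrite /Y (phase_Tp oD) // mderivN (mderiv_Tp oD) // unsplitK; congr (- _); apply/mpolyP => K; rewrite !mcoeff_Tp.
  case: (mdeg K =P 1%N) => //= K1; congr (if _ then _ else _).
  rewrite /mix degyD degybD; have := mdeg_degy K; rewrite K1 => K1'.
  have := pure1 true a; have := pure1 false a; rewrite /pure /s; move: (degy (mnm1 _)) (degyb (mnm1 _)) => x y.
  by case: (side a) => /=; lia.
have YS i : Y i.+1 = - Tp mix (pd a Phi) z i.+2 - T i.+2.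
  rewrite /Y (phase_Tp oD) // mderivN (mderiv_Tp oD) // unsplitK -opprD; congr (- _); apply/mpolyP => K; rewrite mcoeffD !mcoeff_Tp.
  case: (mdeg K =P i.+2) => /= [K1|]; last by rewrite addr0.
  rewrite /mix degyD degybD; have := mdeg_degy K; rewrite K1 => K1'.
  have := pure1 true a; have := pure1 false a; rewrite /pure /s; move: (degy (mnm1 _)) (degyb (mnm1 _)) => x y.
  move: (tay _ _ _) => t.
  case: (side a) => /= /eqP E1 /eqP E2; case: (degy K) K1' => [|k]; case: (degyb K) => [|l] //= K1'; rewrite ?E1 ?E2 ?addr0 ?add0r ?addn0 ?addnS //=; case: x E1 E2 => //=; case: y => //=.
(* The parameter derivative of the phase is thus a total derivative, plus multiplication of q by u,
   minus multiplication by the number u (z); the shift by 2 is the division by hbar. *)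
have kW Z k : fps_mul (fun i => - Tp mix (pd a Phi) z i.+2) Z k =
    fps_mul Y Z k.+1 + fps_mul T Z k.+2 - pd a Phi z *: Z k.+2.
  rewrite (fps_mul_shift0 Y) (fps_mul_shift0 T) (fps_mul_shift0 (fun i => T i.+1)) Y0 T0 -scalerAl mul1r.
  rewrite (_ : fps_mul (fun i => - Tp mix (pd a Phi) z i.+2) Z k = fps_mul (fun i => Y i.+1) Z k + fps_mul (fun i => T i.+2) Z k); last first.
    by rewrite -fps_mulDl; apply: eq_fps_mul => // i _; rewrite YS subrK.
  move: (fps_mul _ _ _) (fps_mul _ _ _) (_ *: _) (Z _) (T 1%N) => x1 x2 x3 x4 x5; ring.
set G := bulG s p q z.
have HS0 : S 0%N = 0 by exact: serS0.
have E1 : gint H S (fps_mul (fun i => - Tp mix (pd a Phi) z i.+2) G) m =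
   gint H S (fps_mul Y G) m.+1 + gint H S (fps_mul T G) m.+2 - pd a Phi z * gint H S G m.+2.
  by rewrite /gint -!fps_mulA kW linearB linearD linearZ.
have E2 : fps_mul T G = bulG s p (fun w => pd a Phi w * q w) z.
  rewrite /G /bulG -/s -/A -/B -/M (_ : Tp (pure (~~ s)) _ z = fps_mul T B).
    by rewrite !fps_mulA (fps_mulC T A).
  by apply/funext => i; apply: (TpM oD) => //; [exact: pure0|exact: pureD].
(* Integration by parts: the derivative along [a] does not see the factor of q, and on the other two
   factors it agrees with the parameter derivative. *)
have E3 : gint H S (fps_mul Y G) m.+1 = - gint H S (fun i => fps_mul (fps_mul A' B) M i + fps_mul (fps_mul A B) M' i) m.
  have := gint_ibp (fun i => G i) (unsplit a) m.+1 (uH Dz) HS0; rewrite -/H -/Y => /eqP.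
  rewrite -eqr_oppLR => /eqP <-; congr (- _); rewrite /gint fps_mul_shift; last first.
    have f0 (x y : nat -> P) : fps_mul x y 0 = x 0%N * y 0%N by rewrite /fps_mul big_ord1.
    by rewrite /G /bulG !f0 !mderivM !mderiv_Tp0 !(mul0r, mulr0, addr0).
  congr (gaussE _ (fps_mul _ _ _)); apply/funext => i.
  rewrite /G /bulG mderiv_fps_mul -/s -/A -/B -/M; congr (_ + _).
    rewrite (_ : (fun i => mderiv _ _) = fps_mul (fun i => mderiv (unsplit a) (A i)) B); last first.
      apply/funext => j; rewrite mderiv_fps_mul (fps_mulC A (fun i => mderiv _ (B i))) [X in _ + X]fps_mul_eq0 ?addr0 //.
      by move=> k _; exact: mderiv_Tp_impure.
    rewrite -!fps_mulA fps_mul_shift ?mderiv_Tp0 //; congr (fps_mul _ _ _); apply/funext => j.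
    exact: mderiv_Tp_pure.
  rewrite fps_mulC fps_mul_shift ?mderiv_Tp0 // fps_mulC; congr (fps_mul _ _ _); apply/funext => j.
  by rewrite /M (mderiv_Tp oD) ?unsplitK //; exact: smooth_mu.
rewrite E1 E2 E3.
rewrite (_ : gint H S (fun i => _ + fps_mul (fps_mul A B) _ i) m = gint H S (bulG s p (pd a q) z) m + gint H S (fun i => fps_mul (fps_mul A' B) M i + fps_mul (fps_mul A B) M' i) m); last first.
  rewrite -gintD /gint; congr (gaussE _ (fps_mul _ _ _)); apply/funext => i.
  by rewrite fps_mulDl /bulG -/A -/B' -/M addrCA addrA.
have fin (x1 x2 x3 x4 x5 : C) : (x4 + x3) * d + (- x3 + x2 - x5 * x1) * d = x4 * d + x2 * d - x5 * (x1 * d) by ring.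
exact: fin.
Qed.

End Star.

(** * Associativity at a gauged point *)

Section Expansion.
Context {R : realType} {n : nat}.
Local Notation C := R[i].
Local Notation V := 'rV[C]_n.
Local Notation P := (mpoly (n + n) C).
Implicit Types (f g u p q : V -> C) (z : V) (K : multinom (n + n)) (I J : multinom n).

(** X^K / K! placed at order |K| in epsilon: what one derivative contributes to [serF1] or
    [serF2]. *)
Definition mono K i : P := if i == mdeg K then (wfact K)^-1 *: mpolyX C K else 0.
Definition emb (s : bool) I : multinom (n + n) := if s then jn (mnm0 : multinom n) I else jn I (mnm0 : multinom n).
Definition lsn (s : bool) I : seq ('I_n + 'I_n) := if s then lstJ I else lstI I.

Lemma mdeg_emb s I : mdeg (emb s I) = mdeg I.
Proof. by case: s; rewrite mdeg_jn mdeg0 ?addn0. Qed.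

Lemma emb_inj s : injective (emb s).
Proof. by case: s => I J /= E; [rewrite -[I](p2_jn mnm0) E p2_jn|rewrite -[I](p1_jn _ mnm0) E p1_jn]. Qed.

Lemma pure_emb s I : pure s (emb s I).
Proof. by case: s; rewrite /pure ?degy_p1 ?degyb_p2 ?p1_jn ?p2_jn mdeg0. Qed.

Lemma pureE s K : pure s K -> K = emb s (if s then p2 K else p1 K).
Proof.
case: s; rewrite /pure /emb ?degy_p1 ?degyb_p2 mdeg_eq0 => /eqP E;
by rewrite -{1}[K]jnK E.
Qed.

Lemma lst_emb s I : lst (emb s I) = lsn s I.
Proof. by case: s; rewrite /lst p1_jn p2_jn /= ?lstI0 // lstJ0 cats0. Qed.

Lemma Tp_mono s f z i M : (i < M)%N ->
  Tp (pure s) f z i = \sum_(I : bmultinom n M) pdL (lsn s I) f z *: mono (emb s I) i.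
Proof.
move=> iM; apply/mpolyP => K; rewrite mcoeff_Tp raddf_sum /=.
have E (I : bmultinom n M) : mcoeff K (pdL (lsn s I) f z *: mono (emb s I) i) =
    if (i == mdeg I) && (emb s I == K) then tay f z (emb s I) else 0.
  rewrite mcoeffZ /mono mdeg_emb; case: (i =P _) => _; last by rewrite mcoeff0 mulr0.
  rewrite mcoeffZ mcoeffX /tay lst_emb /=; case: (emb s I == K); last by rewrite !mulr0.
  by rewrite mulr1 mulrC.
under eq_bigr do rewrite E.
case: ifPn => [/andP[/eqP Ki pK]|nK].
  have KE := pureE pK; set I := (if s then p2 K else p1 K) in KE.
  have kI : (mdeg I < M)%N by rewrite -(mdeg_emb s) -KE Ki.
  rewrite (bigD1 (Sub I kI)) //= -KE -(mdeg_emb s) -KE Ki !eqxx /= big1 ?addr0 // => J JI.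
  case: (emb s J =P K) => [JK|]; last by rewrite andbF.
  by case/eqP: JI; apply/val_inj/(@emb_inj s); rewrite /= JK.
rewrite big1 // => I _; case: ifP => // /andP[/eqP iI /eqP IK]; case/negP: nK.
by rewrite -IK mdeg_emb iI eqxx pure_emb.
Qed.

Variable Phi : V -> C.
Local Notation mu := (fun w => \det (hmx Phi w)).

(** The coefficient at [z] of (d^I p) (d^J q) in the term of order hbar^k, with I on side [s] and J
    on the other side. *)
Definition cc (s : bool) k z I J : C :=
  Lam Phi (fun w => fps_mul (fps_mul (mono (emb s I)) (mono (emb (~~ s) J))) (Tp xpredT mu w)) z k.*2.

Definition prd (s : bool) k p q z : C := bul Phi s p q z k.*2.

Lemma bullet0E f g z k : bullet0 Phi f g z k = prd true k f g z.
Proof. exact: bullet_epsE. Qed.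

Lemma prdC s k p q z : prd s k p q z = prd (~~ s) k q p z. Proof. exact: bulC. Qed.

Lemma ccC s k z I J : cc s k z I J = cc (~~ s) k z J I.
Proof. by rewrite /cc negbK /Lam (fps_mulC (mono _)). Qed.

(** Any M > 2k is allowed, so that expansions of different orders can share one index set. *)
Lemma prd_expand s k p q z M : (k.*2 < M)%N ->
  prd s k p q z = \sum_(I : bmultinom n M) \sum_(J : bmultinom n M)
    cc s k z I J * (pdL (lsn s I) p z * pdL (lsn (~~ s) J) q z).
Proof.
move=> kM; rewrite /prd /bul /Lam /gint.
have -> : fps_mul (bulG Phi s p q z) (fps_exp (K := C) (serS Phi z)) k.*2 =
  \sum_(I : bmultinom n M) \sum_(J : bmultinom n M) (pdL (lsn s I) p z * pdL (lsn (~~ s) J) q z) *: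
  fps_mul (fps_mul (fps_mul (mono (emb s I)) (mono (emb (~~ s) J))) (Tp xpredT mu z)) (fps_exp (K := C) (serS Phi z)) k.*2.
  rewrite /bulG -!fps_mulA; set Z := fps_mul (Tp xpredT mu z) _.
  transitivity (fps_mul (fun i => \sum_(I : bmultinom n M) pdL (lsn s I) p z *: mono (emb s I) i)
     (fps_mul (fun i => \sum_(J : bmultinom n M) pdL (lsn (~~ s) J) q z *: mono (emb (~~ s) J) i) Z) k.*2).
    apply: eq_fps_mul => i ik; first by rewrite (Tp_mono _ _ _ (leq_ltn_trans ik kM)).
    by apply: eq_fps_mul => j ji //; rewrite (Tp_mono _ _ _ (leq_ltn_trans (leq_trans ji ik) kM)).
  have sumL (F : bmultinom n M -> nat -> P) (x : bmultinom n M -> C) (G : nat -> P) i :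
      fps_mul (fun i => \sum_(I : bmultinom n M) x I *: F I i) G i = \sum_(I : bmultinom n M) x I *: fps_mul (F I) G i.
    rewrite /fps_mul; under eq_bigr do rewrite mulr_suml.
    rewrite exchange_big /=; apply: eq_bigr => I _; rewrite scaler_sumr; apply: eq_bigr => j _.
    by rewrite scalerAl.
  rewrite sumL; apply: eq_bigr => I _.
  rewrite fps_mulC -!fps_mulA (sumL (fun J : bmultinom n M => mono (emb (~~ s) J)) (fun J : bmultinom n M => pdL (lsn (~~ s) J) q z)) scaler_sumr.
  apply: eq_bigr => J _; rewrite scalerA; congr (_ *: _).
  by rewrite -!fps_mulA (fps_mulC (mono (emb s I))) !fps_mulA.
have gS (T : finType) (F : T -> P) : gaussE (hmx Phi z) (\sum_I F I) = \sum_I gaussE (hmx Phi z) (F I) by rewrite raddf_sum.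
have gZ c (r : P) : gaussE (hmx Phi z) (c *: r) = c * gaussE (hmx Phi z) r by rewrite linearZ.
rewrite gS mulr_suml; apply: eq_bigr => I _; rewrite gS mulr_suml; apply: eq_bigr => J _.
by rewrite gZ -mulrA mulrC.
Qed.

(** By the count of [gint_bound], hbar^k carries at most k derivatives in each argument, although
    the series in epsilon runs up to order 2k. *)
Lemma cc_bound s k z I J : (k < maxn (mdeg I) (mdeg J))%N -> cc s k z I J = 0.
Proof.
move=> kIJ; rewrite /cc /Lam gint_bound ?mul0r //; first by move=> i; exact: excess_serS.
move=> i m; rewrite /fps_mul raddf_sum /= => mi.
have [j mj] : exists j : 'I_i.+1, mcoeff m (fps_mul (mono (emb s I)) (mono (emb (~~ s) J)) j * Tp xpredT mu z (i - j)%N) != 0.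
  apply/existsP; apply: contraNT mi; rewrite negb_exists => /forallP H.
  by rewrite big1 // => j _; apply/eqP; move: (H j); rewrite negbK.
have [m1 [m2 [mE m1j m2j]]] := mcoeffM_neq0 mj.
move: m2j; rewrite mcoeff_Tp andbT; case: (mdeg m2 =P _) => [m2d _|_]; last by rewrite eqxx.
move: m1j; rewrite /fps_mul raddf_sum /= => m1j.
have [l ml] : exists l : 'I_j.+1, mcoeff m1 (mono (emb s I) l * mono (emb (~~ s) J) (j - l)%N) != 0.
  apply/existsP; apply: contraNT m1j; rewrite negb_exists => /forallP H.
  by rewrite big1 // => l _; apply/eqP; move: (H l); rewrite negbK.
have [k1 [k2 [m1E]]] := mcoeffM_neq0 ml.
have monoP K a (x : multinom (n + n)) : mcoeff x (mono K a) != 0 -> a = mdeg K /\ x = K.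
  rewrite /mono; case: (a =P mdeg K) => [->|_]; last by rewrite mcoeff0 eqxx.
  by rewrite mcoeffZ mcoeffX; case: (K =P x) => [->|_]; rewrite ?mulr0 ?eqxx.
move=> H1 H2; have [lE k1E] := monoP _ _ _ H1; have [jl k2E] := monoP _ _ _ H2; rewrite k1E k2E in m1E.
rewrite mE mdegD m1E mdegD m2d -lE -jl; have := ltn_ord l; have := ltn_ord j => h1 h2; split; first lia.
have : degy (emb s I) = (if s then 0 else mdeg I)%N /\ degyb (emb s I) = (if s then mdeg I else 0)%N.
  by case: (s); rewrite degy_p1 degyb_p2 p1_jn p2_jn mdeg0.
have : degy (emb (~~ s) J) = (if s then mdeg J else 0)%N /\ degyb (emb (~~ s) J) = (if s then 0 else mdeg J)%N.
  by case: (s); rewrite degy_p1 degyb_p2 p1_jn p2_jn mdeg0.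
by move=> [e1 e2] [e3 e4]; rewrite !degyD !degybD e1 e2 e3 e4; move: kIJ; case: (s); lia.
Qed.

End Expansion.

(** * Polynomial functions with prescribed jets *)

Section PolynomialFunctions.
Context {R : realType} {n : nat}.
Local Notation C := R[i].
Local Notation V := 'rV[C]_n.
Local Notation P := (mpoly (n + n) C).
Implicit Types (z : V) (K : multinom (n + n)) (p : P).

(** Realises a prescribed finite jet at [z0] by a function; it serves for gauges and for one-sided
    representatives. *)
Definition pev z0 p z : C := meval (fun a : 'I_(n + n) =>
  match fintype.split a with inl i => z 0 i - z0 0 i | inr j => conjc (z 0 j - z0 0 j) end) p.

Variable z0 : V.
Let D : set V := setT.
Let oD : open D := openT.

Lemma pev_X a z : pev z0 (X_ a) z =
  match fintype.split a with inl i => z 0 i - z0 0 i | inr j => conjc (z 0 j - z0 0 j) end.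
Proof. exact: mevalXU. Qed.

Lemma pevM p q z : pev z0 (p * q) z = pev z0 p z * pev z0 q z. Proof. exact: mevalM. Qed.

Lemma pev_smooth_X a : smooth D (pev z0 (X_ a)) /\ forall b z, pd b (pev z0 (X_ a)) z = (unsplit b == a)%:R.
Proof.
have s1 (j : 'I_n) : smooth D (fun z : V => z 0 j - z0 0 j) by exact: (smoothB oD (smooth_coord oD j) (smooth_cst oD _)).
have d1 (j : 'I_n) b z : pd b (fun z : V => z 0 j - z0 0 j) z = (b == inl j)%:R.
  rewrite (pdB oD b (z := z) I (smooth_coord oD j) (smooth_cst oD (z0 0 j))) pd_cst subr0 pd_coord.
  by case: b => i //=; rewrite (inj_eq inl_inj).
rewrite -[a]splitK; case: (fintype.split a) => j /=.
  have E z : pev z0 (X_ (lshift n j)) z = z 0 j - z0 0 j by rewrite pev_X (unsplitK (inl j)).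
  split; first by apply: (smooth_eq oD _ (s1 j)) => z _; rewrite E.
  move=> b z; rewrite (pd_eq oD b (z := z) (G := fun z => z 0 j - z0 0 j)) // ?d1 //.
  by rewrite -(can_eq (@unsplitK n n)).
have E z : pev z0 (X_ (rshift n j)) z = conjc (z 0 j - z0 0 j) by rewrite pev_X (unsplitK (inr j)).
split; first by apply: (smooth_eq oD _ (smooth_conj oD (s1 j))) => z _; rewrite E.
move=> b z; rewrite (pd_eq oD b (z := z) (G := fun z => conjc (z 0 j - z0 0 j))) //.
etransitivity; first exact: (pd_conj b (z := z) (I : D z) (s1 j)).
case: b => i; rewrite d1 ?eq_lrshift; first exact: conjc0.
rewrite [unsplit _ == _](inj_eq (@rshift_inj _ _)) (inj_eq inl_inj).
by case: (i == j); [exact: conjc1|exact: conjc0].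
Qed.

Lemma mpolyX_ind (Q : P -> Prop) : Q 1 -> (forall a m, Q (mpolyX C m) -> Q (X_ a * mpolyX C m)) -> forall m, Q (mpolyX C m).
Proof.
move=> Q1 QX m; have [k] := ubnP (mdeg m); elim: k m => // k IH m; rewrite ltnS => mk.
have [->|m0] := eqVneq m mnm0; first by rewrite mpolyX0.
have [b mb] : exists b, (0 < m b)%N.
  apply/existsP; apply: contraNT m0; rewrite negb_exists => /forallP m0; apply/eqP/mnmP => b.
  by rewrite mnm0E; apply/eqP; rewrite -leqn0 leqNgt.
have -> : mpolyX C m = X_ b * mpolyX C (mnm_sub m (mnm1 b)) by rewrite /X_ -mpolyXD addmC mnm_subK.
apply/QX/IH; apply: leq_trans mk; rewrite -[X in (_ < mdeg X)%N](mnm_subK mb) mdegD mdeg1 addn1 //.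
Qed.

Lemma pev_smooth_pd p : smooth D (pev z0 p) /\ forall b z, pd b (pev z0 p) z = pev z0 (mderiv (unsplit b) p) z.
Proof.
pose Q p := smooth D (pev z0 p) /\ forall b z, pd b (pev z0 p) z = pev z0 (mderiv (unsplit b) p) z.
have QC c : Q (mpolyC (n + n) c).
  have E : pev z0 (mpolyC (n + n) c) = fun=> c by apply/funext => z; exact: mevalC.
  split; first by rewrite E; exact: (smooth_cst oD).
  by move=> b z; rewrite E mderivC pd_cst /pev meval0.
have QM p1 q1 : Q p1 -> Q q1 -> Q (p1 * q1).
  move=> [s1 d1] [s2 d2]; have E : pev z0 (p1 * q1) = fun z => pev z0 p1 z * pev z0 q1 z by apply/funext => z; exact: mevalM.
  split; first by rewrite E; exact: (smoothM oD s1 s2).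
  by move=> b z; rewrite E (pdM b (I : D z) s1 s2) d1 d2 -!pevM mderivM -mevalD.
have QD p1 q1 : Q p1 -> Q q1 -> Q (p1 + q1).
  move=> [s1 d1] [s2 d2]; have E : pev z0 (p1 + q1) = fun z => pev z0 p1 z + pev z0 q1 z by apply/funext => z; exact: mevalD.
  split; first by rewrite E; exact: (smoothD oD s1 s2).
  by move=> b z; rewrite E (pdD b (I : D z) s1 s2) d1 d2 mderivD -mevalD.
have QX a : Q (X_ a).
  have [s1 d1] := pev_smooth_X a; split=> // b z; rewrite d1 mderiv_X_.
  by case: eqP => _; rewrite /pev ?meval1 ?meval0.
rewrite -/(Q p); elim/mpolyind: p => [|c m p _ _ Qp]; first by rewrite -mpolyC0; exact: QC.
apply: QD Qp; rewrite -mul_mpolyC; apply: (QM _ _ (QC c)); apply: (@mpolyX_ind Q) => [|b k Qk]; first by rewrite -mpolyC1; exact: QC.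
exact: QM (QX b) Qk.
Qed.

Lemma smooth_pev p : smooth D (pev z0 p). Proof. exact: (pev_smooth_pd p).1. Qed.

Lemma pd_pev b p : pd b (pev z0 p) = pev z0 (mderiv (unsplit b) p).
Proof. by apply/funext => z; exact: (pev_smooth_pd p).2. Qed.

Lemma pev0 p : pev z0 p z0 = mcoeff mnm0 p.
Proof.
rewrite -[RHS]mulr1 -(@wfact0 R n) -ev_mderivm mderivm0m /pev; congr (meval _ p); apply/funext => a.
by case: (fintype.split a) => i; rewrite subrr // conjc0.
Qed.

Lemma tay_pev p K : tay (pev z0 p) z0 K = mcoeff K p.
Proof.
have [k] := ubnP (mdeg K); elim: k K p => // k IH K p; rewrite ltnS => mk.
have [->|m0] := eqVneq K mnm0; first by rewrite tay0 pev0.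
have [b mb] : exists b, (0 < K b)%N.
  apply/existsP; apply: contraNT m0; rewrite negb_exists => /forallP m0; apply/eqP/mnmP => b.
  by rewrite mnm0E; apply/eqP; rewrite -leqn0 leqNgt.
rewrite -(mnm_subK mb); set K' := mnm_sub K (mnm1 b).
have c0 : ((K' b).+1%:R : C) != 0 by rewrite pnatr_eq0.
apply: (mulIf c0); rewrite (tay_pd oD) //; last exact: smooth_pev.
rewrite pd_pev splitK IH ?mcoeff_mderiv ?mulr_natr //.
by apply: leq_trans mk; rewrite -[X in (_ < mdeg X)%N](mnm_subK mb) mdegD mdeg1 addn1.
Qed.

End PolynomialFunctions.

(** * The operators D on Laurent sequences, and associativity *)

Section LaurentSequences.
Context {R : realType} {n : nat}.
Local Notation C := R[i].
Local Notation V := 'rV[C]_n.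
Local Notation P := (mpoly (n + n) C).
Variable D : set V.
Hypothesis oD : open D.
Variable Phi : V -> C.
Hypothesis sPhi : smooth D Phi.
Hypothesis uH : forall z, D z -> hmx Phi z \in unitmx.
Implicit Types (f g u p q : V -> C) (z : V) (G H : nat -> V -> C) (L : seq ('I_n + 'I_n)).

Definition seqeq G H := forall j z, D z -> G j z = H j z.
Definition seqsm G := forall j, smooth D (G j).

(* A sequence stands for a Laurent series in hbar with shifted indices; this is
   [exp (- Phi / hbar) (pd a) (exp (Phi / hbar) G)]. *)
Definition Dop a G : nat -> V -> C := fun j z => pd a (G j) z + pd a Phi z * G j.+1 z.
Definition DSl L G := foldl (fun G a => Dop a G) G L.

Lemma sm_Dop a G : seqsm G -> seqsm (Dop a G).
Proof. by move=> sG j; apply: (smoothD oD (smooth_pd oD a (sG j)) (smoothM oD (smooth_pd oD a sPhi) (sG j.+1))). Qed.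

Lemma sm_DSl L G : seqsm G -> seqsm (DSl L G).
Proof. by elim: L G => //= a L IH G sG; apply/IH/sm_Dop. Qed.

Lemma eq_Dop a G H : seqeq G H -> seqeq (Dop a G) (Dop a H).
Proof. by move=> GH j z Dz; rewrite /Dop (pd_eq oD a Dz (GH j)) GH. Qed.

Lemma eq_DSl L G H : seqeq G H -> seqeq (DSl L G) (DSl L H).
Proof. by elim: L G H => //= a L IH G H GH; apply/IH/eq_Dop. Qed.

(** The operators are conjugates of commuting derivations by one function; in coordinates, d_a d_b
    Phi is symmetric. *)
Lemma DopC a b G : seqsm G -> seqeq (Dop a (Dop b G)) (Dop b (Dop a G)).
Proof.
move=> sG j z Dz; rewrite /Dop.
have E x y : pd x (fun w => pd y (G j) w + pd y Phi w * G j.+1 w) z =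
   pd x (pd y (G j)) z + (pd x (pd y Phi) z * G j.+1 z + pd y Phi z * pd x (G j.+1) z).
  have su := smooth_pd oD y sPhi.
  rewrite (pdD x Dz (smooth_pd oD y (sG j)) (smoothM oD su (sG j.+1))).
  by rewrite (pdM x Dz su (sG j.+1)).
rewrite !E (pdC oD a b Dz (sG j)) (pdC oD a b Dz sPhi).
move: (pd _ _ _) (pd _ _ _) (pd _ _ _) (pd _ _ _) (pd _ _ _) (pd _ _ _) (G _ _) (G _ _) => x1 x2 x3 x4 x5 x6 x7 x8; ring.
Qed.

Lemma DSl_Dop L a G : seqsm G -> seqeq (DSl L (Dop a G)) (Dop a (DSl L G)).
Proof.
elim: L G => [|b L IH] G sG /=; first by [].
move=> j z Dz; rewrite -(IH _ (sm_Dop b sG)) //.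
exact: (eq_DSl L (DopC b a sG) j Dz).
Qed.

Lemma DSlC L L' G : seqsm G -> seqeq (DSl L (DSl L' G)) (DSl L' (DSl L G)).
Proof.
elim: L' G => [|a L' IH] G sG /=; first by [].
move=> j z Dz; rewrite (IH _ (sm_Dop a sG)) //.
exact: (eq_DSl L' (DSl_Dop L a sG) j Dz).
Qed.

Lemma pd_eq0 a f z : D z -> (forall w, D w -> f w = 0) -> pd a f z = 0.
Proof. by move=> Dz f0; rewrite (pd_eq oD a Dz f0) pd_cst. Qed.

(** Each operator lowers the first nonzero index by at most one. *)
Lemma DSl_lt L G N i : (forall j z, D z -> (j < N)%N -> G j z = 0) -> (i + size L < N)%N ->
  forall z, D z -> DSl L G i z = 0.
Proof.
elim: L G N i => [|a L IH] G N i G0 iN z Dz /=.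
  by apply: G0 => //; rewrite -(addn0 i).
apply: (IH _ N.-1) => // [j w Dw jN|]; last by move: iN => /=; lia.
rewrite /Dop G0 ?mulr0 ?addr0 //; last by lia.
by apply: pd_eq0 => // x Dx; apply: G0 => //; lia.
Qed.

Lemma DSl_gt L G N i : (forall j z, D z -> (N < j)%N -> G j z = 0) -> (N < i)%N ->
  forall z, D z -> DSl L G i z = 0.
Proof.
elim: L G i => [|a L IH] G i G0 iN z Dz /=; first exact: G0.
apply: IH => // j w Dw jN; rewrite /Dop G0 ?mulr0 ?addr0 //; last by lia.
by apply: pd_eq0 => // x Dx; apply: G0 => //; lia.
Qed.

Section AtPoint.
Variables (z0 : V) (N : nat) (s : bool).
Hypothesis Dz0 : D z0.
Hypothesis gauge : forall a L, side a = s -> all (fun b => side b == s) L -> (size L < N)%N ->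
  pdL L (pd a Phi) z0 = 0.

Lemma pdL_cons_in a L f : smooth D f -> pdL (a :: L) f z0 = pdL L (pd a f) z0.
Proof. by move=> sf; rewrite /= -(pdL_swap oD). Qed.

Lemma pdLD L f g z : D z -> smooth D f -> smooth D g -> pdL L (fun w => f w + g w) z = pdL L f z + pdL L g z.
Proof.
move=> + sf sg; elim: L z => //= b L IH w Dw.
by rewrite (pd_eq oD b Dw IH) (pdD b Dw (smooth_pdL oD _ sf) (smooth_pdL oD _ sg)).
Qed.

Lemma pdL_mul_eq0 (Q : pred ('I_n + 'I_n)) L f u : smooth D f -> smooth D u ->
  (forall L', all Q L' -> (size L' <= size L)%N -> pdL L' u z0 = 0) ->
  all Q L -> pdL L (fun w => u w * f w) z0 = 0.
Proof.
elim: L f u => [|b L IH] f u sf su u0 /=.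
  by move=> _; have := u0 [::] isT (leqnn _); rewrite /= => ->; rewrite mul0r.
move=> /andP[sb aL]; have sbu := smooth_pd oD b su; have sbf := smooth_pd oD b sf.
etransitivity; first exact: (pdL_cons_in b L (smoothM oD su sf)).
have E w : D w -> pd b (fun w => u w * f w) w = pd b u w * f w + u w * pd b f w by move=> Dw; exact: (pdM b Dw su sf).
rewrite (pdL_eq oD L E Dz0) (pdLD L Dz0 (smoothM oD sbu sf) (smoothM oD su sbf)) IH ?add0r //.
  by apply: IH => // L' aL' LL; apply: u0 => //=; exact: leqW.
by move=> L' aL' LL; rewrite -pdL_cons_in //; apply: u0 => //=; rewrite sb.
Qed.

(** By Leibniz every correction term contains a jet of some [pd a Phi] along side [s], of order
    below N, and these vanish at [z0]. *)
Lemma DSl_gauge L G j : seqsm G -> all (fun b => side b == s) L -> (size L <= N)%N ->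
  DSl L G j z0 = pdL L (G j) z0.
Proof.
elim: L G => [|a L IH] G sG //= /andP[sa aL] LN.
rewrite IH //; [|exact: sm_Dop|exact: ltnW].
have su := smooth_pd oD a sPhi.
rewrite (pdLD L Dz0 (smooth_pd oD a (sG j)) (smoothM oD su (sG j.+1))) -pdL_cons_in // (pdL_mul_eq0 (Q := fun b => side b == s) _ su) ?addr0 //.
by move=> L' aL' LL; apply: gauge => //; [exact/eqP|exact: leq_ltn_trans LN].
Qed.

End AtPoint.

Definition fstar (s : bool) f G : nat -> V -> C := fun j z => \sum_(i < j.+1) prd Phi s (j - i) f (G i) z.

Lemma smooth_prd s k p q : smooth D p -> smooth D q -> smooth D (prd Phi s k p q).
Proof. exact: (smooth_bul oD sPhi uH). Qed.

Lemma sm_fstar s f G : smooth D f -> seqsm G -> seqsm (fstar s f G).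
Proof. by move=> sf sG j; apply: (smooth_sum oD) => i _; exact: smooth_prd. Qed.

Lemma pd_prd a k p q z : D z -> smooth D p -> smooth D q ->
  pd a (prd Phi (side a) k p q) z = prd Phi (side a) k p (pd a q) z
   + prd Phi (side a) k.+1 p (fun w => pd a Phi w * q w) z - pd a Phi z * prd Phi (side a) k.+1 p q z.
Proof. exact: (bul_pd oD sPhi uH). Qed.

Lemma prd0 s p q z : prd Phi s 0 p q z = cc Phi s 0 z mnm0 mnm0 * (p z * q z).
Proof.
have m0 (I : bmultinom n 1) : val I = mnm0 by apply/eqP; rewrite -mdeg_eq0 -leqn0 -ltnS; exact: valP I.
have m0b : (mdeg (mnm0 : multinom n) < 1)%N by rewrite mdeg0.
pose O : bmultinom n 1 := Sub mnm0 m0b.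
have allO I : I = O by apply: val_inj; rewrite m0.
rewrite (@prd_expand _ _ _ _ _ _ _ _ 1) // (bigD1 O) //= [X in _ + X]big1 ?addr0; last first.
  by move=> I; rewrite (allO I) eqxx.
rewrite (bigD1 O) //= [X in _ + X]big1 ?addr0; last by move=> I; rewrite (allO I) eqxx.
by rewrite /lsn; case: s; rewrite /= ?lstI0 ?lstJ0.
Qed.

Lemma prd_eqr s k p q q' z : D z -> (forall w, D w -> q w = q' w) -> prd Phi s k p q z = prd Phi s k p q' z.
Proof.
move=> Dz qq; rewrite !(@prd_expand _ _ _ _ _ _ _ _ k.*2.+1) //; apply: eq_bigr => I _; apply: eq_bigr => J _.
by rewrite (pdL_eq oD _ qq Dz).
Qed.

Lemma prdDr s k p q q' z : D z -> smooth D q -> smooth D q' ->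
  prd Phi s k p (fun w => q w + q' w) z = prd Phi s k p q z + prd Phi s k p q' z.
Proof.
move=> Dz sq sq'; rewrite !(@prd_expand _ _ _ _ _ _ _ _ k.*2.+1) // -big_split; apply: eq_bigr => I _.
by rewrite -big_split; apply: eq_bigr => J _; rewrite (pdLD _ Dz sq sq') !mulrDr.
Qed.

Lemma prd_r0 s k p q z : D z -> (forall w, D w -> q w = 0) -> prd Phi s k p q z = 0.
Proof.
move=> Dz q0; rewrite (@prd_expand _ _ _ _ _ _ _ _ k.*2.+1) // big1 // => I _; rewrite big1 // => J _.
rewrite (pdL_eq oD _ (g := fun=> 0) q0 Dz).
suff -> : pdL (lsn (~~ s) J) (fun=> 0) z = 0 by rewrite !mulr0.
by elim: (lsn _ _) z Dz => //= b L IH w Dw; exact: pd_eq0.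
Qed.

(** Summation step of [Dop_fstar]: the terms c X_i cancel after the shift, except the last one,
    which is the missing term of the sum of B. *)
Lemma telescope_shift (A B X : nat -> C) (c : C) j : c * X j.+1 = B j.+1 -> B 0%N = 0 ->
  \sum_(i < j.+1) (A i + (B i - c * X i)) + c * \sum_(i < j.+2) X i = \sum_(i < j.+1) (A i + B i.+1).
Proof.
move=> cX B0; rewrite [X in _ + _ * X]big_ord_recr /= mulrDr cX mulr_sumr addrA -big_split /=.
rewrite (eq_bigr (fun i : 'I_j.+1 => A i + B i)); last by move=> i _; rewrite -addrA subrK.
rewrite !big_split /= -addrA; congr (_ + _).
transitivity (\sum_(i < j.+2) B i); first by rewrite [RHS]big_ord_recr.
by rewrite big_ord_recl B0 add0r.
Qed.

(** The rule [pd_prd] summed over the orders; at order 0 the product commutes with multiplication by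
    u. Since D lowers indices, a nonzero entry at index 0 would be pushed out of the sequence,
    whence the condition on [G 0]. *)
Lemma Dop_fstar a f G : smooth D f -> seqsm G -> (forall z, D z -> G 0%N z = 0) ->
  seqeq (Dop a (fstar (side a) f G)) (fstar (side a) f (Dop a G)).
Proof.
move=> sf sG G0 j z Dz; have su := smooth_pd oD a sPhi.
set u := pd a Phi; set s := side a.
rewrite /Dop /fstar (pd_sum oD) //; last by move=> i _; exact: smooth_prd.
rewrite (eq_bigr (fun i : 'I_j.+1 => prd Phi s (j - i) f (pd a (G i)) z +
    (prd Phi s (j.+1 - i) f (fun w => u w * G i w) z - u z * prd Phi s (j.+1 - i) f (G i) z))); last first.
  by move=> i _; rewrite (pd_prd a (j - i) Dz sf (sG i)) subSn ?addrA // -ltnS.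
rewrite (@telescope_shift (fun i => prd Phi s (j - i) f (pd a (G i)) z)
  (fun i => prd Phi s (j.+1 - i) f (fun w => u w * G i w) z)
  (fun i => prd Phi s (j.+1 - i) f (G i) z)).
- apply: eq_bigr => i _; rewrite subSS.
  exact: (esym (prdDr s (j - i) f Dz (smooth_pd oD a (sG i)) (smoothM oD su (sG i.+1)))).
- rewrite subnn !prd0; move: (cc _ _ _ _ _ _) (f z) (u z) (G _ z) => x1 x2 x3 x4; ring.
- by apply: (prd_r0 _ _ _ Dz) => w Dw; rewrite G0 ?mulr0.
Qed.

Lemma DSl_fstar s L f G : smooth D f -> seqsm G -> all (fun b => side b == s) L ->
  (forall j z, D z -> (j < size L)%N -> G j z = 0) ->
  seqeq (DSl L (fstar s f G)) (fstar s f (DSl L G)).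
Proof.
move=> sf; elim: L G => [|a L IH] G sG //= /andP[/eqP sa aL] G0 j z Dz.
rewrite -IH //; [|exact: sm_Dop|].
  by apply: eq_DSl => // k w Dw; rewrite -sa; apply: Dop_fstar => // x Dx; exact: G0.
by move=> k w Dw kL; rewrite /Dop (G0 k.+1) // mulr0 addr0; apply: pd_eq0 => // x Dx; apply: G0 => //; exact: ltnW.
Qed.

Lemma size_lsn s (I : multinom n) : size (lsn s I) = mdeg I.
Proof.
have szf (T : Type) (h : 'I_n -> T) : size (flatten [seq nseq (I i) (h i) | i <- enum 'I_n]) = mdeg I.
  rewrite size_flatten /shape -map_comp sumnE big_map big_enum /= mdegE.
  by apply: eq_bigr => i _; rewrite size_nseq.
by case: s; exact: szf.
Qed.

Lemma side_lsn s (I : multinom n) : all (fun b => side b == s) (lsn s I).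
Proof.
apply/allP => x; rewrite -has_pred1 has_count /lsn.
case: s; rewrite ?count_lstJ ?count_lstI; by case: x.
Qed.

Lemma reindex4 (T : finType) (F : T -> T -> T -> T -> C) :
  \sum_a \sum_b \sum_c \sum_d F a b c d = \sum_d \sum_c \sum_a \sum_b F a b c d.
Proof.
transitivity (\sum_a \sum_d \sum_c \sum_b F a b c d).
  apply: eq_bigr => a _; rewrite exchange_big /=.
  under eq_bigr do rewrite exchange_big /=.
  by rewrite exchange_big.
by rewrite exchange_big; apply: eq_bigr => d _; rewrite exchange_big.
Qed.

(** For b > k the second index is at most k - i - 1 < m, where c' vanishes. *)
Lemma convolution_cut (c c' : nat -> C) (k i m : nat) : (i <= k)%N -> (k <= i + m)%N ->
  (forall a, (a < m)%N -> c' a = 0) ->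
  \sum_(b < k.+1) c b * c' (k.*2 - i - b)%N = fps_mul c c' (k.*2 - i).
Proof.
move=> ik kim c'0; rewrite /fps_mul (big_ord_widen (k.*2 - i).+1 (fun b => c b * c' (k.*2 - i - b)%N)); last by lia.
rewrite [RHS](bigID (fun b : 'I_ _ => (b < k.+1)%N)) /= [X in _ + X]big1 ?addr0 // => b bk.
by rewrite c'0 ?mulr0 //; have := ltn_ord b; lia.
Qed.

(** The two sums are the same convolution once their truncations at k are harmless. They are, unless
    i + m < k or i + m' < k, in which case both sides vanish. *)
Lemma assoc_term (c c' : nat -> C) (x y : C) k i m m' : (i <= k)%N ->
  (forall b, (b < m)%N -> c b = 0) -> (forall b, (b < m')%N -> c' b = 0) ->
  ((i + m < k)%N -> x = 0) -> ((i + m' < k)%N -> y = 0) -> ((m <= k)%N -> (m' <= k)%N -> x = y) ->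
  (\sum_(b < k.+1) c b * c' (k.*2 - i - b)%N) * x = (\sum_(a < k.+1) c' a * c (k.*2 - i - a)%N) * y.
Proof.
move=> ik c0 c'0 x0 y0 xy; have [iI|Ii] := ltnP (i + m) k.
  rewrite x0 // mulr0; have [Jk|kJ] := leqP m' k; first by rewrite -xy ?x0 ?mulr0 //; lia.
  by rewrite big1 ?mul0r // => a _; rewrite c'0 ?mul0r //; have := ltn_ord a; lia.
have [iJ|Ji] := ltnP (i + m') k.
  rewrite y0 // mulr0; have [Ik|kI] := leqP m k; first by rewrite xy ?y0 ?mulr0 //; lia.
  by rewrite big1 ?mul0r // => a _; rewrite c0 ?mul0r //; have := ltn_ord a; lia.
have E1 := convolution_cut c ik Ji c'0; have E2 := convolution_cut c' ik Ii c0.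
rewrite E1 E2 fps_mulC.
have [Ik|kI] := leqP m k; last first.
  by rewrite fps_mulC -E1 big1 ?mul0r // => a _; rewrite c0 ?mul0r //; have := ltn_ord a; lia.
have [Jk|kJ] := leqP m' k; last first.
  by rewrite -E2 big1 ?mul0r // => a _; rewrite c'0 ?mul0r //; have := ltn_ord a; lia.
by rewrite xy.
Qed.

Section Associativity.
Variables (z0 : V) (k : nat).
Hypothesis Dz0 : D z0.
Hypothesis gauge : forall s a L, side a = s -> all (fun b => side b == s) L -> (size L < k)%N ->
  pdL L (pd a Phi) z0 = 0.

Section Shifted.
Variables g : V -> C.
Hypothesis sg : smooth D g.

(** At index k, g leaves room for k operators D before the sequence is exhausted. *)
Definition Gat : nat -> V -> C := fun i => if i == k then g else (fun=> 0).

Lemma sm_Gat : seqsm Gat.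
Proof. by move=> i; rewrite /Gat; case: (i == k); [exact: sg|exact: (smooth_cst oD)]. Qed.

Lemma Gat_lt i z : (i < k)%N -> Gat i z = 0. Proof. by rewrite /Gat; case: eqP => // ->; rewrite ltnn. Qed.
Lemma Gat_gt i z : (k < i)%N -> Gat i z = 0. Proof. by rewrite /Gat; case: eqP => // ->; rewrite ltnn. Qed.

(** At [z0] the plain jet of p . g along side [s] is its jet under the operators D, and these
    commute with the product by p; so all derivatives end up on g. *)
Lemma pdL_prd s L j p : smooth D p -> all (fun b => side b == s) L -> (size L <= k)%N ->
  pdL L (prd Phi s j p g) z0 = \sum_(i < k.+1) prd Phi s (k + j - i) p (DSl L Gat i) z0.
Proof.
move=> sp aL Lk.
have E z : D z -> prd Phi s j p g z = fstar s p Gat (k + j) z.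
  move=> Dz; have kj : (k < (k + j).+1)%N by rewrite ltnS leq_addr.
  rewrite /fstar (bigD1 (Ordinal kj)) //= {1}/Gat eqxx addKn big1 ?addr0 // => i ik.
  apply: (prd_r0 _ _ _ Dz) => w Dw; rewrite /Gat ifN //.
rewrite (pdL_eq oD L E Dz0) -(DSl_gauge Dz0 (fun a L => gauge (s := s) (a := a) (L := L))) //; last first.
  exact: (sm_fstar _ sp sm_Gat).
rewrite DSl_fstar //; [|exact: sm_Gat|by move=> i z Dz iL; apply: Gat_lt; exact: leq_trans Lk].
rewrite /fstar [RHS](big_ord_widen (k + j).+1 (fun i => prd Phi s (k + j - i) p (DSl L Gat i) z0)); last by rewrite ltnS leq_addr.
rewrite [LHS](bigID (fun b : 'I_ _ => (b < k.+1)%N)) /= [X in _ + X]big1 ?addr0 // => i.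
rewrite -leqNgt => ki; apply: (prd_r0 _ _ _ Dz0) => w Dw.
by apply: (DSl_gt L (N := k)) => // a x Dx; exact: Gat_gt.
Qed.

(** At [z0] the outer plain derivatives are operators D of the other side, and all D commute. *)
Lemma jets_commute (I J : multinom n) i : (mdeg I <= k)%N -> (mdeg J <= k)%N ->
  pdL (lsn false J) (DSl (lsn true I) Gat i) z0 = pdL (lsn true I) (DSl (lsn false J) Gat i) z0.
Proof.
move=> Ik Jk.
rewrite -(DSl_gauge Dz0 (fun a L => gauge (s := false) (a := a) (L := L))) ?side_lsn ?size_lsn //; last exact: (sm_DSl _ sm_Gat).
rewrite -(DSl_gauge Dz0 (fun a L => gauge (s := true) (a := a) (L := L))) ?side_lsn ?size_lsn //; last exact: (sm_DSl _ sm_Gat).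
exact: (DSlC _ _ sm_Gat).
Qed.

Lemma pdL_DSl_eq0 L s (I : multinom n) i : (i + mdeg I < k)%N -> pdL L (DSl (lsn s I) Gat i) z0 = 0.
Proof.
move=> iI; have E z : D z -> DSl (lsn s I) Gat i z = 0.
  by apply: (DSl_lt (N := k)); rewrite ?size_lsn // => j w _; exact: Gat_lt.
rewrite (pdL_eq oD L E Dz0); elim: L (z0) Dz0 => //= b L IH w Dw; exact: pd_eq0.
Qed.

End Shifted.

(** Both bracketings become sums over I, J, I', J', i of F I' * H J times a convolution of
    coefficients and a jet of g, [XL] on the left and [XR] on the right. *)
Lemma prd_assoc f g h : smooth D f -> smooth D g -> smooth D h ->
  \sum_(b < k.+1) prd Phi true b (prd Phi true (k - b) f g) h z0 =
  \sum_(a < k.+1) prd Phi true a f (prd Phi true (k - a) g h) z0.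
Proof.
(* Large enough for orders up to 2k, the highest that occur after the shift by k. *)
move=> sf sg sh; pose M := (k.*2).*2.+1.
pose XL (I J : multinom n) i := pdL (lsn false J) (DSl (lsn true I) (Gat g) i) z0.
pose XR (I J : multinom n) i := pdL (lsn true I) (DSl (lsn false J) (Gat g) i) z0.
pose F I := pdL (lsn true I) f z0; pose H J := pdL (lsn false J) h z0.
pose c b (I J : multinom n) := cc Phi true b z0 I J.
have L1 b : (b < k.+1)%N -> prd Phi true b (prd Phi true (k - b) f g) h z0 =
    \sum_(I : bmultinom n M) \sum_(J : bmultinom n M) \sum_(I' : bmultinom n M) \sum_(J' : bmultinom n M) \sum_(i < k.+1)
     F I' * H J * (c b I J * c (k.*2 - i - b)%N I' J' * XL I J' i).
  move=> bk; rewrite (@prd_expand _ _ _ _ _ _ _ _ M); last by rewrite /M; lia.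
  apply: eq_bigr => I _; apply: eq_bigr => J _.
  (* If |I| > b the coefficient vanishes; otherwise |I| <= k, as [pdL_prd] requires. *)
  have [bI|Ib] := ltnP b (mdeg I).
    rewrite cc_bound ?mul0r; last by rewrite leq_max bI.
    rewrite big1 // => I' _; rewrite big1 // => J' _; rewrite big1 // => i _.
    by rewrite /c cc_bound ?mul0r ?mulr0 // leq_max bI.
  rewrite (pdL_prd sg) ?side_lsn ?size_lsn //; last by lia.
  rewrite -/(H J) -/(c b I J) mulr_suml mulr_sumr.
  transitivity (\sum_(i < k.+1) \sum_(I' : bmultinom n M) \sum_(J' : bmultinom n M)
     F I' * H J * (c b I J * c (k.*2 - i - b)%N I' J' * XL I J' i)).
    apply: eq_bigr => i _; rewrite (_ : (k + (k - b) - i = k.*2 - i - b)%N); last by lia.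
    rewrite (@prd_expand _ _ _ _ _ _ _ _ M); last by rewrite /M; lia.
    rewrite mulr_suml mulr_sumr; apply: eq_bigr => I' _; rewrite mulr_suml mulr_sumr; apply: eq_bigr => J' _.
    rewrite -/(c _ I' J') -/(F I') -/(XL I J' i); move: (c _ _ _) (c _ _ _) (XL _ _ _) (F _) (H _) => x1 x2 x3 x4 x5; ring.
  by rewrite exchange_big; apply: eq_bigr => I' _; rewrite exchange_big.
have L2 a : (a < k.+1)%N -> prd Phi true a f (prd Phi true (k - a) g h) z0 =
    \sum_(I : bmultinom n M) \sum_(J : bmultinom n M) \sum_(I' : bmultinom n M) \sum_(J' : bmultinom n M) \sum_(i < k.+1)
     F I' * H J * (c a I' J' * c (k.*2 - i - a)%N I J * XR I J' i).
  move=> ak; rewrite (@prd_expand _ _ _ _ _ _ _ _ M); last by rewrite /M; lia.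
  rewrite -(reindex4 (fun I' J' J I : bmultinom n M => \sum_(i < k.+1) F I' * H J * (c a I' J' * c (k.*2 - i - a)%N I J * XR I J' i))).
  apply: eq_bigr => I' _; apply: eq_bigr => J' _.
  have [aJ|Ja] := ltnP a (mdeg J').
    rewrite cc_bound ?mul0r; last by rewrite leq_max aJ orbT.
    rewrite big1 // => I _; rewrite big1 // => J _; rewrite big1 // => i _.
    by rewrite /c cc_bound ?mul0r ?mulr0 // leq_max aJ orbT.
  (* Derivatives along side [false] commute with the product by h on the right, so g . h is read as
     the opposite product of h and g. *)
  have prdCf : prd Phi true (k - a) g h = prd Phi false (k - a) h g by apply/funext => w; rewrite prdC.
  rewrite prdCf; change (~~ true) with false.
  have szJ : (size (lsn false J') <= k)%N by rewrite size_lsn; lia.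
  rewrite (pdL_prd sg (k - a) sh (side_lsn false J') szJ).
  rewrite -/(F I') -/(c a I' J') !mulr_sumr.
  transitivity (\sum_(i < k.+1) \sum_(J : bmultinom n M) \sum_(I : bmultinom n M)
     F I' * H J * (c a I' J' * c (k.*2 - i - a)%N I J * XR I J' i)).
    apply: eq_bigr => i _; rewrite (_ : (k + (k - a) - i = k.*2 - i - a)%N); last by lia.
    rewrite (@prd_expand _ _ _ _ _ _ _ _ M); last by rewrite /M; lia.
    rewrite !mulr_sumr; apply: eq_bigr => J _; rewrite !mulr_sumr; apply: eq_bigr => I _.
    rewrite ccC /= -/(c _ I J) -/(H J) -/(XR I J' i); move: (c _ _ _) (c _ _ _) (XR _ _ _) (F _) (H _) => x1 x2 x3 x4 x5; ring.
  by rewrite exchange_big; apply: eq_bigr => J _; rewrite exchange_big.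
etransitivity; first by apply: eq_bigr => b _; exact: (L1 b (ltn_ord b)).
apply: esym; etransitivity; first by apply: eq_bigr => a _; exact: (L2 a (ltn_ord a)).
apply: esym.
do 4![rewrite exchange_big [RHS]exchange_big; apply: eq_bigr => ? _].
rewrite exchange_big [RHS]exchange_big; apply: eq_bigr => i _ /=.
move: (bmnm _) (bmnm _) (bmnm _) (bmnm _) => J' I J I'.
rewrite -!mulr_sumr; congr (_ * _); rewrite -!mulr_suml.
apply: (@assoc_term (fun b => c b I J) (fun b => c b I' J') (XL I J' i) (XR I J' i) k i (mdeg I) (mdeg J')).
- by rewrite -ltnS.
- by move=> b bI; rewrite /c cc_bound // leq_max bI.
- by move=> b bI; rewrite /c cc_bound // leq_max bI orbT.
- exact: (pdL_DSl_eq0 g (lsn false J') true).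
- exact: (pdL_DSl_eq0 g (lsn true I) false).
- exact: (jets_commute sg i).
Qed.

End Associativity.

End LaurentSequences.

(** * Change of potential *)

Opaque pd hmx lst gaussE Tp.

Lemma smooth_sub {R : realType} {n : nat} (D D' : set 'rV[R[i]]_n) f : D' `<=` D -> smooth D f -> smooth D' f.
Proof. by move=> DD /smoothP H; apply/smoothP => k; exact: (Cksub_sub DD (H k)). Qed.

Section Gauge.
Context {R : realType} {n : nat}.
Local Notation C := R[i].
Local Notation V := 'rV[C]_n.
Local Notation P := (mpoly (n + n) C).
Variable D : set V.
Hypothesis oD : open D.
Implicit Types (f g u p q Phi Psi : V -> C) (z : V) (K : multinom (n + n)).

Lemma tay_eq f g z K : D z -> (forall w, D w -> f w = g w) -> tay f z K = tay g z K.
Proof. by move=> Dz fg; rewrite /tay (pdL_eq oD (lst K) fg Dz). Qed.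

(** A mixed coefficient involves some d_i and some dbar_j, hence is a derivative of an entry of
    [hmx]. *)
Lemma tay_mix Phi Psi z K : smooth D Phi -> smooth D Psi -> (forall w, D w -> hmx Phi w = hmx Psi w) ->
  D z -> mix K -> tay Phi z K = tay Psi z K.
Proof.
move=> sP sQ PQ Dz /andP[K1 K2].
have ex (F : 'I_n -> nat) : (0 < \sum_(i < n) F i)%N -> exists i, (0 < F i)%N.
  move=> H; apply/existsP; apply: contraLR H; rewrite negb_exists => /forallP H.
  by rewrite big1 // => i _; apply/eqP; rewrite -leqn0 leqNgt.
have [i Ki] := ex _ K1; have [j Kj] := ex _ K2.
have K1E := mnm_subK Ki; set K' := mnm_sub K (mnm1 (lshift n i)) in K1E.
have K'j : (0 < K' (rshift n j))%N by rewrite -{1}K1E in Kj; move: Kj; rewrite mnmDE mnm1E eq_lrshift addn0.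
have K2E := mnm_subK K'j; set K'' := mnm_sub K' (mnm1 (rshift n j)) in K2E.
have c1 : ((K' (lshift n i)).+1%:R : C) != 0 by rewrite pnatr_eq0.
have c2 : ((K'' (rshift n j)).+1%:R : C) != 0 by rewrite pnatr_eq0.
have E F : smooth D F -> tay F z K * (K' (lshift n i)).+1%:R * (K'' (rshift n j)).+1%:R = tay (pd (inr j) (pd (inl i) F)) z K''.
  move=> sF; have := tay_pd oD K' (lshift n i) Dz sF; rewrite K1E (unsplitK (inl i)) => ->.
  have := tay_pd oD K'' (rshift n j) Dz (smooth_pd oD (inl i) sF).
  by rewrite K2E (unsplitK (inr j)) => ->.
apply: (mulIf c1); apply: (mulIf c2); rewrite (E _ sP) (E _ sQ).
apply: (tay_eq _ Dz) => w Dw.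
rewrite (pdC oD (inr j) (inl i) Dw sP) (pdC oD (inr j) (inl i) Dw sQ).
by rewrite -(hmxE Phi) -(hmxE Psi) (PQ w Dw).
Qed.

Lemma bul_gauge Phi Psi s p q z m : smooth D Phi -> smooth D Psi -> (forall w, D w -> hmx Phi w = hmx Psi w) ->
  D z -> bul Phi s p q z m = bul Psi s p q z m.
Proof.
move=> sP sQ PQ Dz.
have ES : serS Phi z = serS Psi z.
  apply/funext => k; rewrite !serSE; case: (k == 0%N); first by [].
  congr (- _); apply/mpolyP => K; rewrite !mcoeff_Tp; case E: (_ && _); last by [].
  by move/andP: E => [_ mK]; exact: tay_mix.
have EM k : Tp xpredT (fun w => \det (hmx Phi w)) z k = Tp xpredT (fun w => \det (hmx Psi w)) z k.
  apply: eq_Tp => [K _|K]; first by [].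
  by apply: (tay_eq _ Dz) => w Dw; rewrite (PQ w Dw).
have aux H H' S S' (A T T' : nat -> P) : H = H' -> S = S' -> T = T' ->
    gint H S (fps_mul A T) m / \det H = gint H' S' (fps_mul A T') m / \det H' by move=> -> -> ->.
exact: (aux _ _ _ _ _ _ _ (PQ z Dz) ES (funext EM)).
Qed.

Lemma prd_gauge Phi Psi s k p q z : smooth D Phi -> smooth D Psi -> (forall w, D w -> hmx Phi w = hmx Psi w) ->
  D z -> prd Phi s k p q z = prd Psi s k p q z.
Proof. exact: bul_gauge. Qed.

Opaque prd.

Lemma pdL_lst L f z : D z -> smooth D f ->
  pdL L f z = wfact (\big[@mnm_add _/@mnm0 _]_(x <- L) mnm1 (unsplit x)) *
    tay f z (\big[@mnm_add _/@mnm0 _]_(x <- L) mnm1 (unsplit x)).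
Proof.
move=> Dz sf; set K := (X in wfact X); rewrite /tay mulrA mulfV ?mul1r; last first.
  by rewrite /wfact pnatr_eq0 -lt0n prodn_gt0 // => i; exact: fact_gt0.
apply: (pdL_perm oD Dz sf); rewrite {}/K; elim: L => [|a L IH].
  rewrite big_nil perm_sym; apply/perm_nilP/perm_nilP/allP => x _; apply/eqP.
  by rewrite count_lst mnm0E.
rewrite big_cons addmC perm_sym; apply: (perm_trans (lst_add _ _)); rewrite unsplitK perm_cons perm_sym.
exact: IH.
Qed.

(** Subtract the unmixed terms of the Taylor polynomial of Phi at [z0]; their mixed second
    derivatives vanish identically. *)
Lemma gauge_exists Phi z0 k : D z0 -> smooth D Phi -> exists Psi,
  [/\ smooth D Psi, forall w, D w -> hmx Phi w = hmx Psi w &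
    forall s L, all (fun b => side b == s) L -> (size L <= k)%N -> pdL L Psi z0 = 0].
Proof.
move=> Dz sP; pose p : P := \sum_(d < k.+2) Tp (fun K => ~~ mix K) Phi z0 d.
have pE K : mcoeff K p = if (mdeg K < k.+2)%N && ~~ mix K then tay Phi z0 K else 0.
  rewrite raddf_sum /=; have [Kk|kK] := ltnP.
    rewrite (bigD1 (Ordinal Kk)) //= mcoeff_Tp eqxx /= big1 ?addr0 // => d dK.
    by rewrite mcoeff_Tp; case: eqP => //= E; case/eqP: dK; apply: val_inj.
  by rewrite big1 // => d _; rewrite mcoeff_Tp; case: eqP => // E; have := ltn_ord d; rewrite -E ltnNge kK.
have sp : smooth D (pev z0 p) := smooth_sub (@subsetT _ D) (smooth_pev z0 p).
exists (fun w => Phi w - pev z0 p w); split; first exact: (smoothB oD sP sp).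
  move=> w Dw; apply/matrixP => i j; rewrite [LHS]hmxE [RHS]hmxE.
  rewrite [RHS](pd_eq oD (inl i) Dw (fun x Dx => pdB oD (inr j) Dx sP sp)).
  rewrite (pdB oD (inl i) Dw (smooth_pd oD _ sP) (smooth_pd oD _ sp)) !pd_pev.
  rewrite (_ : mderiv _ _ = 0) ?/pev ?meval0 ?subr0 //; apply/mpolyP => K.
  rewrite !mcoeff_mderiv pE mcoeff0 [mix _](_ : _ = true) ?andbF ?mul0rn //=.
  rewrite /mix !degyD !degybD.
  have := pure1 false (inl i : 'I_n + 'I_n); have := pure1 true (inr j : 'I_n + 'I_n).
  have := pure1 true (inl i : 'I_n + 'I_n); have := pure1 false (inr j : 'I_n + 'I_n).
  rewrite /pure /=; lia.
move=> s L aL Lk.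
have pdLB f g z : D z -> smooth D f -> smooth D g -> pdL L (fun w => f w - g w) z = pdL L f z - pdL L g z.
  move=> + sf sg; elim: L {aL Lk} z => // b L' IH w Dw /=.
  by rewrite (pd_eq oD b Dw IH) (pdB oD b Dw (smooth_pdL oD _ sf) (smooth_pdL oD _ sg)).
rewrite pdLB // !pdL_lst // -mulrBr.
set K := (\big[_/_]_(_ <- _) _).
have Kd : (mdeg K < k.+2)%N.
  rewrite /K mdeg_sum; under eq_bigr do rewrite mdeg1.
  by rewrite sum1_size ltnS; exact: leqW.
have Kp : pure s K.
  rewrite /K; elim: L aL {Lk K Kd pdLB} => [|b L' IH] /=; first by rewrite big_nil pure0.
  by move=> /andP[/eqP sb aL']; rewrite big_cons pureD pure1 sb eqxx IH.
rewrite tay_pev pE Kd /= [mix K](_ : _ = false) ?subrr ?mulr0 //.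
by move: Kp; rewrite /pure /mix; case: (s) => /eqP ->; rewrite ?andbF.
Qed.

Variable Phi : V -> C.
Hypothesis sPhi : smooth D Phi.
Hypothesis uH : forall z, D z -> hmx Phi z \in unitmx.

Theorem prd_associative f g h k z : D z -> smooth D f -> smooth D g -> smooth D h ->
  \sum_(b < k.+1) prd Phi true b (prd Phi true (k - b) f g) h z =
  \sum_(a < k.+1) prd Phi true a f (prd Phi true (k - a) g h) z.
Proof.
move=> Dz sf sg sh; have [Psi [sQ PQ gau]] := gauge_exists k Dz sPhi.
have gau' s a L : side a = s -> all (fun b => side b == s) L -> (size L < k)%N -> pdL L (pd a Psi) z = 0.
  by move=> sa aL Lk; rewrite -(pdL_cons_in oD Dz a L sQ); apply: (gau s) => //=; rewrite sa eqxx.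
have uQ w : D w -> hmx Psi w \in unitmx by move=> Dw; rewrite -PQ // uH.
have E p q j w : D w -> prd Phi true j p q w = prd Psi true j p q w by move=> Dw; exact: prd_gauge.
have := prd_assoc oD sQ uQ Dz gau' sf sg sh => A.
transitivity (\sum_(b < k.+1) prd Psi true b (prd Psi true (k - b) f g) h z).
  apply: eq_bigr => b _; etransitivity; first exact: (E _ _ _ _ Dz).
  etransitivity; first exact: prdC.
  etransitivity; last exact: (esym (prdC Psi true b _ h z)).
  exact: (prd_eqr oD Psi (~~ true) b h Dz (fun w Dw => E f g (k - b)%N w Dw)).
etransitivity; first exact: A.
apply: eq_bigr => a _; etransitivity; last exact: (esym (E _ _ _ _ Dz)).
exact: (prd_eqr oD Psi true a f Dz (fun w Dw => esym (E g h (k - a)%N w Dw))).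
Qed.

Lemma prd_classical s p q z : D z -> prd Phi s 0 p q z = p z * q z.
Proof.
move=> Dz; rewrite prd0 [cc _ _ _ _ _ _](_ : _ = 1) ?mul1r // /cc /Lam /gint.
have f0 (x y : nat -> P) : fps_mul x y 0 = x 0%N * y 0%N by rewrite /fps_mul big_ord1.
rewrite !f0 fps_exp0 mulr1 Tp0 // /mono !mdeg_emb mdeg0 eqxx.
have e0 s' : emb s' (mnm0 : multinom n) = mnm0 by apply/eqP; rewrite -mdeg_eq0 mdeg_emb mdeg0.
rewrite !e0 mpolyX0 wfact0 invr1 !scale1r !mul1r.
have gZ c (r : P) : gaussE (hmx Phi z) (c *: r) = c * gaussE (hmx Phi z) r by rewrite linearZ.
by rewrite gZ gaussE1 mulr1 mulfV //; exact: (det_neq0 uH Dz).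
Qed.

Lemma sum_mdeg_le1 M (F : multinom n -> C) : (1 < M)%N -> (forall J, (1 < mdeg J)%N -> F J = 0) ->
  \sum_(J : bmultinom n M) F J = F mnm0 + \sum_(i < n) F (mnm1 i).
Proof.
move=> M1 F0; have b0 : (mdeg (mnm0 : multinom n) < M)%N by rewrite mdeg0; lia.
rewrite (bigD1 (Sub (mnm0 : multinom n) b0 : bmultinom n M)) //=; congr (_ + _).
transitivity (\sum_(J : bmultinom n M) \sum_(i < n) if (J : multinom n) == mnm1 i then F J else 0).
  rewrite big_mkcond; apply: eq_bigr => J _; case: eqP => [->|/eqP J0] /=.
    by rewrite big1 // => i _; case: eqP => // /(congr1 mdeg); rewrite mdeg0 mdeg1.
  have [J1|J1] := ltnP 1 (mdeg J); first by rewrite F0 // big1 // => i _; case: ifP.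
  have J0' : (0 < mdeg J)%N by rewrite lt0n mdeg_eq0; apply: contraNN J0 => /eqP E; apply/eqP/val_inj.
  have [i Ji] : exists i, (0 < J i)%N.
    apply/existsP; apply: contraLR J0'; rewrite negb_exists => /forallP H.
    by rewrite mdegE big1 // => i _; apply/eqP; rewrite -leqn0 leqNgt.
  have JE : J = mnm1 i :> multinom n.
    have E : mnm_add (mnm_sub J (mnm1 i)) (mnm1 i) = J.
      by apply/mnmP => l; rewrite mnmDE mnmBE mnm1E; case: eqP => [<-|_]; rewrite ?subn0 ?addn0 // subnK.
    set J' := mnm_sub _ _ in E.
    suff J'0 : J' = mnm0 :> multinom n by rewrite -E J'0 add0m.
    by apply/eqP; rewrite -mdeg_eq0; move: J1; rewrite -E mdegD mdeg1; lia.
  rewrite (bigD1 i) //= JE eqxx big1 ?addr0 // => j ji; case: eqP => // /mnmP /(_ i).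
  by rewrite !mnm1E eqxx (negbTE ji).
rewrite exchange_big; apply: eq_bigr => i _.
have b1 : (mdeg (mnm1 i) < M)%N by rewrite mdeg1.
rewrite (bigD1 (Sub (mnm1 i) b1 : bmultinom n M)) //= eqxx big1 ?addr0 // => J Ji; case: eqP => // E; case/eqP: Ji; exact: val_inj.
Qed.

Definition dirs (s : bool) (i : 'I_n) : 'I_n + 'I_n := if s then inr i else inl i.

Lemma lsn0 s : lsn s (mnm0 : multinom n) = [::]. Proof. by case: s; [exact: lstJ0|exact: lstI0]. Qed.

Lemma lsn1 s i : lsn s (mnm1 i) = [:: dirs s i].
Proof.
apply/perm_small_eq => //; apply/allP => x _; apply/eqP; case: s; rewrite ?count_lstJ ?count_lstI /=;
case: x => j; rewrite ?mnm1E ?addn0 //=.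
Qed.

(** By [cc_bound] the term of order hbar is a first-order operator in q. Its coefficients b are
    found from [pd_prd] at order 0 with q = 1, which expresses d_a p by the action of b on
    [pd a Phi]. *)
Lemma prd1_beta s p z : D z -> smooth D p -> exists b : 'I_n -> C,
  (forall q, smooth D q -> prd Phi s 1 p q z = prd Phi s 1 p (fun=> 1) z * q z + \sum_i b i * pd (dirs (~~ s) i) q z) /\
  forall j, pd (dirs s j) p z = \sum_i b i * pd (dirs (~~ s) i) (pd (dirs s j) Phi) z.
Proof.
move=> Dz sp.
have [x [b E]] : exists x (b : 'I_n -> C), forall q, prd Phi s 1 p q z = x * q z + \sum_i b i * pd (dirs (~~ s) i) q z.
pose F J := \sum_(I : bmultinom n 3) cc Phi s 1 z I J * pdL (lsn s I) p z.
have F0 (J : multinom n) : (1 < mdeg J)%N -> F J = 0.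
  by move=> J1; rewrite /F big1 // => I _; rewrite cc_bound ?mul0r // leq_max J1 orbT.
exists (F mnm0), (fun i => F (mnm1 i)) => q.
  rewrite (@prd_expand _ _ _ _ _ _ _ _ 3) // exchange_big /=.
  rewrite (eq_bigr (fun J : bmultinom n 3 => F J * pdL (lsn (~~ s) J) q z)); last first.
    by move=> J _; rewrite /F mulr_suml; apply: eq_bigr => I _; rewrite mulrA.
  rewrite (@sum_mdeg_le1 3 (fun J => F J * pdL (lsn (~~ s) J) q z)) //; last by move=> J /F0 ->; rewrite mul0r.
  by rewrite lsn0; congr (_ + _); apply: eq_bigr => i _; rewrite lsn1.
have S0 : \sum_i b i * pd (dirs (~~ s) i) (fun=> 1) z = 0 by rewrite big1 // => i _; rewrite pd_cst mulr0.
have E1 : prd Phi s 1 p (fun=> 1) z = x by rewrite E S0 mulr1 addr0.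
exists b; split=> [q sq|j]; first by rewrite E1 E.
set a := dirs s j; have sa : side a = s by rewrite /a; case: (s).
have c1 := smooth_cst oD (1 : C).
have := pd_prd oD sPhi uH a 0 Dz sp c1; rewrite sa.
rewrite (pd_eq oD a (G := fun w => p w * 1) Dz); last by move=> w Dw; rewrite prd_classical.
rewrite (pdM a Dz sp c1) pd_cst mulr0 addr0 mulr1 prd_classical // pd_cst mulr0 add0r.
rewrite E1 E; move: (pd a Phi z) (pd a p z) => y w; rewrite mulr1 (mulrC x) addrAC subrr add0r => ->.
apply: eq_bigr => i _; congr (_ * _).
by apply: (pd_eq oD _ Dz) => v _; rewrite mulr1.
Qed.

(** Inverting [hmx] solves the linear system for b. The term without derivatives of q uses the
    opposite product: with first argument 1 the system is homogeneous, so the order hbar of p . 1 is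
    a multiple of p. *)
Lemma prd1E p q z : D z -> smooth D p -> smooth D q ->
  prd Phi true 1 p q z = prd Phi true 1 (fun=> 1) (fun=> 1) z * p z * q z +
    \sum_i \sum_j hinv (hmx Phi z) i j * (pd (inr j) p z * pd (inl i) q z).
Proof.
move=> Dz sp sq; have c1 := smooth_cst oD (1 : C).
have uz := uH Dz.
have [b [bE bj]] := prd1_beta true Dz sp; rewrite (bE q sq).
have -> : prd Phi true 1 p (fun=> 1) z = prd Phi true 1 (fun=> 1) (fun=> 1) z * p z.
  rewrite prdC [in RHS]prdC /=; have [b' [b'E b'j]] := prd1_beta false Dz c1.
  rewrite (b'E p sp) [X in _ + X](_ : _ = 0) ?addr0 //.
  have b0 j : b' j = 0.
    transitivity (\sum_i hinv (hmx Phi z) i j * 0); last by rewrite big1 // => i _; rewrite mulr0.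
    have : \sum_i hinv (hmx Phi z) i j * \sum_k b' k * hmx Phi z i k = b' j.
      under eq_bigr do rewrite mulr_sumr.
      rewrite exchange_big (bigD1 j) //= [X in _ + X]big1 ?addr0 => [|k kj].
        rewrite -[RHS]mulr1 (_ : 1 = \sum_i hmx Phi z i j * hinv (hmx Phi z) i j); last by rewrite hinv_mull // eqxx.
        by rewrite mulr_sumr; apply: eq_bigr => i _; rewrite mulrCA (mulrC (hinv _ _ _)).
      rewrite (eq_bigr (fun i => b' k * (hmx Phi z i k * hinv (hmx Phi z) i j))); last by move=> i _; ring.
      by rewrite -mulr_sumr hinv_mull // (negbTE kj) mulr0.
    move=> <-; apply: eq_bigr => i _; congr (_ * _); have := b'j i; rewrite pd_cst => E.
    etransitivity; last exact: (esym E).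
    by apply: eq_bigr => k _; rewrite hmxE (pdC oD (inl i) (inr k)).
  by rewrite big1 // => i _; rewrite b0 mul0r.
congr (_ + _); apply: eq_bigr => i _.
transitivity ((\sum_j hinv (hmx Phi z) i j * pd (inr j) p z) * pd (inl i) q z); last first.
  by rewrite mulr_suml; apply: eq_bigr => j _; rewrite mulrA.
congr (_ * _).
rewrite (eq_bigr (fun j => \sum_k b k * (hinv (hmx Phi z) i j * hmx Phi z k j))); last first.
  move=> j _; rewrite bj mulr_sumr; apply: eq_bigr => k _; rewrite hmxE; ring.
rewrite exchange_big (bigD1 i) //= -mulr_sumr hinv_mulr // eqxx mulr1 big1 ?addr0 // => k ki.
by rewrite -mulr_sumr hinv_mulr // eq_sym (negbTE ki) mulr0.
Qed.

End Gauge.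

(** * The bilinear extension *)

Section Bilinear.
Context {R : realType} {n : nat}.
Local Notation C := R[i].
Local Notation V := 'rV[C]_n.
Variable D : set V.
Hypothesis oD : open D.
Variable Phi : V -> C.
Hypothesis sPhi : smooth D Phi.
Hypothesis uH : forall z, D z -> hmx Phi z \in unitmx.
Implicit Types (F G H : nat -> V -> C) (z : V).

Lemma bulletE F G k z : bullet Phi F G k z =
  \sum_(a < k.+1) \sum_(b < (k - a).+1) prd Phi true (k - a - b) (F a) (G b) z.
Proof. by apply: eq_bigr => a _; apply: eq_bigr => b _; exact: bullet0E. Qed.

Lemma smooth_bullet F G k : (forall a, smooth D (F a)) -> (forall b, smooth D (G b)) -> smooth D (bullet Phi F G k).
Proof.
move=> sF sG; apply: (smooth_eq oD (F := fun z => \sum_(a < k.+1) \sum_(b < (k - a).+1) prd Phi true (k - a - b) (F a) (G b) z)).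
  by move=> z _; rewrite bulletE.
by apply: (smooth_sum oD) => a _; apply: (smooth_sum oD) => b _; exact: (smooth_prd oD sPhi uH).
Qed.

Lemma prd_eql s k p p' q z : D z -> (forall w, D w -> p w = p' w) -> prd Phi s k p q z = prd Phi s k p' q z.
Proof. by move=> Dz pp; rewrite prdC [RHS]prdC; exact: (prd_eqr oD Phi (~~ s) k q Dz pp). Qed.

Lemma bullet_eq F F' G G' k z : D z -> (forall a w, D w -> F a w = F' a w) -> (forall a w, D w -> G a w = G' a w) ->
  bullet Phi F G k z = bullet Phi F' G' k z.
Proof.
move=> Dz FF GG; rewrite !bulletE; apply: eq_bigr => a _; apply: eq_bigr => b _.
by rewrite (prd_eql _ _ _ Dz (FF a)); exact: (prd_eqr oD Phi true _ _ Dz (GG b)).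
Qed.

Lemma prdZr s k p c q z : D z -> smooth D q -> prd Phi s k p (fun w => c * q w) z = c * prd Phi s k p q z.
Proof.
move=> Dz sq; rewrite !(@prd_expand _ _ _ _ _ _ _ _ k.*2.+1) // mulr_sumr; apply: eq_bigr => I _.
rewrite mulr_sumr; apply: eq_bigr => J _; rewrite (_ : pdL _ (fun w => c * q w) z = c * pdL (lsn (~~ s) J) q z).
  move: (cc _ _ _ _ _ _) (pdL _ _ _) (pdL _ _ _) => x y w; ring.
elim: (lsn _ _) z Dz => //= b L IH w Dw.
by rewrite (pd_eq oD b Dw IH) (pdZ oD) //; exact: (smooth_pdL oD).
Qed.

Lemma prd_sumr (T : Type) (r : seq T) (Q : pred T) s k p (q : T -> V -> C) z : D z -> (forall i, smooth D (q i)) ->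
  prd Phi s k p (fun w => \sum_(i <- r | Q i) q i w) z = \sum_(i <- r | Q i) prd Phi s k p (q i) z.
Proof.
move=> Dz sq; elim: r => [|i r IH].
  by rewrite big_nil; apply: (prd_r0 oD _ _ _ _ Dz) => w _; rewrite big_nil.
rewrite big_cons -IH; case: ifP => Qi.
  rewrite -(prdDr oD _ _ _ _ Dz (sq i)); last by apply: (smooth_sum oD) => j _.
  by apply: (prd_eqr oD _ _ _ _ Dz) => w _; rewrite big_cons Qi.
by apply: (prd_eqr oD _ _ _ _ Dz) => w _; rewrite big_cons Qi.
Qed.

Lemma prd_suml (T : Type) (r : seq T) (Q : pred T) s k p (q : T -> V -> C) z : D z -> (forall i, smooth D (q i)) ->
  prd Phi s k (fun w => \sum_(i <- r | Q i) q i w) p z = \sum_(i <- r | Q i) prd Phi s k (q i) p z.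
Proof. move=> Dz sq; etransitivity; first exact: prdC.
etransitivity; first exact: (prd_sumr r Q (~~ s) k p Dz sq).
by apply: eq_bigr => i _; exact: (esym (prdC Phi s k (q i) p z)). Qed.

Lemma sum_triangle (f : nat -> nat -> nat -> C) m N : (m < N)%N ->
  \sum_(a < m.+1) \sum_(b < (m - a).+1) f a b (m - a - b)%N =
  \sum_(a < N) \sum_(b < N) \sum_(c < N) if (a + b + c == m)%N then f a b c else 0.
Proof.
move=> mN; rewrite (big_ord_widen N (fun a => \sum_(b < (m - a).+1) f a b (m - a - b)%N)) //.
rewrite big_mkcond; apply: eq_bigr => a _; case: ifP => am; last first.
  by rewrite big1 // => b _; rewrite big1 // => c _; case: eqP => // E; move: am; lia.
rewrite (big_ord_widen N (fun b => f a b (m - a - b)%N)); last by lia.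
rewrite big_mkcond; apply: eq_bigr => b _; case: ifP => bm; last first.
  by rewrite big1 // => c _; case: eqP => // E; move: bm; lia.
have cN : (m - a - b < N)%N by lia.
rewrite (bigD1 (Ordinal cN)) //= ifT; last by apply/eqP; lia.
rewrite big1 ?addr0 // => c cE; case: eqP => // E; case/eqP: cE; apply: val_inj => /=; lia.
Qed.

Lemma sum_pick (f : nat -> C) m N : \sum_(a < N) (if a == m :> nat then f a else 0) = if (m < N)%N then f m else 0.
Proof.
case: ltnP => mN; last by rewrite big1 // => a _; case: eqP => // E; have := ltn_ord a; lia.
rewrite (bigD1 (Ordinal mN)) //= eqxx big1 ?addr0 // => a; rewrite -val_eqE /= => /negbTE -> //.
Qed.

Lemma sum3 N (F : 'I_N -> 'I_N -> 'I_N -> C) :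
  \sum_(a < N) \sum_(b < N) \sum_(c < N) F a b c = \sum_(x : 'I_N * 'I_N * 'I_N) F x.1.1 x.1.2 x.2.
Proof. by rewrite (pair_bigA _ (fun a b => \sum_c F a b c)) (pair_bigA _ (fun x c => F x.1 x.2 c)). Qed.

Lemma sum_conv N k s (f : nat -> nat -> C) : (k < N)%N ->
  \sum_(c < N) \sum_(e < N) (if (s + c + e == k)%N then f c e else 0) =
  if (s <= k)%N then \sum_(e < (k - s).+1) f (k - s - e)%N e else 0.
Proof.
move=> kN; case: leqP => sk; last first.
  by rewrite big1 // => c _; rewrite big1 // => e _; case: eqP => // E; move: sk; lia.
rewrite exchange_big (big_ord_widen N (fun e => f (k - s - e)%N e)) /=; last by lia.
rewrite [RHS]big_mkcond; apply: eq_bigr => e _; case: ifP => ek; last first.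
  by rewrite big1 // => c _; case: eqP => // E; move: ek; lia.
rewrite (eq_bigr (fun c : 'I_N => if c == (k - s - e)%N :> nat then f c e else 0)); last first.
  by move=> c _; rewrite (_ : (_ == _) = (s + c + e == k)%N) //; apply/eqP/eqP; lia.
by rewrite (sum_pick (f^~ e)) ifT //; lia.
Qed.

(** Both sides are sums over five indices of total k; for fixed indices of F, G and H, the inner
    convolution is [prd_associative] at the remaining order. *)
Theorem bullet_assoc F G H k z : D z -> (forall a, smooth D (F a)) -> (forall a, smooth D (G a)) -> (forall a, smooth D (H a)) ->
  bullet Phi (bullet Phi F G) H k z = bullet Phi F (bullet Phi G H) k z.
Proof.
move=> Dz sF sG sH; pose N := k.+1.
have sP j p q : smooth D p -> smooth D q -> smooth D (prd Phi true j p q) by exact: (smooth_prd oD sPhi uH).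
pose T a b d c e := prd Phi true e (prd Phi true c (F a) (G b)) (H d) z.
pose T' a b d c e := prd Phi true e (F a) (prd Phi true c (G b) (H d)) z.
have c0 := smooth_cst oD (0 : C).
have expand F' G' m w : (m < N)%N -> bullet Phi F' G' m w =
    \sum_(x : 'I_N * 'I_N * 'I_N) (fun w => if (x.1.1 + x.1.2 + x.2 == m)%N then prd Phi true x.2 (F' x.1.1) (G' x.1.2) w else 0) w.
  by move=> mN; rewrite bulletE (sum_triangle (fun a b c => prd Phi true c (F' a) (G' b) w) mN) sum3.
have sm3 F' G' m (x : 'I_N * 'I_N * 'I_N) : (forall a, smooth D (F' a)) -> (forall a, smooth D (G' a)) ->
    smooth D (fun w => if (x.1.1 + x.1.2 + x.2 == m)%N then prd Phi true x.2 (F' x.1.1) (G' x.1.2) w else 0).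
  by move=> sF' sG'; case: (_ == m) => //; exact: sP.
have L : bullet Phi (bullet Phi F G) H k z = \sum_(a < N) \sum_(b < N) \sum_(d < N) \sum_(c < N) \sum_(e < N)
    if (a + b + d + c + e == k)%N then T a b d c e else 0.
  rewrite bulletE (sum_triangle (fun m d e => prd Phi true e (bullet Phi F G m) (H d) z) (leqnn N)).
  transitivity (\sum_(m < N) \sum_(d < N) \sum_(e < N) \sum_(x : 'I_N * 'I_N * 'I_N)
     (if (x.1.1 + x.1.2 + x.2)%N == m then (if (m + d + e == k)%N then T x.1.1 x.1.2 d x.2 e else 0) else 0)).
    apply: eq_bigr => m _; apply: eq_bigr => d _; apply: eq_bigr => e _.
    case: (m + d + e == k)%N; last by rewrite big1 // => x _; case: ifP.
    rewrite (prd_eql _ _ _ Dz (fun w _ => expand F G m w (ltn_ord m))).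
    rewrite prd_suml //; last by move=> x; exact: sm3.
    apply: eq_bigr => x _; case: (_ == nat_of_ord m); first by [].
    by rewrite prdC; apply: (prd_r0 oD _ _ _ _ Dz).
  transitivity (\sum_(x : 'I_N * 'I_N * 'I_N) \sum_(d < N) \sum_(e < N)
     if (x.1.1 + x.1.2 + d + x.2 + e == k)%N then T x.1.1 x.1.2 d x.2 e else 0).
    rewrite [RHS]exchange_big [LHS]exchange_big; apply: eq_bigr => d _.
    rewrite [LHS]exchange_big [RHS]exchange_big; apply: eq_bigr => e _.
    rewrite [LHS]exchange_big; apply: eq_bigr => x _ /=; set y := (x.1.1 + x.1.2 + x.2)%N.
    rewrite (eq_bigr (fun m : 'I_N => if m == y :> nat then (if (m + d + e == k)%N then T x.1.1 x.1.2 d x.2 e else 0) else 0)); last first.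
      by move=> m _; rewrite eq_sym.
    rewrite (sum_pick (fun m => if (m + d + e == k)%N then T x.1.1 x.1.2 d x.2 e else 0)).
    rewrite (_ : (x.1.1 + x.1.2 + d + x.2 + e = y + d + e)%N); last by rewrite /y; lia.
    by case: ltnP => // yN; case: eqP => // E; move: yN; rewrite /N; lia.
  rewrite -(sum3 (fun a b c : 'I_N => \sum_(d < N) \sum_(e < N) if (a + b + d + c + e == k)%N then T a b d c e else 0)).
  by apply: eq_bigr => a _; apply: eq_bigr => b _; exact: exchange_big.
have L' : bullet Phi F (bullet Phi G H) k z = \sum_(a < N) \sum_(b < N) \sum_(d < N) \sum_(c < N) \sum_(e < N)
    if (a + b + d + c + e == k)%N then T' a b d c e else 0.
  rewrite bulletE (sum_triangle (fun a m e => prd Phi true e (F a) (bullet Phi G H m) z) (leqnn N)).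
  apply: eq_bigr => a _.
  transitivity (\sum_(m < N) \sum_(e < N) \sum_(x : 'I_N * 'I_N * 'I_N)
     (if (x.1.1 + x.1.2 + x.2)%N == m then (if (a + m + e == k)%N then T' a x.1.1 x.1.2 x.2 e else 0) else 0)).
    apply: eq_bigr => m _; apply: eq_bigr => e _.
    case: (a + m + e == k)%N; last by rewrite big1 // => x _; case: ifP.
    rewrite (prd_eqr oD Phi true e (F a) Dz (fun w _ => expand G H m w (ltn_ord m))).
    rewrite prd_sumr //; last by move=> x; exact: sm3.
    apply: eq_bigr => x _; case: (_ == nat_of_ord m); first by [].
    by apply: (prd_r0 oD _ _ _ _ Dz).
  transitivity (\sum_(x : 'I_N * 'I_N * 'I_N) \sum_(e < N)
     if (a + x.1.1 + x.1.2 + x.2 + e == k)%N then T' a x.1.1 x.1.2 x.2 e else 0).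
    rewrite [LHS]exchange_big [RHS]exchange_big; apply: eq_bigr => e _.
    rewrite [LHS]exchange_big; apply: eq_bigr => x _ /=; set y := (x.1.1 + x.1.2 + x.2)%N.
    rewrite (eq_bigr (fun m : 'I_N => if m == y :> nat then (if (a + m + e == k)%N then T' a x.1.1 x.1.2 x.2 e else 0) else 0)); last first.
      by move=> m _; rewrite eq_sym.
    rewrite (sum_pick (fun m => if (a + m + e == k)%N then T' a x.1.1 x.1.2 x.2 e else 0)).
    rewrite (_ : (a + x.1.1 + x.1.2 + x.2 + e = a + y + e)%N); last by rewrite /y; lia.
    by case: ltnP => // yN; case: eqP => // E; move: yN; rewrite /N; lia.
  by rewrite -(sum3 (fun b d c : 'I_N => \sum_(e < N) if (a + b + d + c + e == k)%N then T' a b d c e else 0)).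
rewrite L L'; apply: eq_bigr => a _; apply: eq_bigr => b _; apply: eq_bigr => d _.
etransitivity; first exact: (sum_conv (a + b + d) (T a b d) (leqnn N)).
etransitivity; last exact: (esym (sum_conv (a + b + d) (T' a b d) (leqnn N))).
case: (a + b + d <= k)%N; last by [].
exact: (prd_associative oD sPhi uH _ Dz (sF a) (sG b) (sH d)).
Qed.

End Bilinear.

(** * Holomorphic changes of variables *)

Transparent pd.

Section Composition.
Context {R : realType} {n : nat}.
Local Notation C := R[i].
Local Notation V := 'rV[C]_n.
Implicit Types (f g p q F : V -> C) (z w : V).

Lemma row_continuous (T : topologicalType) (s : T -> V) (w : T) : (forall j, {for w, continuous (fun x => s x 0 j)}) -> {for w, continuous s}.
Proof.
move=> H P [Q HQ QP].
have E : \forall x \near nbhs w, forall j : 'I_n, Q 0 j (s x 0 j).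
  by apply: filter_forall => j; exact: (H j _ (HQ 0 j)).
by apply: filterS E => x Hx; apply: QP => i j; rewrite !ord1.
Qed.

Variables (Dc Dd : set V) (sg : V -> V).
Hypothesis oc : open Dc.
Hypothesis od : open Dd.
Hypothesis sgD : forall w, Dd w -> Dc (sg w).
Hypothesis hsg : holomorphic Dd sg.

Definition cmp (s : bool) (i : 'I_n) w : C := if s then conjc (sg w 0 i) else sg w 0 i.

Lemma smooth_cmp s i : smooth Dd (cmp s i).
Proof. by have [H _] := hsg i; case: s; [exact: (smooth_conj od H)|exact: H]. Qed.

(** The Cauchy-Riemann equations and their conjugates. *)
Lemma pd_cmp0 s i b w : Dd w -> pd (dirs (~~ s) b) (cmp s i) w = 0.
Proof.
move=> Dw; have [H0 H1] := hsg i; have E : pd (inr b) (fun w => sg w 0 i) w = 0 by exact: H1.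
case: s => /=; last exact: E.
by etransitivity; [exact: (pd_conj (inl b) Dw H0)|rewrite E; exact: conjc0].
Qed.

Lemma Cksub_sum (T : Type) (r : seq T) k D (F : T -> V -> C) : open D ->
  (forall i, Cksub k D (F i)) -> Cksub k D (fun z => \sum_(i <- r) F i z).
Proof.
move=> oD H; elim: r => [|i r IH].
  by apply: (Cksub_eq oD _ (Cksub_cst k 0 oD)) => w _; rewrite big_nil.
by apply: (Cksub_eq oD _ (Cksub_D oD (H i) IH)) => w _; rewrite big_cons.
Qed.

Definition chainD (b : bool) (j : 'I_n) F w : C := \sum_(i < n)
  (rderive (rd b j) (cmp false i) w * dz i F (sg w) + rderive (rd b j) (cmp true i) w * dzbar i F (sg w)).

Lemma hasD_comp b j F w : Dd w -> smooth Dc F -> hasD (F \o sg) w (rd b j) (chainD b j F w).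
Proof.
move=> Dw sF; have /smoothP/(_ 1%N) F1 := sF.
have z0 (v : V) : w + (0 : R)%:C *: v = w by rewrite scale0r addr0.
have Dg : Dc (sg (w + (0 : R)%:C *: rd b j)) by rewrite z0; exact: sgD.
have H i : cder (fun t => sg (w + t%:C *: rd b j) 0 i) 0 (rderive (rd b j) (cmp false i) w).
  exact: (smooth_hasD b j (smooth_cmp false i) Dw).
have := cder_chain oc F1 Dg H; rewrite z0 /chainD.
rewrite [X in cder _ _ X -> _](_ : _ = \sum_(i < n)
  (rderive (rd b j) (cmp false i) w * dz i F (sg w) + rderive (rd b j) (cmp true i) w * dzbar i F (sg w))) //.
apply: eq_bigr => i _; congr (_ + _ * _).
exact: (esym (hasD_rderive (cder_conj (H i) : hasD (cmp true i) w (rd b j) _))).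
Qed.

Lemma continuous_sg w : Dd w -> {for w, continuous sg}.
Proof. by move=> Dw; apply: row_continuous => j; have /smoothP/(_ 0%N)/Cksub_cont := smooth_cmp false j; exact. Qed.

Lemma smooth_comp F : smooth Dc F -> smooth Dd (F \o sg).
Proof.
move=> sF; apply/smoothP => k; elim: k F sF => [|k IH] F sF.
  split=> // w Dw; apply: continuous_comp; first exact: continuous_sg.
  by have /smoothP/(_ 0%N) H := sF; exact: (Cksub_cont H (sgD Dw)).
apply: (CksubS (dF := fun b j w => chainD b j F w) od).
- by move=> b j w Dw; exact: hasD_comp.
- move=> w Dw; apply: continuous_comp; first exact: continuous_sg.
  by have /smoothP/(_ 0%N) H := sF; exact: (Cksub_cont H (sgD Dw)).
- move=> b j; apply: (Cksub_sum _ od) => i.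
  have sm s : Cksub k Dd (rderive (rd b j) (cmp s i)) by have /smoothP := smooth_rd b j (smooth_cmp s i); exact.
  apply: (Cksub_D od); apply: (Cksub_M od) => //.
    exact: (IH _ (smooth_pd oc (inl i) sF)).
  exact: (IH _ (smooth_pd oc (inr i) sF)).
Qed.

(** The holomorphic Jacobian matrix for [s = false], its conjugate for [s = true]; rows are indexed
    by the variable of differentiation. *)
Definition Bm s w : 'M[C]_n := \matrix_(b, i) pd (dirs s b) (cmp s i) w.

Lemma BmE s w b i : Bm s w b i = pd (dirs s b) (cmp s i) w. Proof. exact: mxE. Qed.

Lemma pd_comp s b F w : Dd w -> smooth Dc F ->
  pd (dirs s b) (F \o sg) w = \sum_i Bm s w b i * pd (dirs s i) F (sg w).
Proof.
move=> Dw sF; rewrite (@pd_of_hasD _ _ _ _ _ (fun c => chainD c (cidx (dirs s b)) F w)); last first.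
  by move=> c; exact: hasD_comp.
rewrite /chainD mulr_sumr -big_split mulr_sumr; apply: eq_bigr => i _ /=.
transitivity (pd (dirs s b) (cmp false i) w * dz i F (sg w) + pd (dirs s b) (cmp true i) w * dzbar i F (sg w)).
  rewrite !pdE; move: (rderive _ _ _) (rderive _ _ _) (rderive _ _ _) (rderive _ _ _) (csgn _) (dz i F _) (dzbar i F _) => x1 x2 x3 x4 x5 x6 x7; ring.
rewrite BmE; case: s.
  by rewrite (pd_cmp0 false i b Dw) mul0r add0r.
by rewrite (pd_cmp0 true i b Dw) mul0r addr0.
Qed.

Lemma smooth_Bm s b i : smooth Dd (fun w => Bm s w b i).
Proof. by apply: (smooth_eq od _ (smooth_pd od (dirs s b) (smooth_cmp s i))) => w _; rewrite BmE. Qed.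

Lemma Bm_sym s b c i w : Dd w -> pd (dirs s c) (fun w => Bm s w b i) w = pd (dirs s b) (fun w => Bm s w c i) w.
Proof.
move=> Dw.
have E x y : pd (dirs s x) (fun w => Bm s w y i) w = pd (dirs s x) (pd (dirs s y) (cmp s i)) w.
  by apply: (pd_eq od _ Dw) => v _; exact: BmE.
by rewrite !E; exact: (pdC od _ _ Dw (smooth_cmp s i)).
Qed.

Lemma pd_Bm0 s b c i w : Dd w -> pd (dirs (~~ s) c) (fun w => Bm s w b i) w = 0.
Proof.
move=> Dw; have E : pd (dirs (~~ s) c) (fun w => Bm s w b i) w = pd (dirs (~~ s) c) (pd (dirs s b) (cmp s i)) w.
  by apply: (pd_eq od _ Dw) => v _; exact: BmE.
rewrite E (pdC od _ _ Dw (smooth_cmp s i)) (pd_eq od _ (G := fun=> 0) Dw) ?pd_cst // => v Dv.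
exact: pd_cmp0.
Qed.

(** The mixed Hessian transforms like a Hermitian form: d_i kills the antiholomorphic Jacobian, so
    no second derivatives of the map appear. *)
Lemma hmx_comp F w i j : Dd w -> smooth Dc F ->
  hmx (F \o sg) w i j = \sum_k \sum_l Bm false w i k * Bm true w j l * hmx F (sg w) k l.
Proof.
move=> Dw sF; rewrite [LHS]hmxE.
have sb := smooth_pd oc (inr _) sF.
rewrite (pd_eq od (inl i) (G := fun w => \sum_l Bm true w j l * (pd (inr l) F \o sg) w) Dw); last first.
  by move=> v Dv; exact: (pd_comp true j Dv sF).
rewrite (pd_sum od) //; last by move=> l _; exact: (smoothM od (smooth_Bm _ _ _) (smooth_comp (sb l))).
rewrite exchange_big; apply: eq_bigr => l _.
etransitivity; first exact: (pdM (inl i) Dw (smooth_Bm true j l) (smooth_comp (sb l))).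
rewrite (pd_Bm0 true j i l Dw : pd (inl i) _ w = 0) mul0r add0r (pd_comp false i Dw (sb l)) mulr_sumr.
by apply: eq_bigr => k _; rewrite hmxE mulrCA mulrA.
Qed.

End Composition.

(** * Uniqueness of the formal integral *)

Opaque pd.

Section Uniqueness.
Context {R : realType} {n : nat}.
Local Notation C := R[i].
Local Notation V := 'rV[C]_n.
Local Notation P := (mpoly (n + n) C).
Local Notation dir := ('I_n + 'I_n)%type.
Implicit Types (F G : V -> C) (a b : dir).
Variable D : set V.
Hypothesis oD : open D.

Definition TT G z := Tp (fun _ : multinom (n + n) => true) G z.

Lemma TT0 G z : TT G z 0 = (G z)%:A. Proof. exact: Tp0. Qed.

Lemma TTD F G z k : D z -> smooth D F -> smooth D G -> TT (fun w => F w + G w) z k = TT F z k + TT G z k.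
Proof. exact: (TpD oD). Qed.

Lemma TTZ c F z k : D z -> smooth D F -> TT (fun w => c * F w) z k = c *: TT F z k.
Proof.
move=> Dz sF; apply/mpolyP => K; rewrite mcoeffZ !mcoeff_Tp; case: (_ == k) => /=; last by rewrite mulr0.
rewrite /tay mulrCA; congr (_ * _); elim: (lst K) z Dz => //= b L IH w Dw.
by rewrite (pd_eq oD b Dw IH) (pdZ oD) //; exact: (smooth_pdL oD).
Qed.

Lemma TT_sum (T : Type) (r : seq T) (F : T -> V -> C) z k : D z -> (forall i, smooth D (F i)) ->
  TT (fun w => \sum_(i <- r) F i w) z k = \sum_(i <- r) TT (F i) z k.
Proof.
move=> Dz sF; elim: r => [|i r IH].
  rewrite big_nil; apply/mpolyP => K; rewrite mcoeff0 mcoeff_Tp; case: ifP => // _.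
  rewrite /tay; set L := lst K; suff -> : pdL L (fun w => \sum_(i <- [::]) F i w) z = 0 by rewrite mulr0.
  elim: L z Dz => [|b L IH] w Dw /=; first by rewrite big_nil.
  by rewrite (pd_eq oD b Dw IH) pd_cst.
rewrite big_cons -IH -TTD //; last by apply: (smooth_sum oD) => j _.
apply: eq_Tp => // K; apply: (tay_eq oD _ Dz) => w _; by rewrite big_cons.
Qed.

Lemma TTM F G z k : D z -> smooth D F -> smooth D G -> TT (fun w => F w * G w) z k = fps_mul (TT F z) (TT G z) k.
Proof. by move=> Dz sF sG; exact: (TpM oD). Qed.

Lemma mderiv_TT F z k a : D z -> smooth D F -> mderiv (unsplit a) (TT F z k.+1) = TT (pd a F) z k.
Proof. by move=> Dz sF; rewrite (mderiv_Tp oD) // unsplitK. Qed.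

Definition van m G z := forall j, (j < m)%N -> TT G z j = 0.

Lemma van_le m m' G z : (m' <= m)%N -> van m G z -> van m' G z.
Proof. by move=> mm H j jm; apply: H; exact: leq_trans mm. Qed.

Lemma van1 G z : G z = 0 -> van 1 G z.
Proof. by move=> G0 [|//] _; rewrite TT0 G0 scale0r. Qed.

Lemma van_pd m G z a : D z -> smooth D G -> van m.+1 G z -> van m (pd a G) z.
Proof. by move=> Dz sG vG j jm; rewrite -mderiv_TT // vG // mderiv0. Qed.

Lemma van_val m G z : van m.+1 G z -> G z = 0.
Proof. by move/(_ 0%N isT); rewrite TT0 => /(congr1 (mcoeff (mnm0 : multinom (n + n)))); rewrite mcoeffZ mcoeff1 eqxx mulr1 mcoeff0. Qed.

(** The phase [phi] is critical at [z0], and [N] is its inverse Hessian: it recovers the coordinates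
    from the linear parts of the d_b phi. *)
Variables (z0 : V) (phi : V -> C) (N : dir -> dir -> C).
Hypothesis Dz0 : D z0.
Hypothesis sphi : smooth D phi.
Hypothesis phi0 : van 2 phi z0.
Hypothesis NE : forall a, \sum_b N a b *: TT (pd b phi) z0 1 = X_ (unsplit a).

(** If G vanishes to order m, Euler's identity gives m G = sum_a X_a d_a G up to higher order, and
    X_a is a combination of the d_b phi up to higher order; this is the resulting coefficient of d_b
    phi in G. *)
Definition quo m G b w : C := m%:R^-1 * \sum_a N a b * pd a G w.

Lemma smooth_quo m G b : smooth D G -> smooth D (quo m G b).
Proof.
move=> sG; apply: (smoothZ oD); apply: (smooth_sum oD) => a _; apply: (smoothZ oD); exact: (smooth_pd oD).
Qed.

Lemma TT_quo m G b i : smooth D G -> TT (quo m G b) z0 i = m%:R^-1 *: \sum_a N a b *: mderiv (unsplit a) (TT G z0 i.+1).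
Proof.
move=> sG; have sa a := smooth_pd oD a sG.
rewrite (TTZ _ _ Dz0); last by apply: (smooth_sum oD) => a _; exact: (smoothZ oD).
congr (_ *: _); rewrite TT_sum //; last by move=> a; exact: (smoothZ oD).
by apply: eq_bigr => a _; rewrite TTZ // -mderiv_TT.
Qed.

Definition rst m G w : C := G w - \sum_b pd b phi w * quo m G b w.

Lemma smooth_rst m G : smooth D G -> smooth D (rst m G).
Proof.
move=> sG; apply: (smoothB oD sG); apply: (smooth_sum oD) => b _.
by apply: (smoothM oD (smooth_pd oD b sphi)); exact: smooth_quo.
Qed.

Lemma sum_dir (A : zmodType) (F : 'I_(n + n) -> A) : \sum_(a : dir) F (unsplit a) = \sum_a F a.
Proof.
rewrite (reindex (@fintype.split n n)) /=; first by apply: eq_bigr => a _; rewrite splitK.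
by exists (@unsplit n n) => x _; [exact: splitK|exact: unsplitK].
Qed.

Lemma van_rst m G : (0 < m)%N -> smooth D G -> van m G z0 -> van m.+1 (rst m G) z0.
Proof.
move=> m0 sG vG j jm; have sa b := smooth_pd oD b sphi.
have sM b : smooth D (fun w => pd b phi w * quo m G b w) by exact: (smoothM oD (sa b) (smooth_quo m b sG)).
have sS : smooth D (fun w => \sum_b pd b phi w * quo m G b w) by apply: (smooth_sum oD) => b _.
rewrite (_ : TT (rst m G) z0 j = TT G z0 j - \sum_b fps_mul (TT (pd b phi) z0) (TT (quo m G b) z0) j); last first.
  transitivity (TT (fun w => G w + -1 * \sum_b pd b phi w * quo m G b w) z0 j).
    by apply: eq_Tp => // K; apply: (tay_eq oD _ Dz0) => w _; rewrite mulN1r.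
  rewrite TTD //; last exact: (smoothZ oD).
  rewrite (TTZ _ _ Dz0 sS) scaleN1r TT_sum //; congr (_ - _); apply: eq_bigr => b _.
  exact: (TTM _ Dz0 (sa b) (smooth_quo m b sG)).
have A0 b : TT (pd b phi) z0 0 = 0 by exact: (van_pd b Dz0 sphi phi0).
have B0 b i : (i.+1 < m)%N -> TT (quo m G b) z0 i = 0.
  by move=> im; rewrite TT_quo // vG // big1 ?scaler0 // => a _; rewrite mderiv0 scaler0.
case: j jm => [|j] jm.
  rewrite vG // big1 ?subr0 // => b _.
  by rewrite /fps_mul big_ord1 A0 mul0r.
(* Below degree m every term vanishes. In degree m the product reduces to the linear part of d_b phi
   times the leading part of the quotient. *)
rewrite ltnS in jm; move: jm; rewrite leq_eqVlt => /orP[/eqP jm|jm]; last first.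
  rewrite vG // big1 ?subr0 // => b _.
  rewrite fps_mul_shift // fps_mulC fps_mul_eq0 // => i ij; apply: B0.
  by apply: leq_ltn_trans jm.
rewrite (eq_bigr (fun b => TT (pd b phi) z0 1 * (m%:R^-1 *: \sum_a N a b *: mderiv (unsplit a) (TT G z0 m)))); last first.
  move=> b _; rewrite fps_mul_shift // /fps_mul big_ord_recl subn0 big1 ?addr0 => [|i _].
    by rewrite (TT_quo m b j sG) -jm.
  by rewrite B0 ?mulr0 //= -jm ltnS /bump leq0n; have := ltn_ord i; lia.
have m1 : (m%:R : C) != 0 by rewrite pnatr_eq0 -lt0n.
apply: (scalerI m1); rewrite scaler0 scalerBr [X in _ - X]scaler_sumr.
have -> : \sum_b m%:R *: (TT (pd b phi) z0 1 * (m%:R^-1 *: \sum_a N a b *: mderiv (unsplit a) (TT G z0 m))) = euler (TT G z0 m).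
  rewrite (eq_bigr (fun b => \sum_a (N a b *: TT (pd b phi) z0 1) * mderiv (unsplit a) (TT G z0 m))); last first.
    move=> b _; rewrite -scalerAr scalerA mulfV // scale1r mulr_sumr; apply: eq_bigr => a _.
    by rewrite -scalerAr -scalerAl.
  rewrite exchange_big /= /euler -(sum_dir (fun a : 'I_(n + n) => X_ a * mderiv a (TT G z0 m))); apply: eq_bigr => a _.
  by rewrite -mulr_suml NE.
by rewrite jm (euler_homog (homog_Tp _ _ _ _)) subrr.
Qed.

(** [delta] stands for the difference of two formal integrals with phase [phi]: the hypotheses are
    linear identities that both satisfy, and [delta01] is the equality of their leading terms. *)
Variable delta : nat -> (V -> C) -> C.
Hypothesis deltaE : forall k F G, (forall w, D w -> F w = G w) -> delta k F = delta k G.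
Hypothesis deltaD : forall k F G, smooth D F -> smooth D G -> delta k (fun w => F w + G w) = delta k F + delta k G.
Hypothesis deltaZ : forall k c F, smooth D F -> delta k (fun w => c * F w) = c * delta k F.
Hypothesis delta_order : forall k F, smooth D F -> van k.*2.+1 F z0 -> delta k F = 0.
Variable B : nat.
Hypothesis delta_ibp : forall k a F, (k <= B)%N -> smooth D F -> delta k (pd a F) + delta k.+1 (fun w => pd a phi w * F w) = 0.
Hypothesis delta_ibp0 : forall a F, smooth D F -> delta 0 (fun w => pd a phi w * F w) = 0.
Hypothesis delta_euler : forall k F, (k <= B)%N -> smooth D F -> (n + k)%:R * delta k F = - delta k.+1 (fun w => phi w * F w).
Hypothesis delta01 : delta 0 (fun=> 1) = 0.

Lemma delta_sum (T : Type) (r : seq T) k (F : T -> V -> C) : (forall i, smooth D (F i)) ->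
  delta k (fun w => \sum_(i <- r) F i w) = \sum_(i <- r) delta k (F i).
Proof.
move=> sF; have c0 := smooth_cst oD (0 : C); elim: r => [|i r IH].
  rewrite big_nil (deltaE k (G := fun w => 0 * 0)); first by rewrite deltaZ // mul0r.
  by move=> w _; rewrite big_nil mulr0.
rewrite big_cons -IH -deltaD //; last by apply: (smooth_sum oD) => j _.
by apply: deltaE => w _; rewrite big_cons.
Qed.

Lemma delta_rst k m G : smooth D G -> delta k G = \sum_b delta k (fun w => pd b phi w * quo m G b w) + delta k (rst m G).
Proof.
move=> sG; have sM b : smooth D (fun w => pd b phi w * quo m G b w).
  exact: (smoothM oD (smooth_pd oD b sphi) (smooth_quo m b sG)).
rewrite -delta_sum // -deltaD //; last exact: smooth_rst; last by apply: (smooth_sum oD) => b _.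
by apply: deltaE => w _; rewrite /rst addrC subrK.
Qed.

(** Induction towards high order of vanishing: [delta_order] kills functions vanishing to order 2k +
    1, and each step replaces G by [rst m G], which vanishes to one order more. *)
Lemma delta_downward k m0 : (0 < m0)%N ->
  (forall m G b, (m0 <= m)%N -> smooth D G -> van m G z0 -> delta k (fun w => pd b phi w * quo m G b w) = 0) ->
  forall G, smooth D G -> van m0 G z0 -> delta k G = 0.
Proof.
move=> m00 H; have [m0k|] := ltnP m0 k.*2.+1; last first.
  by move=> km G sG vG; apply: delta_order => //; exact: van_le vG.
suff A d m G : (k.*2.+1 - m <= d)%N -> (m0 <= m)%N -> smooth D G -> van m G z0 -> delta k G = 0.
  by move=> G; apply: (A k.*2.+1 m0) => //; rewrite leq_subr.
elim: d m G => [|d IH] m G dm mm sG vG.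
  by apply: delta_order => //; apply: van_le vG; move: dm; rewrite leqn0 subn_eq0.
rewrite (delta_rst k m sG) big1 ?add0r => [|b _]; last exact: H.
apply: (IH m.+1) => //; [by move: dm; lia|exact: leqW|exact: smooth_rst|].
by apply: van_rst => //; exact: leq_trans mm.
Qed.

(** Induction on the order. Integration by parts reduces delta at order k + 1 to G (z0) times its
    value at the density 1, and the Euler identity forces that value to be 0. *)
Lemma delta_eq0 k F : (k <= B)%N -> smooth D F -> delta k F = 0.
Proof.
have c1 := smooth_cst oD (1 : C).
elim: k F => [|k IH] F kB sF.
  have A G : smooth D G -> van 1 G z0 -> delta 0 G = 0.
    by apply: delta_downward => // m G' b _ sG' _; apply: delta_ibp0; exact: smooth_quo.
  have sF0 : smooth D (fun w => F w - F z0) by exact: (smoothB oD sF (smooth_cst oD _)).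
  rewrite (deltaE 0 (G := fun w => (F w - F z0) + F z0 * 1)); last by move=> w _; rewrite mulr1 subrK.
  rewrite deltaD //; last exact: (smoothZ oD).
  by rewrite deltaZ // delta01 mulr0 addr0 A //; apply: van1; rewrite subrr.
have A G : smooth D G -> van 1 G z0 -> delta k.+1 G = 0.
  apply: delta_downward => // m G' b _ sG' _.
  have sq := smooth_quo m b sG'; have := delta_ibp b (ltnW kB) sq; rewrite IH ?add0r //; first exact: ltnW.
  exact: (smooth_pd oD).
have val G : smooth D G -> delta k.+1 G = G z0 * delta k.+1 (fun=> 1).
  move=> sG; have sG0 : smooth D (fun w => G w - G z0) by exact: (smoothB oD sG (smooth_cst oD _)).
  rewrite (deltaE k.+1 (G := fun w => (G w - G z0) + G z0 * 1)); last by move=> w _; rewrite mulr1 subrK.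
  rewrite deltaD //; last exact: (smoothZ oD).
  by rewrite deltaZ // A ?add0r //; apply: van1; rewrite subrr.
have ibp b m G : smooth D G -> delta k.+2 (fun w => pd b phi w * quo m G b w) = - (pd b (quo m G b) z0 * delta k.+1 (fun=> 1)).
  move=> sG; have sq := smooth_quo m b sG; have := delta_ibp b kB sq.
  by rewrite (val _ (smooth_pd oD b sq)) => /eqP; rewrite addrC addr_eq0 => /eqP.
have pd_quo b m G : smooth D G -> pd b (quo m G b) z0 = m%:R^-1 * \sum_a N a b * pd a (pd b G) z0.
  move=> sG; rewrite (pdZ oD) //; last by apply: (smooth_sum oD) => a _; apply: (smoothZ oD); exact: (smooth_pd oD).
  congr (_ * _); rewrite (pd_sum oD) //; last by move=> a _; apply: (smoothZ oD); exact: (smooth_pd oD).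
  by apply: eq_bigr => a _; rewrite (pdZ oD) // ?(pdC oD b a) //; exact: (smooth_pd oD).
(* At order k + 2 the same descent starts from vanishing order 3, where the second derivatives
   produced by [pd_quo] vanish at [z0]. *)
have van3_0 G : smooth D G -> van 3 G z0 -> delta k.+2 G = 0.
  apply: delta_downward => // m G' b mm sG' vG'; rewrite ibp // pd_quo // big1 ?mulr0 ?mul0r ?oppr0 // => a _.
  rewrite (@van_val 0 (pd a (pd b G'))) ?mulr0 //; apply: van_pd => //; first exact: (smooth_pd oD).
  by apply: van_pd => //; exact: van_le vG'.
have hess a : \sum_b N a b * pd a (pd b phi) z0 = 1.
  have : mcoeff (mnm1 (unsplit a)) (\sum_b N a b *: TT (pd b phi) z0 1) = 1 by rewrite NE /X_ mcoeffX eqxx.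
  rewrite raddf_sum => <-.
  apply: eq_bigr => b _ /=; rewrite mcoeffZ; congr (_ * _); rewrite mcoeff_Tp mdeg1 /=.
  have sb := smooth_pd oD b sphi.
  have := tay_pd oD (mnm0 : multinom (n + n)) (unsplit a) Dz0 sb.
  by rewrite add0m mnm0E mulr1 unsplitK tay0 => ->.
have E := delta_euler kB c1.
rewrite val // (_ : delta k.+1 (fun=> 1) = 0) ?mulr0 //.
have phi1 : smooth D (fun w => phi w * 1) by exact: (smoothM oD sphi c1).
rewrite (deltaE k.+2 (G := phi)) in E; last by move=> w _; rewrite mulr1.
rewrite (delta_rst _ 2 sphi) (van3_0 _ (smooth_rst 2 sphi)) in E; last exact: van_rst.
rewrite addr0 (eq_bigr (fun b => - (2^-1 * (\sum_a N a b * pd a (pd b phi) z0) * delta k.+1 (fun=> 1)))) in E; last first.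
  by move=> b _; rewrite ibp // pd_quo.
rewrite sumrN -mulr_suml -mulr_sumr exchange_big /= in E.
rewrite (eq_bigr (fun=> 1)) in E; last by move=> a _; exact: hess.
rewrite sumr_const card_sum !card_ord opprK in E.
move: E; move: (delta k.+1 _) => x.
(* With x the value at the density 1, integrating phi by parts gives - n x, so the Euler identity
   reads (n + k + 1) x = n x. *)
rewrite (_ : 2^-1 * (n + n)%:R = n%:R :> C); last by rewrite addnn -muln2 natrM mulrC mulfK // pnatr_eq0.
by rewrite natrD mulrDl => /eqP; rewrite -subr_eq0 addrAC subrr add0r mulf_eq0 pnatr_eq0 /= => /eqP.
Qed.

End Uniqueness.

(** * Invariance under holomorphic changes of variables *)

Section VanishingJets.
Context {R : realType} {n : nat}.
Local Notation C := R[i].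
Local Notation V := 'rV[C]_n.
Local Notation P := (mpoly (n + n) C).
Local Notation dir := ('I_n + 'I_n)%type.
Implicit Types (F G : V -> C) (a b : dir) (D : set V) (S : pred bool).

(* Vanishing of the jets of order less than [m] along the directions of the
   sides selected by [S]. *)
Definition jvan S m G z := forall L, all (fun b => S (side b)) L -> (size L < m)%N -> pdL L G z = 0.

Lemma jvan_pd S m D G z a : open D -> D z -> smooth D G -> S (side a) -> jvan S m.+1 G z -> jvan S m (pd a G) z.
Proof.
move=> oD Dz sG Sa vG L aL Lm; rewrite -(pdL_cons_in oD Dz a L sG).
by apply: vG; rewrite /= ?Sa.
Qed.

Lemma jvan_mul S m D F G z : open D -> D z -> smooth D F -> smooth D G -> jvan S m F z ->
  jvan S m (fun w => F w * G w) z.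
Proof.
move=> oD Dz sF sG vF L aL Lm; apply: (pdL_mul_eq0 oD Dz (Q := fun b => S (side b)) sG sF) => // L' aL' LL.
by apply: vF => //; exact: leq_ltn_trans Lm.
Qed.

Lemma pdL_sum (T : Type) (r : seq T) D (F : T -> V -> C) L z : open D -> D z -> (forall i, smooth D (F i)) ->
  pdL L (fun w => \sum_(i <- r) F i w) z = \sum_(i <- r) pdL L (F i) z.
Proof.
move=> oD Dz sF; elim: L z Dz => //= a L IH w Dw.
rewrite (pd_eq oD a Dw IH) (pd_sum oD) // => i _; exact: (smooth_pdL oD).
Qed.

Lemma vanP m D G z : open D -> D z -> smooth D G -> van m G z <-> jvan predT m G z.
Proof.
move=> oD Dz sG; split=> [vG L _ Lm|vG j jm].
  rewrite (pdL_lst oD L Dz sG); set K := (X in wfact X).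
  have Km : mdeg K = size L.
    rewrite /K mdeg_sum; under eq_bigr do rewrite mdeg1.
    by rewrite sum1_size.
  have := congr1 (mcoeff K) (vG _ Lm); rewrite mcoeff_Tp mcoeff0 Km eqxx /= => ->; exact: mulr0.
apply/mpolyP => K; rewrite mcoeff_Tp mcoeff0; case: (mdeg K =P j) => //= Kj.
rewrite /tay vG ?mulr0 //; first by apply/allP.
suff -> : size (lst K) = mdeg K by rewrite Kj.
Transparent lst.
rewrite /lst size_cat mdeg_degy degy_p1 degyb_p2.
by have := size_lsn false (p1 K); have := size_lsn true (p2 K) => /= -> ->.
Opaque lst.
Qed.

(** The chain rule for a holomorphic map stays on one side, so the jets selected by [S] only involve
    jets of F selected by [S]. *)
Lemma jvan_comp S m Dc Dd (sg : V -> V) F w : open Dc -> open Dd -> (forall v, Dd v -> Dc (sg v)) ->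
  holomorphic Dd sg -> Dd w -> smooth Dc F -> jvan S m F (sg w) -> jvan S m (F \o sg) w.
Proof.
move=> oc od sgD hsg Dw; elim: m F => [|m IH] F sF vF L //.
case: L => [|a L] /=; first by move=> _ _; exact: (vF [::]).
move=> /andP[Sa aL] Lm; have sFs := smooth_comp oc od sgD hsg sF.
etransitivity; first exact: (pdL_cons_in od Dw a L sFs).
have aE : a = dirs (side a) (cidx a) by case: (a).
have E v : Dd v -> pd a (F \o sg) v = \sum_i Bm sg (side a) v (cidx a) i * pd (dirs (side a) i) F (sg v).
  by move=> Dv; rewrite {1}aE; exact: (pd_comp oc od sgD hsg).
rewrite (pdL_eq od L E Dw).
have si i := smooth_pd oc (dirs (side a) i) sF.
have sci i := smooth_comp oc od sgD hsg (si i).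
have sB i := smooth_Bm od hsg (side a) (cidx a) i.
etransitivity; first exact: (pdL_sum (index_enum 'I_n) L od Dw (fun i => smoothM od (sB i) (sci i))).
rewrite big1 // => i _.
transitivity (pdL L (fun v => pd (dirs (side a) i) F (sg v) * Bm sg (side a) v (cidx a) i) w).
  by apply: (pdL_eq od L _ Dw) => v _; rewrite mulrC.
suff H : jvan S m (fun v => pd (dirs (side a) i) F (sg v) * Bm sg (side a) v (cidx a) i) w by exact: (H L aL Lm).
apply: (jvan_mul od Dw (sci i) (sB i)); apply: IH => //; apply: (jvan_pd oc (sgD _ Dw) sF _ vF).
suff -> : side (dirs (side a) i) = side a by [].
by case: (side a).
Qed.

End VanishingJets.

(** * Functions depending on one kind of variables only *)

Section OneSidedRepresentative.
Context {R : realType} {n : nat}.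
Local Notation C := R[i].
Local Notation V := 'rV[C]_n.
Local Notation P := (mpoly (n + n) C).
Local Notation dir := ('I_n + 'I_n)%type.
Variable D : set V.
Hypothesis oD : open D.
Implicit Types (F f : V -> C) (s : bool).

(* A polynomial in the coordinates of the side [s] only, with the same pure
   jet as [f]. *)
Definition holrep s m f z := pev z (\sum_(i < m) Tp (pure s) f z i).

Lemma smooth_holrep s m f z : smooth D (holrep s m f z).
Proof. exact: (smooth_sub (@subsetT _ D) (smooth_pev _ _)). Qed.

Lemma mcoeff_holrep s m f z K : mcoeff K (\sum_(i < m) Tp (pure s) f z i) =
  if (mdeg K < m)%N && pure s K then tay f z K else 0.
Proof.
rewrite raddf_sum /=; have [Kk|kK] := ltnP.
  rewrite (bigD1 (Ordinal Kk)) //= mcoeff_Tp eqxx /= big1 ?addr0 // => d dK.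
  by rewrite mcoeff_Tp; case: eqP => //= E; case/eqP: dK; apply: val_inj.
by rewrite big1 // => d _; rewrite mcoeff_Tp; case: eqP => // E; have := ltn_ord d; rewrite -E ltnNge kK.
Qed.

Lemma pd_holrep s m f z j w : pd (dirs (~~ s) j) (holrep s m f z) w = 0.
Proof.
rewrite pd_pev (_ : mderiv _ _ = 0) ?/pev ?meval0 //; apply/mpolyP => K.
rewrite mcoeff_mderiv mcoeff_holrep mcoeff0 pureD pure1.
by case: s; rewrite /= !andbF mul0rn.
Qed.

Lemma jvan_holrep s m f z : D z -> smooth D f -> jvan (pred1 s) m (fun w => holrep s m f z w - f w) z.
Proof.
move=> Dz sf L aL Lm; have sh := smooth_holrep s m f z.
have pdLB L' h g w : D w -> smooth D h -> smooth D g -> pdL L' (fun w => h w - g w) w = pdL L' h w - pdL L' g w.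
  move=> + s1 s2; elim: L' w => // b L' IH w Dw /=.
  by rewrite (pd_eq oD b Dw IH) (pdB oD b Dw (smooth_pdL oD _ s1) (smooth_pdL oD _ s2)).
rewrite (pdLB _ _ _ _ Dz sh sf) (pdL_lst oD L Dz sh) (pdL_lst oD L Dz sf) -mulrBr.
set K := (\big[_/_]_(_ <- _) _).
have Kd : (mdeg K < m)%N.
  rewrite /K mdeg_sum; under eq_bigr do rewrite mdeg1.
  by rewrite sum1_size.
have Kp : pure s K.
  rewrite /K; elim: L aL {Lm K Kd} => [|b L' IH] /=; first by rewrite big_nil pure0.
  by move=> /andP[/eqP sb aL']; rewrite big_cons pureD pure1 sb eqxx IH.
by rewrite tay_pev mcoeff_holrep Kd Kp subrr mulr0.
Qed.

(** A function without derivatives on the other side has only pure Taylor coefficients, and these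
    are those of f. The one-sided series in the product thus become Taylor series of functions,
    which can be composed with maps. *)
Lemma TT_holrep s m f F z i : D z -> smooth D f -> smooth D F ->
  (forall j w, D w -> pd (dirs (~~ s) j) F w = 0) -> jvan (pred1 s) m (fun w => F w - f w) z ->
  (i < m)%N -> TT F z i = Tp (pure s) f z i.
Proof.
move=> Dz sf sF F0 J im; apply/mpolyP => K; rewrite !mcoeff_Tp andbT.
case: (mdeg K =P i) => //= Ki; have [pK|npK] := boolP (pure s K).
  have pdLB L' h g w : D w -> smooth D h -> smooth D g -> pdL L' (fun w => h w - g w) w = pdL L' h w - pdL L' g w.
    move=> + s1 s2; elim: L' w => // b L' IH w Dw /=.
    by rewrite (pd_eq oD b Dw IH) (pdB oD b Dw (smooth_pdL oD _ s1) (smooth_pdL oD _ s2)).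
  rewrite /tay; congr (_ * _); apply/eqP; rewrite -subr_eq0 -(pdLB _ _ _ _ Dz sF sf); apply/eqP.
  apply: J; first by rewrite (pureE pK) lst_emb; exact: side_lsn.
  by rewrite (pureE pK) lst_emb size_lsn -(mdeg_emb s) -(pureE pK) Ki.
have [b /andP[sb Kb]] : exists b, (side b == ~~ s) && (0 < K (unsplit b))%N.
  apply/existsP; apply: contraNT npK; rewrite negb_exists => /forallP H.
  suff -> : K = \big[@mnm_add _/@mnm0 _]_(b : dir | side b == s) \big[@mnm_add _/@mnm0 _]_(i < K (unsplit b)) mnm1 (unsplit b).
    elim/big_rec: _ => [|b x sb px]; first exact: pure0.
    rewrite pureD px andbT; elim/big_rec: _ => [|j y _ py]; first exact: pure0.
    by rewrite pureD py andbT pure1 eq_sym.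
  apply/mnmP => x; rewrite -[x]splitK; move: (fintype.split x) => {x} b.
  rewrite mnm_sumE; have [sb|sb] := boolP (side b == s).
    rewrite (bigD1 b) //= mnm_sumE [X in _ = (_ + X)%N]big1 ?addn0.
      by under eq_bigr do rewrite mnm1E eqxx; rewrite sum1_card card_ord.
    move=> c /andP[_ cb]; rewrite mnm_sumE big1 // => j _; rewrite mnm1E.
    by rewrite (can_eq (@unsplitK n n)) (negbTE cb).
  rewrite big1; last first.
    move=> c sc; rewrite mnm_sumE big1 // => j _; rewrite mnm1E (can_eq (@unsplitK n n)).
    by case: eqP => // cb; rewrite -cb sc in sb.
  have := H b; rewrite negb_and -eqn0Ngt => /orP[|/eqP//]; by move: sb; case: (side b); case: (s).
have bE : b = dirs (~~ s) (cidx b) by move: sb; case: (b) => j; case: (s).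
have c0 : ((mnm_sub K (mnm1 (unsplit b)) (unsplit b)).+1%:R : C) != 0 by rewrite pnatr_eq0.
rewrite -(mnm_subK Kb); apply: (mulIf c0); rewrite (tay_pd oD) // unsplitK mul0r.
rewrite (tay_eq oD (g := fun=> 0)) //; last by move=> w Dw; rewrite bE; exact: F0.
rewrite /tay (_ : pdL _ _ _ = 0) ?mulr0 //.
by elim: (lst _) (z) Dz => //= a L IH w Dw; rewrite (pd_eq oD a Dw IH) pd_cst.
Qed.

End OneSidedRepresentative.

(** * The formal integral of a density *)

Section IntegralFunctional.
Context {R : realType} {n : nat}.
Local Notation C := R[i].
Local Notation V := 'rV[C]_n.
Local Notation P := (mpoly (n + n) C).
Local Notation dir := ('I_n + 'I_n)%type.
Variable D : set V.
Hypothesis oD : open D.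
Variable Phi : V -> C.
Hypothesis sPhi : smooth D Phi.
Hypothesis uH : forall z, D z -> hmx Phi z \in unitmx.
Implicit Types (f g F G : V -> C) (z : V) (a b : dir).

(* The formal integral of the density [F]. *)
Definition It k F z : C := Lam Phi (fun w => TT F w) z k.*2.

Lemma ItE k F z : It k F z = gint (hmx Phi z) (serS Phi z) (TT F z) k.*2 / \det (hmx Phi z).
Proof. by []. Qed.

Lemma It_ext k F G z : (forall i, (i <= k.*2)%N -> TT F z i = TT G z i) -> It k F z = It k G z.
Proof.
move=> FG; rewrite !ItE; apply: (congr1 (fun p => gaussE (hmx Phi z) p / \det (hmx Phi z))).
by apply: (eq_fps_mul (b := fps_exp (serS Phi z)) _ (fun i _ => erefl)) => i ik; exact: FG.
Qed.

Lemma It_eq k F G z : D z -> (forall w, D w -> F w = G w) -> It k F z = It k G z.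
Proof.
move=> Dz FG; apply: It_ext => i _; apply: eq_Tp => // K; exact: (tay_eq oD).
Qed.

Lemma ItD k F G z : D z -> smooth D F -> smooth D G -> It k (fun w => F w + G w) z = It k F z + It k G z.
Proof.
move=> Dz sF sG; rewrite !ItE -mulrDl -gintD; congr (gaussE _ (fps_mul _ _ _) / _).
by apply/funext => i; exact: (TTD oD).
Qed.

Lemma ItZ k c F z : D z -> smooth D F -> It k (fun w => c * F w) z = c * It k F z.
Proof.
move=> Dz sF; rewrite !ItE mulrA -gintZ; congr (gaussE _ (fps_mul _ _ _) / _).
by apply/funext => i; exact: (TTZ oD).
Qed.

Lemma It_van k F z : van k.*2.+1 F z -> It k F z = 0.
Proof.
move=> vF; rewrite ItE /gint fps_mul_eq0 ?raddf0 ?mul0r // => i ik; exact: vF.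
Qed.

Opaque It.

Lemma It_sum (T : Type) (r : seq T) k (F : T -> V -> C) z : D z -> (forall i, smooth D (F i)) ->
  It k (fun w => \sum_(i <- r) F i w) z = \sum_(i <- r) It k (F i) z.
Proof.
move=> Dz sF; have c0 := smooth_cst oD (0 : C); elim: r => [|i r IH].
  rewrite big_nil (@It_eq k _ (fun w => 0 * 0) z Dz) ?ItZ ?mul0r // => w _; by rewrite big_nil.
have sS : smooth D (fun w => \sum_(i <- r) F i w) by apply: (smooth_sum oD) => j _.
rewrite big_cons -IH; etransitivity; last exact: (ItD k Dz (sF i) sS).
by apply: It_eq => // w _; rewrite big_cons.
Qed.

Transparent It.
Lemma It0 F z : It 0 F z = F z / \det (hmx Phi z).
Proof.
rewrite ItE /gint /fps_mul big_ord1 fps_exp0 mulr1 TT0; congr (_ / _).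
have gZ c (r : P) : gaussE (hmx Phi z) (c *: r) = c * gaussE (hmx Phi z) r by rewrite linearZ.
by rewrite gZ gaussE1 mulr1.
Qed.
Opaque It.

Section Gauged.
Variables (z0 : V) (M : nat).
Hypothesis Dz0 : D z0.
Hypothesis gauge : forall s, jvan (pred1 s) M.+1 Phi z0.

Let phi w := - Phi w.

Lemma sphi : smooth D phi. Proof. exact: (smoothN oD). Qed.

(** In the gauge the pure jets of Phi vanish up to order M, so the mixed part is the whole Taylor
    polynomial and the phase is an ordinary function. *)
Lemma TT_phi i : (i <= M)%N -> TT phi z0 i = - Tp mix Phi z0 i.
Proof.
move=> iM; apply/mpolyP => K; rewrite mcoeffN !mcoeff_Tp andbT; case: (mdeg K =P i) => [Ki|_] /=; last by rewrite oppr0.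
transitivity (- tay Phi z0 K).
  rewrite /tay -mulrN; congr (_ * _); elim: (lst K) (z0) Dz0 => //= b L IH w Dw.
  by rewrite (pd_eq oD b Dw IH) (pdN oD) //; exact: (smooth_pdL oD).
case: ifP => // /negbT mK; congr (- _); rewrite /tay.
have [s pK] : exists s, pure s K.
  move: mK; rewrite /mix /pure negb_and -!eqn0Ngt => /orP[] H; [by exists true|by exists false].
suff -> : pdL (lst K) Phi z0 = 0 by rewrite mulr0.
rewrite (pureE pK) lst_emb; apply: (@gauge s); first exact: side_lsn.
by rewrite size_lsn -(mdeg_emb s) -(pureE pK) Ki ltnS.
Qed.

Lemma phase_TT i : (i.+2 <= M)%N -> phase (hmx Phi z0) (serS Phi z0) i = TT phi z0 i.+2.
Proof. by move=> iM; rewrite TT_phi // (phase_Tp oD). Qed.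

Lemma van2_phi : (1 <= M)%N -> van 2 phi z0.
Proof.
move=> M1 j j2; rewrite TT_phi; last by lia.
apply/mpolyP => K; rewrite mcoeffN mcoeff0 mcoeff_Tp /mix.
have := mdeg_degy K; case: (mdeg K =P j) => [Kj|_]; last by rewrite oppr0.
by move=> E; case: ifP => [/= /andP[]|_]; rewrite ?oppr0 //; lia.
Qed.

(** The order k + 1 involves the Taylor polynomial of phi up to degree 2k + 3, whence the bound on
    M. *)
Lemma It_ibp k a F : (k.*2.+3 <= M)%N -> smooth D F -> It k (pd a F) z0 + It k.+1 (fun w => pd a phi w * F w) z0 = 0.
Proof.
move=> kM sF; have sa := smooth_pd oD a sphi.
rewrite !ItE -mulrDl [X in X / _](_ : _ = 0) ?mul0r //; apply/eqP; rewrite addr_eq0; apply/eqP.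
set H := hmx Phi z0; set S := serS Phi z0.
have := gint_ibp (TT F z0) (unsplit a) k.*2.+1 (uH Dz0) (serS0 Phi z0); rewrite -/H -/S.
set Y := fun i => mderiv (unsplit a) (phase H S i).
have -> : gint H S (fun i => mderiv (unsplit a) (TT F z0 i)) k.*2.+1 = gint H S (TT (pd a F) z0) k.*2.
  rewrite /gint fps_mul_shift; last exact: mderiv_Tp0.
  by congr (gaussE _ (fps_mul _ _ _)); apply/funext => i; exact: (mderiv_TT oD).
move=> ->; congr (- _); rewrite /gint doubleS.
have -> : TT (fun w => pd a phi w * F w) z0 = fps_mul (TT (pd a phi) z0) (TT F z0).
  by apply/funext => i; exact: (TTM oD).
rewrite -!fps_mulA [in RHS]fps_mul_shift; last first.
  by apply: (van_pd oD a Dz0 sphi (van2_phi _)) => //; lia.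
congr (gaussE _ _); apply: eq_fps_mul => // i ik.
by rewrite /Y phase_TT ?(mderiv_TT oD) //; [exact: sphi|lia].
Qed.

Lemma It_ibp0 a F : (1 <= M)%N -> It 0 (fun w => pd a phi w * F w) z0 = 0.
Proof.
move=> M1; rewrite It0 (@van_val _ _ 0 (pd a phi)) ?mul0r //.
exact: (van_pd oD a Dz0 sphi (van2_phi M1)).
Qed.

Lemma It_euler k F : (k.*2.+2 <= M)%N -> smooth D F -> (n + k)%:R * It k F z0 = - It k.+1 (fun w => phi w * F w) z0.
Proof.
move=> kM sF; rewrite !ItE mulrA -mulNr; congr (_ / _).
set H := hmx Phi z0; set S := serS Phi z0.
have := gint_euler k.*2 (uH Dz0) (serS0 Phi z0) (homog_serS Phi z0) (fun i => homog_Tp (fun=> true) F z0 i).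
rewrite -/H -/S -/(TT F z0).
have -> : gint H S (fps_mul (phase H S) (TT F z0)) k.*2 = gint H S (TT (fun w => phi w * F w) z0) k.+1.*2.
  have -> : TT (fun w => phi w * F w) z0 = fps_mul (TT phi z0) (TT F z0).
    by apply/funext => i; exact: (TTM oD _ Dz0 sphi).
  have v2 := van2_phi (leq_trans _ kM : (1 <= M)%N).
  rewrite /gint doubleS -!fps_mulA [in RHS]fps_mul_shift; last exact: v2.
  rewrite [in RHS]fps_mul_shift; last exact: v2.
  congr (gaussE _ _); apply: eq_fps_mul => // i ik.
  by rewrite phase_TT //; lia.
have two : (2 : C) != 0 by rewrite pnatr_eq0.
rewrite (_ : (n + n + k.*2)%:R = 2 * (n + k)%:R :> C); last by rewrite -natrM; congr (_%:R); lia.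
move: (gint _ _ _ _) (gint _ _ _ _) => x y E; apply: (mulfI two).
by rewrite mulrN E opprK mulrA.
Qed.

(** The inverse Hessian of - Phi: the gauge removes the pure second derivatives, so only the
    off-diagonal blocks - H remain to be inverted. *)
Definition invHess a b : C := match a, b with
  | inl k, inr j => - hinv (hmx Phi z0) k j
  | inr k, inl i => - hinv (hmx Phi z0) i k
  | _, _ => 0 end.

Lemma invHessE a : (2 <= M)%N -> \sum_b invHess a b *: TT (pd b phi) z0 1 = X_ (unsplit a).
Proof.
move=> M2; have E b : TT (pd b phi) z0 1 = - mderiv (unsplit b) (quad (hmx Phi z0)).
  by rewrite -(mderiv_TT oD 1 b Dz0 sphi) TT_phi // mderivN (quad_Tp oD).
under eq_bigr do rewrite E.
rewrite big_sumType /=; case: a => k /=.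
  rewrite big1 ?add0r => [|i _]; last by rewrite scale0r.
  rewrite (eq_bigr (fun j => \sum_i (hinv (hmx Phi z0) k j * hmx Phi z0 i j) *: X_ (lshift n i))); last first.
    by move=> j _; rewrite mderiv_quad_ybar scaleNr scalerN opprK scaler_sumr; apply: eq_bigr => i _; rewrite scalerA.
  rewrite exchange_big (bigD1 k) //= -scaler_suml hinv_mulr ?uH // eqxx scale1r big1 ?addr0 // => i ik.
  by rewrite -scaler_suml hinv_mulr ?uH // eq_sym (negbTE ik) scale0r.
rewrite [X in _ + X]big1 ?addr0 => [|i _]; last by rewrite scale0r.
rewrite (eq_bigr (fun i => \sum_j (hmx Phi z0 i j * hinv (hmx Phi z0) i k) *: X_ (rshift n j))); last first.
  by move=> i _; rewrite mderiv_quad_y scaleNr scalerN opprK scaler_sumr; apply: eq_bigr => j _; rewrite scalerA mulrC.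
rewrite exchange_big (bigD1 k) //= -scaler_suml hinv_mull ?uH // eqxx scale1r big1 ?addr0 // => j jk.
by rewrite -scaler_suml hinv_mull ?uH // (negbTE jk) scale0r.
Qed.

End Gauged.

Lemma prd_It k f g fh gh z : D z -> smooth D fh -> smooth D gh ->
  (forall i, (i <= k.*2)%N -> TT fh z i = Tp (pure true) f z i) ->
  (forall i, (i <= k.*2)%N -> TT gh z i = Tp (pure false) g z i) ->
  prd Phi true k f g z = It k (fun w => fh w * gh w * \det (hmx Phi w)) z.
Proof.
move=> Dz sf sg Ef Eg; have smu := smooth_mu oD sPhi.
Transparent prd.
rewrite /prd /bul /Lam ItE; congr (gaussE _ _ / _).
apply: eq_fps_mul => // i ik; rewrite [RHS](TTM oD _ Dz (smoothM oD sf sg) smu) /bulG.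
apply: eq_fps_mul => // j ji; rewrite (TTM oD _ Dz sf sg); have jk := leq_trans ji ik.
by apply: eq_fps_mul => l lj; rewrite ?Ef ?Eg //; exact: leq_trans jk.
Opaque prd.
Qed.

End IntegralFunctional.

(** * Behaviour of the formal integral under a holomorphic map *)

Section Invariance.
Context {R : realType} {n : nat}.
Local Notation C := R[i].
Local Notation V := 'rV[C]_n.
Local Notation P := (mpoly (n + n) C).
Local Notation dir := ('I_n + 'I_n)%type.
Variables (Dc Dd : set V) (sg : V -> V).
Hypothesis oc : open Dc.
Hypothesis od : open Dd.
Hypothesis sgD : forall w, Dd w -> Dc (sg w).
Hypothesis hsg : holomorphic Dd sg.
Implicit Types (f g F G : V -> C) (z w : V) (a : dir) (b : 'I_n).

Let B := Bm sg.
Let smB := smooth_Bm od hsg.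
Let smC F (sF : smooth Dc F) : smooth Dd (F \o sg) := smooth_comp oc od sgD hsg sF.

Section Unit.
Hypothesis uB : forall s w, Dd w -> B s w \in unitmx.

(** The Jacobian determinant of the map on the underlying real space. *)
Definition jac w : C := \det (Bm sg true w) * \det (Bm sg false w).

Lemma smooth_detB s : smooth Dd (fun w => \det (B s w)).
Proof. exact: (smooth_det od (fun i j => smB s i j)). Qed.

Lemma smooth_jac : smooth Dd jac.
Proof. exact: (smoothM od (smooth_detB true) (smooth_detB false)). Qed.

Lemma smooth_hB s b i : smooth Dd (fun w => hinv (B s w) b i).
Proof. exact: (smooth_hinv od (fun i j => smB s i j) (fun w => @uB s w)). Qed.

Lemma jacE s w : jac w = \det (B s w) * \det (B (~~ s) w).
Proof. by rewrite /jac /B; case: s => //=; exact: mulrC. Qed.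

(** The Piola identity. The derivatives of the determinant and of the inverse matrix cancel by the
    symmetry [Bm_sym]; the determinant of the other side is constant in these directions. *)
Lemma piola s i w : Dd w -> \sum_b pd (dirs s b) (fun w => jac w * hinv (B s w) b i) w = 0.
Proof.
move=> Dw; pose H' b w := \matrix_(x, y) pd (dirs s b) (fun w => B s w x y) w.
have H'E b x y v : H' b v x y = pd (dirs s b) (fun w => B s w x y) v by exact: mxE.
have d0 b : pd (dirs s b) (fun w => \det (B (~~ s) w)) w = 0.
  rewrite (pd_det od (H' := fun=> 0) (fun i j => smB (~~ s) i j) _ (fun w => @uB (~~ s) w) Dw).
    by rewrite big1 ?mulr0 // => x _; rewrite big1 // => y _; rewrite mxE mul0r.
  by move=> x y v Dv; rewrite mxE -{1}[s]negbK; exact: (pd_Bm0 od hsg).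
have E b : pd (dirs s b) (fun w => jac w * hinv (B s w) b i) w = jac w *
    (\sum_x \sum_y H' b w x y * hinv (B s w) x y * hinv (B s w) b i - \sum_j \sum_k hinv (B s w) b j * H' b w k j * hinv (B s w) k i).
  rewrite (pdM _ Dw smooth_jac (smooth_hB s b i)).
  rewrite (pd_hinv od (H' := H' b) (fun i j => smB s i j) (fun i j w _ => esym (H'E b i j w)) (fun w => @uB s w) b i Dw).
  rewrite (pd_eq od (dirs s b) (G := fun w => \det (B s w) * \det (B (~~ s) w)) Dw); last by move=> v _; exact: jacE.
  rewrite (pdM _ Dw (smooth_detB s) (smooth_detB (~~ s))) d0 mulr0 addr0.
  rewrite (pd_det od (H' := H' b) (fun i j => smB s i j) (fun i j w _ => esym (H'E b i j w)) (fun w => @uB s w) Dw).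
  rewrite (jacE s) mulrBr mulrN; congr (_ - _).
      rewrite (_ : \sum_x \sum_y H' b w x y * hinv (B s w) x y * hinv (B s w) b i = (\sum_x \sum_y H' b w x y * hinv (B s w) x y) * hinv (B s w) b i).
    move: (\sum_x _) (\det _) (\det _) (hinv _ _ _) => x1 x2 x3 x4; ring.
  by rewrite mulr_suml; apply: eq_bigr => x _; rewrite mulr_suml.
rewrite (eq_bigr _ (fun b _ => E b)) -mulr_sumr sumrB.
rewrite [X in _ - X](_ : _ = \sum_b \sum_x \sum_y H' b w x y * hinv (B s w) x y * hinv (B s w) b i) ?subrr ?mulr0 //.
transitivity (\sum_b \sum_k \sum_j hinv (B s w) b j * H' b w k j * hinv (B s w) k i).
  by apply: eq_bigr => b _; exact: exchange_big.
rewrite exchange_big; apply: eq_bigr => k _; apply: eq_bigr => b _; apply: eq_bigr => j _.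
rewrite !H'E (Bm_sym od hsg s k b j Dw : pd (dirs s b) (fun w => B s w k j) w = pd (dirs s k) (fun w => B s w b j) w).
by rewrite mulrC [hinv _ b j * _]mulrC mulrC.
Qed.

End Unit.

Variable Phi : V -> C.
Hypothesis sPhi : smooth Dc Phi.
Hypothesis uc : forall z, Dc z -> hmx Phi z \in unitmx.
Hypothesis ud : forall w, Dd w -> hmx (Phi \o sg) w \in unitmx.

Let sPd : smooth Dd (Phi \o sg) := smC sPhi.

Lemma hmx_comp_mx w : Dd w -> hmx (Phi \o sg) w = B false w *m hmx Phi (sg w) *m (B true w)^T.
Proof.
move=> Dw; apply/matrixP => i j; rewrite [LHS](hmx_comp oc od sgD hsg) // mxE exchange_big.
apply: eq_bigr => l _; rewrite !mxE mulr_suml; apply: eq_bigr => k _.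
by rewrite /B !BmE [LHS]mulrAC.
Qed.

Lemma det_comp w : Dd w -> \det (hmx (Phi \o sg) w) = jac w * \det (hmx Phi (sg w)).
Proof.
move=> Dw; rewrite hmx_comp_mx // !det_mulmx det_tr /jac /B.
move: (\det _) (\det _) (\det _) => x y z; ring.
Qed.

Lemma unit_B s w : Dd w -> B s w \in unitmx.
Proof.
move=> Dw; have := ud Dw; rewrite !unitmxE !unitfE det_comp // (jacE s) !mulf_eq0 !negb_or => /andP[/andP[h _] _].
exact: h.
Qed.

Lemma pd_back s i F w : Dd w -> smooth Dc F ->
  pd (dirs s i) F (sg w) = \sum_b hinv (B s w) b i * pd (dirs s b) (F \o sg) w.
Proof.
move=> Dw sF.
rewrite (eq_bigr (fun b => \sum_j (B s w b j * hinv (B s w) b i) * pd (dirs s j) F (sg w))); last first.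
  by move=> b _; rewrite (pd_comp oc od sgD hsg) // mulr_sumr; apply: eq_bigr => j _; rewrite mulrA [hinv _ _ _ * _]mulrC.
rewrite exchange_big (bigD1 i) //= -mulr_suml hinv_mull ?unit_B // eqxx mul1r big1 ?addr0 // => j ji.
by rewrite -mulr_suml hinv_mull ?unit_B // (negbTE ji) mul0r.
Qed.

Section AtPoint.
Variables (w0 : V) (M : nat).
Hypothesis Dw0 : Dd w0.
Hypothesis gauge : forall s, jvan (pred1 s) M.+1 Phi (sg w0).

Let z0 := sg w0.
Let Dz0 : Dc z0 := sgD Dw0.
Let phi w := - Phi w.
Let sph : smooth Dc phi := smoothN oc sPhi.
Let gauged s : jvan (pred1 s) M.+1 (Phi \o sg) w0 := jvan_comp oc od sgD hsg Dw0 sPhi (@gauge s).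

Definition push F w := jac w * F (sg w).

Lemma smooth_push F : smooth Dc F -> smooth Dd (push F).
Proof. by move=> sF; exact: (smoothM od smooth_jac (smC sF)). Qed.

(** By [piola] the transported derivative is a sum of total derivatives of the [Q b], and the chain
    rule turns the derivative of phi into that of the transported phase; [It_ibp] applies to each
    [Q b]. *)
Lemma push_ibp k s i F : (k.*2.+3 <= M)%N -> smooth Dc F ->
  It (Phi \o sg) k (push (pd (dirs s i) F)) w0 + It (Phi \o sg) k.+1 (push (fun w => pd (dirs s i) phi w * F w)) w0 = 0.
Proof.
move=> kM sF; pose Q b w := jac w * hinv (B s w) b i * F (sg w).
have sjh b : smooth Dd (fun w => jac w * hinv (B s w) b i) by exact: (smoothM od smooth_jac (smooth_hB unit_B s b i)).
have sQ b : smooth Dd (Q b) by exact: (smoothM od (sjh b) (smC sF)).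
have sphd : smooth Dd (fun w => - (Phi \o sg) w) := smoothN od sPd.
have E1 w : Dd w -> push (pd (dirs s i) F) w = \sum_b pd (dirs s b) (Q b) w.
  move=> Dw; rewrite /push pd_back //.
  rewrite [RHS](eq_bigr (fun b => pd (dirs s b) (fun w => jac w * hinv (B s w) b i) w * F (sg w) +
     jac w * hinv (B s w) b i * pd (dirs s b) (F \o sg) w)); last first.
    by move=> b _; exact: (pdM (dirs s b) Dw (sjh b) (smC sF)).
  rewrite big_split /= -mulr_suml piola //; last exact: unit_B.
  by rewrite mul0r add0r mulr_sumr; apply: eq_bigr => b _; rewrite mulrA.
have E2 w : Dd w -> push (fun w => pd (dirs s i) phi w * F w) w = \sum_b pd (dirs s b) (fun w => - (Phi \o sg) w) w * Q b w.
  move=> Dw; rewrite /push (pd_back s i Dw sph) mulr_suml mulr_sumr; apply: eq_bigr => b _.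
  rewrite /Q (_ : pd (dirs s b) (phi \o sg) w = pd (dirs s b) (fun w => - (Phi \o sg) w) w) //.
  move: (jac w) (hinv _ _ _) (pd _ _ _) (F _) => x1 x2 x3 x4; ring.
have sp b : smooth Dd (pd (dirs s b) (Q b)) by exact: (smooth_pd od).
have sm b : smooth Dd (fun w => pd (dirs s b) (fun w => - (Phi \o sg) w) w * Q b w).
  exact: (smoothM od (smooth_pd od (dirs s b) sphd) (sQ b)).
rewrite (It_eq od (Phi \o sg) k Dw0 E1) (It_eq od (Phi \o sg) k.+1 Dw0 E2).
rewrite (It_sum od (Phi \o sg) _ k Dw0 sp) (It_sum od (Phi \o sg) _ k.+1 Dw0 sm) -big_split /= big1 // => b _.
exact: (It_ibp od sPd ud Dw0 gauged (dirs s b) kM (sQ b)).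
Qed.

Definition dlt k F : C := It Phi k F z0 - It (Phi \o sg) k (push F) w0.

(** The difference of the two integrals meets the hypotheses of [delta_eq0]; the bound on M pays for
    integration by parts up to order k. *)
Lemma dlt_eq0 k F : (k.*2.+3 <= M)%N -> smooth Dc F -> dlt k F = 0.
Proof.
move=> kM sF; have M2 : (2 <= M)%N by lia.
have M1 : (1 <= M)%N by lia.
have gz s : jvan (pred1 s) M.+1 Phi z0 := @gauge s.
have vphi : van 2 phi z0 := van2_phi oc sPhi Dz0 gz M1.
have NE a := invHessE oc sPhi uc Dz0 gz a M2.
have jB j : (j <= k)%N -> (j.*2.+3 <= M)%N by lia.
have sphd : smooth Dd (fun w => - (Phi \o sg) w) := smoothN od sPd.
have dE j F1 F2 : (forall w, Dc w -> F1 w = F2 w) -> dlt j F1 = dlt j F2.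
  move=> E; have e1 := It_eq oc Phi j Dz0 E.
  have E' w : Dd w -> push F1 w = push F2 w by move=> Dw; rewrite /push (E _ (sgD Dw)).
  exact: (congr2 (fun x y : C => x - y) e1 (It_eq od (Phi \o sg) j Dw0 E')).
have dD j F1 F2 : smooth Dc F1 -> smooth Dc F2 -> dlt j (fun w => F1 w + F2 w) = dlt j F1 + dlt j F2.
  move=> s1 s2; rewrite /dlt (ItD oc Phi j Dz0 s1 s2).
  rewrite (It_eq od (Phi \o sg) j (G := fun w => push F1 w + push F2 w) Dw0); last by move=> w _; exact: mulrDr.
  rewrite (ItD od (Phi \o sg) j Dw0 (smooth_push s1) (smooth_push s2)).
  by rewrite opprD addrACA.
have dZ j c F1 : smooth Dc F1 -> dlt j (fun w => c * F1 w) = c * dlt j F1.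
  move=> s1; rewrite /dlt (ItZ oc Phi j c Dz0 s1).
  rewrite (It_eq od (Phi \o sg) j (G := fun w => c * push F1 w) Dw0); last by move=> w _; exact: mulrCA.
  by rewrite (ItZ od (Phi \o sg) j c Dw0 (smooth_push s1)) mulrBr.
have pushJ m F1 : smooth Dc F1 -> van m F1 z0 -> van m (push F1) w0.
  move=> s1 /(vanP m oc Dz0 s1) v1; apply/(vanP m od Dw0 (smooth_push s1)).
  suff H : jvan predT m (fun w => F1 (sg w) * jac w) w0.
    move=> L aL Lm; rewrite -[RHS](H L aL Lm); apply: (pdL_eq od L _ Dw0) => w _; exact: mulrC.
  exact: (jvan_mul od Dw0 (smC s1) smooth_jac (jvan_comp oc od sgD hsg Dw0 s1 v1)).
have dO j F1 : smooth Dc F1 -> van j.*2.+1 F1 z0 -> dlt j F1 = 0.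
  move=> s1 v1; rewrite /dlt (It_van Phi v1) (It_van (Phi \o sg) (pushJ _ _ s1 v1)).
  exact: subrr.
have dI j a F1 : (j <= k)%N -> smooth Dc F1 -> dlt j (pd a F1) + dlt j.+1 (fun w => pd a phi w * F1 w) = 0.
  move=> jk s1; rewrite /dlt addrACA (It_ibp oc sPhi uc Dz0 gz a (jB _ jk) s1) add0r -opprD.
  have -> : a = dirs (side a) (cidx a) by case: (a).
  by rewrite (push_ibp (side a) (cidx a) (jB _ jk) s1) oppr0.
have dI0 a F1 : smooth Dc F1 -> dlt 0 (fun w => pd a phi w * F1 w) = 0.
  move=> s1; rewrite /dlt (It_ibp0 oc sPhi Dz0 gz a F1 M1) sub0r It0.
  by rewrite /push (@van_val _ _ 0 (pd a phi) z0 (van_pd oc a Dz0 sph vphi)) mul0r mulr0 mul0r oppr0.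
have dEu j F1 : (j <= k)%N -> smooth Dc F1 -> (n + j)%:R * dlt j F1 = - dlt j.+1 (fun w => phi w * F1 w).
  move=> jk s1; have jM : (j.*2.+2 <= M)%N by have := jB _ jk; lia.
  have e1 := It_euler oc sPhi uc Dz0 gz jM s1.
  have e2 := It_euler od sPd ud Dw0 gauged jM (smooth_push s1).
  have e3 : It (Phi \o sg) j.+1 (fun w => - (Phi \o sg) w * push F1 w) w0 = It (Phi \o sg) j.+1 (push (fun w => phi w * F1 w)) w0.
    apply: (It_eq od _ _ Dw0) => w _; exact: mulrCA.
  have gen (c x y x' y' y'' : C) : c * x = - x' -> c * y = - y' -> y' = y'' -> c * (x - y) = - (x' - y'').
    by move=> h1 h2 <-; rewrite mulrBr h1 h2 -opprD.
  exact: (gen _ _ _ _ _ _ e1 e2 e3).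
(* In the leading term the Jacobian of the density cancels that of det H. *)
have d1 : dlt 0 (fun=> 1) = 0.
  have e1 := It0 Phi (fun=> 1) z0.
  have e2 : It (Phi \o sg) 0 (push (fun=> 1)) w0 = jac w0 * 1 / (jac w0 * \det (hmx Phi z0)).
    by etransitivity; [exact: It0|congr (_ / _); exact: det_comp].
  rewrite /dlt e1 e2; clear e1 e2.
  have J0 : jac w0 != 0.
    have u s : \det (B s w0) != 0 by rewrite -unitfE -unitmxE; exact: unit_B.
    rewrite /jac mulf_eq0 negb_or; apply/andP; split; [exact: (u true)|exact: (u false)].
  have H0 : \det (hmx Phi z0) != 0 by move: (uc Dz0); rewrite unitmxE unitfE.
  by move: (jac w0) (\det _) J0 H0 => x y x0 y0; rewrite mulr1 mul1r invfM mulVKf // subrr.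
exact: (delta_eq0 oc Dz0 sph vphi NE dE dD dZ dO dI dI0 dEu d1 (leqnn k) sF).
Qed.

(** One-sided representatives stay one-sided under a holomorphic map and keep matching the jets, so
    both products are integrals of corresponding densities. *)
Lemma prd_comp_gauged k f g : (k.*2.+3 <= M)%N -> smooth Dc f -> smooth Dc g ->
  prd (Phi \o sg) true k (f \o sg) (g \o sg) w0 = prd Phi true k f g z0.
Proof.
move=> kM sf sg'; pose fh := holrep true k.*2.+1 f z0; pose gh := holrep false k.*2.+1 g z0.
have sfh : smooth Dc fh := smooth_holrep Dc true k.*2.+1 f z0.
have sgh : smooth Dc gh := smooth_holrep Dc false k.*2.+1 g z0.
have cs s h i v : smooth Dc h -> Dd v -> (forall i z, pd (dirs (~~ s) i) h z = 0) -> pd (dirs (~~ s) i) (h \o sg) v = 0.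
  move=> sh Dv h0; rewrite (pd_comp oc od sgD hsg) // big1 // => j _.
  by rewrite h0 mulr0.
have jc s h : smooth Dc h -> jvan (pred1 s) k.*2.+1 (fun w => (holrep s k.*2.+1 h z0 \o sg) w - (h \o sg) w) w0.
  move=> sh; apply: (jvan_comp oc od sgD hsg Dw0 (F := fun z => holrep s k.*2.+1 h z0 z - h z)).
    exact: (smoothB oc (smooth_holrep Dc s _ h z0) sh).
  have := @jvan_holrep _ _ Dc oc s k.*2.+1 h z0 Dz0 sh; exact.
have e1 : prd Phi true k f g z0 = It Phi k (fun w => fh w * gh w * \det (hmx Phi w)) z0.
  apply: (prd_It oc sPhi Dz0 sfh sgh) => i ik.
    apply: (@TT_holrep _ _ Dc oc true k.*2.+1 f fh z0 i Dz0 sf sfh) ik => [j z _|]; first exact: pd_holrep.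
    exact: (@jvan_holrep _ _ Dc oc true k.*2.+1 f z0 Dz0 sf).
  apply: (@TT_holrep _ _ Dc oc false k.*2.+1 g gh z0 i Dz0 sg' sgh) ik => [j z _|]; first exact: pd_holrep.
  exact: (@jvan_holrep _ _ Dc oc false k.*2.+1 g z0 Dz0 sg').
have e2 : prd (Phi \o sg) true k (f \o sg) (g \o sg) w0 =
    It (Phi \o sg) k (fun w => (fh \o sg) w * (gh \o sg) w * \det (hmx (Phi \o sg) w)) w0.
  apply: (prd_It od sPd Dw0 (smC sfh) (smC sgh)) => i ik.
    apply: (@TT_holrep _ _ Dd od true k.*2.+1 (f \o sg) (fh \o sg) w0 i Dw0 (smC sf) (smC sfh) _ (jc true f sf) ik) => j v Dv.
    by apply: (cs true) => // l z; exact: pd_holrep.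
  apply: (@TT_holrep _ _ Dd od false k.*2.+1 (g \o sg) (gh \o sg) w0 i Dw0 (smC sg') (smC sgh) _ (jc false g sg') ik) => j v Dv.
  by apply: (cs false) => // l z; exact: pd_holrep.
have e3 : It (Phi \o sg) k (fun w => (fh \o sg) w * (gh \o sg) w * \det (hmx (Phi \o sg) w)) w0 =
    It (Phi \o sg) k (push (fun w => fh w * gh w * \det (hmx Phi w))) w0.
  apply: (It_eq od _ _ Dw0) => w Dw.
  have gen (x y j' m' d : C) : d = j' * m' -> x * y * d = j' * (x * y * m') by move=> ->; exact: mulrCA.
  exact: (gen _ _ _ _ _ (det_comp Dw)).
have sF : smooth Dc (fun w => fh w * gh w * \det (hmx Phi w)) := smoothM oc (smoothM oc sfh sgh) (smooth_mu oc sPhi).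
have := dlt_eq0 kM sF; rewrite /dlt => /eqP; rewrite subr_eq0 => /eqP e4.
exact: (etrans e2 (etrans e3 (etrans (esym e4) (esym e1)))).
Qed.

End AtPoint.

End Invariance.

(** Gauge the potential at [sg w0]: its pull-back is gauged at [w0], and neither product changes,
    since both see mixed derivatives only. *)
Theorem prd_comp (R : realType) (n : nat) (Dc Dd : set 'rV[R[i]]_n) (sg : 'rV[R[i]]_n -> 'rV[R[i]]_n)
    (Phi f g : 'rV[R[i]]_n -> R[i]) k w0 :
  open Dc -> open Dd -> (forall w, Dd w -> Dc (sg w)) -> holomorphic Dd sg -> smooth Dc Phi ->
  (forall z, Dc z -> hmx Phi z \in unitmx) -> (forall w, Dd w -> hmx (Phi \o sg) w \in unitmx) ->
  Dd w0 -> smooth Dc f -> smooth Dc g ->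
  prd (Phi \o sg) true k (f \o sg) (g \o sg) w0 = prd Phi true k f g (sg w0).
Proof.
move=> oc od sgD hsg sP uc ud Dw sf sg'.
have [Psi [sQ PQ gau]] := gauge_exists oc k.*2.+3 (sgD _ Dw) sP.
have uc' z : Dc z -> hmx Psi z \in unitmx by move=> Dz; rewrite -PQ //; exact: uc.
have sPs := smooth_comp oc od sgD hsg sP; have sQs := smooth_comp oc od sgD hsg sQ.
have PQs w : Dd w -> hmx (Phi \o sg) w = hmx (Psi \o sg) w.
  move=> Dv; apply/matrixP => i j.
  etransitivity; first exact: (hmx_comp oc od sgD hsg i j Dv sP).
  etransitivity; last exact: (esym (hmx_comp oc od sgD hsg i j Dv sQ)).
  by apply: eq_bigr => a _; apply: eq_bigr => b _; rewrite (PQ _ (sgD _ Dv)).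
have ud' w : Dd w -> hmx (Psi \o sg) w \in unitmx by move=> Dv; rewrite -PQs //; exact: ud.
have G s : jvan (pred1 s) k.*2.+4 Psi (sg w0) by move=> L aL Lk; exact: (gau s).
etransitivity; first exact: (prd_gauge od true k (f \o sg) (g \o sg) sPs sQs PQs Dw).
etransitivity; last exact: (esym (prd_gauge oc true k f g sP sQ PQ (sgD _ Dw))).
exact: (prd_comp_gauged oc od sgD hsg sQ uc' ud' Dw G (leqnn _) sf sg').
Qed.

(** * Integrals depending on a parameter *)

Transparent pd.

Section AffineReparametrization.
Context {R : realType}.
Local Notation C := R[i].

Lemma is_derive_affine (a b x : R) : is_derive x (1 : R) (fun s : R => a + s * b) b.
Proof.
have cb : b @[h --> (0 : R)^'] --> b by exact: cvg_cst.
apply: is_derive_of_cvg; apply: cvg_trans cb; apply: near_eq_cvg; near=> h.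
have h0 : h != 0 by near: h; exact: nbhs_dnbhs_neq.
rewrite /= (_ : _ - _ = h * b) ?mulKf //; ring.
Unshelve. all: by end_near. Qed.

Lemma is_derive_comp_affine (f : R -> R) (a b x d : R) : is_derive (a + x * b) (1 : R) f d ->
  is_derive x (1 : R) (fun s : R => f (a + s * b)) (b * d).
Proof.
move=> D1; rewrite mulrC.
exact: (@is_derive1_comp R f (fun s : R => a + s * b) x d b D1 (is_derive_affine a b x)).
Qed.

Lemma cder_comp_affine (g : R -> C) (a b x : R) (d : C) : cder g (a + x * b) d ->
  cder (fun s : R => g (a + s * b)) x (b%:C * d).
Proof.
move=> [h1 h2]; split; [rewrite ReM|rewrite ImM] => /=; rewrite mul0r ?subr0 ?addr0;
  [exact: (is_derive_comp_affine h1)|exact: (is_derive_comp_affine h2)].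
Qed.

End AffineReparametrization.

(** * Bounded functionals applied to families of functions *)

Section BoundedFunctional.
Context {R : realType} {T : topologicalType}.
Local Notation C := R[i].
Variable A : set T.
Hypothesis cA : compact A.
Implicit Types (f g : T -> C).

Lemma cc_cst (W : topologicalType) (c : C) : continuous (fun _ : W => c).
Proof. by move=> w; exact: cst_continuous. Qed.

Lemma ccM (W : topologicalType) (f g : W -> C) w : {for w, continuous f} -> {for w, continuous g} ->
  {for w, continuous (fun t => f t * g t)}.
Proof. by move=> a b; exact: (cvgM a b). Qed.

Lemma ccD (W : topologicalType) (f g : W -> C) w : {for w, continuous f} -> {for w, continuous g} ->
  {for w, continuous (fun t => f t + g t)}.
Proof. by move=> a b; exact: (cvgD a b). Qed.

Lemma ccB (W : topologicalType) (f g : W -> C) w : {for w, continuous f} -> {for w, continuous g} ->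
  {for w, continuous (fun t => f t - g t)}.
Proof. by move=> a b; exact: (cvgB a b). Qed.

(** Compactness of A makes the continuity in w uniform in t. *)
Lemma near_sup (W : topologicalType) (w0 : W) (K : W -> T -> C) (e : C) : 0 < e ->
  (forall t, A t -> {for (w0, t), continuous (fun p => K p.1 p.2)}) ->
  \forall w \near w0, forall t, A t -> `|K w0 t - K w t| <= e.
Proof.
move=> e0 cK; have := (@compact_near_coveringP T A).1 cA W (nbhs w0) (fun w t => `|K w0 t - K w t| <= e) _.
apply => t At; have e2 : 0 < e / 2 by rewrite divr_gt0.
have /cvgrPdist_lt/(_ _ e2)[[/= U1 U2] [U1w U2t] sub] := cK t At.
exists (U2, U1) => // -[t' w] /= [U2t' U1w'].
have h1 : `|K w0 t - K w t'| < e / 2 by apply: (sub (w, t')).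
have h2 : `|K w0 t - K w0 t'| < e / 2 by apply: (sub (w0, t')); split => //=; exact: nbhs_singleton.
have -> : K w0 t' - K w t' = (K w0 t - K w t') - (K w0 t - K w0 t') by ring.
by apply: (le_trans (ler_normB _ _)); rewrite (splitr e) lerD // ltW.
Qed.

(** Only linearity and a bound by the supremum over A are asked of I, so that segment integrals and
    iterated double integrals are treated together. *)
Variables (I : (T -> C) -> C) (B : R).
Hypothesis B0 : 0 <= B.
Hypothesis ID : forall f g, continuous f -> continuous g -> I (fun t => f t + g t) = I f + I g.
Hypothesis IZ : forall c f, continuous f -> I (fun t => c * f t) = c * I f.
Hypothesis IB : forall f (M : R), continuous f -> (forall t, A t -> `|f t| <= M%:C) -> `|I f| <= (B * M)%:C.

Let divB_le (e : R) : 0 < e -> e / (B + 1) * B <= e.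
Proof.
move=> e0; have B1 : 0 < B + 1 by rewrite ltr_wpDl.
by rewrite mulrAC ler_pdivrMr // ler_wpM2l ?(ltW e0) // lerDl.
Qed.

Lemma functB f g : continuous f -> continuous g -> I (fun t => f t - g t) = I f - I g.
Proof.
move=> cf cg; have cg' : continuous (fun t => -1 * g t).
  by move=> t; exact: (ccM (f := fun=> -1) (g := g) (@cc_cst T (-1) t) (cg t)).
transitivity (I (fun t => f t + -1 * g t)); first by congr I; apply/funext => t; rewrite mulN1r.
by rewrite ID // IZ // mulN1r.
Qed.

Lemma funct_cont (W : topologicalType) (w0 : W) (K : W -> T -> C) :
  (forall t, A t -> {for (w0, t), continuous (fun p => K p.1 p.2)}) ->
  (\forall w \near w0, continuous (K w)) -> {for w0, continuous (fun w => I (K w))}.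
Proof.
move=> cK cK'; apply/cvgrPdist_le => e e0.
have eE : e = (complex.Re e)%:C by rewrite RRe_real // gtr0_real.
have er0 : 0 < complex.Re e by rewrite -ltcR -eE.
pose d := complex.Re e / (B + 1).
have d0 : 0 < d by rewrite divr_gt0 // ltr_wpDl.
have d0' : 0 < d%:C by rewrite ltcR.
have Kw0 := nbhs_singleton cK'.
near=> w.
have cw : continuous (K w) by near: w; exact: cK'.
rewrite -(functB Kw0 cw).
apply: (le_trans (IB (M := d) _ _)).
- by move=> t; apply: ccB; [exact: Kw0|exact: cw].
- by near: w; exact: near_sup d0' cK.
rewrite eE lecR mulrC; exact: divB_le.
Unshelve. all: by end_near. Qed.

(** The difference quotient minus the derivative, [q h], tends to 0 uniformly on A by the mean value
    theorem for real and imaginary parts; the bound on I gives the limit. *)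
Lemma funct_der (k k' : R -> T -> C) (s0 : R) :
  (\forall s \near s0, continuous (k s)) -> continuous (k' s0) ->
  (\forall s \near s0, forall t, A t -> cder (k^~ t) s (k' s t)) ->
  (forall t, A t -> {for (s0, t), continuous (fun p => k' p.1 p.2)}) ->
  cder (fun s => I (k s)) s0 (I (k' s0)).
Proof.
move=> ck ck' dk jk'.
pose q h t := h%:C^-1 * (k (s0 + h) t - k s0 t) - k' s0 t.
have ck0 := nbhs_singleton ck.
have ck1 : \forall h \near (0 : R), continuous (k (s0 + h)).
  have [d /= d0 Hd] := (nbhs_ballP _ _).1 ck.
  apply/nbhs_ballP; exists d; first exact: d0.
  move=> h hd; apply: Hd; move: hd; rewrite -!ball_normE /=.
  by rewrite opprD addNKr sub0r.
have key e : 0 < e -> \forall h \near (0 : R)^', forall t, A t -> `|q h t| <= e%:C.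
  move=> e0; have e2 : 0 < e / 2 by rewrite divr_gt0.
  have e2' : 0 < (e / 2)%:C by rewrite ltcR.
  have H1 := near_sup e2' jk'.
  have [d /= d0 Hd] := (nbhs_ballP _ _).1 (filterI H1 dk).
  near=> h => t At.
  have hd : `|h| < d by near: h; apply: dnbhs0_lt.
  have h0 : h != 0 by near: h; exact: nbhs_dnbhs_neq.
  have mv (p : C -> R) (dp : forall (g : R -> C) (s : R) (c : C), cder g s c -> is_derive s (1 : R) (fun x => p (g x)) (p c))
      (pB : forall x y, p (x - y) = p x - p y) (pN : forall x, `|p x|%:C <= `|x|) (pZ : forall (r : R) x, p (r%:C * x) = r * p x) :
      `|p (q h t)| <= e / 2.
    have [||th th01] := @MVT_segment R (fun s => p (k (s0 + s * h) t)) (fun s => h * p (k' (s0 + s * h) t)) 0 1 ler01.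
    - move=> x; rewrite in_itv /= => /andP[x0 x1].
      have bx : ball s0 d (s0 + x * h).
        rewrite -ball_normE /= opprD addNKr normrN normrM gtr0_norm //.
        by apply: le_lt_trans hd; rewrite ler_piMl // ltW.
      have D1 := dp _ _ _ ((Hd _ bx).2 t At).
            exact: (is_derive_comp_affine D1).
    - apply: continuous_in_subspaceT => x; rewrite inE /= in_itv /= => /andP[x0 x1].
      have bx : ball s0 d (s0 + x * h).
        rewrite -ball_normE /= opprD addNKr normrN normrM ger0_norm //.
        by apply: le_lt_trans hd; rewrite ler_piMl // ltW.
      have D1 := is_derive_continuous (dp _ _ _ ((Hd _ bx).2 t At)).
      exact: (@cvg_comp _ _ _ (fun s : R => s0 + s * h) (fun y => p (k y t)) _ _ _ (is_derive_continuous (is_derive_affine s0 h x)) D1).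
    rewrite subr0 mulr1 mul1r mul0r addr0 => E.
    have bt : ball s0 d (s0 + th * h).
      move: th01; rewrite in_itv /= => /andP[t0 t1].
      rewrite -ball_normE /= opprD addNKr normrN normrM ger0_norm //.
      by apply: le_lt_trans hd; rewrite ler_piMl // ltW.
    have qE : p (q h t) = p (k' (s0 + th * h) t - k' s0 t).
      rewrite /q -fmorphV !pB pZ pB E mulKf //.
    by rewrite qE pB distrC -pB -lecR; apply: (le_trans (pN _)); exact: (Hd _ bt).1.
  apply: (le_trans (normc_le_ReIm _)); rewrite lecR (splitr e) lerD //.
    apply: (mv (@complex.Re R)) => [g s c []//|x y|x|r x]; [exact: raddfB|exact: normc_ge_Re|].
    by rewrite ReM /= mul0r subr0.
  apply: (mv (@complex.Im R)) => [g s c []//|x y|x|r x]; [exact: raddfB|exact: normc_ge_Im|].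
  by rewrite ImM /= mul0r addr0.
have cq h : continuous (k (s0 + h)) -> continuous (q h).
  move=> ch t; exact: (ccB (f := fun t => h%:C^-1 * (k (s0 + h) t - k s0 t)) (ccM (f := fun=> h%:C^-1) (g := fun t => k (s0 + h) t - k s0 t) (@cc_cst T _ t) (ccB (ch t) (ck0 t))) (ck' t)).
have Iq h : continuous (k (s0 + h)) -> I (q h) = h%:C^-1 * (I (k (s0 + h)) - I (k s0)) - I (k' s0).
  move=> ch; have cb : continuous (fun t => k (s0 + h) t - k s0 t).
    by move=> t; apply: ccB; [exact: ch|exact: ck0].
  have cb' : continuous (fun t => h%:C^-1 * (k (s0 + h) t - k s0 t)).
    by move=> t; exact: (ccM (f := fun=> h%:C^-1) (g := fun t => k (s0 + h) t - k s0 t) (@cc_cst T _ t) (cb t)).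
  by rewrite /q (functB cb' ck') (IZ _ cb) (functB ch ck0).
have cvgp (p : C -> R) (pB : forall x y, p (x - y) = p x - p y) (pN : forall x, `|p x|%:C <= `|x|) (pZ : forall (r : R) x, p (r%:C * x) = r * p x) :
    is_derive s0 (1 : R) (fun s => p (I (k s))) (p (I (k' s0))).
  apply: is_derive_of_cvg; apply/cvgrPdist_le => e e0.
  have d0 : 0 < e / (B + 1) by rewrite divr_gt0 // ltr_wpDl.
  near=> h.
  have ch : continuous (k (s0 + h)) by near: h; apply: nbhs_dnbhs; exact: ck1.
  have pE : h^-1 * (p (I (k (s0 + h))) - p (I (k s0))) - p (I (k' s0)) = p (I (q h)) by rewrite Iq // -fmorphV pB pZ pB.
  rewrite -normrN opprB pE -lecR; apply: (le_trans (pN _)).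
  have Hb : forall t, A t -> `|q h t| <= (e / (B + 1))%:C by near: h; exact: key.
  apply: (le_trans (IB (cq _ ch) Hb)).
  by rewrite lecR mulrC; exact: divB_le.
split; apply: cvgp.
- by move=> x y; exact: raddfB.
- exact: normc_ge_Re.
- by move=> r x; rewrite ReM /= mul0r subr0.
- by move=> x y; exact: raddfB.
- exact: normc_ge_Im.
- by move=> r x; rewrite ImM /= mul0r addr0.
Unshelve. all: by end_near. Qed.

Section Family.
Context {n : nat}.
Local Notation V := 'rV[C]_n.
Variables (D D' : set V) (a : T -> V) (lam : T -> R).
Hypothesis oD : open D.
Hypothesis oD' : open D'.
Hypothesis ca : continuous a.
Hypothesis cl : continuous lam.
Let sg (t : T) (z : V) : V := a t + (lam t)%:C *: z.
Hypothesis sgD : forall t z, D z -> D' (sg t z).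
Implicit Types (c : T -> C) (h : V -> C) (z v : V).

Let cl' : continuous (fun t => (lam t)%:C : C).
Proof.
by move=> t; exact: (@cvg_comp _ _ _ lam (real_complex R) _ _ _ (@cl t) (@RtoC_continuous R _)).
Qed.

Lemma sg_continuous : continuous (fun p : V * T => sg p.2 p.1).
Proof.
move=> [z t]; have h1 : a p.2 @[p --> (z, t)] --> a t.
  exact: (@cvg_comp _ _ _ snd a _ _ _ (@cvg_snd _ _ _ _ _) (@ca t)).
have h2 : ((lam p.2)%:C : C) @[p --> (z, t)] --> ((lam t)%:C : C).
  exact: (@cvg_comp _ _ _ snd (fun t => (lam t)%:C : C) _ _ _ (@cvg_snd _ _ _ _ _) (@cl' t)).
have h3 : p.1 @[p --> (z, t)] --> z by exact: cvg_fst.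
exact: (cvgD h1 (cvgZ h2 h3)).
Qed.

Lemma fam_joint c h : continuous c -> (forall z, D' z -> {for z, continuous h}) ->
  forall z t, D z -> {for (z, t), continuous (fun p : V * T => c p.2 * h (sg p.2 p.1))}.
Proof.
move=> cc ch z t Dz.
have h1 : c p.2 @[p --> (z, t)] --> c t.
  exact: (@cvg_comp _ _ _ snd c _ _ _ (@cvg_snd _ _ _ _ _) (@cc t)).
have h2 : h (sg p.2 p.1) @[p --> (z, t)] --> h (sg t z).
  exact: (@cvg_comp _ _ _ (fun p : V * T => sg p.2 p.1) h _ _ _ (@sg_continuous (z, t)) (ch _ (sgD t Dz))).
exact: (cvgM h1 h2).
Qed.

Lemma fam_cont c h z : continuous c -> (forall z, D' z -> {for z, continuous h}) -> D z -> continuous (fun t => c t * h (sg t z)).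
Proof.
move=> cc ch Dz t.
have h1 : (z, t') @[t' --> t] --> (z, t) by exact: (cvg_pair (@cvg_cst _ z _ (nbhs t) _) (@cvg_id _ (nbhs t))).
exact: (@cvg_comp _ _ _ (fun t' => (z, t')) (fun p : V * T => c p.2 * h (sg p.2 p.1)) _ _ _ h1 (@fam_joint c h cc ch z t Dz)).
Qed.

(** Covers both integral operators below: the radial homotopy, with a t = (1 - t) c and lam t = t,
    and the Cauchy transform, where [a] runs through a disc and lam = 1. *)
Definition fam c h z : C := I (fun t => c t * h (sg t z)).

Lemma fam_continuous c h z : continuous c -> (forall z, D' z -> {for z, continuous h}) -> D z -> {for z, continuous (fam c h)}.
Proof.
move=> cc ch Dz; apply: (@funct_cont V z (fun z t => c t * h (sg t z))) => [t At|].
  exact: (fam_joint cc ch).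
by apply: (near_open oD Dz) => w Dw; exact: fam_cont.
Qed.

Lemma fam_hasD c h z b j : continuous c -> Cksub 1 D' h -> D z ->
  hasD (fam c h) z (rd b j) (fam (fun t => c t * (lam t)%:C) (rderive (rd b j) h) z).
Proof.
move=> cc ch Dz; set v := rd b j.
have ch0 w (Dw : D' w) := Cksub_cont ch Dw.
have ch1 w (Dw : D' w) : {for w, continuous (rderive v h)} := Cksub_cont (Cksub_rd b j ch) Dw.
have cc' : continuous (fun t => c t * (lam t)%:C) by move=> t; exact: (ccM (@cc t) (@cl' t)).
have nD : \forall s \near (0 : R), D (z + s%:C *: v).
  have := @line_continuous R n z v 0; rewrite /continuous_at scale0r addr0 => H.
  by apply: H; exact: open_nbhs_nbhs.
pose k (s : R) t := c t * h (sg t (z + s%:C *: v)).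
pose k' (s : R) t := c t * (lam t)%:C * rderive v h (sg t (z + s%:C *: v)).
have E0 : (fun t => c t * (lam t)%:C * rderive v h (sg t z)) = k' 0.
  by apply/funext => t; rewrite /k' scale0r addr0.
rewrite /hasD /fam E0; apply: (@funct_der k k' 0).
- by apply: filterS nD => s Ds; exact: (fam_cont cc ch0 Ds).
- by rewrite -E0; exact: (fam_cont cc' ch1 Dz).
- apply: filterS nD => s Ds t At; rewrite /k /k' -mulrA; apply: cderZ.
  set w := sg t _; have H := Cksub_hasD b j ch (sgD t Ds : D' w).
  rewrite -/v in H.
    have E x : h (sg t (z + x%:C *: v)) = h (w + (- s * lam t + x * lam t)%:C *: v).
    rewrite /w /sg -addrA; congr (h (_ + _)); rewrite !scalerDr !scalerA -addrA; congr (_ + _).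
    by rewrite -scalerDl -!rmorphM -rmorphD; congr (_%:C *: _); ring.
  apply: (cder_ext (fun x => esym (E x))).
  apply: (@cder_comp_affine _ (fun y : R => h (w + y%:C *: v))).
  by rewrite mulNr addNr.
- move=> t At.
  have h1 : (z + p.1%:C *: v, p.2) @[p --> ((0 : R), t)] --> (z, t).
    have := @line_continuous R n z v 0; rewrite /continuous_at scale0r addr0 => H.
    have H' : z + p.1%:C *: v @[p --> ((0 : R), t)] --> z.
      exact: (@cvg_comp _ _ _ fst (fun x : R => z + x%:C *: v) _ _ _ (@cvg_fst _ _ _ _ _) H).
    exact: (cvg_pair H' (@cvg_snd _ _ _ _ _)).
  have e0 : k' 0 t = c t * (lam t)%:C * rderive v h (sg t z) by rewrite -E0.
  have h2 : k' p.1 p.2 @[p --> ((0 : R), t)] --> k' 0 t.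
    rewrite e0.
    exact: (@cvg_comp _ _ _ (fun p : R * T => (z + p.1%:C *: v, p.2)) (fun p : V * T => c p.2 * (lam p.2)%:C * rderive v h (sg p.2 p.1)) _ _ _ h1 (@fam_joint _ _ cc' ch1 z t Dz)).
  exact: h2.
Qed.

Lemma Cksub_fam k c h : continuous c -> Cksub k D' h -> Cksub k D (fam c h).
Proof.
elim: k c h => [|k IH] c h cc sh.
  by split; [move=> z Dz; exact: (fam_continuous cc (fun w Dw => Cksub_cont sh Dw))|].
have sh1 : Cksub 1 D' h.
  by elim: (k) sh => // m IHm /Cksub_le.
have cc' : continuous (fun t => c t * (lam t)%:C) by move=> t; exact: (ccM (@cc t) (@cl' t)).
apply: (@CksubS _ _ _ _ _ (fun b j => fam (fun t => c t * (lam t)%:C) (rderive (rd b j) h)) oD).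
- by move=> b j z Dz; exact: fam_hasD.
- by move=> z Dz; exact: (fam_continuous cc (fun w Dw => Cksub_cont sh Dw)).
- by move=> b j; apply: IH => //; exact: Cksub_rd.
Qed.

Lemma smooth_fam c h : continuous c -> smooth D' h -> smooth D (fam c h).
Proof. by move=> cc /smoothP sh; apply/smoothP => k; exact: Cksub_fam. Qed.

Lemma pd_fam c h z b : continuous c -> smooth D' h -> D z ->
  pd b (fam c h) z = fam (fun t => c t * (lam t)%:C) (pd b h) z.
Proof.
move=> cc sh Dz; have sh1 := (smoothP D' h).1 sh 1.
rewrite (pd_of_hasD (a := b) (fun s => fam_hasD s (cidx b) cc sh1 Dz)) /fam.
have cc' : continuous (fun t => c t * (lam t)%:C) by move=> t; exact: (ccM (@cc t) (@cl' t)).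
have cr s : continuous (fun t => c t * (lam t)%:C * rderive (rd s (cidx b)) h (sg t z)).
  by apply: (fam_cont cc') => // w Dw; exact: (Cksub_cont (Cksub_rd s (cidx b) sh1) Dw).
have cz (x : C) s : continuous (fun t => x * (c t * (lam t)%:C * rderive (rd s (cidx b)) h (sg t z))).
  by move=> t; exact: (ccM (f := fun=> x) (@cc_cst T x t) (cr s t)).
rewrite -(IZ (csgn b * 'i) (cr true)) -(ID (cr false) (cz _ true)) -IZ; last by move=> t; exact: (ccD (cr false t) (cz _ true t)).
congr I; apply/funext => t; rewrite pdE.
move: (rderive _ _ _) (rderive _ _ _) => x y; ring.
Qed.

End Family.

End BoundedFunctional.

(** * Integrals of complex-valued functions *)

Section CurveIntegral.
Context {R : realType}.
Local Notation C := R[i].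
Local Notation mu := (@lebesgue_measure R).
Implicit Types (f g : R -> C) (a b : R).

Definition cint a b f : C :=
  (\int[mu]_(x in `[a, b]) complex.Re (f x)) +i* (\int[mu]_(x in `[a, b]) complex.Im (f x)).

Lemma integrable_cont a b (f : R -> R) : continuous f -> mu.-integrable `[a, b] (EFin \o f).
Proof.
move=> cf; apply: continuous_compact_integrable; first exact: segment_compact.
exact: continuous_subspaceT.
Qed.

Let Re_cont f : continuous f -> continuous (fun x => complex.Re (f x)).
Proof. by move=> cf x; exact: ((continuous_ReIm f x).1 (cf x)).1. Qed.

Let Im_cont f : continuous f -> continuous (fun x => complex.Im (f x)).
Proof. by move=> cf x; exact: ((continuous_ReIm f x).1 (cf x)).2. Qed.

Lemma cintD a b f g : continuous f -> continuous g -> cint a b (fun x => f x + g x) = cint a b f + cint a b g.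
Proof.
move=> cf cg; apply: ReIm_eq; rewrite ?ReD ?ImD /=.
  under eq_Rintegral do rewrite ReD.
  by rewrite RintegralD //; apply: integrable_cont; exact: Re_cont.
under eq_Rintegral do rewrite ImD.
by rewrite RintegralD //; apply: integrable_cont; exact: Im_cont.
Qed.

Lemma cintZ a b c f : continuous f -> cint a b (fun x => c * f x) = c * cint a b f.
Proof.
move=> cf; have iR := integrable_cont a b (Re_cont cf).
have iI := integrable_cont a b (Im_cont cf).
have iZ (r : R) (h : R -> R) : mu.-integrable `[a, b] (EFin \o h) -> mu.-integrable `[a, b] (EFin \o (fun x => r * h x)).
  by move=> ih; under [_ \o _]eq_fun do rewrite /= EFinM; exact: integrableZl.
apply: ReIm_eq; rewrite ?ReM ?ImM /=.
  under eq_Rintegral do rewrite ReM.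
  by rewrite RintegralB ?RintegralZl //; exact: iZ.
under eq_Rintegral do rewrite ImM.
by rewrite RintegralD ?RintegralZl //; exact: iZ.
Qed.

(** The factor 2 comes from estimating real and imaginary parts separately. *)
Lemma cint_bound a b f (M : R) : a <= b -> continuous f -> (forall x, x \in `[a, b] -> `|f x| <= M%:C) ->
  `|cint a b f| <= (2 * (b - a) * M)%:C.
Proof.
move=> ab cf fM.
have bound (h : R -> R) : continuous h -> (forall x, x \in `[a, b] -> `|h x| <= M) -> `|\int[mu]_(x in `[a, b]) h x| <= (b - a) * M.
  move=> ch hM; have mab : measurable (`[a, b]%classic : set (measurableTypeR R)) by exact: measurable_itv.
apply: (le_trans (le_normr_Rintegral mab (integrable_cont a b ch))).
  have -> : (b - a) * M = \int[mu]_(x in `[a, b]) M.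
    rewrite Rintegral_cst //= lebesgue_measure_itv /= lte_fin mulrC; case: ltP => //= ba.
    by rewrite (@le_anti _ _ a b) ?ab // subrr.
  apply: le_Rintegral => //.
  - by apply: integrable_cont => x; exact: (@cvg_comp _ _ _ h Num.norm _ _ _ (ch x) (@norm_continuous _ R^o _)).
  - by apply: integrable_cont => x; exact: cst_continuous.
apply: (le_trans (normc_le_ReIm _)); rewrite lecR -mulrA mulr_natl mulr2n lerD //.
  apply: bound; first exact: Re_cont.
  by move=> x xab; rewrite -lecR (le_trans (normc_ge_Re _)) // fM.
apply: bound; first exact: Im_cont.
by move=> x xab; rewrite -lecR (le_trans (normc_ge_Im _)) // fM.
Qed.

Lemma cint_FTC a b (F f : R -> C) : a < b -> continuous f -> continuous F ->
  (forall x, a < x < b -> cder F x (f x)) -> cint a b f = F b - F a.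
Proof.
move=> ab cf cF dF.
have ftc (h k : R -> R) : continuous h -> continuous k -> (forall x, a < x < b -> is_derive x (1 : R) k (h x)) ->
    \int[mu]_(x in `[a, b]) h x = k b - k a.
  move=> ch ck dk; rewrite /Rintegral (continuous_FTC2 ab (continuous_subspaceT ch) (F := k)) //.
    split.
    - by move=> x; rewrite in_itv /= => xab; have [] := dk x xab.
    - by apply: cvg_at_right_filter; exact: ck.
    - by apply: cvg_at_left_filter; exact: ck.
  by move=> x; rewrite in_itv /= => xab; have [dkx <-] := dk x xab; rewrite derive1E.
apply: ReIm_eq.
  transitivity (complex.Re (F b) - complex.Re (F a)); last by rewrite raddfB.
  apply: (ftc (fun x => complex.Re (f x)) (fun x => complex.Re (F x)) (Re_cont cf) (Re_cont cF)).
  by move=> x xab; have [] := dF x xab.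
transitivity (complex.Im (F b) - complex.Im (F a)); last by rewrite raddfB.
apply: (ftc (fun x => complex.Im (f x)) (fun x => complex.Im (F x)) (Im_cont cf) (Im_cont cF)).
by move=> x xab; have [] := dF x xab.
Qed.

(** An iterated integral suffices: the fundamental theorem is applied in one variable at a time. *)
Definition cint2 (a b a' b' : R) (f : R * R -> C) : C := cint a b (fun r => cint a' b' (fun th => f (r, th))).

Section Double.
Variables (a b a' b' : R).
Hypothesis ab : a <= b.
Hypothesis ab' : a' <= b'.

Lemma cint_slice (f : R * R -> C) r : continuous f -> continuous (fun th => f (r, th)).
Proof.
move=> cf th; have h1 : (r, t') @[t' --> th] --> (r, th) by exact: (cvg_pair (@cvg_cst _ r _ (nbhs th) _) (@cvg_id _ (nbhs th))).
exact: (@cvg_comp _ _ _ (fun t' => (r, t')) f _ _ _ h1 (cf (r, th))).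
Qed.

Lemma cint_param_continuous (f : R * R -> C) : continuous f -> continuous (fun r => cint a' b' (fun th => f (r, th))).
Proof.
move=> cf r.
have bd (g : R -> C) (M : R) : continuous g -> (forall t, `[a', b']%classic t -> `|g t| <= M%:C) -> `|cint a' b' g| <= (2 * (b' - a') * M)%:C.
  by move=> cg gM; exact: (cint_bound ab' cg gM).
have B0 : 0 <= 2 * (b' - a') by rewrite mulr_ge0 // subr_ge0.
apply: (funct_cont (@segment_compact R a' b') B0 (@cintD a' b') (@cintZ a' b') bd (w0 := r) (K := fun r th => f (r, th))).
  have E : (fun p : R * R => f (p.1, p.2)) = f by apply/funext => -[].
  have cf' : continuous (fun p : R * R => f (p.1, p.2)) by rewrite E.
  by move=> t _; exact: cf'.
by near=> r'; exact: cint_slice.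
Unshelve. all: by end_near. Qed.

Lemma cint2D (f g : R * R -> C) : continuous f -> continuous g -> cint2 a b a' b' (fun x => f x + g x) = cint2 a b a' b' f + cint2 a b a' b' g.
Proof.
move=> cf cg; rewrite /cint2 -cintD; [|exact: cint_param_continuous..].
congr cint; apply/funext => r; apply: cintD; exact: cint_slice.
Qed.

Lemma cint2Z c (f : R * R -> C) : continuous f -> cint2 a b a' b' (fun x => c * f x) = c * cint2 a b a' b' f.
Proof.
move=> cf; rewrite /cint2 -cintZ; last exact: cint_param_continuous.
congr cint; apply/funext => r; apply: cintZ; exact: cint_slice.
Qed.

Lemma cint2_bound (f : R * R -> C) (M : R) : continuous f -> (forall p, (`[a, b]%classic `*` `[a', b']%classic) p -> `|f p| <= M%:C) ->
  `|cint2 a b a' b' f| <= ((2 * (b - a)) * (2 * (b' - a')) * M)%:C.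
Proof.
move=> cf fM; rewrite -mulrA; apply: (cint_bound ab (cint_param_continuous cf)) => r rab.
by apply: (@cint_bound a' b' (fun th => f (r, th)) M ab' (@cint_slice f r cf)) => th thab; apply: fM; split.
Qed.

End Double.
End CurveIntegral.

(** * Smooth cutoffs *)

Section FlatFunctions.
Context {R : realType}.
Local Notation C := R[i].
Implicit Types (p : {poly R}) (x y h : R).

(* The functions [P(1/x) exp(-1/x)], extended by 0 to [x <= 0]: a class stable
   under derivation. *)
Definition flat p x : R := if 0 < x then p.[x^-1] * expR (- x^-1) else 0.

Lemma poly_bound p : exists2 c : R, 0 <= c & forall y, 1 <= y -> `|p.[y]| <= c * y ^+ (size p).
Proof.
exists (\sum_(i < size p) `|p`_i|) => [|y y1]; first exact: sumr_ge0.
rewrite horner_coef mulr_suml; apply: (le_trans (ler_norm_sum _ _ _)); apply: ler_sum => i _.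
rewrite normrM ler_wpM2l // normrX ger0_norm ?(le_trans ler01) //.
by rewrite ler_weXn2l // ltnW.
Qed.

(** From exp y >= (y / k)^k with k = size p + 1, one power more than the polynomial uses up, which
    leaves the factor x. *)
Lemma flat_bound p : exists2 c : R, 0 <= c & forall x, `|x| <= 1 -> `|flat p x| <= c * `|x|.
Proof.
have [c c0 Hc] := poly_bound p; pose k := (size p).+1.
have k0 : (0 : R) < k%:R by rewrite ltr0n.
exists (c * k%:R ^+ k) => [|x x1]; first by rewrite mulr_ge0 // exprn_ge0 // ltW.
rewrite /flat; case: ltP => [x0|_]; last by rewrite normr0 mulr_ge0 // mulr_ge0 // exprn_ge0 // ltW.
move: x1; rewrite (gtr0_norm x0) => x1; set y := x^-1.
have y1 : 1 <= y by rewrite /y -[1]invr1 lef_pV2 ?posrE.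
have y0 : 0 < y := lt_le_trans ltr01 y1.
have ey : (y / k%:R) ^+ k <= expR y.
  have -> : expR y = expR (y / k%:R) ^+ k by rewrite -expRM_natl mulrC divfK ?gt_eqF.
  rewrite lerXn2r ?nnegrE ?divr_ge0 ?ltW ?expR_gt0 //.
  apply: lt_le_trans (expR_ge1Dx _); by rewrite ltrDr.
have ey' : expR (- y) <= (k%:R / y) ^+ k.
  rewrite expRN -[leRHS]invrK lef_pV2 ?posrE ?expR_gt0 ?invr_gt0 ?exprn_gt0 ?divr_gt0 //.
  by rewrite -exprVn invf_div.
rewrite normrM [`|expR _|]ger0_norm ?expR_ge0 //.
apply: (le_trans (ler_pM _ _ (Hc y y1) ey')); rewrite ?expR_ge0 //.
rewrite expr_div_n -mulrA /k [y ^+ (size p).+1]exprS -/k.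
have yn : y ^+ size p != 0 by rewrite gt_eqF // exprn_gt0.
rewrite -mulrA ler_wpM2l // mulrCA ler_wpM2l ?exprn_ge0 ?(ltW k0) //.
by rewrite invfM mulrCA divff // mulr1 /y invrK.
Qed.

Lemma flat_cvg0 p : flat p h @[h --> (0 : R)] --> (0 : R).
Proof.
have [c c0 Hc] := flat_bound p; apply/cvgrPdist_le => e e0.
have d0 : 0 < e / (c + 1) by rewrite divr_gt0 // ltr_wpDl.
have N (r : R) : 0 < r -> \forall h \near (0 : R), `|h| <= r by move=> r0; exact: nbhs0_le.
near=> h; rewrite sub0r normrN.
have h1 : `|h| <= 1 by near: h; exact: N.
have h2 : `|h| <= e / (c + 1) by near: h; exact: N.
apply: (le_trans (Hc h h1)); apply: (le_trans (ler_wpM2l c0 h2)).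
rewrite mulrCA ler_piMr ?(ltW e0) // ler_pdivrMr ?ltr_wpDl // mul1r lerDl //.
Unshelve. all: by end_near. Qed.

(** The derivative of P(1/x) exp(-1/x) is (P - P')(1/x) x^-2 exp(-1/x). *)
Definition flat_deriv p := (p - p^`()) * 'X^2.

Lemma is_derive_flat p x : is_derive x (1 : R) (flat p) (flat (flat_deriv p) x).
Proof.
have [x0|x0|x0] := ltrgtP x 0.
- have -> : flat (flat_deriv p) x = 0 by rewrite /flat ltNge ltW.
  have c0 : (0 : R) @[h --> (0 : R)^'] --> (0 : R) by exact: cvg_cst.
  apply: is_derive_of_cvg; apply: cvg_trans c0; apply: near_eq_cvg; near=> h.
  have hx : x + h < 0.
    rewrite -(subrr x) ltrD2l; near: h; apply: nbhs_dnbhs.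
    by apply: lt_nbhsl; rewrite oppr_gt0.
  by rewrite /flat !ltNge !ltW //= subrr mulr0.
- have D1 : is_derive x (1 : R) (fun y => y^-1) (- x ^- 2).
    have := @is_deriveV R (id : R -> R) x 1 1 (lt0r_neq0 x0) (is_derive_id _ _).
    by move=> H; apply: (is_derive_eq H); rewrite /GRing.scale /= mulr1.
  have D2 : is_derive x (1 : R) ((fun y => p.[y]) \o (fun y => y^-1)) (p^`().[x^-1] * - x ^- 2).
    apply: is_derive1_comp D1; apply: DeriveDef; first exact: derivable_horner.
    by rewrite -derive1E -derivE.
  have D3 : is_derive x (1 : R) (expR \o (fun y => - y^-1)) (expR (- x^-1) * (x ^- 2)).
    by apply: is_derive1_comp; have := is_deriveN D1; rewrite opprK.
  have D4 := is_deriveM D2 D3.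
  apply: (near_eq_is_derive (f := fun y => p.[y^-1] * expR (- y^-1))).
  + near=> y; rewrite /flat ifT //; near: y; exact: lt_nbhsr.
  apply: (is_derive_eq D4); rewrite /flat x0 /flat_deriv hornerM hornerXn hornerD hornerN /= -!exprVn.
  have gen (y u v e : R) : u * (e * y ^+ 2) + e * (v * - y ^+ 2) = (u - v) * y ^+ 2 * e by ring.
  exact: gen.
rewrite x0; have -> : flat (flat_deriv p) 0 = 0 by rewrite /flat ltxx.
(* At 0, from the right, the difference quotient of [flat p] is [flat (p * 'X)]. *)
have c0 : flat (p * 'X) h @[h --> (0 : R)^'] --> (0 : R).
  by move=> P /(flat_cvg0 (p * 'X)) H; apply: nbhs_dnbhs.
apply: is_derive_of_cvg; apply: cvg_trans c0; apply: near_eq_cvg; near=> h.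
rewrite /flat ltxx add0r subr0; case: ltP => h0; last by rewrite mulr0.
by rewrite hornerM hornerX mulrAC mulrC.
Unshelve. all: by end_near. Qed.

Lemma flat_continuous p : continuous (flat p).
Proof. by move=> x; exact: is_derive_continuous (is_derive_flat p x). Qed.

Lemma flat1_gt0 x : 0 < x -> 0 < flat 1 x.
Proof. by move=> x0; rewrite /flat x0 hornerC mul1r expR_gt0. Qed.

Lemma flat1_ge0 x : 0 <= flat 1 x.
Proof. by rewrite /flat; case: ifP => // _; rewrite hornerC mul1r expR_ge0. Qed.

Lemma flat_le0 p x : x <= 0 -> flat p x = 0.
Proof. by rewrite /flat ltNge => ->. Qed.

End FlatFunctions.

(** * A cutoff in one coordinate *)

Section Bump.
Context {R : realType} {n : nat}.
Local Notation C := R[i].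
Local Notation V := 'rV[C]_n.
Implicit Types (z : V) (D : set V) (q : V -> R).

Lemma smooth_flat D q (p : {poly R}) : open D -> smooth D (fun z => (q z)%:C) -> smooth D (fun z => (flat p (q z))%:C).
Proof.
move=> oD /smoothP sq; apply/smoothP => k.
have cf (p' : {poly R}) z : D z -> {for z, continuous (fun z => (flat p' (q z))%:C : C)}.
  move=> Dz; have cq : {for z, continuous q} := ((continuous_ReIm _ _).1 (Cksub_cont (sq 0) Dz)).1.
  have h1 : flat p' (q w) @[w --> z] --> flat p' (q z) by exact: (@cvg_comp _ _ _ q (flat p') _ _ _ cq (@flat_continuous R p' (q z))).
  exact: (@cvg_comp _ _ _ (fun w => flat p' (q w)) (real_complex R) _ _ _ h1 (@RtoC_continuous R _)).
elim: k p => [|k IH] p; first by split=> // z Dz; exact: cf.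
apply: (@CksubS _ _ _ _ _ (fun b j z => (flat (flat_deriv p) (q z))%:C * rderive (rd b j) (fun z => (q z)%:C) z) oD).
- move=> b j z Dz; have [H _] := Cksub_hasD b j (sq 1) Dz; split.
    rewrite ReM /= mul0r subr0.
    have D0 : is_derive (q (z + (0 : R)%:C *: rd b j)) (1 : R) (flat p) (flat (flat_deriv p) (q z)).
      by rewrite scale0r addr0; exact: is_derive_flat.
    exact: (is_derive1_comp D0 H).
  have Hq := Cksub_hasD b j (sq 1) Dz.
  have im0 : complex.Im (rderive (rd b j) (fun z => (q z)%:C) z) = 0.
    have [_ H'] := Hq; have [_ <-] := H'; exact: derive_cst.
  rewrite ImM im0 mulr0 mul0r addr0; exact: is_derive_cst.
- by move=> z Dz; exact: cf.
- move=> b j; apply: (Cksub_M oD (IH _)); exact: (Cksub_rd b j (sq k.+1)).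
Qed.

Variables (c : V) (m : 'I_n).

(** The squared modulus is used because it is smooth. *)
Definition dsq (j : 'I_n) z : R := complex.Re (z 0 j - c 0 j) ^+ 2 + complex.Im (z 0 j - c 0 j) ^+ 2.

Lemma dsqE j z : (dsq j z)%:C = (z 0 j - c 0 j) * conjc (z 0 j - c 0 j).
Proof. by rewrite /dsq; case: (z 0 j - c 0 j) => x y; apply: ReIm_eq => /=; ring. Qed.

Lemma smooth_dsq D j : open D -> smooth D (fun z => (dsq j z)%:C).
Proof.
move=> oD; have s1 : smooth D (fun z => z 0 j - c 0 j) := smoothB oD (smooth_coord oD j) (smooth_cst oD _).
by apply: (smooth_eq oD _ (smoothM oD s1 (smooth_conj oD s1))) => z _; rewrite dsqE.
Qed.

Lemma dsq_continuous j : continuous (dsq j).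
Proof.
move=> z; have sd := smooth_dsq j (@openT V).
exact: ((continuous_ReIm _ _).1 (Cksub_cont ((smoothP _ _).1 sd 0) (I : setT z))).1.
Qed.

Variables (a b : R).
Hypothesis ab : a < b.

(** The classical cutoff made from exp (- 1/x). It depends on coordinate [m] only, so dbar in the
    other coordinates does not see it. *)
Definition chi z : C := (flat 1 (b - dsq m z))%:C / ((flat 1 (b - dsq m z))%:C + (flat 1 (dsq m z - a))%:C).

Lemma chi_den z : (flat 1 (b - dsq m z))%:C + (flat 1 (dsq m z - a))%:C != 0 :> C.
Proof.
rewrite -rmorphD; have -> : (0 : C) = (0 : R)%:C by [].
rewrite (inj_eq (@complexI R)) gt_eqF //.
have [h|h] := ltP (dsq m z) b.
  by rewrite ltr_pwDl ?flat1_ge0 // flat1_gt0 // subr_gt0.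
by rewrite ltr_wpDl ?flat1_ge0 // flat1_gt0 // subr_gt0 (lt_le_trans ab).
Qed.

Lemma chi1 z : dsq m z <= a -> chi z = 1.
Proof.
move=> za; have := chi_den z; rewrite /chi [flat 1 (_ - a)]flat_le0 ?subr_le0 // addr0 => h.
exact: divff.
Qed.

Lemma chi0 z : b <= dsq m z -> chi z = 0.
Proof. by move=> zb; rewrite /chi flat_le0 ?subr_le0 // mul0r. Qed.

Let s1 D (oD : open D) : smooth D (fun z => (flat 1 (b - dsq m z))%:C : C).
Proof.
apply: (smooth_flat 1 oD); apply: (smooth_eq oD _ (smoothB oD (smooth_cst oD b%:C) (smooth_dsq m oD))) => z _.
by rewrite rmorphB.
Qed.

Let s2 D (oD : open D) : smooth D (fun z => (flat 1 (dsq m z - a))%:C : C).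
Proof.
apply: (smooth_flat 1 oD); apply: (smooth_eq oD _ (smoothB oD (smooth_dsq m oD) (smooth_cst oD a%:C))) => z _.
by rewrite rmorphB.
Qed.

Lemma smooth_chi D : open D -> smooth D chi.
Proof.
move=> oD; apply: (smoothM oD (s1 oD)); apply: (smoothV oD _ (smoothD oD (s1 oD) (s2 oD))).
by move=> z _; exact: chi_den.
Qed.

Lemma pd_chi0 l z : l != m -> pd (inr l) chi z = 0.
Proof.
move=> lm; rewrite (@pd_of_hasD _ _ _ _ _ (fun=> 0)) => [|s /=]; first by rewrite mulr0 addr0 mulr0.
have E t : chi (z + t%:C *: rd s l) = chi z.
  have h : (z + t%:C *: rd s l) 0 m = z 0 m.
    by rewrite !mxE; case: s; rewrite !mxE eqxx (eq_sym m) (negbTE lm) /= ?mulr0 addr0.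
  by rewrite /chi /dsq h.
by apply: (cder_ext (fun t => esym (E t))); exact: cder_cst.
Qed.

End Bump.

(** * The local dbar and ddbar lemmas *)

Opaque pd.

Section CauchyTransform.
Context {R : realType} {n : nat}.
Local Notation C := R[i].
Local Notation V := 'rV[C]_n.
Implicit Types (z : V) (D : set V) (F : V -> C).

Definition cis (t : R) : C := cos t +i* sin t.

Lemma cder_cis (t : R) : cder cis t ('i%C * cis t).
Proof.
split => /=; rewrite mul0r mul1r ?sub0r ?add0r; [exact: is_derive_cos|exact: is_derive_sin].
Qed.

Lemma cis_continuous : continuous cis.
Proof. by move=> t; exact: cder_continuous (cder_cis t). Qed.

Lemma cis2pi : cis (2 * pi) = cis 0.
Proof. by rewrite /cis mulr_natl cos2pi sin2pi cos0 sin0. Qed.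

Variable m : 'I_n.
Let em : V := delta_mx 0 m.

Definition circ (p : R * R) : V := (p.1%:C * cis p.2) *: em.

Lemma circE (p : R * R) j : circ p 0 j = if j == m then p.1%:C * cis p.2 else 0.
Proof. by rewrite !mxE eqxx /=; case: eqP => _; rewrite ?mulr1 ?mulr0. Qed.

Lemma circ_coef_continuous : continuous (fun p : R * R => (p.1%:C * cis p.2) : C).
Proof.
move=> p; have h1 : ((q.1%:C : C) @[q --> p] --> (p.1%:C : C)).
  exact: (@cvg_comp _ _ _ fst (real_complex R) _ _ _ (@cvg_fst _ _ _ _ _) (@RtoC_continuous R _)).
have h2 : (cis q.2 @[q --> p] --> cis p.2).
  exact: (@cvg_comp _ _ _ snd cis _ _ _ (@cvg_snd _ _ _ _ _) (@cis_continuous _)).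
exact: (cvgM h1 h2).
Qed.

Lemma circ_continuous : continuous circ.
Proof. by move=> p; rewrite /continuous_at /circ; apply: cvgZr_tmp; exact: circ_coef_continuous. Qed.

Definition ccis (p : R * R) : C := conjc (cis p.2).

Lemma ccis_continuous : continuous ccis.
Proof.
move=> p; have h2 : (cis q.2 @[q --> p] --> cis p.2).
  exact: (@cvg_comp _ _ _ snd cis _ _ _ (@cvg_snd _ _ _ _ _) (@cis_continuous _)).
exact: (@cvg_comp _ _ _ (fun q : R * R => cis q.2) (@conjc R) _ _ _ h2 (@conjc_continuous R _)).
Qed.

Let one_continuous : continuous (fun _ : R * R => (1 : R)).
Proof. by move=> p; exact: cst_continuous. Qed.

Variable rho : R.
Hypothesis rho0 : 0 < rho.

Let tau : R := 2 * pi.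
Let tau0 : 0 < tau. Proof. by rewrite mulr_gt0 // pi_gt0. Qed.

(** In polar coordinates w = z + r exp (i t) this is the area integral of F (w) / (w - z) over a
    disc in coordinate [m]: the Jacobian r cancels the modulus of w - z. *)
Definition cauchy F := fam (cint2 0 rho 0 tau) circ (fun=> 1) ccis F.

(** By [Dm], D is a full plane in coordinate [m], so the circles of integration stay inside it. *)
Variable D : set V.
Hypothesis oD : open D.
Hypothesis Dm : forall (z w : V), D z -> (forall j, j != m -> w 0 j = z 0 j) -> D w.

Let Dcirc (p : R * R) z : D z -> D (circ p + (1%:C : C) *: z).
Proof.
move=> Dz; apply: (Dm Dz) => j jm.
by rewrite mxE circE (negbTE jm) add0r mxE mul1r.
Qed.

Let cA : compact (`[0, rho]%classic `*` `[0, tau]%classic : set (R * R)).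
Proof. by apply: compact_setX; exact: segment_compact. Qed.

Let B0 : 0 <= (2 * (rho - 0)) * (2 * (tau - 0)).
Proof. by rewrite !subr0; apply: mulr_ge0; apply: mulr_ge0; rewrite ?(ltW rho0) ?(ltW tau0). Qed.

Let cI2D := @cint2D R 0 rho 0 tau (ltW tau0).
Let cI2Z := @cint2Z R 0 rho 0 tau (ltW tau0).
Let cI2B := @cint2_bound R 0 rho 0 tau (ltW rho0) (ltW tau0).

Lemma smooth_cauchy F : smooth D F -> smooth D (cauchy F).
Proof.
move=> sF; exact: (smooth_fam cA B0 cI2D cI2Z cI2B oD circ_continuous one_continuous Dcirc ccis_continuous sF).
Qed.

Lemma pd_cauchy b F z : smooth D F -> D z -> pd b (cauchy F) z = cauchy (pd b F) z.
Proof.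
move=> sF Dz; rewrite [LHS](pd_fam cA B0 cI2D cI2Z cI2B oD circ_continuous one_continuous Dcirc b ccis_continuous sF Dz).
apply: (congr1 (fun c => fam (cint2 0 rho 0 tau) circ (fun=> 1) c (pd b F) z)).
by apply/funext => p; exact: mulr1.
Qed.

Lemma cauchy_eq0 F z : (forall w, D w -> F w = 0) -> D z -> cauchy F z = 0.
Proof.
move=> F0 Dz; rewrite /cauchy /fam.
transitivity (cint2 0 rho 0 tau (fun p => 0 * ccis p)).
  by congr cint2; apply/funext => p; rewrite F0 ?mul0r ?mulr0 //; exact: Dcirc.
by rewrite cI2Z ?mul0r //; exact: ccis_continuous.
Qed.

(* In polar coordinates around [z],
   [2 r e^(-it) dbar F = r dF/dr + i dF/dt]; the last term integrates to 0
   over a period. *)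
Lemma cauchy_dbar F z : smooth D F -> D z -> (forall t, F (z + circ (rho, t)) = 0) ->
  cauchy (pd (inr m) F) z = - pi%:C * F z.
Proof.
move=> sF Dz Frho; have sF1 := (smoothP D F).1 sF 1.
pose w r t := circ (r, t) + (1%:C : C) *: z.
have Dw r t : D (w r t) by exact: Dcirc.
have w_m r t : w r t 0 m = r%:C * cis t + z 0 m by rewrite mxE circE eqxx mxE mul1r.
have w_j r t j : j != m -> w r t 0 j = z 0 j by move=> jm; rewrite mxE circE (negbTE jm) add0r mxE mul1r.
have chain (g : R -> V) (t0 : R) (d : C) : D (g t0) -> cder (fun t => g t 0 m) t0 d -> (forall t j, j != m -> g t 0 j = z 0 j) ->
    cder (fun t => F (g t)) t0 (d * pd (inl m) F (g t0) + conjc d * pd (inr m) F (g t0)).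
  move=> Dg dg gj; have H := @cder_chain _ _ D F g t0 (fun j => if j == m then d else 0) oD sF1 Dg.
  apply: (cder_eq (H _)).
    move=> j; case: eqP => [->//|/eqP jm].
    by apply: (cder_ext (fun t => esym (gj t j jm))); exact: cder_cst.
  rewrite (bigD1 m) //= eqxx big1 ?addr0 // => j jm.
  rewrite (negbTE jm) mul0r add0r (_ : conjc (0 : C) = 0) ?mul0r //; exact: conjc0.
pose g r t := F (w r t).
pose dF a r t := pd a F (w r t).
have cRtoC r t : cder (fun s : R => s%:C * cis t + z 0 m) r (cis t).
  have := cderD (cderM (cder_RtoC (is_derive_id r (1 : R))) (cder_cst (cis t) r)) (cder_cst (z 0 m) r).
  by move=> H; apply: (cder_eq H); rewrite mul1r mulr0 !addr0.
have dr r t : cder (fun r => g r t) r (cis t * dF (inl m) r t + conjc (cis t) * dF (inr m) r t).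
  apply: (chain (fun r => w r t) r) => //; last by move=> s j; exact: w_j.
  by apply: (cder_ext (fun s => esym (w_m s t))); exact: cRtoC.
have dt r t : cder (fun t => g r t) t (('i%C * r%:C * cis t) * dF (inl m) r t + conjc ('i%C * r%:C * cis t) * dF (inr m) r t).
  apply: (chain (fun t => w r t) t) => //; last by move=> s j; exact: w_j.
  apply: (cder_ext (fun s => esym (w_m r s))).
  apply: (cder_eq (cderD (cderZ r%:C (cder_cis t)) (cder_cst (z 0 m) t))).
  by rewrite addr0 mulrCA mulrA.
have cw : continuous (fun p : R * R => w p.1 p.2).
  move=> p; have E : (fun p : R * R => w p.1 p.2) = (fun p => circ p + (1%:C : C) *: z) by apply/funext => -[].
  rewrite E; apply: cvgD; [exact: circ_continuous|exact: cvg_cst].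
have cG (G : V -> C) : smooth D G -> continuous (fun p : R * R => G (w p.1 p.2)).
  move=> /smoothP/(_ 0) sG p; exact: (@cvg_comp _ _ _ (fun p : R * R => w p.1 p.2) G _ _ _ (cw p) (Cksub_cont sG (Dw p.1 p.2))).
have cdF a : continuous (fun p : R * R => dF a p.1 p.2) by apply: cG; exact: (smooth_pd oD).
have cg : continuous (fun p : R * R => g p.1 p.2) := cG F sF.
have ccis2 : continuous (fun p : R * R => cis p.2).
  by move=> p; exact: (@cvg_comp _ _ _ snd cis _ _ _ (@cvg_snd _ _ _ _ _) (@cis_continuous _)).
pose f2 (p : R * R) := 2 * (ccis p * dF (inr m) p.1 p.2).
pose gr (p : R * R) := cis p.2 * dF (inl m) p.1 p.2 + ccis p * dF (inr m) p.1 p.2.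
have cf0 : continuous (fun p => ccis p * dF (inr m) p.1 p.2) by move=> p; exact: (ccM (@ccis_continuous p) (cdF (inr m) p)).
have cf2 : continuous f2 by move=> p; exact: (ccM (f := fun=> 2) (@cc_cst R _ 2 p) (cf0 p)).
have cgr : continuous gr by move=> p; exact: (ccD (ccM (ccis2 p) (cdF (inl m) p)) (cf0 p)).
(* The integral of F over the circle of radius r: it is 0 at rho, since F vanishes there, and 2 pi F
   z at 0. *)
pose G r := cint 0 tau (g r).
have cgs r : continuous (g r) by exact: (cint_slice (f := fun p => g p.1 p.2)).
have bd (h : R -> C) (M : R) : continuous h -> (forall t, `[0, tau]%classic t -> `|h t| <= M%:C) -> `|cint 0 tau h| <= (2 * (tau - 0) * M)%:C.
  by move=> ch hM; exact: (cint_bound (ltW tau0) ch hM).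
have Bt : 0 <= 2 * (tau - 0) by rewrite subr0 mulr_ge0 // ltW.
have dG r : cder G r (cint 0 tau (fun t => gr (r, t))).
  apply: (funct_der (@segment_compact R 0 tau) Bt (@cintD R 0 tau) (@cintZ R 0 tau) bd (k := g) (k' := fun r t => gr (r, t)) (s0 := r)).
  - by near=> s; exact: cgs.
  - exact: cint_slice.
  - by near=> s; move=> t _; exact: dr.
  - move=> t _; have E : (fun p : R * R => gr (p.1, p.2)) = gr by apply/funext => -[].
    have cgr' : continuous (fun p : R * R => gr (p.1, p.2)) by rewrite E.
    exact: cgr'.
(* For r > 0 the angular derivative integrates to 0 over a period, so G'(r) is the angular integral
   of [f2]. *)
have key r : 0 < r -> cint 0 tau (fun t => gr (r, t)) = cint 0 tau (fun t => f2 (r, t)).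
  move=> r0; pose gt t := ('i%C * r%:C * cis t) * dF (inl m) r t + conjc ('i%C * r%:C * cis t) * dF (inr m) r t.
  have gtE t : gt t = 'i%C * r%:C * (gr (r, t) - f2 (r, t)).
        rewrite /gt /gr /f2 /ccis /cis /=.
    case: (dF (inl m) r t) => a b; case: (dF (inr m) r t) => x y.
    by move: (cos t) (sin t) => u v; apply: ReIm_eq => /=; ring.
  have cgr1 := cint_slice (r := r) cgr; have cf21 := cint_slice (r := r) cf2.
  have cd : continuous (fun t => gr (r, t) - f2 (r, t)) by move=> t; exact: (ccB (cgr1 t) (cf21 t)).
  have cgt : continuous gt.
    have -> : gt = (fun t => 'i%C * r%:C * (gr (r, t) - f2 (r, t))) by apply/funext.
    by move=> t; exact: (ccM (f := fun=> 'i%C * r%:C) (@cc_cst R _ _ t) (cd t)).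
  have E := cint_FTC tau0 cgt (cgs r) (fun t _ => dt r t).
  have gper : g r tau = g r 0 by rewrite /g /w /circ /= cis2pi.
  rewrite gper subrr in E.
  have E' : cint 0 tau gt = 'i%C * r%:C * cint 0 tau (fun t => gr (r, t) - f2 (r, t)).
    exact: (etrans (congr1 (cint 0 tau) (funext gtE)) (cintZ 0 tau _ cd)).
  have ir0 : 'i%C * r%:C != 0 :> C.
    rewrite mulf_neq0 //; first exact: (neq0Ci C).
    by have -> : (0 : C) = (0 : R)%:C by []; rewrite (inj_eq (@complexI R)) gt_eqF.
  have := E; rewrite E' => /eqP; rewrite mulf_eq0 (negbTE ir0) /= => /eqP E2.
  have E3 : cint 0 tau (fun t => gr (r, t) - f2 (r, t)) = cint 0 tau (fun t => gr (r, t)) - cint 0 tau (fun t => f2 (r, t)).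
    exact: (functB (@cintD R 0 tau) (@cintZ R 0 tau) cgr1 cf21).
  by apply/eqP; rewrite -subr_eq0 -E3 E2.
have main : cint 0 rho (fun r => cint 0 tau (fun t => f2 (r, t))) = G rho - G 0.
  apply: cint_FTC => //.
  - exact: (cint_param_continuous (ltW tau0) cf2).
  - by move=> r; exact: cder_continuous (dG r).
  - by move=> r /andP[r0 _]; rewrite -key.
have Grho : G rho = 0.
  rewrite /G (_ : g rho = fun t => 0 * 1); first by rewrite cintZ ?mul0r // => t; exact: cst_continuous.
  by apply/funext => t; rewrite mul0r /g /w scale1r addrC Frho.
have G0 : G 0 = tau%:C * F z.
  have g0 t : g 0 t = F z by rewrite /g /w /circ /= mul0r scale0r add0r scale1r.
  have cc (c : C) : continuous (fun _ : R => c) by move=> t; exact: cst_continuous.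
  have := @cint_FTC R 0 tau (fun t => F z * t%:C) (fun=> F z) tau0 (cc _) _ _.
  rewrite /G (_ : g 0 = fun=> F z); last by apply/funext.
  move=> ->; first by rewrite mulr0 subr0 mulrC.
    by move=> t; exact: (ccM (f := fun=> F z) (cc _ t) (@RtoC_continuous R t)).
  move=> t _; apply: (cder_eq (cderZ (F z) (cder_RtoC (is_derive_id t (1 : R))))); exact: mulr1.
have two0 : (2 : C) != 0 by rewrite pnatr_eq0.
apply: (mulfI two0).
have E1 : 2 * cauchy (pd (inr m) F) z = cint2 0 rho 0 tau f2.
  have -> : cauchy (pd (inr m) F) z = cint2 0 rho 0 tau (fun p => ccis p * dF (inr m) p.1 p.2).
    by rewrite /cauchy /fam; congr cint2; apply/funext => -[].
  exact: (esym (cI2Z 2 cf0)).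
rewrite E1 /cint2 main Grho G0 sub0r /tau rmorphM rmorph_nat -mulNr -mulrN mulrA //.
Unshelve. all: by end_near. Qed.

End CauchyTransform.

(** * The dbar equation on polydiscs *)

Section Dolbeault.
Context {R : realType} {n : nat}.
Local Notation C := R[i].
Local Notation V := 'rV[C]_n.
Variable c : V.
Implicit Types (z : V) (D : set V) (F : V -> C) (r : R).

(* [r] is the square of the radius. *)
Definition PD r : set V := [set z | forall j, dsq c j z < r].

Lemma near_dsq_lt j r z : dsq c j z < r -> \forall w \near z, dsq c j w < r.
Proof.
move=> zr; have H := @dsq_continuous R n c j z [set x | x < r] (lt_nbhsl zr).
exact: H.
Qed.

Lemma near_dsq_gt j r z : r < dsq c j z -> \forall w \near z, r < dsq c j w.
Proof.
move=> zr; have H := @dsq_continuous R n c j z [set x | r < x] (lt_nbhsr zr).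
exact: H.
Qed.

Lemma open_PD r : open (PD r).
Proof.
rewrite openE => z Dz.
suff H : \forall w \near nbhs z, forall j : 'I_n, dsq c j w < r by exact: H.
by apply: filter_forall => j; exact: near_dsq_lt.
Qed.

Lemma PD_center r : 0 < r -> PD r c.
Proof. by move=> r0 j; rewrite /dsq subrr expr0n add0r. Qed.

Lemma PD_sub r r' : r <= r' -> PD r `<=` PD r'.
Proof. by move=> rr z Dz j; exact: lt_le_trans (Dz j) rr. Qed.

Lemma PD_nbhs D : open D -> D c -> exists2 r, 0 < r & PD r `<=` D.
Proof.
move=> oD Dc; have /nbhs_ballP[e /= e0 He] := open_nbhs_nbhs (conj oD Dc).
have eE : e = (complex.Re e)%:C by rewrite RRe_real // gtr0_real.
have er0 : 0 < complex.Re e by rewrite -ltcR -eE.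
exists (complex.Re e ^+ 2) => [|z Dz]; first exact: exprn_gt0.
apply: He; split=> [//|i j]; rewrite !ord1.
rewrite -ball_normE /= eE normc_def ltcR -[ltRHS]gtr0_norm // -sqrtr_sqr ltr_sqrt ?exprn_gt0 //.
by have := Dz j; rewrite /dsq -[c 0 j - z 0 j]opprB; case: (z 0 j - c 0 j) => x y /=; rewrite !sqrrN.
Qed.

Lemma smoothU D1 D2 F : smooth D1 F -> smooth D2 F -> smooth (D1 `|` D2) F.
Proof.
move=> /smoothP H1 /smoothP H2; apply/smoothP => k.
elim: k F {H1 H2} (H1 k) (H2 k) => [|k IH] F [c1 h1] [c2 h2]; split => //.
- by move=> z []; [exact: c1|exact: c2].
- by move=> z []; [exact: c1|exact: c2].
move=> b j; have [d1 k1] := h1 b j; have [d2 k2] := h2 b j; split; last exact: IH.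
by move=> z []; [exact: d1|exact: d2].
Qed.

(** Cut alpha off in coordinate [m], extend it by 0 to the whole plane of that coordinate and take
    the Cauchy transform, which commutes with the other dbar operators. *)
Lemma dbar_step (m : 'I_n) (a r : R) (alpha : V -> C) : 0 < a -> a < r -> smooth (PD r) alpha ->
  exists u, [/\ smooth (PD r) u, forall z, PD a z -> pd (inr m) u z = alpha z &
    forall l, l != m -> (forall z, PD r z -> pd (inr l) alpha z = 0) -> forall z, PD r z -> pd (inr l) u z = 0].
Proof.
move=> a0 ar sal; have r0 := lt_trans a0 ar.
pose b := (a + r) / 2; have ab : a < b by rewrite /b; lra.
have br : b < r by rewrite /b; lra.
(* Coordinate [m] is left free in D'; F is smooth there, being 0 on [D2] and chi alpha on the
   polydisc. *)
pose D' : set V := [set z | forall j, j != m -> dsq c j z < r].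
have oD' : open D'.
  rewrite openE => z Dz.
  suff H : \forall w \near nbhs z, forall j : 'I_n, j != m -> dsq c j w < r by exact: H.
  apply: filter_forall => j; have [->|jm] := eqVneq j m; first by apply: nearW.
  by apply: filterS (near_dsq_lt (Dz j jm)) => w.
pose D2 : set V := D' `&` [set z | b < dsq c m z].
have oD2 : open D2.
  by apply: openI => //; rewrite openE => z Dz; exact: near_dsq_gt.
have PD' : PD r `<=` D' by move=> z Dz j _.
have D'U : D' = PD r `|` D2.
  apply/seteqP; split=> z; last by case=> [|[]//]; exact: PD'.
  move=> Dz; have [h|h] := ltP (dsq c m z) r; last by right; split=> //=; exact: lt_le_trans br h.
  by left=> j; have [->|jm] := eqVneq j m => //; exact: Dz.
pose F z := if dsq c m z < r then chi c m a b z * alpha z else 0.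
have F1 z : PD r z -> F z = chi c m a b z * alpha z by move=> Dz; rewrite /F Dz.
have F2 z : D2 z -> F z = 0 by move=> [_ /= /ltW zb]; rewrite /F; case: ifP => // _; rewrite chi0 ?mul0r.
have schi := smooth_chi c m ab (open_PD (r := r)).
have sF1 : smooth (PD r) (fun z => chi c m a b z * alpha z) := smoothM (open_PD (r := r)) schi sal.
have sF : smooth D' F.
  rewrite D'U; apply: smoothU.
    by apply: (smooth_eq (open_PD (r := r)) _ sF1) => z Dz; rewrite F1.
  by apply: (smooth_eq oD2 _ (smooth_cst oD2 0)) => z Dz; rewrite F2.
have Dm (z w : V) : D' z -> (forall j, j != m -> w 0 j = z 0 j) -> D' w.
  by move=> Dz wz j jm; rewrite /dsq wz //; exact: Dz.
(* A circle of this radius in coordinate [m] about a point of the polydisc leaves the polydisc,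
   hence the support of F, because rho^2 >= 4 r. *)
pose rho := 2 * (1 + r); have rho0 : 0 < rho by rewrite /rho; lra.
pose k : C := - (pi%:C)^-1.
have pi0 : (pi%:C : C) != 0.
  by have -> : (0 : C) = (0 : R)%:C by []; rewrite (inj_eq (@complexI R)) gt_eqF // pi_gt0.
have sc := smooth_cauchy rho0 oD' Dm sF.
exists (fun z => k * cauchy m rho F z); split.
- exact: (smoothZ (open_PD (r := r)) k (smooth_sub PD' sc)).
- move=> z Dz; have Dr : PD r z by apply: PD_sub Dz; exact: ltW.
  rewrite (pdZ oD' (inr m) k (PD' _ Dr) sc) (pd_cauchy rho0 oD' Dm (inr m) sF (PD' _ Dr)).
  rewrite (cauchy_dbar rho0 oD' Dm sF (PD' _ Dr)).
    rewrite F1 // chi1 //; last by apply: ltW; exact: Dz.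
    by rewrite mul1r /k mulrA mulNr mulrN opprK mulVf // mul1r.
  move=> t; rewrite /F ifF //; apply/negbTE; rewrite -leNgt.
  have := Dr m; rewrite /dsq mxE circE eqxx /= /cis.
  have cs : rho ^+ 2 = (rho * cos t) ^+ 2 + (rho * sin t) ^+ 2 by rewrite !exprMn -mulrDr cos2Dsin2 mulr1.
  case: (z 0 m) => x y; case: (c 0 m) => x' y' /=.
  have E1 : (x + (rho * cos t - 0 * sin t) - x') = (x - x') + rho * cos t by ring.
  have E2 : (y + (rho * sin t + 0 * cos t) - y') = (y - y') + rho * sin t by ring.
  rewrite E1 E2; move: (x - x') (y - y') (rho * cos t) (rho * sin t) cs => X Y U W cs H.
  have h1 : 0 <= (X + U / 2) ^+ 2 by exact: sqr_ge0.
  have h2 : 0 <= (Y + W / 2) ^+ 2 by exact: sqr_ge0.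
  have h3 : 4 * r <= rho ^+ 2 by rewrite /rho; have := sqr_ge0 (1 - r); have := sqr_ge0 r; nra.
  nra.
move=> l lm al0 z Dz; rewrite (pdZ oD' (inr l) k (PD' _ Dz) sc) (pd_cauchy rho0 oD' Dm (inr l) sF (PD' _ Dz)).
suff c0 : cauchy m rho (pd (inr l) F) z = 0 by rewrite c0 mulr0.
apply: (cauchy_eq0 rho Dm _ (PD' _ Dz)) => w; rewrite {1}D'U => -[Dw|Dw].
  
rewrite (pd_eq (open_PD (r := r)) (inr l) Dw F1) (pdM (inr l) Dw schi sal) al0 // mulr0 addr0.
  by rewrite pd_chi0 // mul0r.
by rewrite (pd_eq oD2 (inr l) Dw F2) pd_cst.
Qed.

(** Induction on the number of components that may be nonzero. Solving for the last of them, m, and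
    subtracting dbar u kills it; closedness gives dbar_j alpha_m = 0 for the components j that
    already vanish, so they remain zero. Each step halves the squared radius. *)
Theorem dolbeault r (alpha : 'I_n -> V -> C) : 0 < r -> (forall j, smooth (PD r) (alpha j)) ->
  (forall j l z, PD r z -> pd (inr l) (alpha j) z = pd (inr j) (alpha l) z) ->
  exists r' f, [/\ 0 < r', r' <= r, smooth (PD r') f & forall j z, PD r' z -> pd (inr j) f z = alpha j z].
Proof.
move=> r0 sal cal.
suff H k : (k <= n)%N -> forall r (alpha : 'I_n -> V -> C), 0 < r -> (forall j, smooth (PD r) (alpha j)) ->
  (forall j l z, PD r z -> pd (inr l) (alpha j) z = pd (inr j) (alpha l) z) ->
  (forall (j : 'I_n) z, PD r z -> (k <= j)%N -> alpha j z = 0) ->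
  exists r' f, [/\ 0 < r', r' <= r, smooth (PD r') f & forall j z, PD r' z -> pd (inr j) f z = alpha j z].
  apply: (H n (leqnn n) r alpha r0 sal cal) => j z _.
  by rewrite leqNgt ltn_ord.
elim: k => [|k IH] kn {}r {}alpha {}r0 {}sal {}cal al0.
  exists r, (fun=> 0); split => //; first exact: (smooth_cst (open_PD (r := r))).
  by move=> j z Dz; rewrite pd_cst al0.
pose m := Ordinal kn; pose a := r / 2.
have a0 : 0 < a by rewrite /a; lra.
have ar : a < r by rewrite /a; lra.
have [u [su um ul]] := dbar_step m a0 ar (sal m).
have ss := PD_sub (ltW ar); have oa := open_PD (r := a).
have sua := smooth_sub ss su.
have sala j := smooth_sub ss (sal j).
pose al' j z := alpha j z - pd (inr j) u z.
have sal' j : smooth (PD a) (al' j) := smoothB oa (sala j) (smooth_pd oa (inr j) sua).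
have cal' j l z : PD a z -> pd (inr l) (al' j) z = pd (inr j) (al' l) z.
  move=> Dz; rewrite (pdB oa (inr l) Dz (sala j) (smooth_pd oa (inr j) sua)) (pdB oa (inr j) Dz (sala l) (smooth_pd oa (inr l) sua)).
  exact: (congr2 (fun x y : C => x - y) (cal j l z (ss _ Dz)) (pdC oa (inr l) (inr j) Dz sua)).
have al0' (j : 'I_n) z : PD a z -> (k <= j)%N -> al' j z = 0.
  move=> Dz; rewrite leq_eqVlt => /orP[/eqP kj|kj].
    have -> : j = m by apply: val_inj.
    by rewrite /al' um // subrr.
  have jm : j != m by apply/eqP => jm; rewrite jm ltnn in kj.
  rewrite /al' (al0 j z (ss _ Dz) kj) (ul j jm _ z (ss _ Dz)) ?subrr // => w Dw.
  rewrite cal // (pd_eq (open_PD (r := r)) (inr m) (G := fun=> 0) Dw) ?pd_cst // => v Dv.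
  exact: al0.
have [r' [f [r'0 r'a sf fE]]] := IH (ltnW kn) a al' a0 sal' cal' al0'.
have o' := open_PD (r := r'); have su' := smooth_sub (PD_sub r'a) sua.
exists r', (fun z => f z + u z); split => //; first exact: le_trans r'a (ltW ar).
  exact: (smoothD o' sf su').
move=> j z Dz; rewrite (pdD (inr j) Dz sf su') fE // /al' subrK //.
Qed.

End Dolbeault.

(** * Potentials of closed Hermitian forms on polydiscs *)

Section LocalPotential.
Context {R : realType} {n : nat}.
Local Notation C := R[i].
Local Notation V := 'rV[C]_n.
Variable c : V.
Implicit Types (z : V) (F : V -> C).

(* The interval [0, 1] is integrated over; [clamp] keeps the homotopy inside
   the polydisc for every real parameter. *)
Definition clamp (t : R) : R := (`|t| - `|t - 1| + 1) / 2.

Lemma clamp_continuous : continuous clamp.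
Proof.
move=> t; have h1 : `|x - 1| @[x --> t] --> `|t - 1|.
  by apply: cvg_norm; apply: cvgB; [exact: cvg_id|exact: cvg_cst].
have h2 : `|x| @[x --> t] --> `|t| by apply: cvg_norm; exact: cvg_id.
have h3 : `|x| - `|x - 1| + 1 @[x --> t] --> `|t| - `|t - 1| + 1.
  by apply: cvgD; [exact: (cvgB h2 h1)|exact: cvg_cst].
exact: (cvgM h3 (@cvg_cst _ (2^-1 : R) _ (nbhs t) _)).
Qed.

Lemma clamp01 t : 0 <= clamp t <= 1.
Proof. rewrite /clamp; case: (ger0P t); case: (ger0P (t - 1)); lra. Qed.

Lemma clampE t : 0 <= t <= 1 -> clamp t = t.
Proof. rewrite /clamp => /andP[]; case: (ger0P t); case: (ger0P (t - 1)); lra. Qed.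

Definition cone (t : R) : V := (1 - clamp t)%:C *: c.

(** The integral of t^m F (c + t (z - c)) over [0, 1]. *)
Definition radial (m : nat) F := fam (cint 0 1) cone clamp (fun t => (clamp t)%:C ^+ m : C) F.

Let cA : compact (`[0, 1]%classic : set R). Proof. exact: segment_compact. Qed.
Let B0 : 0 <= 2 * (1 - 0) :> R. Proof. by rewrite subr0 mulr1. Qed.
Let cIB (f : R -> C) (M : R) : continuous f -> (forall t, `[0, 1]%classic t -> `|f t| <= M%:C) -> `|cint 0 1 f| <= (2 * (1 - 0) * M)%:C.
Proof. by move=> cf fM; exact: (cint_bound ler01 cf fM). Qed.

Let clampC : continuous (fun t => (clamp t)%:C : C).
Proof. by move=> t; exact: (@cvg_comp _ _ _ clamp (real_complex R) _ _ _ (@clamp_continuous t) (@RtoC_continuous R _)). Qed.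

Let cpow m : continuous (fun t => (clamp t)%:C ^+ m : C).
Proof.
elim: m => [|m IH] t; first exact: cst_continuous.
under [X in continuous_at _ X]eq_fun do rewrite exprS.
by exact: (ccM (f := fun t => (clamp t)%:C : C) (g := fun t => (clamp t)%:C ^+ m : C) (@clampC t) (IH t)).
Qed.

Let cone_continuous : continuous cone.
Proof.
move=> t; apply: cvgZr_tmp.
apply: (@cvg_comp _ _ _ (fun t => 1 - clamp t) (real_complex R) _ _ _ _ (@RtoC_continuous R _)).
by apply: cvgB; [exact: cvg_cst|exact: clamp_continuous].
Qed.

Variable r : R.
Hypothesis r0 : 0 < r.
Let oD : open (PD c r) := open_PD (r := r).

Lemma coneE t z : cone t + (clamp t)%:C *: z = c + (clamp t)%:C *: (z - c).
Proof. by apply/rowP => j; rewrite !mxE rmorphB rmorph1; ring. Qed.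

Let coneD t z : PD c r z -> PD c r (cone t + (clamp t)%:C *: z).
Proof.
move=> Dz j; have /andP[c0 c1] := clamp01 t; rewrite coneE /dsq !mxE addrAC subrr add0r.
have := Dz j; rewrite /dsq; case: (z 0 j - c 0 j) => x y /=; move: (clamp t) c0 c1 => s c0 c1.
rewrite !mul0r subr0 addr0; apply: le_lt_trans; rewrite !exprMn -mulrDr.
by rewrite ler_piMl ?addr_ge0 ?sqr_ge0 // exprn_ile1.
Qed.

Lemma smooth_radial m F : smooth (PD c r) F -> smooth (PD c r) (radial m F).
Proof.
move=> sF; exact: (smooth_fam cA B0 (@cintD R 0 1) (@cintZ R 0 1) cIB oD cone_continuous clamp_continuous coneD (@cpow m) sF).
Qed.

Lemma pd_radial m b F z : smooth (PD c r) F -> PD c r z -> pd b (radial m F) z = radial m.+1 (pd b F) z.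
Proof.
move=> sF Dz; rewrite [LHS](pd_fam cA B0 (@cintD R 0 1) (@cintZ R 0 1) cIB oD cone_continuous clamp_continuous coneD b (@cpow m) sF Dz).
apply: (congr1 (fun c => fam (cint 0 1) cone clamp c (pd b F) z)).
by apply/funext => t; rewrite exprSr.
Qed.

Lemma radial_eq m F G z : (forall w, PD c r w -> F w = G w) -> PD c r z -> radial m F z = radial m G z.
Proof.
move=> FG Dz; rewrite /radial /fam; apply: (congr1 (cint 0 1)); apply/funext => t.
by rewrite FG //; exact: coneD.
Qed.

Lemma conjc_cint (f : R -> C) : continuous f -> conjc (cint 0 1 f) = cint 0 1 (fun t => conjc (f t)).
Proof.
move=> cf; apply: ReIm_eq => /=.
  by apply: eq_Rintegral => t _; case: (f t).
have cI : continuous (fun t => complex.Im (f t)) by move=> t; exact: ((continuous_ReIm f t).1 (cf t)).2.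
rewrite -mulN1r -RintegralZl //; last exact: integrable_cont.
by apply: eq_Rintegral => t _; case: (f t) => x y /=; rewrite mulN1r.
Qed.

Let fam_c m F z : smooth (PD c r) F -> PD c r z -> continuous (fun t => (clamp t)%:C ^+ m * F (cone t + (clamp t)%:C *: z) : C).
Proof.
move=> /smoothP/(_ 0) sF Dz.
exact: (fam_cont cone_continuous clamp_continuous coneD (@cpow m) (fun w Dw => Cksub_cont sF Dw) Dz).
Qed.

Lemma conj_radial m F z : smooth (PD c r) F -> PD c r z -> conjc (radial m F z) = radial m (fun w => conjc (F w)) z.
Proof.
move=> sF Dz; rewrite [LHS](conjc_cint (fam_c (m := m) sF Dz)) /radial /fam.
apply: (congr1 (cint 0 1)); apply/funext => t; rewrite rmorphM rmorphXn; congr (_ ^+ _ * _).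
by apply: ReIm_eq => //=; rewrite oppr0.
Qed.

(* d/dt (t^2 F(c + t(z - c))) *)
Lemma radial_euler F z : smooth (PD c r) F -> PD c r z ->
  2 * radial 1 F z + \sum_i ((z 0 i - c 0 i) * radial 2 (pd (inl i) F) z + conjc (z 0 i - c 0 i) * radial 2 (pd (inr i) F) z) = F z.
Proof.
move=> sF Dz; have sF1 := (smoothP _ F).1 sF 1.
pose G (t : R) := (clamp t)%:C ^+ 2 * F (cone t + (clamp t)%:C *: z).
pose e m F' (t : R) : C := (clamp t)%:C ^+ m * F' (cone t + (clamp t)%:C *: z).
pose g t := 2 * e 1 F t + \sum_i ((z 0 i - c 0 i) * e 2 (pd (inl i) F) t + conjc (z 0 i - c 0 i) * e 2 (pd (inr i) F) t).
have ce m F' : smooth (PD c r) F' -> continuous (e m F') by move=> sF'; exact: fam_c.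
have sp b := smooth_pd oD b sF.
have cZ (x : C) f : continuous f -> continuous (fun t : R => x * f t).
  by move=> cf t; exact: (ccM (f := fun=> x) (@cc_cst R _ x t) (cf t)).
have c1 i : continuous (fun t => (z 0 i - c 0 i) * e 2 (pd (inl i) F) t + conjc (z 0 i - c 0 i) * e 2 (pd (inr i) F) t).
  by move=> t; exact: (ccD (cZ _ _ (ce 2 _ (sp (inl i))) t) (cZ _ _ (ce 2 _ (sp (inr i))) t)).
have cs (s : seq 'I_n) : continuous (fun t => \sum_(i <- s) ((z 0 i - c 0 i) * e 2 (pd (inl i) F) t + conjc (z 0 i - c 0 i) * e 2 (pd (inr i) F) t)) /\
   cint 0 1 (fun t => \sum_(i <- s) ((z 0 i - c 0 i) * e 2 (pd (inl i) F) t + conjc (z 0 i - c 0 i) * e 2 (pd (inr i) F) t)) =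
   \sum_(i <- s) ((z 0 i - c 0 i) * radial 2 (pd (inl i) F) z + conjc (z 0 i - c 0 i) * radial 2 (pd (inr i) F) z).
  elim: s => [|i s [IHc IHi]].
    have E : (fun t : R => \sum_(i <- [::]) ((z 0 i - c 0 i) * e 2 (pd (inl i) F) t + conjc (z 0 i - c 0 i) * e 2 (pd (inr i) F) t)) = fun t => 0 * 0.
      by apply/funext => t; rewrite big_nil mul0r.
    rewrite E big_nil; split; first by move=> t; exact: cst_continuous.
    transitivity (0 * cint 0 1 (fun=> 0 : C)); last exact: mul0r.
    exact: (cintZ 0 1 0 (@cc_cst R R 0)).
  have E : (fun t : R => \sum_(j <- i :: s) ((z 0 j - c 0 j) * e 2 (pd (inl j) F) t + conjc (z 0 j - c 0 j) * e 2 (pd (inr j) F) t)) =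
    fun t => ((z 0 i - c 0 i) * e 2 (pd (inl i) F) t + conjc (z 0 i - c 0 i) * e 2 (pd (inr i) F) t) + \sum_(j <- s) ((z 0 j - c 0 j) * e 2 (pd (inl j) F) t + conjc (z 0 j - c 0 j) * e 2 (pd (inr j) F) t).
    by apply/funext => t; rewrite big_cons.
  rewrite E big_cons; split; first by move=> t; exact: (ccD (c1 i t) (IHc t)).
  rewrite (cintD 0 1 (c1 i) IHc) IHi; congr (_ + _).
  rewrite (cintD 0 1 (cZ _ _ (ce 2 _ (sp (inl i)))) (cZ _ _ (ce 2 _ (sp (inr i))))).
  by rewrite (cintZ 0 1 _ (ce 2 _ (sp (inl i)))) (cintZ 0 1 _ (ce 2 _ (sp (inr i)))).
have [cs1 cs2] := cs (index_enum 'I_n).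
have cg : continuous g by move=> t; exact: (ccD (cZ _ _ (ce 1%N _ sF) t) (cs1 t)).
have gE : cint 0 1 g = 2 * radial 1 F z + \sum_i ((z 0 i - c 0 i) * radial 2 (pd (inl i) F) z + conjc (z 0 i - c 0 i) * radial 2 (pd (inr i) F) z).
  rewrite (cintD 0 1 (cZ 2 _ (ce 1%N _ sF)) cs1) cs2; congr (_ + _).
  exact: (cintZ 0 1 2 (ce 1%N _ sF)).
rewrite -gE.
have cl0 : clamp 0 = 0 by rewrite clampE // lexx ler01.
have cl1 : clamp 1 = 1 by rewrite clampE // lexx ler01.
rewrite (@cint_FTC R 0 1 G g ltr01 cg (ce 2%N _ sF)).
  rewrite /G cl0 cl1 expr1n mul1r expr0n mul0r subr0 /cone cl1 subrr scale0r add0r scale1r //.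
move=> t /andP[t0 t1].
have nt : \forall s \near t, clamp s = s.
  have n1 : \forall s \near t, 0 < s by exact: lt_nbhsr.
  have n2 : \forall s \near t, s < 1 by exact: lt_nbhsl.
  by apply: filterS2 n1 n2 => s s0 s1; rewrite clampE // !ltW.
have ct : clamp t = t by exact: nbhs_singleton nt.
pose H (s : R) := s%:C ^+ 2 * F (c + s%:C *: (z - c)).
have Gt : \forall s \near t, H s = G s.
  by apply: filterS nt => s cs'; rewrite /G coneE cs'.
apply: (cder_near Gt).
have Dt : PD c r (c + t%:C *: (z - c)) by rewrite -ct -coneE; exact: coneD.
have dl i : cder (fun s : R => (c + s%:C *: (z - c)) 0 i) t (z 0 i - c 0 i).
  have := cderD (cder_cst (c 0 i) t) (cderM (cder_RtoC (is_derive_id t (1 : R))) (cder_cst (z 0 i - c 0 i) t)).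
  move=> D1; apply: (cder_ext _ (cder_eq D1 _)); first by move=> s; rewrite !mxE.
  by rewrite mul1r mulr0 addr0 add0r.
have dF := cder_chain oD sF1 Dt dl.
have d2 : cder (fun s : R => s%:C ^+ 2) t (2 * t%:C).
  have D1 := cder_RtoC (is_derive_id t (1 : R)).
  apply: (cder_ext _ (cder_eq (cderM D1 D1) _)); first by move=> s; rewrite expr2.
  by rewrite mul1r mulr1 mulr_natl mulr2n.
apply: (cder_eq (cderM d2 dF)).
rewrite /g /e coneE ct expr1 mulrA; congr (_ + _); rewrite mulr_sumr; apply: eq_bigr => i _.
Transparent pd.
by rewrite /pd mulrDr; congr (_ + _); rewrite mulrCA.
Opaque pd.
Qed.

(** With R_1 = [radial 1], the form alpha_j = sum_i (z^i - c^i) R_1 h_ij is dbar-closed. Take f with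
    dbar f = alpha and Phi = f + conj f. Then d_k dbar_j Phi = d_k alpha_j + conj (d_j alpha_k),
    which closedness and Hermitian symmetry of h turn into the left side of [radial_euler] for h k
    j. *)
Theorem ddbar_lemma (h : 'I_n -> 'I_n -> V -> C) : (forall i j, smooth (PD c r) (h i j)) ->
  (forall i j k z, PD c r z -> pd (inl k) (h i j) z = pd (inl i) (h k j) z) ->
  (forall i j z, PD c r z -> h j i z = conjc (h i j z)) ->
  exists r' Phi, [/\ 0 < r', r' <= r, smooth (PD c r') Phi &
    forall z i j, PD c r' z -> hmx Phi z i j = h i j z].
Proof.
move=> sh ch hh.
have shc i j : smooth (PD c r) (fun z => conjc (h i j z)) := smooth_conj oD (sh i j).
have ch' i j l z : PD c r z -> pd (inr l) (h i j) z = pd (inr j) (h i l) z.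
  move=> Dz; rewrite (pd_eq oD (inr l) Dz (fun w Dw => hh j i w Dw)) (pd_eq oD (inr j) Dz (fun w Dw => hh l i w Dw)).
  have e1 := pd_conj (inr l) Dz (sh j i); have e2 := pd_conj (inr j) Dz (sh l i).
  by etransitivity; first exact: e1; rewrite ch //; exact: (esym e2).
pose x i z := z 0 i - c 0 i.
have sx i : smooth (PD c r) (x i) := smoothB oD (smooth_coord oD i) (smooth_cst oD _).
have dx b i z : PD c r z -> pd b (x i) z = if b is inl k then (k == i)%:R else 0.
  by move=> Dz; rewrite (pdB oD b Dz (smooth_coord oD i) (smooth_cst oD (c 0 i))) pd_cst subr0 pd_coord.
pose alpha j z := \sum_i x i z * radial 1 (h i j) z.
have sR m i j := smooth_radial m (sh i j).
have sxR i j : smooth (PD c r) (fun z => x i z * radial 1 (h i j) z) := smoothM oD (sx i) (sR 1 i j).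
have sal j : smooth (PD c r) (alpha j) by apply: (smooth_sum oD) => i _; exact: sxR.
have dal b j z : PD c r z -> pd b (alpha j) z = (if b is inl k then radial 1 (h k j) z else 0) + \sum_i x i z * radial 2 (pd b (h i j)) z.
  move=> Dz; rewrite [LHS](pd_sum oD) //.
  rewrite (eq_bigr (fun i => pd b (x i) z * radial 1 (h i j) z + x i z * radial 2 (pd b (h i j)) z)); last first.
    by move=> i _; rewrite (pdM b Dz (sx i) (sR 1%N i j)) (pd_radial 1 b (sh i j) Dz).
  rewrite big_split /=; congr (_ + _); case: b => k.
    rewrite (bigD1 k) //= dx // eqxx mul1r big1 ?addr0 // => i ik.
    by rewrite dx // eq_sym (negbTE ik) mul0r.
  by rewrite big1 // => i _; rewrite dx // mul0r.
have cal j l z : PD c r z -> pd (inr l) (alpha j) z = pd (inr j) (alpha l) z.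
  move=> Dz; etransitivity; first exact: (dal (inr l) j z Dz).
  etransitivity; last exact: (esym (dal (inr j) l z Dz)).
  apply: (congr1 (fun x => 0 + x)); apply: eq_bigr => i _; apply: (congr1 (fun y => x i z * y)).
  by apply: (radial_eq _ _ Dz) => w Dw; exact: ch'.
have [r' [f [r'0 r'r sf fE]]] := dolbeault r0 sal cal.
have o' := open_PD (c := c) (r := r'); have ss := @PD_sub _ _ c _ _ r'r.
have sfc : smooth (PD c r') (fun z => conjc (f z)) := smooth_conj o' sf.
exists r', (fun z => f z + conjc (f z)); split => //; first exact: (smoothD o' sf sfc).
move=> z k j Dz; have Dr := ss _ Dz; rewrite [LHS]hmxE.
rewrite (pd_eq o' (inl k) (G := fun w => alpha j w + pd (inr j) (fun w => conjc (f w)) w) Dz); last first.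
  by move=> w Dw; rewrite (pdD (inr j) Dw sf sfc) fE.
rewrite (pdD (inl k) Dz (smooth_sub ss (sal j)) (smooth_pd o' (inr j) sfc)) (pdC o' (inl k) (inr j) Dz sfc).
rewrite (pd_eq o' (inr j) (F := pd (inl k) (fun w => conjc (f w))) (G := fun w => conjc (alpha k w)) Dz); last first.
  by move=> w Dw; etransitivity; [exact: (pd_conj (inl k) Dw sf)|rewrite -fE].
rewrite [X in _ + X](_ : _ = conjc (pd (inl j) (alpha k) z)); last exact: (pd_conj (inr j) Dz (smooth_sub ss (sal k))).
rewrite !dal // rmorphD.
rewrite -(radial_euler (sh k j) Dr).
have e1 : conjc (radial 1 (h j k) z) = radial 1 (h k j) z.
  by rewrite conj_radial //; apply: radial_eq => // w Dw; rewrite -hh.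
have e2 : conjc (\sum_i x i z * radial 2 (pd (inl j) (h i k)) z) = \sum_i conjc (x i z) * radial 2 (pd (inr i) (h k j)) z.
  rewrite rmorph_sum; apply: eq_bigr => i _; rewrite rmorphM; apply: (congr1 (fun y => conjc (x i z) * y)).
  etransitivity; first exact: (conj_radial 2 (smooth_pd oD (inl j) (sh i k)) Dr).
  apply: (radial_eq _ _ Dr) => w Dw; rewrite ch //.
  rewrite (pd_eq oD (inr i) Dw (fun v Dv => hh j k v Dv)).
  by apply: esym; exact: (pd_conj (inr i) Dw (sh j k)).
have e3 : \sum_i x i z * radial 2 (pd (inl k) (h i j)) z = \sum_i x i z * radial 2 (pd (inl i) (h k j)) z.
  apply: eq_bigr => i _; apply: (congr1 (fun y => x i z * y)).
  by apply: (radial_eq _ _ Dr) => w Dw; exact: ch.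
have gen (a b s s' t t' : C) : b = a -> s = s' -> t = t' -> a + s + (b + t) = 2 * a + (s' + t') by move=> -> -> ->; ring.
have e4 : \sum_i (x i z * radial 2 (pd (inl i) (h k j)) z + conjc (x i z) * radial 2 (pd (inr i) (h k j)) z) =
  \sum_i x i z * radial 2 (pd (inl i) (h k j)) z + \sum_i conjc (x i z) * radial 2 (pd (inr i) (h k j)) z by exact: big_split.
etransitivity; last exact: (congr1 (fun y => 2 * radial 1 (h k j) z + y) (esym e4)).
exact: (gen _ _ _ _ _ _ e1 e3 e2).
Qed.

End LocalPotential.

(** * Manifolds *)

Opaque bullet.

Section BulletLinear.
Context {R : realType} {n : nat}.
Local Notation C := R[i].
Local Notation V := 'rV[C]_n.

Lemma sum_antidiag (m : nat) (f : nat -> nat -> C) :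
  \sum_(k < m.+1) \sum_(i < k.+1) f i (k - i)%N = \sum_(i < m.+1) \sum_(j < (m - i).+1) f i j.
Proof.
transitivity (\sum_(k < m.+1) \sum_(i < m.+1 | (i <= k)%N) f i (k - i)%N).
  by apply: eq_bigr => k _; rewrite (big_ord_widen m.+1 (fun i => f i (k - i)%N)).
rewrite (exchange_big_dep predT) //=; apply: eq_bigr => i _.
rewrite -(big_geq_mkord i m.+1 predT (fun k => f i (k - i)%N)) -{1}[nat_of_ord i]add0n big_addn big_mkord.
rewrite subSn; last by rewrite -ltnS.
by apply: eq_bigr => j _; rewrite addnK.
Qed.

Lemma sum_triangleC (m : nat) (f : nat -> nat -> C) :
  \sum_(i < m.+1) \sum_(j < (m - i).+1) f i j = \sum_(j < m.+1) \sum_(i < (m - j).+1) f i j.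
Proof.
rewrite -!sum_antidiag -[RHS](sum_antidiag m (fun j i => f i j)); apply: eq_bigr => k _.
rewrite (reindex_inj rev_ord_inj) /=; apply: eq_bigr => i _.
by rewrite subSS subKn // -ltnS.
Qed.

Variable D : set V.
Hypothesis oD : open D.
Variable Phi : V -> C.
Hypothesis sPhi : smooth D Phi.
Implicit Types (F G : nat -> V -> C) (a : nat -> C).

Definition vscale a F : nat -> V -> C := fun k z => \sum_(i < k.+1) a i * F (k - i)%N z.

Lemma prdDl s k p p' q z : D z -> smooth D p -> smooth D p' ->
  prd Phi s k (fun w => p w + p' w) q z = prd Phi s k p q z + prd Phi s k p' q z.
Proof.
move=> Dz sp sp'; etransitivity; first exact: prdC.
etransitivity; first exact: (prdDr oD Phi (~~ s) k q Dz sp sp').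
exact: (congr2 (fun x y : C => x + y) (esym (prdC Phi s k p q z)) (esym (prdC Phi s k p' q z))).
Qed.

Lemma prdZl s k p c q z : D z -> smooth D q -> prd Phi s k (fun w => c * q w) p z = c * prd Phi s k q p z.
Proof.
move=> Dz sq; etransitivity; first exact: prdC.
etransitivity; first exact: (prdZr oD Phi (~~ s) k p c Dz sq).
exact: (congr1 (fun x : C => c * x) (esym (prdC Phi s k q p z))).
Qed.

Lemma smooth_vscale a F k : (forall j, smooth D (F j)) -> smooth D (vscale a F k).
Proof. by move=> sF; apply: (smooth_sum oD) => i _; exact: (smoothZ oD). Qed.

Lemma bulletDl F F' G k z : D z -> (forall j, smooth D (F j)) -> (forall j, smooth D (F' j)) ->
  bullet Phi (fun j w => F j w + F' j w) G k z = bullet Phi F G k z + bullet Phi F' G k z.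
Proof.
move=> Dz sF sF'; rewrite !bulletE -big_split; apply: eq_bigr => i _; rewrite -big_split; apply: eq_bigr => b _.
exact: prdDl.
Qed.

Lemma bulletDr F G G' k z : D z -> (forall j, smooth D (G j)) -> (forall j, smooth D (G' j)) ->
  bullet Phi F (fun j w => G j w + G' j w) k z = bullet Phi F G k z + bullet Phi F G' k z.
Proof.
move=> Dz sF sF'; rewrite !bulletE -big_split; apply: eq_bigr => i _; rewrite -big_split; apply: eq_bigr => b _.
exact: (prdDr oD).
Qed.

Lemma bulletZl a F G m z : D z -> (forall j, smooth D (F j)) ->
  bullet Phi (vscale a F) G m z = \sum_(i < m.+1) a i * bullet Phi F G (m - i)%N z.
Proof.
move=> Dz sF.
pose f i j := a i * \sum_(b < (m - (i + j)).+1) prd Phi true (m - (i + j) - b) (F j) (G b) z.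
transitivity (\sum_(k < m.+1) \sum_(i < k.+1) f i (k - i)%N).
  rewrite bulletE; apply: eq_bigr => k _.
  transitivity (\sum_(b < (m - k).+1) \sum_(i < k.+1) a i * prd Phi true (m - k - b) (F (k - i)%N) (G b) z).
    apply: eq_bigr => b _; etransitivity.
      exact: (prd_suml oD Phi (index_enum 'I_k.+1) predT true (m - k - b) (G b) (q := fun i w => a i * F (k - i)%N w) Dz (fun i => smoothZ oD (a i) (sF _))).
    by apply: eq_bigr => i _; exact: prdZl.
  rewrite exchange_big; apply: eq_bigr => i _; rewrite /f mulr_sumr subnKC; last by rewrite -ltnS.
  by [].
rewrite sum_antidiag; apply: eq_bigr => i _; rewrite bulletE mulr_sumr; apply: eq_bigr => j _.
by rewrite /f subnDA.
Qed.

Lemma bulletZr a F G m z : D z -> (forall j, smooth D (G j)) ->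
  bullet Phi F (vscale a G) m z = \sum_(i < m.+1) a i * bullet Phi F G (m - i)%N z.
Proof.
move=> Dz sG.
pose g k i := \sum_(j < (m - k - i).+1) a i * prd Phi true (m - k - (i + j)) (F k) (G j) z.
transitivity (\sum_(k < m.+1) \sum_(i < (m - k).+1) g k i).
  rewrite bulletE; apply: eq_bigr => k _.
  transitivity (\sum_(b < (m - k).+1) \sum_(i < b.+1) a i * prd Phi true (m - k - (i + (b - i))) (F k) (G (b - i)%N) z).
    apply: eq_bigr => b _; etransitivity.
      exact: (prd_sumr oD Phi (index_enum 'I_b.+1) predT true (m - k - b) (F k) (q := fun i w => a i * G (b - i)%N w) Dz (fun i => smoothZ oD (a i) (sG _))).
    apply: eq_bigr => i _; rewrite subnKC; last by rewrite -ltnS.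
    exact: (prdZr oD).
  exact: (sum_antidiag (m - k) (fun i j => a i * prd Phi true (m - k - (i + j)) (F k) (G j) z)).
rewrite sum_triangleC; apply: eq_bigr => i _; rewrite bulletE mulr_sumr; apply: eq_bigr => k _.
rewrite /g mulr_sumr -!subnDA (addnC k i); apply: eq_bigr => j _.
by congr (_ * prd _ _ _ _ _ _); lia.
Qed.

End BulletLinear.

Section LocalSmoothness.
Context {R : realType} {n : nat}.
Local Notation C := R[i].
Local Notation V := 'rV[C]_n.
Implicit Types (D : set V) (F : V -> C).

Lemma smooth_local D F : (forall z, D z -> exists D', [/\ open D', D' z & smooth D' F]) -> smooth D F.
Proof.
move=> H; apply/smoothP => k.
have {}H z : D z -> exists D', [/\ open D', D' z & Cksub k D' F].
  by move=> /H[D' [oD' Dz /smoothP sF]]; exists D'.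
elim: k F H => [|k IH] F H; split => //.
- by move=> z /H[D' [_ Dz [cF _]]]; exact: cF.
- by move=> z /H[D' [_ Dz [cF _]]]; exact: cF.
move=> b j; split; first by move=> z /H[D' [_ Dz [_ h]]]; exact: (h b j).1.
by apply: IH => z /H[D' [oD' Dz [_ h]]]; exists D'; split => //; exact: (h b j).2.
Qed.

Lemma rderive_smooth D F z (u : V) : open D -> smooth D F -> D z ->
  rderive u F z = \sum_j (u 0 j * pd (inl j) F z + conjc (u 0 j) * pd (inr j) F z).
Proof.
Transparent pd.
move=> oD /smoothP/(_ 1) sF Dz; have Dg : D (z + (0 : R)%:C *: u) by rewrite scale0r addr0.
have dl i : cder (fun s : R => (z + s%:C *: u) 0 i) 0 (u 0 i).
  have := cderD (cder_cst (z 0 i) 0) (cderM (cder_RtoC (is_derive_id 0 (1 : R))) (cder_cst (u 0 i) 0)).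
  move=> D1; apply: (cder_ext _ (cder_eq D1 _)); first by move=> s; rewrite !mxE.
  by rewrite mul1r mulr0 addr0 add0r.
have := hasD_rderive (cder_chain oD sF Dg dl : hasD F z u _).
by move=> ->; apply: eq_bigr => j _; rewrite scale0r addr0.
Opaque pd.
Qed.

End LocalSmoothness.

(** * Charts, their restrictions and their transitions *)

Section Charts.
Context {R : realType} {n : nat} {X : topologicalType}.
Local Notation C := R[i].
Local Notation V := 'rV[C]_n.
Implicit Types (c d e : chart R n X) (W : set X) (p : X) (z : V).

Lemma cimgP c W z : cimg c W z <-> [/\ cdom c (cinv c z), W (cinv c z) & cmap c (cinv c z) = z].
Proof.
split=> [[p [cp Wp] <-]|[cz Wz E]]; first by rewrite cmapK.
by exists (cinv c z).
Qed.

Lemma cimgS c W W' : W `<=` W' -> cimg c W `<=` cimg c W'.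
Proof. by move=> WW _ [p [cp Wp] <-]; exists p => //; split => //; exact: WW. Qed.

Lemma open_cimg c W : open W -> open (cimg c W).
Proof.
move=> oW; rewrite openE => _ [p [cp Wp] <-].
have h1 : \forall z \near cmap c p, (cmap c @` cdom c) z.
  by apply: open_nbhs_nbhs; split; [exact: cimg_open|exists p].
have h2 : \forall z \near cmap c p, W (cinv c z).
  apply: (cinv_continuous cp); rewrite cmapK //.
  by apply: open_nbhs_nbhs.
suff H : \forall z \near cmap c p, cimg c W z by exact: H.
apply: filterS2 h1 h2 => z [q cq <-] Wq; exists q => //; split => //.
by move: Wq; rewrite cmapK.
Qed.

Lemma open_preim c (D : set V) : open D -> open (cdom c `&` cmap c @^-1` D).
Proof.
move=> oD; rewrite openE => p [cp Dp].
have h1 : \forall q \near p, cdom c q by apply: open_nbhs_nbhs; split => //; exact: cdom_open.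
have h2 : \forall q \near p, D (cmap c q).
  by apply: (cmap_continuous cp); apply: open_nbhs_nbhs.
suff H : \forall q \near p, (cdom c `&` cmap c @^-1` D) q by exact: H.
by apply: filterS2 h1 h2.
Qed.

Section Restrict.
Variables (c : chart R n X) (W : set X).
Hypothesis oW : open W.

Fact restrict_dom_open : open (cdom c `&` W).
Proof. by apply: openI => //; exact: cdom_open. Qed.

Fact restrict_img_open : open (cmap c @` (cdom c `&` W)).
Proof. exact: open_cimg. Qed.

(** A potential is found near a point only; restriction makes it the potential of a chart. *)
Definition restrict : chart R n X := @Chart R n X (cdom c `&` W) (cmap c) (cinv c) restrict_dom_open restrict_img_open
  (fun p cp => cmap_continuous cp.1) (fun p cp => cinv_continuous cp.1) (fun p cp => cmapK cp.1).

Lemma cimg_restrict W' : cimg restrict W' `<=` cimg c W'.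
Proof. by move=> _ [p [[cp _] Wp] <-]; exists p. Qed.

Lemma holomorphic_sub (D D' : set V) T : D' `<=` D -> holomorphic D T -> holomorphic D' T.
Proof.
move=> DD hT k; have [s h] := hT k; split; first exact: smooth_sub s.
by move=> j z Dz; apply: h; exact: DD.
Qed.

Lemma compatible_restrict d : compatible c d -> compatible restrict d.
Proof.
move=> [h1 h2]; split; first exact: holomorphic_sub (@cimg_restrict _) h1.
by apply: holomorphic_sub h2; apply: cimgS => p [].
Qed.

End Restrict.

Lemma transition_cmap c d p : cdom c p -> transition c d (cmap c p) = cmap d p.
Proof. by move=> cp; rewrite /transition cmapK. Qed.

End Charts.

Section HolomorphicCharts.
Context {R : realType} {n : nat}.
Local Notation C := R[i].
Local Notation V := 'rV[C]_n.

Lemma holomorphic_comp (D1 D2 : set V) (s t : V -> V) : open D1 -> open D2 -> (forall z, D1 z -> D2 (s z)) ->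
  holomorphic D1 s -> holomorphic D2 t -> holomorphic D1 (t \o s).
Proof.
move=> o1 o2 sD hs ht k; have [st t0] := ht k.
split; first exact: (smooth_comp o2 o1 sD hs st).
move=> j z Dz; etransitivity; first exact: (pd_comp o2 o1 sD hs true j Dz st).
by rewrite big1 // => i _; rewrite [X in _ * X](t0 i (s z) (sD _ Dz)) mulr0.
Qed.

Lemma holomorphic_local (D : set V) (t : V -> V) :
  (forall z, D z -> exists D' t', [/\ open D', D' z, holomorphic D' t' & forall w, D' w -> t w = t' w]) -> holomorphic D t.
Proof.
move=> H k; split.
  apply: smooth_local => z /H[D' [t' [oD' Dz ht' E]]]; exists D'; split => //.
  by apply: (smooth_eq oD' _ (ht' k).1) => w Dw; rewrite E.
move=> j z /H[D' [t' [oD' Dz ht' E]]].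
etransitivity; first exact: (pd_eq oD' (inr j) Dz (fun w Dw => congr1 (fun v : V => v 0 k) (E w Dw))).
exact: (ht' k).2.
Qed.

Variable M : complexManifold R n.
Implicit Types (c d e : chart R n M) (p : M) (W : set M).

Lemma holo_atlas c : atlas c -> holo_chart c.
Proof. by move=> ac d ad; exact: atlas_compatible. Qed.

(** Near each point of the overlap the transition factors through a chart [e] of the atlas, with
    which both charts are compatible. *)
Lemma holo_compat c d : holo_chart c -> holo_chart d -> holomorphic (cimg c (cdom d)) (transition c d).
Proof.
move=> hc hd; apply: holomorphic_local => _ [p [cp dp] <-].
have [e ae ep] := atlas_cover p.
have oW : open (cdom d `&` cdom e) by apply: openI; exact: cdom_open.
have o1 := open_cimg (c := c) oW; have o2 := open_cimg (c := e) (@cdom_open _ _ _ d).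
exists (cimg c (cdom d `&` cdom e)), (transition e d \o transition c e); split => //.
- by exists p.
- apply: (holomorphic_comp o1 o2 _ _ (hd e ae).2).
    by move=> _ [q [cq [dq eq]] <-]; rewrite transition_cmap //; exists q.
  by apply: holomorphic_sub (hc e ae).1; apply: cimgS => q [].
by move=> _ [q [cq [dq eq]] <-]; rewrite /= !transition_cmap.
Qed.

Lemma holo_restrict c W (oW : open W) : holo_chart c -> holo_chart (restrict c oW).
Proof. by move=> hc d ad; apply: compatible_restrict; exact: hc. Qed.

End HolomorphicCharts.

(** * Coefficients and potentials of the symplectic form *)

Section SymplecticForm.
Context {R : realType} {n : nat}.
Local Notation C := R[i].
Local Notation V := 'rV[C]_n.
Variable M : complexManifold R n.
Variable omega : twoForm M.
Hypothesis sy : symplectic omega.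
Hypothesis t11 : type11 omega.
Implicit Types (c d e : chart R n M) (p : M) (W : set M) (z u v w : V) (H : 'M[C]_n).

Definition herm H u v : C := \sum_(i < n) \sum_(j < n) H i j * (u 0 i * conjc (v 0 j) - v 0 i * conjc (u 0 j)).

Lemma has_coefE c p H u v : has_coef omega c p H -> (omega c p u v)%:C = 'i%C / 2 * herm H u v.
Proof. by move=> h; exact: h. Qed.

Let dl (i : 'I_n) : V := delta_mx 0 i.

Lemma sum_delta (i : 'I_n) (F : 'I_n -> C) (x : C) (y : 'I_n -> C) : (forall j, y j = if j == i then x else 0) ->
  \sum_j F j * y j = F i * x.
Proof.
move=> yE; rewrite (bigD1 i) //= yE eqxx big1 ?addr0 // => j ji.
by rewrite yE (negbTE ji) mulr0.
Qed.

Lemma herm_rank1 H u v : herm H u v = \sum_i (\sum_j H i j * conjc (v 0 j)) * u 0 i - \sum_i (\sum_j H i j * conjc (u 0 j)) * v 0 i.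
Proof.
rewrite /herm -sumrB; apply: eq_bigr => i _; rewrite !mulr_suml -sumrB; apply: eq_bigr => j _.
rewrite mulrBr; congr (_ - _); rewrite -mulrA; congr (_ * _); exact: mulrC.
Qed.

Lemma herm_delta H i j (x y : C) : herm H (x *: dl i) (y *: dl j) = H i j * x * conjc y - H j i * y * conjc x.
Proof.
have dE k l (a : C) : (a *: dl k) 0 l = if l == k then a else 0.
  by rewrite !mxE eqxx /=; case: eqP; rewrite ?mulr1 ?mulr0.
have cE k l (a : C) : conjc ((a *: dl k) 0 l) = if l == k then conjc a else 0.
  by rewrite dE; case: eqP => // _; exact: conjc0.
rewrite herm_rank1.
rewrite (sum_delta _ (dE i ^~ x)) (sum_delta _ (dE j ^~ y)) (sum_delta _ (cE j ^~ y)) (sum_delta _ (cE i ^~ x)).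
by congr (_ - _); rewrite mulrAC.
Qed.

(** Recovers the coefficients: with e_i = [dl i], omega (e_i, i e_j) = (H_ij + H_ji) / 2 and omega
    (e_i, e_j) = i (H_ij - H_ji) / 2. *)
Definition Hm c p : 'M[C]_n := \matrix_(i, j) ((omega c p (dl i) ('i%C *: dl j))%:C - 'i%C * (omega c p (dl i) (dl j))%:C).

Lemma has_coef_uniq c p H : has_coef omega c p H -> H = Hm c p.
Proof.
move=> h; apply/matrixP => i j; rewrite mxE !(has_coefE _ _ h).
have e1 := herm_delta H i j 1 'i%C; have e2 := herm_delta H i j 1 1.
rewrite scale1r in e1; rewrite !scale1r in e2; rewrite e1 e2.
have two0 : (2 : C) != 0 by rewrite pnatr_eq0.
have i2 : 'i%C * 'i%C = -1 :> C by apply: ReIm_eq => /=; ring.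
have ci : conjc 'i%C = - 'i%C :> C by apply: ReIm_eq => /=; rewrite ?oppr0.
have c1 : conjc 1 = 1 :> C by exact: conjc1.
have gen (I a b : C) : I * I = -1 -> a = I / 2 * (a * 1 * - I - b * I * 1) - I * (I / 2 * (a * 1 * 1 - b * 1 * 1)).
    move=> I2; have k2 : 2 * 2^-1 = 1 :> C by exact: divff.
  move: (2^-1) k2 => k k2.
  transitivity (- (I * I) * (2 * k) * a); last by ring.
  by rewrite I2 k2 opprK !mul1r.
rewrite ci c1; exact: gen.
Qed.

Lemma Hm_coef c p : holo_chart c -> cdom c p -> has_coef omega c p (Hm c p).
Proof. by move=> hc cp; have [H h] := t11 hc cp; rewrite -(has_coef_uniq h). Qed.

(* omega is real, hence its coefficients are Hermitian. *)
Lemma Hm_herm c p i j : holo_chart c -> cdom c p -> Hm c p j i = conjc (Hm c p i j).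
Proof.
move=> hc cp; have h := Hm_coef hc cp; have [h1 h2] : (omega c p (dl j) ('i%C *: dl i)) = (omega c p (dl i) ('i%C *: dl j)) /\ omega c p (dl j) (dl i) = - omega c p (dl i) (dl j).
  split; last by rewrite tf_antisym.
  apply: (@complexI R); rewrite !(has_coefE _ _ h).
  have e1 := herm_delta (Hm c p) i j 1 'i%C; have e2 := herm_delta (Hm c p) j i 1 'i%C.
  rewrite scale1r in e1; rewrite scale1r in e2; rewrite e1 e2; congr (_ * _).
  case: (Hm c p i j) => x y; case: (Hm c p j i) => x' y'; apply: ReIm_eq => /=; ring.
rewrite !mxE h1 h2; move: (omega c p _ _) (omega c p _ _) => x y.
by apply: ReIm_eq => /=; ring.
Qed.

(** For u in the left kernel, omega (u, v) = 0 for every v: one half of the form vanishes directly,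
    the other by Hermitian symmetry. Nondegeneracy gives u = 0. *)
Lemma Hm_unit c p : holo_chart c -> cdom c p -> Hm c p \in unitmx.
Proof.
move=> hc cp; rewrite -row_free_unit -kermx_eq0; apply/eqP/row_matrixP => i; rewrite row0.
set u := row i _; have uH : u *m Hm c p = 0 by rewrite -row_mul mulmx_ker row0.
apply: (sy.2 c p hc cp) => v; apply: (@complexI R); rewrite (has_coefE _ _ (Hm_coef hc cp)) herm_rank1.
rewrite [X in _ - X]big1 ?subr0; last first.
  move=> k _; rewrite (_ : \sum_j _ = conjc ((u *m Hm c p) 0 k)).
    by rewrite uH mxE (_ : conjc (0 : C) = 0) ?mul0r //; exact: conjc0.
  rewrite mxE rmorph_sum; apply: eq_bigr => j _; rewrite rmorphM mulrC; congr (_ * _).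
  exact: Hm_herm.
rewrite [X in _ * X](_ : _ = \sum_j (u *m Hm c p) 0 j * conjc (v 0 j)).
  by rewrite uH big1 ?mulr0 // => j _; rewrite mxE mul0r.
under eq_bigr do rewrite mulr_suml; rewrite exchange_big; apply: eq_bigr => j _.
rewrite mxE mulr_suml; apply: eq_bigr => k _; rewrite [u 0 k * _]mulrC mulrAC //.
Qed.

Section InChart.
Variable c : chart R n M.
Hypothesis hc : holo_chart c.
Let D := cimg c setT.
Let oD : open D := open_cimg openT.

Lemma cimgT z : D z -> cdom c (cinv c z). Proof. by move=> /cimgP[]. Qed.

Definition om u v z : C := (omega c (cinv c z) u v)%:C.

Lemma smooth_om u v : smooth D (om u v). Proof. exact: tf_smooth. Qed.

Lemma om_anti u v z : D z -> om u v z = - om v u z.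
Proof. by move=> Dz; rewrite /om (tf_antisym omega hc (cimgT Dz)) rmorphN. Qed.

Definition hh i j z : C := Hm c (cinv c z) i j.

Lemma hhE i j z : hh i j z = om (dl i) ('i%C *: dl j) z - 'i%C * om (dl i) (dl j) z.
Proof. exact: mxE. Qed.

Lemma smooth_hh i j : smooth D (hh i j).
Proof.
apply: (smooth_eq oD _ (smoothB oD (smooth_om _ _) (smoothZ oD 'i%C (smooth_om _ _)))) => z _.
by rewrite hhE.
Qed.

(** Forms of type (1,1) are invariant under the complex structure. *)
Lemma om_ii u v z : D z -> om ('i%C *: u) ('i%C *: v) z = om u v z.
Proof.
move=> Dz; rewrite /om !(has_coefE _ _ (Hm_coef hc (cimgT Dz))); congr (_ * _).
apply: eq_bigr => i _; apply: eq_bigr => j _; congr (_ * _); rewrite !mxE.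
case: (u 0 i) (u 0 j) (v 0 i) (v 0 j) => [a b] [a' b'] [x y] [x' y'].
by apply: ReIm_eq => /=; ring.
Qed.

Lemma om_i u v z : D z -> om ('i%C *: u) v z = - om u ('i%C *: v) z.
Proof.
move=> Dz; rewrite /om !(has_coefE _ _ (Hm_coef hc (cimgT Dz))) -mulrN; congr (_ * _).
rewrite /herm -sumrN; apply: eq_bigr => i _; rewrite -sumrN; apply: eq_bigr => j _; rewrite -[RHS]mulrN; congr (_ * _); rewrite !mxE.
case: (u 0 i) (u 0 j) (v 0 i) (v 0 j) => [a b] [a' b'] [x y] [x' y'].
by apply: ReIm_eq => /=; ring.
Qed.

Lemma hh_herm i j z : D z -> hh j i z = conjc (hh i j z).
Proof. by move=> Dz; apply: Hm_herm => //; exact: cimgT. Qed.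

Lemma rderive_opp F u z : D z -> smooth D F -> rderive u (fun w => - F w) z = - rderive u F z.
Proof.
move=> Dz sF; rewrite !(rderive_smooth u oD) //; last exact: (smoothN oD).
rewrite -sumrN; apply: eq_bigr => j _; rewrite !(pdN oD) // opprD !mulrN //.
Qed.

(** Closedness on the triples (e_k, e_i, i e_j), (i e_k, i e_i, i e_j), (i e_k, i e_i, e_j) and
    (e_k, e_i, e_j). Invariance under i makes the third terms agree in pairs, and they cancel in the
    combination that forms d_k h_ij - d_i h_kj. *)
Lemma hh_closed i j k z : D z -> pd (inl k) (hh i j) z = pd (inl i) (hh k j) z.
Proof.
move=> Dz; have cl := sy.1 c hc z Dz.
have S u v := smooth_om u v.
have dH a l m : pd (inl a) (hh l m) z = pd (inl a) (om (dl l) ('i%C *: dl m)) z - 'i%C * pd (inl a) (om (dl l) (dl m)) z.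
  rewrite (pd_eq oD (inl a) Dz (fun w _ => hhE l m w)).
  by rewrite (pdB oD _ Dz (S _ _) (smoothZ oD _ (S _ _))) (pdZ oD _ _ Dz (S _ _)).
have neg F G u : smooth D F -> smooth D G -> (forall w, D w -> F w = - G w) -> rderive u F z = - rderive u G z.
  by move=> sF sG FG; rewrite (rderive_eq u oD Dz FG) rderive_opp.
pose X u v a := rderive (dl a) (om u v) z; pose Y u v a := rderive ('i%C *: dl a) (om u v) z.
have E1 : rderive (dl i) (om ('i%C *: dl j) (dl k)) z = - X (dl k) ('i%C *: dl j) i by apply: neg => // w Dw; exact: om_anti.
have E2 u : rderive u (om ('i%C *: dl k) ('i%C *: dl i)) z = rderive u (om (dl k) (dl i)) z by apply: (rderive_eq u oD Dz) => w Dw; exact: om_ii.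
have E3 : rderive ('i%C *: dl k) (om ('i%C *: dl i) ('i%C *: dl j)) z = Y (dl i) (dl j) k by apply: (rderive_eq _ oD Dz) => w Dw; exact: om_ii.
have E4 : rderive ('i%C *: dl i) (om ('i%C *: dl j) ('i%C *: dl k)) z = - Y (dl k) (dl j) i.
  by apply: neg => // w Dw; rewrite om_ii // om_anti.
have E5 : rderive ('i%C *: dl k) (om ('i%C *: dl i) (dl j)) z = - Y (dl i) ('i%C *: dl j) k by apply: neg => // w Dw; exact: om_i.
have E7 : rderive (dl i) (om (dl j) (dl k)) z = - X (dl k) (dl j) i by apply: neg => // w Dw; exact: om_anti.
have E8 : rderive ('i%C *: dl i) (om (dl j) ('i%C *: dl k)) z = Y (dl k) ('i%C *: dl j) i.
  by apply: (rderive_eq _ oD Dz) => w Dw; rewrite om_anti // om_i // opprK.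
have c1 : X (dl i) ('i%C *: dl j) k + rderive (dl i) (om ('i%C *: dl j) (dl k)) z + rderive ('i%C *: dl j) (om (dl k) (dl i)) z = 0.
  exact: (cl (dl k) (dl i) ('i%C *: dl j)).
have c2 : rderive ('i%C *: dl k) (om ('i%C *: dl i) ('i%C *: dl j)) z + rderive ('i%C *: dl i) (om ('i%C *: dl j) ('i%C *: dl k)) z
    + rderive ('i%C *: dl j) (om ('i%C *: dl k) ('i%C *: dl i)) z = 0.
  exact: (cl ('i%C *: dl k) ('i%C *: dl i) ('i%C *: dl j)).
have c3 : rderive ('i%C *: dl k) (om ('i%C *: dl i) (dl j)) z + rderive ('i%C *: dl i) (om (dl j) ('i%C *: dl k)) z
    + rderive (dl j) (om ('i%C *: dl k) ('i%C *: dl i)) z = 0.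
  exact: (cl ('i%C *: dl k) ('i%C *: dl i) (dl j)).
have c4 : X (dl i) (dl j) k + rderive (dl i) (om (dl j) (dl k)) z + rderive (dl j) (om (dl k) (dl i)) z = 0.
  exact: (cl (dl k) (dl i) (dl j)).
rewrite E1 in c1; rewrite E3 E4 E2 in c2; rewrite E5 E8 E2 in c3; rewrite E7 in c4.
have pdX a u v : pd (inl a) (om u v) z = 2^-1 * (X u v a - 'i%C * Y u v a).
  by rewrite pdE; congr (_ * (_ + _)); rewrite mulN1r mulNr.
have gen (I a b g d a' b' g' d' r1 r2 : C) : I * I = -1 -> a - a' + r1 = 0 -> d - d' + r1 = 0 -> - b + b' + r2 = 0 -> g - g' + r2 = 0 ->
    2^-1 * (a - I * b) - I * (2^-1 * (g - I * d)) = 2^-1 * (a' - I * b') - I * (2^-1 * (g' - I * d')).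
  move=> I2 h1 h2 h3 h4; rewrite !(mulrCA I) -!mulrBr; congr (_ * _).
  have -> : a = a' - r1 by rewrite -[LHS](subr0 a) -h1; ring.
  have -> : d = d' - r1 by rewrite -[LHS](subr0 d) -h2; ring.
  have -> : b = b' + r2 by rewrite -[LHS](addr0 b) -h3; ring.
  have -> : g = g' - r2 by rewrite -[LHS](subr0 g) -h4; ring.
  by rewrite !mulrBr !mulrDr !mulrA I2; ring.
rewrite (dH k i j) (dH i k j) !pdX.
have i2 : 'i%C * 'i%C = -1 :> C by apply: ReIm_eq => /=; ring.
exact: (gen _ _ _ _ _ _ _ _ _ _ _ i2 c1 c2 c3 c4).
Qed.

End InChart.
Lemma hermE H u v : herm H u v = (u *m H *m (map_mx conjc v)^T) 0 0 - (v *m H *m (map_mx conjc u)^T) 0 0.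
Proof.
have E (x y : V) : (x *m H *m (map_mx conjc y)^T) 0 0 = \sum_i (\sum_j H i j * conjc (y 0 j)) * x 0 i.
  rewrite mxE; under eq_bigr do rewrite !mxE mulr_suml; rewrite exchange_big; apply: eq_bigr => i _.
  rewrite mulr_suml; apply: eq_bigr => j _; rewrite -mulrA mulrC; congr (_ * _); exact: mxE.
by rewrite herm_rank1 !E.
Qed.

Lemma dtransitionE c d p u : holo_chart c -> holo_chart d -> cdom c p -> cdom d p ->
  dtransition c d p u = u *m Bm (transition c d) false (cmap c p).
Proof.
move=> hc hd cp dp; have oD := open_cimg (c := c) (@cdom_open _ _ _ d).
have Dp : cimg c (cdom d) (cmap c p) by exists p.
have ht := holo_compat hc hd; apply/rowP => k; rewrite !mxE.
rewrite (rderive_smooth u oD (ht k).1 Dp); apply: eq_bigr => j _.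
rewrite (_ : pd (inr j) _ _ = 0); last exact: (ht k).2.
by rewrite mulr0 addr0 BmE.
Qed.

Lemma Bm_conj c d p : holo_chart c -> holo_chart d -> cdom c p -> cdom d p ->
  Bm (transition c d) true (cmap c p) = map_mx conjc (Bm (transition c d) false (cmap c p)).
Proof.
move=> hc hd cp dp; have oD := open_cimg (c := c) (@cdom_open _ _ _ d).
have Dp : cimg c (cdom d) (cmap c p) by exists p.
have ht := holo_compat hc hd; apply/matrixP => b k; rewrite [RHS]mxE !BmE.
exact: (pd_conj (inr b) Dp (ht k).1).
Qed.

Lemma Hm_change c d p : holo_chart c -> holo_chart d -> cdom c p -> cdom d p ->
  Hm d p = Bm (transition d c) false (cmap d p) *m Hm c p *m (Bm (transition d c) true (cmap d p))^T.
Proof.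
move=> hc hd cp dp; apply: esym; apply: has_coef_uniq => u v; rewrite -/(herm _ u v).
rewrite (tf_chart omega hd hc dp cp u v) (has_coefE _ _ (Hm_coef hc cp)) !dtransitionE // !hermE Bm_conj //.
set B := Bm _ _ _; congr (_ * (_ - _)); rewrite map_mxM trmx_mul !mulmxA //.
Qed.

(** The two charts are related by [tf_chart], and the transition between them is the identity. *)
Lemma omega_restrict c W (oW : open W) p u v : holo_chart c -> cdom c p -> W p ->
  omega (restrict c oW) p u v = omega c p u v.
Proof.
move=> hc cp Wp; have hr := holo_restrict oW hc.
rewrite (tf_chart omega hr hc (conj cp Wp) cp).
have E x : dtransition (restrict c oW) c p x = x; last by rewrite !E.
apply/rowP => k; rewrite mxE; have oD := open_cimg (c := c) oW.
have Dp : cimg c W (cmap c p) by exists p.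
rewrite (rderive_eq (G := fun z => z 0 k) x oD Dp); last first.
  by move=> _ [q [cq Wq] <-]; rewrite /transition /= cmapK.
rewrite (rderive_smooth x oD (smooth_coord oD k) Dp) (bigD1 k) //= !pd_coord eqxx mulr1 mulr0 addr0.
by rewrite big1 ?addr0 // => j jk; rewrite !pd_coord (negbTE jk) !mulr0 addr0.
Qed.

(** The ddbar-lemma yields Phi on a polydisc around the image of p, so the chart is shrunk to the
    preimage of that polydisc. *)
Lemma potential_restrict c p : holo_chart c -> cdom c p ->
  exists W (oW : open W) Phi, potential omega (restrict c oW) Phi /\ W p.
Proof.
move=> hc cp; have oD := open_cimg (c := c) (@openT M).
have Dp : cimg c setT (cmap c p) by exists p.
have [r r0 rD] := PD_nbhs oD Dp.
have [r' [Phi [r'0 r'r sPhi hE]]] := @ddbar_lemma R n (cmap c p) r r0 (hh c)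
  (fun i j => smooth_sub rD (smooth_hh hc i j)) (fun i j k z Dz => hh_closed hc i j k (rD _ Dz))
  (fun i j z Dz => hh_herm hc i j (rD _ Dz)).
have oW := open_preim c (open_PD (c := cmap c p) (r := r')).
have Wp : (cdom c `&` cmap c @^-1` PD (cmap c p) r') p by split=> //; exact: PD_center.
exists (cdom c `&` cmap c @^-1` PD (cmap c p) r'), oW, Phi; split=> //.
split; first exact: holo_restrict.
  by apply: smooth_sub sPhi => _ [q [[cq [_ Dq]] _] <-].
move=> q [cq Wq] u v; rewrite omega_restrict // [cmap _ q]/=.
have -> : hmx Phi (cmap c q) = Hm c q by apply/matrixP => i j; rewrite hE ?/hh ?cmapK //; exact: Wq.2.
exact: (Hm_coef hc cq).
Qed.

Lemma potential_near p : exists c Phi, potential omega c Phi /\ cdom c p.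
Proof.
have [c ac cp] := atlas_cover p.
have [W [oW [Phi [pc Wp]]]] := potential_restrict (holo_atlas ac) cp.
by exists (restrict c oW), Phi.
Qed.

Lemma potential_hmx c Phi p : potential omega c Phi -> cdom c p -> hmx Phi (cmap c p) = Hm c p.
Proof. by move=> [_ _ h] cp; apply: has_coef_uniq; exact: h. Qed.

Lemma potential_unit c Phi z : potential omega c Phi -> cimg c setT z -> hmx Phi z \in unitmx.
Proof. by move=> pc [p [cp _] <-]; rewrite (potential_hmx pc cp); apply: Hm_unit => //; case: pc. Qed.

(** On the overlap, Psi and the composite of Phi with the transition have the same mixed
    derivatives, hence give the same product; [prd_comp] compares the composite with Phi. *)
Theorem chart_bullet_change c d Phi Psi (F G : nat -> M -> C) k p : potential omega c Phi -> potential omega d Psi ->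
  fsmooth_on (cdom c `&` cdom d) F -> fsmooth_on (cdom c `&` cdom d) G -> cdom c p -> cdom d p ->
  chart_bullet c Phi F G k p = chart_bullet d Psi F G k p.
Proof.
move=> pc pd' sF sG cp dp; have [hc sPhi _] := pc; have [hd sPsi _] := pd'.
pose Dc := cimg c (cdom d); pose Dd := cimg d (cdom c); pose sg := transition d c.
have oc : open Dc := open_cimg (@cdom_open _ _ _ d).
have od : open Dd := open_cimg (@cdom_open _ _ _ c).
have hsg : holomorphic Dd sg := holo_compat hd hc.
have sgD w : Dd w -> Dc (sg w) by move=> [q [dq cq] <-]; rewrite /sg transition_cmap //; exists q.
have Dp : Dd (cmap d p) by exists p.
have sPc : smooth Dc Phi by apply: smooth_sub sPhi; exact: cimgS.
have sPd : smooth Dd Psi by apply: smooth_sub sPsi; exact: cimgS.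
have sPs : smooth Dd (Phi \o sg) := smooth_comp oc od sgD hsg sPc.
have uc z : Dc z -> hmx Phi z \in unitmx by move=> Dz; apply: (potential_unit pc); exact: cimgS Dz.
have hE w : Dd w -> hmx Psi w = hmx (Phi \o sg) w.
  move=> Dw; have [q [dq cq] wE] := Dw.
  have e := hmx_comp_mx oc od sgD hsg sPc Dw; rewrite e -wE (potential_hmx pd' dq) (Hm_change hc hd cq dq).
  have e5 : hmx Phi (sg (cmap d q)) = Hm c q by rewrite /sg (transition_cmap c dq) (potential_hmx pc cq).
  exact: (congr1 (fun H => Bm sg false (cmap d q) *m H *m (Bm sg true (cmap d q))^T) (esym e5)).
have ud w : Dd w -> hmx (Phi \o sg) w \in unitmx.
  by move=> Dw; rewrite -hE //; apply: (potential_unit pd'); exact: cimgS Dw.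
have sub : Dc `<=` cimg c (cdom c `&` cdom d) by move=> _ [q [cq dq] <-]; exists q.
have sFc j : smooth Dc (F j \o cinv c) := smooth_sub sub (sF j c hc).
have sGc j : smooth Dc (G j \o cinv c) := smooth_sub sub (sG j c hc).
have fE (f : M -> C) w : Dd w -> (f \o cinv d) w = ((f \o cinv c) \o sg) w.
  by move=> [q [dq cq] <-]; rewrite /sg /= transition_cmap // !cmapK.
rewrite /chart_bullet !bulletE; apply: eq_bigr => i _; apply: eq_bigr => j _.
have e1 := prd_gauge od true (k - i - j) (F i \o cinv d) (G j \o cinv d) sPd sPs hE Dp.
have e2 := prd_eql od (Phi \o sg) true (k - i - j) (G j \o cinv d) Dp (fE (F i)).
have e3 := prd_eqr od (Phi \o sg) true (k - i - j) ((F i \o cinv c) \o sg) Dp (fE (G j)).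
have e4 := prd_comp (k - i - j) oc od sgD hsg sPc uc ud Dp (sFc i) (sGc j).
have e5 : sg (cmap d p) = cmap c p by exact: transition_cmap.
rewrite e5 in e4.
exact: (esym (etrans e1 (etrans e2 (etrans e3 e4)))).
Qed.

End SymplecticForm.

(** * The global product *)

Section Quantization.
Context {R : realType} {n : nat}.
Local Notation C := R[i].
Local Notation V := 'rV[C]_n.
Variable M : complexManifold R n.
Variable omega : twoForm M.
Hypothesis sy : symplectic omega.
Hypothesis t11 : type11 omega.
Implicit Types (c d e : chart R n M) (p q : M) (F G K : nat -> M -> C) (f g : M -> C).

Let potential_at p : {cPhi : chart R n M * (V -> C) | potential omega cPhi.1 cPhi.2 /\ cdom cPhi.1 p}.
Proof.
apply: cid; have [c [Phi h]] := potential_near sy t11 p.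
by exists (c, Phi).
Qed.

Definition star F G : nat -> M -> C := fun k p =>
  chart_bullet (sval (potential_at p)).1 (sval (potential_at p)).2 F G k p.

Lemma fsmooth_sub (W W' : set M) F : W' `<=` W -> fsmooth_on W F -> fsmooth_on W' F.
Proof.
move=> WW sF k c hc; apply: smooth_sub (sF k c hc) => _ [q [cq Wq] <-].
by exists q => //; split => //; exact: WW.
Qed.

Lemma star_glues : glues_bullets omega star.
Proof.
move=> F G sF sG c Phi pc k p cp; rewrite /star.
case: (potential_at p) => -[d Psi] /= [pd' dp].
by apply: (chart_bullet_change sy t11 k pd' pc) => //; apply: fsmooth_sub (@subsetT _ _) _.
Qed.

Lemma starE c Phi F G k p : fsmooth_on setT F -> fsmooth_on setT G -> potential omega c Phi -> cdom c p ->
  star F G k p = bullet Phi (fun a => F a \o cinv c) (fun b => G b \o cinv c) k (cmap c p).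
Proof. by move=> sF sG pc cp; exact: (star_glues sF sG pc). Qed.

Opaque star.

Let addF F G k p : (F + G) k p = F k p + G k p.
Proof. by []. Qed.

Lemma smooth_coordF F c : fsmooth_on setT F -> holo_chart c -> forall k, smooth (cimg c setT) (F k \o cinv c).
Proof. by move=> sF hc k; exact: sF. Qed.

(** Near a point a single potential computes the product, and the result is pulled back to the chart
    [c]. *)
Lemma star_smooth F G : fsmooth_on setT F -> fsmooth_on setT G -> fsmooth_on setT (star F G).
Proof.
move=> sF sG k c hc; apply: smooth_local => _ [p [cp _] <-].
have [d [Psi [pd' dp]]] := potential_near sy t11 p; have [hd sPsi _] := pd'.
have oc := open_cimg (c := c) (@cdom_open _ _ _ d); have od := open_cimg (c := d) (@openT M).
exists (cimg c (cdom d)); split => //; first by exists p.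
have tD z : cimg c (cdom d) z -> cimg d setT (transition c d z).
  by move=> [q [cq dq] <-]; rewrite transition_cmap //; exists q.
have sb := smooth_bullet od sPsi (fun z Dz => potential_unit sy t11 pd' Dz) k (smooth_coordF sF hd) (smooth_coordF sG hd).
apply: (smooth_eq oc _ (smooth_comp od oc tD (holo_compat hc hd) sb)) => _ [q [cq dq] <-].
have e1 := starE k sF sG pd' dq; have e2 := transition_cmap d cq; have e3 := cmapK cq.
transitivity (bullet Psi (fun k0 => F k0 \o cinv d) (fun k0 => G k0 \o cinv d) k (cmap d q)).
  exact: (congr1 (bullet Psi (fun k0 => F k0 \o cinv d) (fun k0 => G k0 \o cinv d) k) e2).
exact: (etrans (esym e1) (congr1 (star F G k) (esym e3))).
Qed.

Lemma fscale_add_smooth a F F' : fsmooth_on setT F -> fsmooth_on setT F' -> fsmooth_on setT (fscale a F + F').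
Proof.
move=> sF sF' k c hc; have oD := open_cimg (c := c) (@openT M).
have s1 := smooth_vscale oD (F := fun j => F j \o cinv c) a k (smooth_coordF sF hc).
by apply: (smooth_eq oD _ (smoothD oD s1 (smooth_coordF sF' hc k))) => z _.
Qed.

Lemma star_linearl a F F' G : fsmooth_on setT F -> fsmooth_on setT F' -> fsmooth_on setT G ->
  star (fscale a F + F') G = fscale a (star F G) + star F' G.
Proof.
move=> sF sF' sG; apply/funext => k; apply/funext => p.
have [d [Psi [pd' dp]]] := potential_near sy t11 p; have [hd sPsi _] := pd'.
have od := open_cimg (c := d) (@openT M); have Dp : cimg d setT (cmap d p) by exists p.
have e0 := starE k (fscale_add_smooth a sF sF') sG pd' dp.
have vF := fun j => smooth_vscale od (F := fun j => F j \o cinv d) a j (smooth_coordF sF hd).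
have e1 := bulletDl od Psi (fun b => G b \o cinv d) k Dp vF (smooth_coordF sF' hd).
have e2 := bulletZl od Psi a (fun b => G b \o cinv d) k Dp (smooth_coordF sF hd).
rewrite addF /fscale.
rewrite (eq_bigr _ (fun (i : 'I_k.+1) _ => congr1 (fun x => a i * x) (starE (k - i)%N sF sG pd' dp))).
exact: (etrans e0 (etrans e1 (congr2 (fun x y => x + y) e2 (esym (starE k sF' sG pd' dp))))).
Qed.

Lemma star_linearr a F G G' : fsmooth_on setT F -> fsmooth_on setT G -> fsmooth_on setT G' ->
  star F (fscale a G + G') = fscale a (star F G) + star F G'.
Proof.
move=> sF sG sG'; apply/funext => k; apply/funext => p.
have [d [Psi [pd' dp]]] := potential_near sy t11 p; have [hd sPsi _] := pd'.
have od := open_cimg (c := d) (@openT M); have Dp : cimg d setT (cmap d p) by exists p.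
have e0 := starE k sF (fscale_add_smooth a sG sG') pd' dp.
have vG := fun j => smooth_vscale od (F := fun j => G j \o cinv d) a j (smooth_coordF sG hd).
have e1 := bulletDr od Psi (fun b => F b \o cinv d) k Dp vG (smooth_coordF sG' hd).
have e2 := bulletZr od Psi a (fun b => F b \o cinv d) k Dp (smooth_coordF sG hd).
rewrite addF /fscale.
rewrite (eq_bigr _ (fun (i : 'I_k.+1) _ => congr1 (fun x => a i * x) (starE (k - i)%N sF sG pd' dp))).
exact: (etrans e0 (etrans e1 (congr2 (fun x y => x + y) e2 (esym (starE k sF sG' pd' dp))))).
Qed.

Lemma star_assoc F G K : fsmooth_on setT F -> fsmooth_on setT G -> fsmooth_on setT K ->
  star (star F G) K = star F (star G K).
Proof.
move=> sF sG sK; apply/funext => k; apply/funext => p.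
have [d [Psi [pd' dp]]] := potential_near sy t11 p; have [hd sPsi _] := pd'.
have od := open_cimg (c := d) (@openT M); have Dp : cimg d setT (cmap d p) by exists p.
have E F' G' j w : fsmooth_on setT F' -> fsmooth_on setT G' -> cimg d setT w -> (star F' G' j \o cinv d) w = bullet Psi (fun a => F' a \o cinv d) (fun b => G' b \o cinv d) j w.
  move=> sF' sG' [q [dq _] <-].
  exact: (etrans (congr1 (star F' G' j) (cmapK dq)) (starE j sF' sG' pd' dq)).
have e0 := starE k (star_smooth sF sG) sK pd' dp.
have e4 := starE k sF (star_smooth sG sK) pd' dp.
have e1 := bullet_eq od Psi k Dp (fun j w => E F G j w sF sG) (fun j w _ => erefl ((K j \o cinv d) w)).
have e2 := bullet_eq od Psi k Dp (fun j w _ => erefl ((F j \o cinv d) w)) (fun j w => E G K j w sG sK).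
have e3 := bullet_assoc od sPsi (fun z Dz => potential_unit sy t11 pd' Dz) k Dp (smooth_coordF sF hd) (smooth_coordF sG hd) (smooth_coordF sK hd).
exact: (etrans e0 (etrans e1 (etrans e3 (etrans (esym e2) (esym e4))))).
Qed.

Lemma fconst_smooth f : smooth_on setT f -> fsmooth_on setT (fconst f).
Proof.
move=> sf [|k] c hc; first exact: sf.
have oD := open_cimg (c := c) (@openT M).
by apply: (smooth_eq oD _ (smooth_cst oD 0)).
Qed.

Lemma star_fconst0 f g p : smooth_on setT f -> smooth_on setT g -> star (fconst f) (fconst g) 0 p = f p * g p.
Proof.
move=> sf sg; have [d [Psi [pd' dp]]] := potential_near sy t11 p.
have od := open_cimg (c := d) (@openT M); have Dp : cimg d setT (cmap d p) by exists p.
rewrite (starE 0 (fconst_smooth sf) (fconst_smooth sg) pd' dp) bulletE !big_ord1.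
etransitivity; first exact: (prd_classical (fun z Dz => potential_unit sy t11 pd' Dz) true (f \o cinv d) (g \o cinv d) Dp).
by rewrite /= !cmapK.
Qed.

Lemma star_fconst1 c Phi f g p : smooth_on setT f -> smooth_on setT g -> potential omega c Phi -> cdom c p ->
  star (fconst f) (fconst g) 1 p = prd Phi true 1 (f \o cinv c) (g \o cinv c) (cmap c p).
Proof.
move=> sf sg pc cp; have [hc _ _] := pc.
have od := open_cimg (c := c) (@openT M); have Dp : cimg c setT (cmap c p) by exists p.
have uH z (Dz : cimg c setT z) := potential_unit sy t11 pc Dz.
have z1 : prd Phi true 0 (f \o cinv c) (fconst g 1 \o cinv c) (cmap c p) = 0.
  by etransitivity; [exact: (prd_classical uH true (f \o cinv c) (fconst g 1 \o cinv c) Dp)|exact: mulr0].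
have z2 : prd Phi true 0 (fconst f 1 \o cinv c) (g \o cinv c) (cmap c p) = 0.
  by etransitivity; [exact: (prd_classical uH true (fconst f 1 \o cinv c) (g \o cinv c) Dp)|exact: mul0r].
rewrite (starE 1 (fconst_smooth sf) (fconst_smooth sg) pc cp) bulletE.
rewrite big_ord_recl big_ord_recl big_ord0 addr0.
transitivity (prd Phi true 1 (f \o cinv c) (g \o cinv c) (cmap c p) + prd Phi true 0 (f \o cinv c) (fconst g 1 \o cinv c) (cmap c p)
   + prd Phi true 0 (fconst f 1 \o cinv c) (g \o cinv c) (cmap c p)); last by rewrite z1 z2 !addr0.
apply: (congr2 (fun x y => x + y)).
  etransitivity; first exact: (@big_ord_recl _ _ _ 1 _).
  by apply: (congr1 (fun x => _ + x)); exact: big_ord1.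
exact: big_ord1.
Qed.

Lemma star_commutator1 f g c p H : smooth_on setT f -> smooth_on setT g -> holo_chart c -> cdom c p -> has_coef omega c p H ->
  star (fconst f) (fconst g) 1 p - star (fconst g) (fconst f) 1 p = (2 * 'i)^-1 * poisson c H f g p.
Proof.
move=> sf sg hc cp hH.
(* The chart c need not carry a potential, but a restriction of it does. *)
have [W [oW [Phi [pc Wp]]]] := potential_restrict sy t11 hc cp; have [hr sPhi hPhi] := pc.
have od := open_cimg (c := restrict c oW) (@openT M); have Dp : cimg (restrict c oW) setT (cmap c p) by exists p.
have uH z (Dz : cimg (restrict c oW) setT z) := potential_unit sy t11 pc Dz.
have sfc := sf _ hr; have sgc := sg _ hr.
rewrite (star_fconst1 sf sg pc (conj cp Wp)) (star_fconst1 sg sf pc (conj cp Wp)).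
have HE : hmx Phi (cmap c p) = H.
  rewrite (has_coef_uniq hH); apply: has_coef_uniq => u v.
  by rewrite -(omega_restrict omega oW u v hc cp Wp); exact: (hPhi p (conj cp Wp)).
have e1 := prd1E od sPhi uH Dp sfc sgc; have e2 := prd1E od sPhi uH Dp sgc sfc.
rewrite HE in e1 e2.
pose x i := pd (inl i) (f \o cinv c) (cmap c p); pose x' j := pd (inr j) (f \o cinv c) (cmap c p).
pose y i := pd (inl i) (g \o cinv c) (cmap c p); pose y' j := pd (inr j) (g \o cinv c) (cmap c p).
Transparent pd.
have PE : poisson c H f g p = 2 / 'i * \sum_i \sum_j hinv H i j * (x i * y' j - x' j * y i) by [].
Opaque pd.
rewrite PE.
(* The multiples of f g cancel in the commutator, and (2 i)^-1 (2 / i) = -1, whence the order S2 -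
   S1. *)
have gen (K a b S1 S2 S I : C) : I * I = -1 -> S = S2 - S1 -> K * a * b + S1 - (K * b * a + S2) = (2 * I)^-1 * (2 / I * S).
  move=> I2 ->; have I0 : I != 0 by apply/eqP => I0; move: I2; rewrite I0 mul0r => /eqP; rewrite eq_sym oppr_eq0 oner_eq0.
  have two0 : (2 : C) != 0 by rewrite pnatr_eq0.
  rewrite invfM !mulrA [2^-1 * _ * 2]mulrAC mulVf // mul1r -invfM I2 invrN1 mulN1r; ring.
etransitivity; first exact: (congr2 (fun x y => x - y) e1 e2).
apply: gen; first exact: (mulCii C).
rewrite -sumrB; apply: eq_bigr => i _; rewrite -sumrB; apply: eq_bigr => j _; rewrite -mulrBr; congr (_ * (_ - _)).
exact: mulrC.
Qed.

Theorem star_quantization : deformation_quantization omega star.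
Proof.
split.
- exact: star_smooth.
- exact: star_linearl.
- exact: star_linearr.
- exact: star_assoc.
- by move=> f g sf sg p; exact: star_fconst0.
- move=> f g sf sg p; have e1 := star_fconst0 p sf sg; have e2 := star_fconst0 p sg sf.
  transitivity (star (fconst f) (fconst g) 0 p - star (fconst g) (fconst f) 0 p); first by [].
  by rewrite e1 e2 mulrC subrr.
- by move=> f g sf sg c p H hc cp hH; exact: star_commutator1.
Qed.

Lemma star_unique star' F G : glues_bullets omega star' -> fsmooth_on setT F -> fsmooth_on setT G -> star' F G = star F G.
Proof.
move=> gl sF sG; apply/funext => k; apply/funext => p.
have [d [Psi [pd' dp]]] := potential_near sy t11 p.
exact: (etrans (gl F G sF sG d Psi pd' k p dp) (esym (star_glues sF sG pd' k dp))).
Qed.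

End Quantization.

Theorem corollary3p14 (R : realType) (n : nat) (M : complexManifold R n)
    (omega : twoForm M) (omega_symplectic : symplectic omega)
    (omega_type11 : type11 omega) :
  (forall c d Phi Psi, potential omega c Phi -> potential omega d Psi ->
   forall F G : nat -> M -> R[i],
     fsmooth_on (cdom c `&` cdom d) F -> fsmooth_on (cdom c `&` cdom d) G ->
   forall k p, cdom c p -> cdom d p ->
     chart_bullet c Phi F G k p = chart_bullet d Psi F G k p) /\
  exists star : (nat -> M -> R[i]) -> (nat -> M -> R[i]) -> nat -> M -> R[i],
    [/\ glues_bullets omega star,
        forall star', glues_bullets omega star' ->
          forall F G, fsmooth_on setT F -> fsmooth_on setT G ->
            star' F G = star F G
      & deformation_quantization omega star].
Proof.
split=> [c d Phi Psi pc pd' F G sF sG k p cp dp|].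
  exact: (chart_bullet_change omega_symplectic omega_type11 k pc pd' sF sG cp dp).
exists (star omega_symplectic omega_type11); split.
- exact: star_glues.
- by move=> star' gl F G sF sG; exact: star_unique.
- exact: star_quantization.
Qed.
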